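(* Let $\alpha,\beta\in\mathbb{R}$ satisfy $0\le\alpha<\beta+1$ and $\beta\le 2\alpha$. Then the problem $$\mu(\alpha,\beta):=\inf\left\{\frac{P_\alpha(\Omega)}{[A_\beta(\Omega)]^{(\alpha+1)/(\beta+2)}}:\ \Omega\subset\mathbb{R}^2_+ \text{ measurable},\ 0<A_\beta(\Omega)<+\infty\right\}$$ has a minimizer, which is given by $$\Omega^\star:=\{(x,y):\ |x|<f(y),\ 0<y<1\},\qquad f(y):=\int_y^1\frac{t^{\beta-\alpha+1}}{\sqrt{1-t^{2(\beta-\alpha+1)}}}\,dt\quad(0<y<1).$$ Moreover, with $\gamma:=\beta+1-\alpha$ and $B$ the Beta function, $$\mu(\alpha,\beta)=\gamma^{\frac{\alpha+1}{\beta+2}-1}\cdot\left[\frac{(\beta+1)(\beta+2)}{\alpha+1}\right]^{\frac{\alpha+1}{\beta+2}}\cdot\left[B\left(\frac{\alpha+1}{2\gamma},\frac12\right)\right]^{\frac{\gamma}{\beta+2}}.$$ In particular, $\mu(\alpha,2\alpha)=\sqrt{\dfrac{2\pi(2\alpha+1)}{\alpha+1}}$.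
   Context: $\mathbb{R}^2_+:=\{(x,y)\in\mathbb{R}^2:\ y>0\}$. For measurable $\Omega\subset\mathbb{R}^2_+$, the weighted area is $A_\beta(\Omega):=\iint_\Omega y^\beta\,dx\,dy$, and the weighted relative perimeter is $$P_\alpha(\Omega):=\sup\left\{\iint_\Omega \operatorname{div}(y^\alpha\mathbf{v})\,dx\,dy:\ \mathbf{v}\in C^1_0(\mathbb{R}^2_+,\mathbb{R}^2),\ |\mathbf{v}|\le1\text{ in }\Omega\right\}\in[0,+\infty],$$ where $C_0^1$ denotes $C^1$ vector fields with compact support in the open half-plane $\mathbb{R}^2_+$. For sufficiently regular open $\Omega$ (open with rectifiable boundary) $P_\alpha(\Omega)=\int_{\partial\Omega\cap\mathbb{R}^2_+}y^\alpha\,d\mathscr{H}_1$, with $\mathscr{H}_1$ the one-dimensional Hausdorff measure. A minimizer is a set $\Omega$ admissible in the infimum at which the quotient equals $\mu(\alpha,\beta)$. *)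

(* Defs.v *)
From HB Require Import structures.
From mathcomp Require Import all_boot all_order all_algebra.
From mathcomp Require Import all_classical all_reals all_analysis.

Set Implicit Arguments.
Unset Strict Implicit.
Unset Printing Implicit Defensive.

Import Order.TTheory GRing.Theory Num.Theory.
Import numFieldNormedType.Exports.

Local Open Scope classical_set_scope.
Local Open Scope ring_scope.

(* The library's product measure lives on the Borel sets of the plane.  Here
   "measurable" means Lebesgue measurable, so it is completed: [leb2_type R] is
   [R * R] with the Caratheodory (i.e. Lebesgue) sigma-algebra. *)
Definition leb2_borel (R : realType) :
    {measure set (measurableTypeR R * measurableTypeR R) -> \bar R} :=
  (@lebesgue_measure R \x @lebesgue_measure R)%E.

Definition leb2_type (R : realType) := caratheodory_type ((@leb2_borel R)^*)%mu.

Definition leb2 (R : realType) : {measure set (leb2_type R) -> \bar R} :=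
  @completed_measure_extension _ _ _ (@leb2_borel R).

Definition lebesgue_measurable2 (R : realType) (A : set (R * R)) : Prop :=
  measurable (A : set (leb2_type R)).

Definition half_plane (R : realType) : set (R * R) := [set z | 0 < z.2].

(* Euclidean norm; the library's norm on [R * R] is the max norm. *)
Definition enorm2 (R : realType) (w : R * R) : R :=
  Num.sqrt (w.1 ^+ 2 + w.2 ^+ 2).

Definition e_x (R : realType) : R * R := (1, 0).
Definition e_y (R : realType) : R * R := (0, 1).

Definition divergence (R : realType) (w : R * R -> R * R) (z : R * R) : R :=
  'D_(@e_x R) (fst \o w) z + 'D_(@e_y R) (snd \o w) z.

Definition C1_on (R : realType) (D : set (R * R)) (v : R * R -> R * R) : Prop :=
  forall z, D z ->
    [/\ derivable v z (@e_x R), derivable v z (@e_y R),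
        {for z, continuous ('D_(@e_x R) v)} &
        {for z, continuous ('D_(@e_y R) v)}].

(* A compactly supported field on the open half-plane is identified with its
   extension by zero to the whole plane. *)
Definition C1c_half_plane (R : realType) (v : R * R -> R * R) : Prop :=
  let supp := closure [set z | v z != 0] in
  [/\ C1_on (@half_plane R) v, compact supp & supp `<=` @half_plane R].

Definition warea (R : realType) (beta : R) (Omega : set (R * R)) : \bar R :=
  (\int[@leb2 R]_(z in Omega) (z.2 `^ beta)%:E)%E.

Definition wperimeter (R : realType) (alpha : R) (Omega : set (R * R)) : \bar R :=
  ereal_sup
    [set (\int[@leb2 R]_(z in Omega)
            (divergence (fun z => z.2 `^ alpha *: v z) z)%:E)%E
    | v in [set v : R * R -> R * R |
             C1c_half_plane v /\ forall z, Omega z -> enorm2 (v z) <= 1]].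

Definition isop_quotient (R : realType) (alpha beta : R) (Omega : set (R * R)) :
    \bar R :=
  (wperimeter alpha Omega / warea beta Omega `^ ((alpha + 1) / (beta + 2))%R)%E.

Definition admissible (R : realType) (beta : R) : set (set (R * R)) :=
  [set Omega | [/\ Omega `<=` @half_plane R, lebesgue_measurable2 Omega &
                   (0 < warea beta Omega < +oo)%E]].

Definition isop_mu (R : realType) (alpha beta : R) : \bar R :=
  ereal_inf [set isop_quotient alpha beta Omega | Omega in admissible beta].

Definition is_minimizer (R : realType) (alpha beta : R) (Omega : set (R * R)) :
    Prop :=
  admissible beta Omega /\ isop_quotient alpha beta Omega = isop_mu alpha beta.

Definition profile (R : realType) (alpha beta y : R) : R :=
  \int[@lebesgue_measure R]_(t in `]y, 1[)
    (t `^ (beta - alpha + 1) / Num.sqrt (1 - t `^ (2 * (beta - alpha + 1)))).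

Definition Omega_star (R : realType) (alpha beta : R) : set (R * R) :=
  [set z | `|z.1| < profile alpha beta z.2 /\ 0 < z.2 < 1].

(* The library's [beta_fun] only takes natural-number arguments. *)
Definition Beta (R : realType) (a b : R) : R :=
  \int[@lebesgue_measure R]_(t in `]0, 1[)
    (t `^ (a - 1) * (1 - t) `^ (b - 1)).

(* Main.v *)
(* Lower bound.  Let E be the set of heights y at which the horizontal slice of
   Omega has positive length.  Let w have mean 0 and compact support in (0, oo),
   let V be its primitive, and let a >= 0 satisfy a^2 + V^2 <= y^(2 alpha).
   Fields y^alpha v whose vertical component is V and whose horizontal component
   grows by 2 a across each slice over E give
     P >= 2 int_E a + int_Omega w(y).
   Take V = l (y^(beta+1) - c^(beta+1)) - c^alpha on each interval (c, d) of E, so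
   that w = l (beta + 1) y^beta there; V can be reset for free outside E.  The
   largest slope l for which V <= y^alpha everywhere is attained at the right end
   of one interval, and on that interval alone int a is at least a constant times
   l^(-(alpha+1)/gamma), with equality for an interval starting at 0.  Hence
   P >= l (beta + 1) A + const * l^(-(alpha+1)/gamma), and the weighted AM-GM
   inequality removes l.  Since E is merely measurable, its intervals are replaced
   by runs of cells of a geometric grid whose ratio tends to 1.
   Equality.  The divergence theorem on Omega_star and Cauchy-Schwarz against its
   normal give P(Omega_star) <= 2 int_0^1 t^alpha / sqrt (1 - t^(2 gamma)) dt, and
   integration by parts expresses the area by the same integral. *)
Require Import Defs.
From HB Require Import structures.
From mathcomp Require Import all_boot all_order all_algebra.
From mathcomp Require Import all_classical all_reals all_analysis.
From mathcomp Require Import measurable_realfun.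
From mathcomp Require Import ring lra.

Set Implicit Arguments.
Unset Strict Implicit.
Unset Printing Implicit Defensive.

Import Order.TTheory GRing.Theory Num.Theory.
Import numFieldNormedType.Exports.

Local Open Scope classical_set_scope.
Local Open Scope ring_scope.

(** * Smooth steps *)

Section smoothstep.
Context {R : realType}.
Implicit Types (f g df dg : R -> R) (C x e : R).

(** The obstacle is regularity: the fields in [wperimeter] are C^1 with compact support, while the
    calibration is prescribed by merely measurable data. It is therefore built as an integral
    superposition of explicit smooth steps, and regularity is recorded through second-order
    estimates with uniform constants, because such pointwise bounds on linear expressions survive
    integration against any integrable weight. The vertical smoothing is one-sided: the value at
    height y averages values at heights t <= y, where t^alpha <= y^alpha, so the constraint |y^alpha
    v| <= y^alpha is kept exactly and not just up to an error. The hypothesis beta <= 2 alpha means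
    gamma <= alpha + 1; it makes an interval (c, d) at least as good as one starting at 0.
    Finiteness of the perimeter is what allows runs of cells to replace E: a short cell containing
    both thick slices and a nonnegligible set of empty ones contributes a fixed amount to the
    perimeter, so almost all of E lies in an open set. For the same reason there are gaps above
    every height, in which the primitive V returns to 0. *)

Definition bounded_C11 C f df := forall x e : R,
  [/\ `|f x| <= C, `|df x| <= C & `|f (x + e) - f x - e * df x| <= C * e ^+ 2].

Lemma bounded_C11_ge0 C f df : bounded_C11 C f df -> 0 <= C.
Proof. by move=> /(_ 0 0)[+ _ _]; apply: le_trans. Qed.

(** At distance at least 1 the sup bound suffices; below it the quadratic term is at most linear. *)
Lemma bounded_C11_lip C f df : bounded_C11 C f df ->
  forall x y, `|f x - f y| <= 2 * C * `|x - y|.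
Proof.
move=> H x y.
have C0 := bounded_C11_ge0 H.
have [h1 h2 h3] := H y (x - y).
have [g1 _ _] := H x 0.
rewrite [y + _]addrC subrK in h3.
have [xy|xy] := leP 1 `|x - y|.
  apply: (@le_trans _ _ (2 * C)); last by rewrite ler_peMr// mulr_ge0.
  by rewrite (le_trans (ler_normB _ _))//; lra.
have -> : f x - f y = (f x - f y - (x - y) * df y) + (x - y) * df y by ring.
rewrite (le_trans (ler_normD _ _))// normrM.
rewrite -[(x - y) ^+ 2]real_normK ?num_real// in h3.
have := normr_ge0 (x - y); have := normr_ge0 (df y).
set a := `|x - y| in h3 xy *; set b := `|df y| in h2 *; move=> b0 a0.
rewrite (le_trans (lerD h3 (lexx _)))//.
have p1 : 0 <= C * a * (1 - a) by rewrite !mulr_ge0// subr_ge0 ltW.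
have p2 : 0 <= a * (C - b) by rewrite mulr_ge0// subr_ge0.
by rewrite expr2; lra.
Qed.

(** Adding the expansions of [f] at [x] and at [y] cancels the values of [f] and leaves
    [(x - y) * (df x - df y)]. *)
Lemma bounded_C11_dlip C f df : bounded_C11 C f df ->
  forall x y, `|df x - df y| <= 2 * C * `|x - y|.
Proof.
move=> H x y.
have [->|xy] := eqVneq x y; first by rewrite !subrr normr0 mulr0.
have [_ _ h3] := H y (x - y).
have [_ _ h4] := H x (y - x).
rewrite [y + _]addrC subrK in h3; rewrite [x + _]addrC subrK in h4.
have d0 : 0 < `|x - y| by rewrite normr_gt0 subr_eq0.
rewrite -(ler_pM2l d0) -normrM.
have -> : (x - y) * (df x - df y) = (f x - f y - (x - y) * df y) +
  (f y - f x - (y - x) * df x) by ring.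
rewrite (le_trans (ler_normD _ _))//.
rewrite (le_trans (lerD h3 h4))//.
rewrite -[(y - x) ^+ 2]real_normK ?num_real// distrC.
rewrite -[(x - y) ^+ 2]real_normK ?num_real//.
set a := `|x - y|. nra.
Qed.

Lemma bounded_C11_cst c : bounded_C11 `|c| (fun=> c) (fun=> 0).
Proof.
move=> x e; rewrite subrr mulr0 subrr normr0 lexx normr_ge0.
by rewrite mulr_ge0// sqr_ge0.
Qed.

Lemma bounded_C11D C C' f g df dg : bounded_C11 C f df -> bounded_C11 C' g dg ->
  bounded_C11 (C + C') (fun x => f x + g x) (fun x => df x + dg x).
Proof.
move=> hf hg x e; have [f1 f2 f3] := hf x e; have [g1 g2 g3] := hg x e.
split.
- by rewrite (le_trans (ler_normD _ _))//; lra.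
- by rewrite (le_trans (ler_normD _ _))//; lra.
have -> : f (x + e) + g (x + e) - (f x + g x) - e * (df x + dg x) =
 (f (x + e) - f x - e * df x) + (g (x + e) - g x - e * dg x) by ring.
rewrite (le_trans (ler_normD _ _))//; lra.
Qed.

Lemma bounded_C11Z C k f df : bounded_C11 C f df ->
  bounded_C11 (`|k| * C) (fun x => k * f x) (fun x => k * df x).
Proof.
move=> hf x e; have [f1 f2 f3] := hf x e.
split; rewrite ?normrM ?ler_wpM2l//.
have -> : k * f (x + e) - k * f x - e * (k * df x) =
 k * (f (x + e) - f x - e * df x) by ring.
by rewrite normrM -mulrA ler_wpM2l.
Qed.

(** The 6 covers 4 for the product of the two increments, each at most [2 * C * |e|], and 1 for each
    of the two remainders. *)
Lemma bounded_C11M C f g df dg : bounded_C11 C f df -> bounded_C11 C g dg ->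
  bounded_C11 (C + 6 * C * C) (fun x => f x * g x)
    (fun x => df x * g x + f x * dg x).
Proof.
move=> hf hg x e; have [f1 f2 f3] := hf x e; have [g1 g2 g3] := hg x e.
have C0 := bounded_C11_ge0 hf.
have fl := bounded_C11_lip hf (x + e) x.
have gl := bounded_C11_lip hg (x + e) x.
have [fe1 _ _] := hf (x + e) 0.
rewrite [x + e - x]addrAC subrr add0r in fl gl.
have fg : `|f x| * `|g x| <= C * C by apply: ler_pM.
have CC : 0 <= C * C by rewrite !mulr_ge0.
have dfg : `|df x| * `|g x| <= C * C by apply: ler_pM.
have fdg : `|f x| * `|dg x| <= C * C by apply: ler_pM.
split.
- by rewrite normrM; lra.
- by rewrite (le_trans (ler_normD _ _))// !normrM; lra.
have -> : f (x + e) * g (x + e) - f x * g x - e * (df x * g x + f x * dg x) =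
  (f (x + e) - f x) * (g (x + e) - g x) + (f (x + e) - f x - e * df x) * g x
  + f x * (g (x + e) - g x - e * dg x) by ring.
rewrite (le_trans (ler_normD _ _))// !normrM.
have t3 : `|f x| * `|g (x + e) - g x - e * dg x| <= C * (C * e ^+ 2) by apply: ler_pM.
have t2 : `|f (x + e) - f x - e * df x| * `|g x| <= C * e ^+ 2 * C by apply: ler_pM.
have t1 : `|f (x + e) - f x| * `|g (x + e) - g x| <= (2 * C * `|e|) * (2 * C * `|e|).
  by apply: ler_pM.
have e2 : `|e| * `|e| = e ^+ 2 by rewrite -expr2 real_normK ?num_real.
have {}t1 : `|f (x + e) - f x| * `|g (x + e) - g x| <= 4 * C * C * e ^+ 2.
  by rewrite (le_trans t1)// -e2; lra.
have e0 : 0 <= e ^+ 2 by rewrite sqr_ge0.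
have n12 := ler_normD ((f (x + e) - f x) * (g (x + e) - g x))
  ((f (x + e) - f x - e * df x) * g x).
rewrite !normrM in n12.
have p2 : 0 <= C * C * e ^+ 2 by rewrite mulr_ge0.
have p3 : 0 <= C * e ^+ 2 by rewrite mulr_ge0.
apply: (le_trans (lerD n12 (lexx _))).
apply: (le_trans (lerD (lerD t1 t2) t3)).
lra.
Qed.

Lemma bounded_C11_affine C f df a b : bounded_C11 C f df ->
  bounded_C11 (C * (1 + `|a| + a ^+ 2)) (fun x => f (a * x + b))
    (fun x => a * df (a * x + b)).
Proof.
move=> hf x e; have C0 := bounded_C11_ge0 hf.
have [f1 f2 f3] := hf (a * x + b) (a * e).
have a0 := normr_ge0 a; have a2 := sqr_ge0 a.
have e2 := sqr_ge0 e.
have Ca : 0 <= C * `|a| by rewrite mulr_ge0.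
have Ca2 : 0 <= C * a ^+ 2 by rewrite mulr_ge0.
split.
- by rewrite (le_trans f1)//; lra.
- rewrite normrM (le_trans (ler_wpM2l a0 f2))//; lra.
have -> : a * (x + e) + b = a * x + b + a * e by ring.
have -> : e * (a * df (a * x + b)) = a * e * df (a * x + b) by ring.
rewrite (le_trans f3)// exprMn.
have q1 : 0 <= C * e ^+ 2 by rewrite mulr_ge0.
have q2 : 0 <= C * `|a| * e ^+ 2 by rewrite mulr_ge0.
lra.
Qed.

Definition clamp x : R := Num.max 0 (Num.min 1 x).

Lemma clamp_itv x : 0 <= clamp x <= 1.
Proof. by rewrite /clamp le_max lexx/= ge_max ler01 ge_min lexx. Qed.

Lemma clamp_id x : 0 <= x <= 1 -> clamp x = x.
Proof. by rewrite /clamp => /andP[x0 x1]; rewrite min_r// max_r. Qed.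

Lemma clamp_le0 x : x <= 0 -> clamp x = 0.
Proof. by rewrite /clamp => x0; rewrite max_l// ge_min x0 orbT. Qed.

Lemma clamp_ge1 x : 1 <= x -> clamp x = 1.
Proof. by rewrite /clamp => x1; rewrite min_l// max_r. Qed.

(* Composing with [clamp] keeps second-order accuracy because the derivative
   vanishes at both ends of [0, 1]. *)
Lemma bounded_C11_clamp C f df :
  (forall a b, 0 <= a <= 1 -> 0 <= b <= 1 ->
    [/\ `|f a| <= C, `|df a| <= C, `|f b - f a - (b - a) * df a| <= C * (b - a) ^+ 2,
     `|df a| <= C * a & `|df a| <= C * (1 - a)]) ->
  bounded_C11 (C + C) (f \o clamp) (df \o clamp).
Proof.
move=> H x e /=.
have [h1 h2 h3 h4 h5] := H _ _ (clamp_itv x) (clamp_itv (x + e)).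
have C0 : 0 <= C by rewrite (le_trans _ h1).
split; [by lra|by lra|].
set a := clamp x in h1 h2 h3 h4 h5 *; set b := clamp (x + e) in h3 *.
have -> : f b - f a - e * df a = (f b - f a - (b - a) * df a) + (b - a - e) * df a by ring.
rewrite (le_trans (ler_normD _ _))// normrM.
have /andP[a0 a1] := clamp_itv x; have /andP[b0 b1] := clamp_itv (x + e).
rewrite -/a -/b in a0 a1 b0 b1.
suff [k1 k2] : (b - a) ^+ 2 <= e ^+ 2 /\ `|b - a - e| * `|df a| <= C * e ^+ 2.
  by have := ler_wpM2l C0 k1; lra.
have [x0|x0] := leP x 0.
  have aE : a = 0 by rewrite /a clamp_le0.
  have -> : `|df a| = 0 by apply/eqP; rewrite eq_le normr_ge0 (le_trans h4)// aE mulr0.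
  rewrite mulr0 mulr_ge0 ?sqr_ge0//; split => //.
  have [xe|xe] := leP (x + e) 0; first by rewrite /b clamp_le0// aE subrr expr0n sqr_ge0.
  have bx : b <= x + e by rewrite /b /clamp ge_max (ltW xe) ge_min lexx orbT.
  rewrite aE subr0; nra.
have [x1|x1] := leP 1 x.
  have aE : a = 1 by rewrite /a clamp_ge1.
  have -> : `|df a| = 0 by apply/eqP; rewrite eq_le normr_ge0 (le_trans h5)// aE subrr mulr0.
  rewrite mulr0 mulr_ge0 ?sqr_ge0//; split => //.
  have [xe|xe] := leP 1 (x + e); first by rewrite /b clamp_ge1// aE subrr expr0n sqr_ge0.
  have bx : x + e <= b by rewrite /b /clamp le_max le_min lexx (ltW xe) orbT.
  rewrite aE; nra.
have aE : a = x by rewrite /a clamp_id// !ltW.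
have [xe|xe] := leP (x + e) 0.
  have bE : b = 0 by rewrite /b clamp_le0.
  rewrite bE aE; split; first nra.
  have e0 : e <= 0 by lra.
  have -> : `|0 - x - e| = - (x + e) by rewrite ger0_norm; lra.
  rewrite aE in h4.
  have t : - (x + e) * `|df x| <= - e * (C * x) by apply: ler_pM => //; lra.
  rewrite (le_trans t)//; have : 0 <= C * - e * (- e - x) by rewrite !mulr_ge0//; lra.
  nra.
have [xe1|xe1] := leP 1 (x + e).
  have bE : b = 1 by rewrite /b clamp_ge1.
  rewrite bE aE; split; first nra.
  have -> : `|1 - x - e| = x + e - 1 by rewrite -normrN ger0_norm; lra.
  rewrite aE in h5.
  have t : (x + e - 1) * `|df x| <= e * (C * (1 - x)) by apply: ler_pM => //; lra.
  rewrite (le_trans t)//; have : 0 <= C * e * (e - (1 - x)) by rewrite !mulr_ge0//; lra.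
  nra.
have bE : b = x + e by rewrite /b clamp_id// !ltW.
rewrite bE aE addrAC subrr add0r subrr normr0 mul0r; split => //.
by rewrite mulr_ge0// sqr_ge0.
Qed.

(** The quintic smoothstep, flat to second order at both ends. Second order is needed because its
    derivative, rescaled, is the mollifier and must again satisfy a [bounded_C11] estimate. *)
Definition sstep x := let c := clamp x in 10 * c ^+ 3 - 15 * c ^+ 4 + 6 * c ^+ 5.
Definition dsstep x := let c := clamp x in 30 * c ^+ 2 * (1 - c) ^+ 2.
Definition ddsstep x := let c := clamp x in 60 * c * (1 - c) * (1 - 2 * c).

Lemma bounded_C11_sstep : bounded_C11 (180 + 180) sstep dsstep.
Proof.
apply: (@bounded_C11_clamp _ (fun c => 10 * c ^+ 3 - 15 * c ^+ 4 + 6 * c ^+ 5)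
  (fun c => 30 * c ^+ 2 * (1 - c) ^+ 2)) => a b /andP[a0 a1] /andP[b0 b1].
have a0' : 0 <= 1 - a by lra.
have b0' : 0 <= 1 - b by lra.
have m1 (u v : R) : 0 <= u <= 1 -> 0 <= v <= 1 -> 0 <= u * v <= 1.
  by move=> /andP[u0 u1] /andP[v0 v1]; rewrite mulr_ge0// mulr_ile1.
have A : 0 <= a <= 1 by apply/andP.
have B : 0 <= b <= 1 by apply/andP.
have A' : 0 <= 1 - a <= 1 by lra.
have h : 0 <= a * (1 - a) <= 1 by apply: m1.
have -> : 30 * a ^+ 2 * (1 - a) ^+ 2 = 30 * ((a * (1 - a)) * (a * (1 - a))) by ring.
have /andP[hh0 hh1] := m1 _ _ h h.
have /andP[aa0 aa1] := m1 _ _ A A.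
have /andP[ab0 ab1] := m1 _ _ A B.
have /andP[bb0 bb1] := m1 _ _ B B.
have /andP[aaa0 aaa1] := m1 _ _ A (m1 _ _ A A).
have /andP[aab0 aab1] := m1 _ _ A (m1 _ _ A B).
have /andP[abb0 abb1] := m1 _ _ A (m1 _ _ B B).
have /andP[bbb0 bbb1] := m1 _ _ B (m1 _ _ B B).
have n0 : `|30 * ((a * (1 - a)) * (a * (1 - a)))| = 30 * ((a * (1 - a)) * (a * (1 - a))).
  by rewrite ger0_norm//; lra.
have /andP[q0 q1] := m1 _ _ A' (m1 _ _ h A').
have /andP[r0 r1] := m1 _ _ A (m1 _ _ h A).
have k1 : (a * (1 - a)) * (a * (1 - a)) <= a by nra.
have k2 : (a * (1 - a)) * (a * (1 - a)) <= 1 - a by nra.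
rewrite n0; split; [|by lra| |by lra|by lra].
- have -> : 10 * a ^+ 3 - 15 * a ^+ 4 + 6 * a ^+ 5 =
    a * (a * a) * (10 - 15 * a + 6 * (a * a)) by ring.
  rewrite normrM (ger0_norm aaa0).
  have : `|10 - 15 * a + 6 * (a * a)| <= 180 by rewrite ler_norml; lra.
  by move=> hn; rewrite (le_trans (ler_wpM2l aaa0 hn))//; lra.
(* The remainder is divisible by [(b - a) ^+ 2]; the cofactor is bounded monomial by monomial on the
   unit square. *)
have -> : 10 * b ^+ 3 - 15 * b ^+ 4 + 6 * b ^+ 5 - (10 * a ^+ 3 - 15 * a ^+ 4 +
    6 * a ^+ 5) - (b - a) * (30 * (a * (1 - a) * (a * (1 - a)))) = (b - a) ^+ 2 *
  (10 * (b + 2 * a) - 15 * (b * b + 2 * (a * b) + 3 * (a * a)) +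
   6 * (b * (b * b) + 2 * (a * (b * b)) + 3 * (a * (a * b)) + 4 * (a * (a * a)))) by ring.
rewrite normrM [`|(b - a) ^+ 2|]ger0_norm ?sqr_ge0// mulrC ler_wpM2r ?sqr_ge0//.
by rewrite ler_norml; lra.
Qed.

Lemma bounded_C11_dsstep : bounded_C11 (390 + 390) dsstep ddsstep.
Proof.
apply: (@bounded_C11_clamp _ (fun c => 30 * c ^+ 2 * (1 - c) ^+ 2)
  (fun c => 60 * c * (1 - c) * (1 - 2 * c))) => a b /andP[a0 a1] /andP[b0 b1].
have m1 (u v : R) : 0 <= u <= 1 -> 0 <= v <= 1 -> 0 <= u * v <= 1.
  by move=> /andP[u0 u1] /andP[v0 v1]; rewrite mulr_ge0// mulr_ile1.
have A : 0 <= a <= 1 by apply/andP.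
have B : 0 <= b <= 1 by apply/andP.
have A' : 0 <= 1 - a <= 1 by lra.
have h := m1 _ _ A A'.
have /andP[h0 h1] := h.
have /andP[hh0 hh1] := m1 _ _ h h.
have /andP[aa0 aa1] := m1 _ _ A A.
have /andP[ab0 ab1] := m1 _ _ A B.
have /andP[bb0 bb1] := m1 _ _ B B.
have ha : a * (1 - a) <= a by nra.
have ha' : a * (1 - a) <= 1 - a by nra.
have dE : `|60 * a * (1 - a) * (1 - 2 * a)| <= 60 * (a * (1 - a)).
  have -> : 60 * a * (1 - a) * (1 - 2 * a) = 60 * (a * (1 - a)) * (1 - 2 * a) by ring.
  rewrite normrM ger0_norm; last by lra.
  have n1 : `|1 - 2 * a| <= 1 by rewrite ler_norml; lra.
  by rewrite -[leRHS]mulr1 ler_wpM2l//; lra.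
split; [|by apply: le_trans dE _; lra| |by apply: le_trans dE _; lra|
  by apply: le_trans dE _; lra].
- have -> : 30 * a ^+ 2 * (1 - a) ^+ 2 = 30 * ((a * (1 - a)) * (a * (1 - a))) by ring.
  by rewrite ger0_norm; lra.
have -> : 30 * b ^+ 2 * (1 - b) ^+ 2 - 30 * a ^+ 2 * (1 - a) ^+ 2 -
    (b - a) * (60 * a * (1 - a) * (1 - 2 * a)) = (b - a) ^+ 2 *
  (30 * (1 - 2 * (b + 2 * a) + (b * b + 2 * (a * b) + 3 * (a * a)))) by ring.
rewrite normrM [`|(b - a) ^+ 2|]ger0_norm ?sqr_ge0// mulrC ler_wpM2r ?sqr_ge0//.
by rewrite ler_norml; lra.
Qed.

Lemma sstep_itv x : 0 <= sstep x <= 1.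
Proof.
rewrite /sstep /=; have /andP[] := clamp_itv x; set c := clamp x => c0 c1.
have c3 : 0 <= c ^+ 3 by rewrite exprn_ge0.
have c3' : 0 <= (1 - c) ^+ 3 by rewrite exprn_ge0// subr_ge0.
apply/andP; split.
  have -> : 10 * c ^+ 3 - 15 * c ^+ 4 + 6 * c ^+ 5 =
    c ^+ 3 * (10 - 15 * c + 6 * c ^+ 2) by ring.
  by rewrite mulr_ge0//; nra.
rewrite -subr_ge0; have -> : 1 - (10 * c ^+ 3 - 15 * c ^+ 4 + 6 * c ^+ 5) =
  (1 - c) ^+ 3 * (1 + 3 * c + 6 * c ^+ 2) by ring.
by rewrite mulr_ge0//; nra.
Qed.

Lemma sstep_le0 x : x <= 0 -> sstep x = 0.
Proof. by move=> x0; rewrite /sstep clamp_le0//=; ring. Qed.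

Lemma sstep_ge1 x : 1 <= x -> sstep x = 1.
Proof. by move=> x0; rewrite /sstep clamp_ge1//=; ring. Qed.

Lemma dsstep_ge0 x : 0 <= dsstep x.
Proof. by rewrite /dsstep /= mulr_ge0 ?sqr_ge0// mulr_ge0 ?sqr_ge0. Qed.

(** The maximum is 15/8; the crude constant 180 + 180 of [bounded_C11_sstep] is the source of every
    360 below. *)
Lemma dsstep_le x : dsstep x <= 360.
Proof. by have [_ h _] := bounded_C11_sstep x 0; have := ler_norm (dsstep x); lra. Qed.

Lemma dsstep_out x : x <= 0 \/ 1 <= x -> dsstep x = 0.
Proof.
by case=> h; rewrite /dsstep; [rewrite clamp_le0|rewrite clamp_ge1]=> //=; ring.
Qed.

End smoothstep.

(** The hypothesis puts the difference quotient within [C * |h|] of [l]. *)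
Lemma is_derive_quad {R : realType} (V W : normedModType R) (f : V -> W) (a v : V)
  (l : W) (C : R) :
  (forall h : R, `|h| <= 1 -> `|f (h *: v + a) - f a - h *: l| <= C * h ^+ 2) ->
  is_derive a v f l.
Proof.
move=> H.
have C0 : 0 <= C.
  have := H 1; rewrite normr1 expr1n mulr1 => /(_ (lexx _)).
  exact: le_trans.
have cv : (fun h => h^-1 *: ((f \o shift a) (h *: v) - f a)) @ 0^' --> l.
  apply/cvgrPdist_le => /= e e0.
  near=> h.
  have h0 : h != 0 by near: h; exact: nbhs_dnbhs_neq.
  have he : `|h| <= Num.min 1 (e / (C + 1)).
    near: h; apply: dnbhs0_le; rewrite lt_min ltr01 divr_gt0//; lra.
  move: he; rewrite le_min => /andP[h1 he].
  have := H h h1.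
  rewrite [in X in _ -> X](_ : l = h^-1 *: (h *: l)); last first.
    by rewrite scalerA mulVf// scale1r.
  rewrite -scalerBr normrZ normfV [`|h *: l - _|]distrC => hC.
  rewrite -(ler_pM2l (_ : 0 < `|h|)) ?normr_gt0// mulrA mulfV ?normr_eq0// mul1r.
  apply: le_trans hC _.
  rewrite -[h ^+ 2]real_normK ?num_real// expr2 mulrCA ler_wpM2l//.
  rewrite (le_trans (ler_wpM2l C0 he))// mulrA ler_pdivrMr; last by lra.
  nra.
by apply: DeriveDef; [apply/cvg_ex; exists l|exact/cvg_lim].
Unshelve. all: by end_near. Qed.

(** * Test fields *)

Section plane_C11.
Context {R : realType}.
Implicit Types (u ux uy : R * R -> R) (C x y e : R).

(** Expansions are asked only along the two axes, the directions of the divergence, and Lipschitz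
    bounds only for [u] and its two partials. Each clause bounds a linear expression in
    [(u, ux, uy)], which makes the notion stable under superposition. *)
Definition plane_C11 C u ux uy := forall x y,
  [/\ forall e, `|u (x + e, y) - u (x, y) - e * ux (x, y)| <= C * e ^+ 2,
      forall e, `|u (x, y + e) - u (x, y) - e * uy (x, y)| <= C * e ^+ 2,
      forall x' y', `|u (x, y) - u (x', y')| <= C * (`|x - x'| + `|y - y'|),
      forall x' y', `|ux (x, y) - ux (x', y')| <= C * (`|x - x'| + `|y - y'|) &
      forall x' y', `|uy (x, y) - uy (x', y')| <= C * (`|x - x'| + `|y - y'|)].

Lemma lip_prod_continuous (g : R * R -> R) C :
  (forall x y x' y', `|g (x, y) - g (x', y')| <= C * (`|x - x'| + `|y - y'|)) ->
  continuous g.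
Proof.
move=> H z; apply/cvgrPdist_le => /= e e0.
have C0 : 0 <= C.
  have := H 1 0 0 0; rewrite !subr0 normr1 normr0 addr0 mulr1; exact: le_trans.
have d : 0 < e / (2 * C + 1) by rewrite divr_gt0//; lra.
near=> w.
have zw : `|z - w| <= e / (2 * C + 1).
  near: w; exists (ball z.1 (e / (2 * C + 1)), ball z.2 (e / (2 * C + 1))) => /=.
    by split; apply: nbhsx_ballx.
  move=> w [] /=; rewrite -!ball_normE /= => w1 w2.
  by rewrite prod_normE/= ge_max !ltW.
move: zw; rewrite prod_normE/= ge_max => /andP[z1 z2].
rewrite (surjective_pairing z) (surjective_pairing w).
apply: le_trans (H _ _ _ _) _.
have C1 : 0 < 2 * C + 1 by lra.
move: z1 z2; rewrite !ler_pdivlMr// => z1 z2.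
have n1 := normr_ge0 (z.1 - w.1); have n2 := normr_ge0 (z.2 - w.2).
nra.
Unshelve. all: by end_near. Qed.

Lemma plane_C11_is_derive_x C u ux uy z : plane_C11 C u ux uy ->
  is_derive z (@e_x R) u (ux z).
Proof.
case: z => x y H; apply: (@is_derive_quad _ _ _ _ _ _ _ C) => h _.
have [h1 _ _ _ _] := H x y.
have -> : h *: @e_x R + (x, y) = (x + h, y).
  rewrite [LHS]surjective_pairing /e_x /=; congr (_, _).
    by rewrite /GRing.scale/= mulr1 addrC.
  by rewrite /GRing.scale/= mulr0 add0r.
exact: h1.
Qed.

Lemma plane_C11_is_derive_y C u ux uy z : plane_C11 C u ux uy ->
  is_derive z (@e_y R) u (uy z).
Proof.
case: z => x y H; apply: (@is_derive_quad _ _ _ _ _ _ _ C) => h _.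
have [_ h1 _ _ _] := H x y.
have -> : h *: @e_y R + (x, y) = (x, y + h).
  rewrite [LHS]surjective_pairing /e_y /=; congr (_, _).
    by rewrite /GRing.scale/= mulr0 add0r.
  by rewrite /GRing.scale/= mulr1 addrC.
exact: h1.
Qed.

Lemma is_derive_pair (V : normedModType R) (f g : V -> R) (a v : V) (df dg : R) :
  is_derive a v f df -> is_derive a v g dg ->
  is_derive a v (fun z => (f z, g z)) (df, dg).
Proof.
move=> [fd fE] [gd gE].
have fc : (fun h : R => h^-1 *: ((f \o shift a) (h *: v) - f a)) @ 0^' --> df.
  by rewrite -fE; exact: fd.
have gc : (fun h : R => h^-1 *: ((g \o shift a) (h *: v) - g a)) @ 0^' --> dg.
  by rewrite -gE; exact: gd.
have c := cvg_pair fc gc.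
have {}c : (fun h : R => h^-1 *: (((fun z => (f z, g z)) \o shift a) (h *: v) - (f a, g a))) @ 0^' --> (df, dg).
  exact: c.
by apply: DeriveDef; [apply/cvg_ex; exists (df, dg)|exact/cvg_lim].
Qed.

Lemma is_derive_powR_x (r : R) (z : R * R) : 0 < z.2 ->
  is_derive z (@e_x R) (fun w : R * R => w.2 `^ r) 0.
Proof.
move=> z0; apply: (@is_derive_quad _ _ _ _ _ _ _ 0) => h _.
by rewrite /= /GRing.scale/= !mulr0 add0r !subrr normr0 mul0r.
Qed.

Lemma is_derive_powR_y (r : R) (z : R * R) : 0 < z.2 ->
  is_derive z (@e_y R) (fun w : R * R => w.2 `^ r) (r * z.2 `^ (r - 1)).
Proof.
move=> z0.
have [fd fE] := is_derive1_powR r z0.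
have E : (fun h : R => h^-1 *: (((fun w : R * R => w.2 `^ r) \o shift z) (h *: @e_y R) - z.2 `^ r))
  = (fun h => h^-1 *: (((fun x : R => x `^ r) \o shift z.2) (h *: (1 : R)) - z.2 `^ r)).
  by [].
by apply: DeriveDef; rewrite /derivable /derive /= E.
Qed.

Lemma near_eq_continuous_at (T U : topologicalType) (f g : T -> U) (z : T) :
  (\forall w \near z, g w = f w) -> {for z, continuous f} -> {for z, continuous g}.
Proof.
move=> e fc; have E := nbhs_singleton e.
rewrite /prop_for /continuous_at E; apply: cvg_trans fc; apply: near_eq_cvg.
by apply: filterS e => w ->.
Qed.

(** The competitor is [v = y^(-alpha) u]: dividing by the weight loses no smoothness since [u]
    vanishes below [delta > 0], and it turns [|u| <= y^alpha] into [|v| <= 1]. *)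
Lemma wperimeter_ge_field (alpha C C' N delta : R) (Omega : set (R * R))
    u1 u1x u1y u2 u2x u2y :
  plane_C11 C u1 u1x u1y -> plane_C11 C' u2 u2x u2y -> 0 < delta ->
  (forall x y, [\/ N < `|x|, y < delta | N < y] -> u1 (x, y) = 0 /\ u2 (x, y) = 0) ->
  (forall x y, 0 < y -> u1 (x, y) ^+ 2 + u2 (x, y) ^+ 2 <= (y `^ alpha) ^+ 2) ->
  (\int[@leb2 R]_(z in Omega) (u1x z + u2y z)%:E <= wperimeter alpha Omega)%E.
Proof.
move=> h1 h2 d0 hsupp hbd.
pose v (z : R * R) : R * R := (z.2 `^ (- alpha) * u1 z, z.2 `^ (- alpha) * u2 z).
(* At nonpositive heights the two powers need not cancel, and the vanishing of [u] takes over. *)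
have vE : (fun z : R * R => z.2 `^ alpha *: v z) = (fun z => (u1 z, u2 z)).
  apply/funext => -[x y]; rewrite /v /=.
  have [y0|y0] := ltP 0 y.
    rewrite [LHS]surjective_pairing /=; congr (_, _);
      by rewrite /GRing.scale/= mulrA powRN mulfV ?mul1r// gt_eqF// powR_gt0.
  have [|-> ->] := hsupp x y; first by apply: Or32; rewrite (le_lt_trans y0).
  by rewrite mulr0 [LHS]surjective_pairing /=; congr (_, _); rewrite /GRing.scale/= mulr0.
have divE z : divergence (fun z => z.2 `^ alpha *: v z) z = u1x z + u2y z.
  rewrite vE /divergence; congr (_ + _).
    have E : fst \o (fun z : R * R => (u1 z, u2 z)) = u1 by apply/funext.
    by rewrite E; have [_ ->] := plane_C11_is_derive_x z h1.
  have E : snd \o (fun z : R * R => (u1 z, u2 z)) = u2 by apply/funext.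
  by rewrite E; have [_ ->] := plane_C11_is_derive_y z h2.
apply: ereal_sup_ubound; exists v; last first.
  by apply: eq_integral => z _; rewrite divE.
split; last first.
  move=> [x y] _; rewrite /enorm2 /v /=.
  have [y0|y0] := ltP 0 y; last first.
    have [|-> ->] := hsupp x y; first by apply: Or32; rewrite (le_lt_trans y0).
    by rewrite mulr0 expr0n/= addr0 sqrtr0.
  rewrite -[leRHS]sqrtr1; apply: ler_wsqrtr.
  rewrite !exprMn -mulrDr powRN exprVn mulrC ler_pdivrMr ?exprn_gt0 ?powR_gt0// mul1r.
  exact: hbd.
have dx z : half_plane z -> is_derive z (@e_x R) v
    (z.2 `^ (- alpha) * u1x z, z.2 `^ (- alpha) * u2x z).
  move=> z0; apply: is_derive_pair.
    apply: (is_derive_eq (is_deriveM (is_derive_powR_x (- alpha) z0) (plane_C11_is_derive_x z h1))).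
    by rewrite /GRing.scale/= mulr0 addr0.
  apply: (is_derive_eq (is_deriveM (is_derive_powR_x (- alpha) z0) (plane_C11_is_derive_x z h2))).
  by rewrite /GRing.scale/= mulr0 addr0.
pose dyu (u uy : R * R -> R) (z : R * R) : R :=
  z.2 `^ (- alpha) * uy z + u z * (- alpha * z.2 `^ (- alpha - 1)).
have dy z : half_plane z -> is_derive z (@e_y R) v (dyu u1 u1y z, dyu u2 u2y z).
  move=> z0; apply: is_derive_pair.
    by apply: (is_derive_eq (is_deriveM (is_derive_powR_y (- alpha) z0) (plane_C11_is_derive_y z h1))).
  by apply: (is_derive_eq (is_deriveM (is_derive_powR_y (- alpha) z0) (plane_C11_is_derive_y z h2))).
have nearH (z : R * R) : half_plane z -> \forall w \near z, half_plane w.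
  case: z => x y /= z0.
  exists (setT, [set t : R | 0 < t]) => /=.
    split; first exact: filterT.
    exact: (lt_nbhsr z0).
  by case=> a b /= [].
have cont (C0 : R) u ux uy : plane_C11 C0 u ux uy -> [/\ continuous u, continuous ux & continuous uy].
  move=> h; split; apply: (@lip_prod_continuous _ C0) => x y x' y';
    by have [_ _ g1 g2 g3] := h x y.
have [u1c u1xc u1yc] := cont _ _ _ _ h1.
have [u2c u2xc u2yc] := cont _ _ _ _ h2.
have powc r (z : R * R) : half_plane z -> {for z, continuous (fun w : R * R => w.2 `^ r)}.
  move=> z0.
  apply: (@continuous_comp _ _ _ snd (fun t : R => t `^ r)); first exact: cvg_snd.
  apply: differentiable_continuous; apply/derivable1_diffP.
  by have [] := is_derive1_powR r z0.
have pairc (f g : R * R -> R) (z : R * R) : {for z, continuous f} -> {for z, continuous g} ->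
  {for z, continuous (fun w => (f w, g w))} by exact: cvg_pair.
have sumc (f g : R * R -> R) (z : R * R) : {for z, continuous f} -> {for z, continuous g} ->
  {for z, continuous (fun w => f w + g w)} by exact: cvgD.
have prodc (f g : R * R -> R) (z : R * R) : {for z, continuous f} -> {for z, continuous g} ->
  {for z, continuous (fun w => f w * g w)} by exact: cvgM.
pose box : set (R * R) := `[- N, N]%classic `*` `[delta, N]%classic.
have cbox : compact box by apply: compact_setX; exact: segment_compact.
have sub : closure [set z | v z != 0] `<=` box.
  have clbox : closed box by apply: compact_closed.
  rewrite closureE; apply: smallest_sub => // -[x y] /= vz.
  have nout : ~ [\/ N < `|x|, y < delta | N < y].
    by move=> /hsupp[e1 e2]; move/eqP: vz; apply; rewrite /v /= e1 e2 mulr0.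
  split; rewrite /= in_itv/=.
    by rewrite -ler_norml leNgt; apply/negP => ?; apply: nout; apply: Or31.
  by apply/andP; split; rewrite leNgt; apply/negP => ?; apply: nout;
    [apply: Or32|apply: Or33].
split.
- move=> z z0; split; [by have [] := dx z z0|by have [] := dy z z0| |].
  + have near_eq : \forall w \near z, 'D_(e_x R) v w =
        (w.2 `^ (- alpha) * u1x w, w.2 `^ (- alpha) * u2x w).
      by apply: filterS (nearH z z0) => w w0; have [_ ->] := dx w w0.
    apply: (near_eq_continuous_at near_eq).
    by apply: (pairc _ _ z); apply: (prodc _ _ z); by [apply: powc|apply: u1xc|apply: u2xc].
  + have near_eq : \forall w \near z, 'D_(e_y R) v w = (dyu u1 u1y w, dyu u2 u2y w).
      by apply: filterS (nearH z z0) => w w0; have [_ ->] := dy w w0.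
    apply: (near_eq_continuous_at near_eq).
    have dyuc u uy : continuous u -> continuous uy -> {for z, continuous (dyu u uy)}.
      move=> uc uyc; apply: (sumc _ _ z); apply: (prodc _ _ z); [exact: powc|exact: uyc|exact: uc|].
      by apply: (prodc _ _ z); [exact: cvg_cst|exact: powc].
    by apply: (pairc _ _ z); apply: (dyuc _ _).
- by apply: subclosed_compact cbox sub; exact: closed_closure.
- move=> z /sub[_]; rewrite /= in_itv/= /half_plane /= => /andP[+ _].
  exact: lt_le_trans.
Qed.

End plane_C11.

(** * Borel versions of Lebesgue measurable sets *)

Section borel_version.
Context d (T : measurableType d) (R : realType) (mu : {measure set T -> \bar R}).
Local Open Scope ereal_scope.

(** Countable covers whose measure exceeds the outer measure by less than [1 / (n + 1)] are
    intersected; infinite outer measure takes the whole space. *)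
Lemma measurable_hull (X : set T) :
  exists H, [/\ measurable H, X `<=` H & (mu^*)%mu X = mu H].
Proof.
have [Xoo|Xfin] := eqVneq ((mu^*)%mu X) +oo.
  exists setT; split => //; rewrite Xoo; apply/esym/eqP; rewrite -leye_eq -Xoo.
  by rewrite -measurable_mu_extE//; exact: le_mu_ext.
have inv0 n : (0 < n.+1%:R^-1 :> R)%R by rewrite invr_gt0.
have fX : (mu^*)%mu X \is a fin_num by rewrite ge0_fin_numE ?mu_ext_ge0// ltey.
have coverE (n : nat) : exists F : (set T)^nat, measurable_cover X F /\
    \sum_(0 <= k <oo) mu (F k) < (mu^*)%mu X + n.+1%:R^-1%:E.
  by have [_ [F XF <-] ?] := lb_ereal_inf_adherent (inv0 n) fX; exists F.
pose F n := projT1 (cid (coverE n)).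
have FE n : measurable_cover X (F n) /\
    \sum_(0 <= k <oo) mu (F n k) < (mu^*)%mu X + n.+1%:R^-1%:E.
  by rewrite /F; case: cid.
pose H := \bigcap_n \bigcup_m F n m.
have mH n : measurable (\bigcup_m F n m).
  by apply: bigcupT_measurable => m; have [[+ _] _] := FE n; apply.
have mHH : measurable H by exact: bigcapT_measurable.
have XH : X `<=` H by apply: sub_bigcap => n _; have [[_ +] _] := FE n.
exists H; split => //; apply/eqP; rewrite eq_le; apply/andP; split.
  by rewrite -measurable_mu_extE//; exact: le_mu_ext.
apply/lee_addgt0Pr => e e0.
have [n ne] : exists n, (n.+1%:R^-1 < e)%R.
  have := near_infty_natSinv_lt (PosNum e0).
  by move=> [n _ /(_ n (leqnn n))] /= ?; exists n.
apply: (@le_trans _ _ (mu (\bigcup_m F n m))).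
  by rewrite le_measure ?inE//; exact: bigcap_inf.
apply: (@le_trans _ _ (\sum_(0 <= k <oo) mu (F n k))).
  apply: (@measure_sigma_subadditive _ _ _ mu) => //.
  by have [[+ _] _] := FE n.
by rewrite (le_trans (ltW (FE n).2))// leeD2l// lee_fin ltW.
Qed.

(** On each piece of finite measure the hull exceeds [E] by a set of outer measure 0, which itself
    has a null hull; both hulls are united over the exhaustion. *)
Lemma caratheodory_borel_version (E : set T) (S : (set T)^nat) :
  (forall n, measurable (S n) /\ mu (S n) < +oo) -> \bigcup_n S n = setT ->
  (mu^*)%mu.-cara.-measurable E ->
  exists E' N, [/\ measurable E', measurable N, mu N = 0 &
    forall z, ~ N z -> (E z <-> E' z)].
Proof.
move=> mS ST mE.
have mES n : (mu^*)%mu.-cara.-measurable (E `&` S n).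
  apply: caratheodory_measurable_setI => //.
  exact: (@caratheodory_measurable_mu_ext _ _ _ mu _ (mS n).1).
pose H n := projT1 (cid (measurable_hull (E `&` S n))).
have HE n : [/\ measurable (H n), E `&` S n `<=` H n & (mu^*)%mu (E `&` S n) = mu (H n)].
  by rewrite /H; case: cid.
pose N n := projT1 (cid (measurable_hull (H n `\` (E `&` S n)))).
have NE n : [/\ measurable (N n), H n `\` (E `&` S n) `<=` N n &
   (mu^*)%mu (H n `\` (E `&` S n)) = mu (N n)].
  by rewrite /N; case: cid.
have N0 n : mu (N n) = 0.
  have [mH sH eH] := HE n.
  have [_ _ <-] := NE n.
  (* The Caratheodory condition is tested on the hull itself; finiteness of its measure allows the
     cancellation. *)
  have := mES n (H n) : (mu^*)%mu (H n) = (mu^*)%mu (H n `&` (E `&` S n)) +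
    (mu^*)%mu (H n `&` ~` (E `&` S n)).
  rewrite (setIidr sH) eH measurable_mu_extE// -setDE.
  have fH : mu (H n) \is a fin_num.
    rewrite -eH ge0_fin_numE ?mu_ext_ge0// (le_lt_trans _ (mS n).2)//.
    have := @le_mu_ext _ _ _ mu _ _ (@subIsetr _ E (S n)).
    by rewrite (measurable_mu_extE _ (mS n).1).
  by move/eqP; rewrite addeC -sube_eq// ?fin_num_adde_defl// subee// => /eqP.
exists (\bigcup_n H n), (\bigcup_n N n); split.
- by apply: bigcupT_measurable => n; have [] := HE n.
- by apply: bigcupT_measurable => n; have [] := NE n.
- apply/eqP; rewrite eq_le measure_ge0 andbT.
  apply: (@le_trans _ _ (\sum_(0 <= k <oo) mu (N k))); last by rewrite eseries0.
  apply: (@measure_sigma_subadditive _ _ _ mu) => //.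
    by move=> n; have [] := NE n.
  by apply: bigcupT_measurable => n; have [] := NE n.
- move=> z Nz; split => [Ez|[n _ Hz]].
    have : (\bigcup_n S n) z by rewrite ST.
    by move=> [n _ Sz]; exists n => //; have [_ + _] := HE n; apply.
  have [_ sN _] := NE n.
  apply: contrapT => Ez; apply: Nz; exists n => //; apply: sN; split => //.
  by move=> [].
Qed.

End borel_version.

Section leb2_borel.
Context {R : realType}.
Local Open Scope ereal_scope.
Notation T2 := (measurableTypeR R * measurableTypeR R)%type.

Lemma leb2_borel_version (Omega : set (R * R)) : lebesgue_measurable2 Omega ->
  exists (Omega' N : set T2), [/\ measurable Omega', measurable N, @leb2_borel R N = 0 &
    forall z, ~ N z -> (Omega z <-> Omega' z)].
Proof.
pose I (n : nat) : set (measurableTypeR R) := `[- n%:R, n%:R]%classic%R.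
move=> mO; apply: (@caratheodory_borel_version _ _ _ (@leb2_borel R) Omega (fun n => I n `*` I n)) => //.
  move=> n; split; first by apply: measurableX; exact: measurable_itv.
  have -> : leb2_borel R (I n `*` I n) = lebesgue_measure (I n) * lebesgue_measure (I n).
    by apply: product_measure1E; exact: measurable_itv.
  rewrite /I lebesgue_measure_itv/=.
  by case: ifPn => _; rewrite ?mule0// -EFinD -EFinM ltry.
apply/seteqP; split => // -[x y] _.
have [n hn] : exists n : nat, (`|x| <= n%:R /\ `|y| <= n%:R)%R.
  pose M : R := Num.max `|x : R|%R `|y : R|%R.
  exists (Num.trunc M).+1.
  have : (M <= (Num.trunc M).+1%:R)%R by apply/ltW/truncnS_gt.
  by rewrite ge_max => /andP[].
exists n => //; rewrite /I; split; rewrite /= in_itv/= -ler_norml; apply hn.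
Qed.

(** The identity from the completed space to the product space pushes [leb2] forward to
    [leb2_borel]; the null set [N] is discarded before the transfer. *)
Lemma ge0_leb2_integral (Omega : set (R * R)) (Omega' N : set T2) (f : T2 -> \bar R) :
  lebesgue_measurable2 Omega ->
  measurable Omega' -> measurable N -> @leb2_borel R N = 0 ->
  (forall z, ~ N z -> (Omega z <-> Omega' z)) ->
  measurable_fun setT f -> (forall z, 0 <= f z) ->
  \int[@leb2 R]_(z in Omega) f z = \int[@leb2_borel R]_(z in Omega') f z.
Proof.
move=> mO mO' mN N0 NO mf hf.
have subm (A : set T2) : measurable A -> measurable (A : set (leb2_type R)).
  by move=> mA; exact: (@caratheodory_measurable_mu_ext _ _ _ (@leb2_borel R) _ mA).
have leb2E (A : set T2) : measurable A -> leb2 R A = leb2_borel R A.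
  by move=> mA; exact: (@measurable_mu_extE _ _ _ (@leb2_borel R) A mA).
have mid : measurable_fun setT (idfun : leb2_type R -> T2).
  by move=> _ Y mY; rewrite setTI; exact: subm.
have mf' : measurable_fun setT (f : leb2_type R -> \bar R).
  by move=> _ Y mY; rewrite setTI; apply: subm; rewrite -[X in measurable X]setTI; exact: mf.
rewrite integral_mkcond (integral_mkcond Omega').
have mres (A : set (leb2_type R)) : measurable A ->
    measurable_fun setT (f \_ A : leb2_type R -> \bar R).
  by move=> mA; apply/(measurable_restrictT _ mA); exact: measurable_funTS.
transitivity (\int[@leb2 R]_z (f \_ (Omega' : set (R * R))) z).
  apply: ae_eq_integral; [exact: measurableT|exact: mres|by apply: mres; exact: subm|].
  exists N; split; [exact: subm|by rewrite leb2E|].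
  move=> z /= h; apply: contrapT => Nz; apply: h => _.
  rewrite /patch; have [oo' o'o] := NO z Nz.
  have [/set_mem Oz|Oz] := boolP (z \in Omega).
    by rewrite (mem_set (oo' Oz)).
  by rewrite ifF//; apply/negP => /set_mem/o'o/mem_set; apply/negP.
have mg : measurable_fun setT (f \_ Omega').
  by apply/(measurable_restrictT _ mO'); exact: measurable_funTS.
have eqm (A : set T2) : measurable A -> A `<=` setT ->
    pushforward (@leb2 R) (idfun : leb2_type R -> T2) A = @leb2_borel R A.
  by move=> mA _; rewrite /pushforward preimage_id leb2E.
transitivity (\int[pushforward (@leb2 R) (idfun : leb2_type R -> T2)]_z
    (f \_ Omega') z); last exact: eq_measure_integral.
rewrite ge0_integral_pushforward//=.
by move=> z _; rewrite /patch; case: ifP.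
Qed.

Lemma leb2_integral (Omega : set (R * R)) (Omega' N : set T2) (f : T2 -> \bar R) :
  lebesgue_measurable2 Omega ->
  measurable Omega' -> measurable N -> @leb2_borel R N = 0 ->
  (forall z, ~ N z -> (Omega z <-> Omega' z)) ->
  measurable_fun setT f ->
  \int[@leb2 R]_(z in Omega) f z = \int[@leb2_borel R]_(z in Omega') f z.
Proof.
move=> mO mO' mN N0 NO mf.
rewrite integralE [RHS]integralE; congr (_ - _);
  apply: (ge0_leb2_integral mO mO' mN) => //.
- exact: measurable_funepos.
- exact: measurable_funeneg.
Qed.

End leb2_borel.

(** * Mollification *)

Section parametric_integral.
Context d1 d2 (T1 : measurableType d1) (T2 : measurableType d2) (R : realType).
Variable m2 : {sigma_finite_measure set T2 -> \bar R}.
Local Open Scope ereal_scope.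

Lemma measurable_fun_param_integral (g : T1 * T2 -> \bar R) :
  measurable_fun setT g -> measurable_fun setT (fun x => \int[m2]_y g (x, y)).
Proof.
move=> mg.
rewrite (_ : (fun x => _) = (fun x => \int[m2]_y (g^\+)%E (x, y) - \int[m2]_y (g^\-)%E (x, y))).
  apply: emeasurable_funB.
    apply: (@measurable_fun_fubini_tonelli_F _ _ _ _ _ m2 (g^\+)%E) => //.
    exact: measurable_funepos.
  apply: (@measurable_fun_fubini_tonelli_F _ _ _ _ _ m2 (g^\-)%E) => //.
  exact: measurable_funeneg.
apply/funext => x; rewrite [LHS]integralE; congr (_ - _); apply: eq_integral => y _.
  by rewrite !funeposE.
by rewrite !funenegE.
Qed.

Lemma measurable_fun_param_Rintegral (g : T1 * T2 -> R) :
  measurable_fun setT g -> measurable_fun setT (fun x => (\int[m2]_y g (x, y))%R).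
Proof.
move=> mg; apply: (measurableT_comp (fine_measurable measurableT)).
by apply: (@measurable_fun_param_integral (EFin \o g)); exact/measurable_EFinP.
Qed.

End parametric_integral.

Section approximate_identity.
Context {R : realType}.
Notation mu := (@lebesgue_measure R).
Implicit Types (f : R -> R) (x y t N C M : R).

Lemma is_derive_bounded_C11 C f df x : bounded_C11 C f df ->
  is_derive x 1 f (df x).
Proof.
move=> hf; apply: (@is_derive_quad _ _ _ _ _ _ _ C) => h _.
have [_ _] := hf x h; rewrite /GRing.scale/= mulr1 [h + x]addrC.
by [].
Qed.

Lemma bounded_C11_continuous C f df : bounded_C11 C f df -> continuous f.
Proof.
move=> hf x; apply: differentiable_continuous; apply/derivable1_diffP.
by have [] := is_derive_bounded_C11 x hf.
Qed.

Lemma dsstep_continuous : continuous (@dsstep R).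
Proof. exact: bounded_C11_continuous bounded_C11_dsstep. Qed.

Lemma sstep_continuous : continuous (@sstep R).
Proof. exact: bounded_C11_continuous bounded_C11_sstep. Qed.

Lemma measurable_dsstep : measurable_fun setT (@dsstep R).
Proof. by apply: continuous_measurable_fun; exact: dsstep_continuous. Qed.

Lemma measurable_sstep : measurable_fun setT (@sstep R).
Proof. by apply: continuous_measurable_fun; exact: sstep_continuous. Qed.

(** One-sided on purpose: the kernel lives on [[0, 1/N]], so [moll N f y] averages [f] over
    arguments below [y], and a bound by the nondecreasing [t^alpha] passes to [y]. *)
Definition mollifier N t : R := N * dsstep (N * t).

Lemma mollifier_ge0 N t : 0 <= N -> 0 <= mollifier N t.
Proof. by move=> N0; rewrite mulr_ge0// dsstep_ge0. Qed.

Lemma mollifier_le N t : 0 <= N -> mollifier N t <= 360 * N.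
Proof. by move=> N0; rewrite /mollifier mulrC ler_wpM2r// dsstep_le. Qed.

Lemma mollifier_out N t : 0 < N -> t <= 0 \/ N^-1 <= t -> mollifier N t = 0.
Proof.
move=> N0 h; rewrite /mollifier dsstep_out ?mulr0//.
case: h => h; [left|right]; first by rewrite pmulr_rle0.
by rewrite -(mulfV (lt0r_neq0 N0)) ler_pM2l.
Qed.

Lemma measurable_mollifier N : measurable_fun setT (mollifier N).
Proof.
apply: measurable_funM => //.
by apply: measurableT_comp; [exact: measurable_dsstep|exact: measurable_funM].
Qed.

(* [sstep (N * _)] is the primitive of the mollifier that vanishes at 0. *)
Lemma integral_mollifier_itv N y b : 0 < N -> b <= y ->
  (\int[mu]_(t in `[b, y]) (mollifier N (y - t))%:E = (sstep (N * (y - b)))%:E)%E.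
Proof.
move=> N0; rewrite le_eqVlt => /predU1P[->|by_].
  by rewrite set_itv1 integral_set1 subrr mulr0 sstep_le0.
have D : bounded_C11 (`|-1| * ((180 + 180) * (1 + `|- N| + (- N) ^+ 2)))
    (fun t => -1 * sstep (- N * t + N * y)) (fun t => -1 * (- N * dsstep (- N * t + N * y))).
  by apply: bounded_C11Z; apply: bounded_C11_affine; exact: bounded_C11_sstep.
have E (t : R) : - N * t + N * y = N * (y - t) by ring.
rewrite (@continuous_FTC2 _ (fun t => mollifier N (y - t))
  (fun t => -1 * sstep (- N * t + N * y)) b y by_).
- rewrite !E subrr mulr0 (sstep_le0 (lexx _)) mulr0 -EFinB; congr (_%:E); ring.
- apply: continuous_subspaceT => t.
  apply: (@cvgM _ _ (nbhs t) _ (fun=> N) (fun t => dsstep (N * (y - t)))).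
    exact: cvg_cst.
  apply: (@continuous_comp _ _ _ (fun t => N * (y - t)) (@dsstep R)).
    by apply: cvgM; [exact: cvg_cst|apply: cvgB; [exact: cvg_cst|exact: cvg_id]].
  exact: dsstep_continuous.
- split.
  + by move=> t _; have [] := is_derive_bounded_C11 t D.
  + by apply: cvg_at_right_filter; exact: (bounded_C11_continuous D).
  + by apply: cvg_at_left_filter; exact: (bounded_C11_continuous D).
- move=> t _; rewrite derive1E; have [_ ->] := is_derive_bounded_C11 t D.
  by rewrite E /mollifier; ring.
Qed.

Lemma integral_mollifier N y : 0 < N ->
  (\int[mu]_t (mollifier N (y - t))%:E = 1)%E.
Proof.
move=> N0.
have yy : y - N^-1 <= y by rewrite lerBlDr lerDl invr_ge0 ltW.
have := integral_mollifier_itv N0 yy.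
have -> : y - (y - N^-1) = N^-1 by ring.
rewrite mulfV ?gt_eqF// sstep_ge1// => <-.
rewrite [RHS]integral_mkcond; apply: eq_integral => t _.
rewrite patchE; case: ifPn => // /negP tn; congr (_%:E).
apply: mollifier_out => //.
have [ty|ty] := leP (y - t) 0; first by left.
right; rewrite leNgt; apply/negP => h; apply: tn; rewrite inE/= in_itv/=.
by apply/andP; split; lra.
Qed.

Definition moll N f y : R := \int[mu]_t (f t * mollifier N (y - t)).

Lemma measurable_moll2 N (f : R -> R -> R) :
  measurable_fun setT (fun z : R * R => f z.1 z.2) ->
  measurable_fun setT (fun z : R * R => moll N (f z.1) z.2).
Proof.
move=> mf; rewrite /moll.
apply: (@measurable_fun_param_Rintegral _ _ (R * R)%type (measurableTypeR R) R mu
  (fun z => f z.1.1 z.2 * mollifier N (z.1.2 - z.2))).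
apply: measurable_funM.
  have mp : measurable_fun setT (fun x : (R * R) * measurableTypeR R => (x.1.1, x.2)).
    apply/measurable_fun_pairP; split.
    - exact: (measurableT_comp measurable_fst measurable_fst).
    - exact: measurable_snd.
  exact: (measurableT_comp mf mp).
apply: (measurableT_comp (measurable_mollifier N)).
by apply: measurable_funB => //; apply: measurableT_comp.
Qed.

Lemma integrable_mollifier N y : 0 < N ->
  mu.-integrable setT (fun t => (mollifier N (y - t))%:E).
Proof.
move=> N0; apply/integrableP; split.
  apply/measurable_EFinP; apply: (measurableT_comp (measurable_mollifier N)).
  exact: measurable_funB.
under eq_integral do rewrite gee0_abs ?lee_fin ?mollifier_ge0 ?(ltW N0)//.
by rewrite integral_mollifier// ltry.
Qed.

Lemma integrable_moll N f C y : 0 < N -> measurable_fun setT f ->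
  (forall t, `|f t| <= C) ->
  mu.-integrable setT (fun t => (f t * mollifier N (y - t))%:E).
Proof.
move=> N0 mf fC.
have C0 : 0 <= C by rewrite (le_trans _ (fC 0)).
apply: (@le_integrable _ _ _ mu _ measurableT _ (fun t => C%:E * (mollifier N (y - t))%:E)%E).
- apply/measurable_EFinP; apply: measurable_funM => //.
  by apply: (measurableT_comp (measurable_mollifier N)); exact: measurable_funB.
- move=> t _; rewrite /= lee_fin !normrM.
  by apply: ler_pM => //; rewrite (le_trans (fC t))// ler_norm.
- by apply: integrableZl => //; exact: integrable_mollifier.
Qed.

Lemma moll_norm_le N f C y : 0 < N -> measurable_fun setT f ->
  (forall t, `|f t| <= C) -> `|moll N f y| <= C.
Proof.
move=> N0 mf fC.
have C0 : 0 <= C by rewrite (le_trans _ (fC 0)).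
rewrite /moll (le_trans (le_normr_Rintegral _ _))//; first exact: (integrable_moll _ _ _ fC).
rewrite -lee_fin /Rintegral fineK; last first.
  have /integrableP[_] := integrable_moll y N0 mf fC.
  by move=> h; rewrite ge0_fin_numE// integral_ge0// => x _; rewrite lee_fin.
have -> : C%:E = (\int[mu]_t (C%:E * (mollifier N (y - t))%:E))%E.
  rewrite ge0_integralZl//; last 2 first.
  - apply/measurable_EFinP; apply: (measurableT_comp (measurable_mollifier N)).
    exact: measurable_funB.
  - by move=> t _; rewrite lee_fin mollifier_ge0// ltW.
  by rewrite integral_mollifier// mule1.
apply: ge0_le_integral => //.
- apply/measurable_EFinP; apply: measurableT_comp => //; apply: measurable_funM => //.
  by apply: (measurableT_comp (measurable_mollifier N)); exact: measurable_funB.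
- apply/measurable_EFinP; apply: measurable_funM => //.
  by apply: (measurableT_comp (measurable_mollifier N)); exact: measurable_funB.
- move=> t _; rewrite -EFinM lee_fin normrM ler_pM//.
  by rewrite ger0_norm// mollifier_ge0// ltW.
Qed.

Lemma moll_out N f M y : 1 <= N -> (forall t, M < `|t| -> f t = 0) ->
  M + 1 < `|y| -> moll N f y = 0.
Proof.
move=> N1 fM yM; rewrite /moll /Rintegral.
rewrite (eq_integral (cst 0%E)) ?integral0// => t _; congr (_%:E).
have [tM|tM] := ltP M `|t|; first by rewrite fM// mul0r.
have N0 : 0 < N by lra.
rewrite mollifier_out ?mulr0//.
have [ty|ty] := leP (y - t) 0; first by left.
right; apply: (@le_trans _ _ 1); first by rewrite invf_le1.
have := ler_normB y t; have := ler_normD (y - t) t; rewrite subrK (gtr0_norm ty); lra.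
Qed.

(** The kernel is at most [360 * N] and lives in a ball of measure [2 / N], whence 720 times the
    mean deviation on that ball. *)
Lemma moll_lebesgue_pt f C N y : 0 < N -> measurable_fun setT f ->
  (forall t, `|f t| <= C) ->
  (`|moll N f y - f y|%:E <= 720%:E * davg f y N^-1)%E.
Proof.
move=> N0 mf fC.
have C0 : 0 <= C by rewrite (le_trans _ (fC 0)).
have mm : measurable_fun setT (fun t => mollifier N (y - t)).
  by apply: (measurableT_comp (measurable_mollifier N)); exact: measurable_funB.
have fcC t : `|f t - f y| <= C + C by rewrite (le_trans (ler_normB _ _))// lerD.
have mfc : measurable_fun setT (fun t => f t - f y) by exact: measurable_funB.
have -> : moll N f y - f y = \int[mu]_t ((f t - f y) * mollifier N (y - t)).
  have e1 : f y = \int[mu]_t (f y * mollifier N (y - t)).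
    rewrite RintegralZl//; last exact: integrable_mollifier.
    by rewrite /Rintegral integral_mollifier//= mulr1.
  rewrite {1}e1 /moll -RintegralB//; last 2 first.
  - exact: (integrable_moll _ _ _ fC).
  - by apply: (@integrable_moll _ _ `|f y|) => //; exact: measurable_cst.
  by apply: eq_Rintegral => t _; rewrite mulrBl.
apply: (@le_trans _ _ (\int[mu]_t `|(f t - f y) * mollifier N (y - t)|)%:E).
  rewrite lee_fin; apply: le_normr_Rintegral => //.
  exact: (integrable_moll _ _ _ fcC).
rewrite /Rintegral fineK; last first.
  have /integrableP[_] := integrable_moll y N0 mfc fcC.
  by move=> h; rewrite ge0_fin_numE// integral_ge0// => x _; rewrite lee_fin.
have iN0 : 0 < N^-1 by rewrite invr_gt0.
have k0 : (0 <= (360 * N)%:E)%E by rewrite lee_fin; have := N0; lra.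
rewrite /davg /iavg lebesgue_measure_ball ?(ltW iN0)//.
have mb : measurable (ball y N^-1 : set R) by exact: measurable_ball.
have mfb : measurable_fun setT (fun t => `|f t - f y|%:E).
  by apply/measurable_EFinP; exact: measurableT_comp.
apply: (@le_trans _ _ (\int[mu]_(t in ball y N^-1) ((360 * N)%:E * `|f t - f y|%:E))%E).
  rewrite [leRHS]integral_mkcond; apply: ge0_le_integral => //.
  - apply/measurable_EFinP; apply: measurableT_comp => //; exact: measurable_funM.
  - apply/(measurable_restrictT _ mb); apply: measurable_funTS.
    exact: measurable_funeM.
  - move=> t _; rewrite patchE; case: ifPn => tb.
      rewrite -EFinM lee_fin normrM mulrC ler_wpM2r//.
      by rewrite ger0_norm ?mollifier_le ?mollifier_ge0 ?ltW.
    rewrite mollifier_out ?mulr0 ?normr0//.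
    have [ty|ty] := leP (y - t) 0; first by left.
    right; rewrite leNgt; apply/negP => h; move/negP: tb; apply.
    by rewrite inE /ball/= gtr0_norm.
rewrite ge0_integralZl; [|exact: mb|exact: (measurable_funTS mfb)|
  by move=> t _; rewrite lee_fin|exact: k0].
rewrite muleA inver mulrn_eq0/= gt_eqF// -EFinM lee_wpmul2r//.
  by rewrite integral_ge0.
rewrite lee_fin; have -> : 720 / (N^-1 *+ 2) = 360 * N.
  by field; rewrite gt_eqF.
by [].
Qed.

(** Convergence holds at every Lebesgue point of [f]. *)
Lemma moll_ae_cvg f C : measurable_fun setT f -> (forall t, `|f t| <= C) ->
  {ae mu, forall y, moll n.+1%:R f y @[n --> \oo] --> f y}.
Proof.
move=> mf fC.
have C0 : 0 <= C by rewrite (le_trans _ (fC 0)).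
have lf : locally_integrable setT f.
  split => //; first exact: openT.
  move=> K _ cK; apply: (@le_lt_trans _ _ (\int[mu]_(x in K) (cst C%:E x))%E).
    apply: ge0_le_integral => //; first exact: compact_measurable.
    - apply/measurable_EFinP; apply: measurable_funTS; exact: measurableT_comp.
    - by move=> x _; rewrite lee_fin.
  rewrite (integral_cst mu (compact_measurable cK)); apply: lte_mul_pinfty => //.
  exact: compact_finite_measure.
have [Z [mZ Z0 ZS]] := lebesgue_differentiation lf.
exists Z; split => //; apply: subset_trans ZS => y /=; apply: contra_not => hy.
have h0 : (720%:E * davg f y n.+1%:R^-1)%E @[n --> \oo] --> (720%:E * 0)%E.
  apply: cvgeM; [by []|exact: cvg_cst|].
  have /cvge_at_rightP/(_ (fun n => n.+1%:R^-1)) := hy.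
  by apply; split => //; exact: cvg_harmonic.
rewrite mule0 in h0.
apply/subr_cvg0/norm_cvg0P.
have h1 : (`|moll n.+1%:R f y - f y|%:E)%E @[n --> \oo] --> 0%:E.
  apply: squeeze_cvge (cvg_cst _) h0; apply: nearW => n.
  by rewrite lee_fin normr_ge0/= (moll_lebesgue_pt _ _ mf fC).
exact: fine_cvg h1.
Qed.

Lemma moll_L1_cvg f C M : measurable_fun setT f -> (forall t, `|f t| <= C) ->
  (forall t, M < `|t| -> f t = 0) ->
  (\int[mu]_y `|moll n.+1%:R f y - f y|%:E)%E @[n --> \oo] --> 0%E.
Proof.
move=> mf fC fM.
have mm n : measurable_fun setT (moll n.+1%:R f).
  have mf2 : measurable_fun setT (fun z : R * R => f z.2).
    by apply: measurableT_comp.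
  have := measurable_moll2 n.+1%:R (f := fun=> f) mf2.
  by move=> h; exact: (measurable_fun_pair2 (0 : R) h).
have I := @dominated_convergence _ _ _ mu setT measurableT
  (fun n y => (moll n.+1%:R f y)%:E) (fun y => (f y)%:E)
  (fun y => (C%:E * (\1_(`[- (M + 1), M + 1]%classic) y)%:E)%E).
have [|||||_ + _] := I.
- by move=> n; apply/measurable_EFinP; exact: mm.
- exact/measurable_EFinP.
- have [Z [mZ Z0 ZS]] := moll_ae_cvg mf fC.
  exists Z; split => //; apply: subset_trans ZS => y /=; apply: contra_not => h _.
  by apply: cvg_EFin => //; exact: nearW.
- apply: integrableZl => //; apply/integrableP; split.
    by apply/measurable_EFinP; exact: measurable_indic.
  under eq_integral do rewrite gee0_abs ?lee_fin//.
  rewrite integral_indic//= setIT lebesgue_measure_itv/=.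
  by case: ifP => _; rewrite ?ltry// -EFinB ltry.
- apply: aeW => y n _; rewrite -EFinM lee_fin indicE.
  have [yM|yM] := boolP (y \in `[- (M + 1), M + 1]%classic); first by rewrite mulr1 (moll_norm_le _ _ mf fC).
  rewrite mulr0 (moll_out _ fM) ?normr0//; first by rewrite ler1n.
  by rewrite ltNge; apply: contra yM => h; rewrite inE/= in_itv/= -ler_norml.
- move=> h; apply: cvg_trans h; apply: near_eq_cvg; exact: nearW.
Qed.

(** Only the second variable is smoothed. The one-variable limits for fixed [x] are dominated by a
    multiple of the indicator of [[-M, M]]. *)
Lemma moll2_L1_cvg (f : R -> R -> R) C M :
  measurable_fun setT (fun z : R * R => f z.1 z.2) ->
  (forall x t, `|f x t| <= C) ->
  (forall x t, M < `|x| \/ M < `|t| -> f x t = 0) ->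
  (\int[mu]_x \int[mu]_y `|moll n.+1%:R (f x) y - f x y|%:E)%E @[n --> \oo] --> 0%E.
Proof.
move=> mf fC fM.
have C0 : 0 <= C by rewrite (le_trans _ (fC 0 0)).
have mfx x : measurable_fun setT (f x) by exact: (measurable_fun_pair2 (x : R) mf).
have mm n : measurable_fun setT (fun z : R * R => moll n.+1%:R (f z.1) z.2).
  exact: measurable_moll2.
have md n : measurable_fun setT (fun z : R * R => (`|moll n.+1%:R (f z.1) z.2 - f z.1 z.2|)%:E).
  by apply/measurable_EFinP; apply: measurableT_comp => //; exact: measurable_funB.
have mI n : measurable_fun setT
    (fun x => \int[mu]_y `|moll n.+1%:R (f x) y - f x y|%:E)%E.
  exact: (measurable_fun_param_integral mu (md n)).
have box x n : (\int[mu]_y `|moll n.+1%:R (f x) y - f x y|%:E <=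
    (2 * C)%:E * mu `[(- (M + 1))%R, (M + 1)%R])%E.
  have mb : measurable (`[(- (M + 1))%R, (M + 1)%R]%classic : set R) by exact: measurable_itv.
  rewrite -(integral_cst mu mb) [leRHS]integral_mkcond; apply: ge0_le_integral => //.
  - exact: (measurable_fun_pair2 (x : R) (md n)).
  - by apply/(measurable_restrictT _ mb); exact: measurable_cst.
  - move=> y _; rewrite patchE.
    have [yM|yM] := boolP (y \in `[- (M + 1), M + 1]%classic).
      rewrite lee_fin (le_trans (ler_normB _ _))//.
      have := moll_norm_le y (ltr0Sn _ n) (mfx x) (fC x); have := fC x y; lra.
    have yM' : M + 1 < `|y|.
      by rewrite ltNge; apply: contra yM => h; rewrite inE/= in_itv/= -ler_norml.
    rewrite (moll_out _ _ yM') ?ler1n//; last by move=> t tM; rewrite fM//; right.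
    by rewrite fM ?subrr ?normr0//; right; lra.
have [|||||_ + _] := @dominated_convergence _ _ _ mu setT measurableT
  (fun n x => (\int[mu]_y `|moll n.+1%:R (f x) y - f x y|%:E)%E) (cst 0%E)
  (fun x => ((2 * C)%:E * mu `[(- (M + 1))%R, (M + 1)%R] * (\1_(`[- M, M]%classic) x)%:E)%E).
- exact: mI.
- exact: measurable_cst.
- apply: aeW => x _; apply: (@moll_L1_cvg _ C M) => //.
  by move=> t tM; apply: fM; right.
- have -> : (fun x => ((2 * C)%:E * mu `[(- (M + 1))%R, (M + 1)%R] * (\1_(`[- M, M]%classic) x)%:E)%E)
    = (fun x => ((2 * C * fine (mu `[(- (M + 1))%R, (M + 1)%R]))%:E * (\1_(`[- M, M]%classic) x)%:E)%E).
    apply/funext => x; congr (_ * _)%E; rewrite lebesgue_measure_itv/=.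
    by case: ifP => _; rewrite /= ?mule0 ?mulr0// -EFinD -EFinM.
  apply: integrableZl => //; apply/integrableP; split.
    by apply/measurable_EFinP; exact: measurable_indic.
  under eq_integral do rewrite gee0_abs ?lee_fin//.
  rewrite integral_indic//= setIT lebesgue_measure_itv/=.
  by case: ifP => _; rewrite ?ltry// -EFinB ltry.
- apply: aeW => x n _; rewrite gee0_abs; last by apply: integral_ge0.
  rewrite indicE; have [xM|xM] := boolP (x \in `[- M, M]%classic).
    by rewrite mule1 box.
  have xM' : M < `|x|.
    by rewrite ltNge; apply: contra xM => h; rewrite inE/= in_itv/= -ler_norml.
  rewrite mule0 integral0_eq// => y _.
  rewrite fM; last by left.
  rewrite /moll /Rintegral (eq_integral (cst 0%E)) ?integral0//= ?subrr ?normr0//.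
  by move=> t _; rewrite fM ?mul0r//; left.
- rewrite [X in X @ _ --> _ -> _](_ : _ =
    (fun n => \int[mu]_x \int[mu]_y `|moll n.+1%:R (f x) y - f x y|%:E)%E)//.
  apply/funext => n /=; apply: eq_integral => x _.
  by rewrite sube0 gee0_abs//; apply: integral_ge0.
Qed.

End approximate_identity.

(** * Products and superpositions of smooth fields *)

Section plane_C11_constructions.
Context {R : realType}.

Lemma bounded_C11_le (C D : R) f df : C <= D -> bounded_C11 C f df -> bounded_C11 D f df.
Proof.
move=> CD h x e; have [h1 h2 h3] := h x e; split; rewrite ?(le_trans h1)// ?(le_trans h2)//.
by rewrite (le_trans h3)// ler_wpM2r// sqr_ge0.
Qed.

Lemma plane_C11_prod (C : R) f df g dg : bounded_C11 C f df -> bounded_C11 C g dg ->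
  plane_C11 (4 * C * C) (fun z => f z.1 * g z.2) (fun z => df z.1 * g z.2)
    (fun z => f z.1 * dg z.2).
Proof.
move=> hf hg.
have C0 := bounded_C11_ge0 hf.
have lip2 (p q : R -> R) (x y x' y' : R) : (forall t, `|p t| <= C) -> (forall t, `|q t| <= C) ->
    (forall s t, `|p s - p t| <= 2 * C * `|s - t|) ->
    (forall s t, `|q s - q t| <= 2 * C * `|s - t|) ->
    `|p x * q y - p x' * q y'| <= 4 * C * C * (`|x - x'| + `|y - y'|).
  move=> pC qC pl ql.
  have -> : p x * q y - p x' * q y' = (p x - p x') * q y + p x' * (q y - q y') by ring.
  rewrite (le_trans (ler_normD _ _))// !normrM.
  have a1 : `|p x - p x'| * `|q y| <= 2 * C * `|x - x'| * C by apply: ler_pM.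
  have a2 : `|p x'| * `|q y - q y'| <= C * (2 * C * `|y - y'|) by apply: ler_pM.
  have b1 : 0 <= C * C * `|x - x'| by rewrite !mulr_ge0.
  have b2 : 0 <= C * C * `|y - y'| by rewrite !mulr_ge0.
  lra.
have fb t : `|f t| <= C by have [] := hf t 0.
have gb t : `|g t| <= C by have [] := hg t 0.
have dfb t : `|df t| <= C by have [] := hf t 0.
have dgb t : `|dg t| <= C by have [] := hg t 0.
have fl := bounded_C11_lip hf; have gl := bounded_C11_lip hg.
have dfl := bounded_C11_dlip hf; have dgl := bounded_C11_dlip hg.
move=> x y /=; split => [e|e|x' y'|x' y'|x' y']; [| |exact: lip2|exact: lip2|exact: lip2].
- have -> : f (x + e) * g y - f x * g y - e * (df x * g y) =
    (f (x + e) - f x - e * df x) * g y by ring.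
  have [_ _ h] := hf x e; rewrite normrM.
  have a1 : `|f (x + e) - f x - e * df x| * `|g y| <= C * e ^+ 2 * C by apply: ler_pM.
  have b : 0 <= C * C * e ^+ 2 by rewrite mulr_ge0 ?sqr_ge0// mulr_ge0.
  lra.
- have -> : f x * g (y + e) - f x * g y - e * (f x * dg y) =
    f x * (g (y + e) - g y - e * dg y) by ring.
  have [_ _ h] := hg y e; rewrite normrM.
  have a1 : `|f x| * `|g (y + e) - g y - e * dg y| <= C * (C * e ^+ 2) by apply: ler_pM.
  have b : 0 <= C * C * e ^+ 2 by rewrite mulr_ge0 ?sqr_ge0// mulr_ge0.
  lra.
Qed.

End plane_C11_constructions.

Section Rintegral_tools.
Context d (T : measurableType d) (R : realType) (mu : {measure set T -> \bar R}).

Lemma integrable_bounded_mul (k g : T -> R) (C : R) :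
  mu.-integrable setT (EFin \o k) -> measurable_fun setT g -> (forall x, `|g x| <= C) ->
  mu.-integrable setT (EFin \o (fun x => k x * g x)).
Proof.
move=> ik mg gC.
have mk : measurable_fun setT k by apply/measurable_EFinP; exact: measurable_int ik.
apply: (@le_integrable _ _ _ mu _ measurableT _ (fun x => C%:E * (k x)%:E)%E).
- by apply/measurable_EFinP; exact: measurable_funM.
- move=> x _; rewrite /= lee_fin !normrM mulrC ler_wpM2r//.
  by rewrite (le_trans (gC x))// ler_norm.
- by apply: integrableZl.
Qed.

Lemma Rintegral_norm_le_bound (k g : T -> R) (C : R) :
  mu.-integrable setT (EFin \o k) -> measurable_fun setT g -> (forall x, `|g x| <= C) ->
  `|\int[mu]_x (k x * g x)| <= C * \int[mu]_x `|k x|.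
Proof.
move=> ik mg gC.
have ikg := integrable_bounded_mul ik mg gC.
rewrite (le_trans (le_normr_Rintegral _ _))// -RintegralZl//; last exact: integrable_norm.
apply: le_Rintegral => //.
- exact: integrable_norm ikg.
- exact: (integrableZl measurableT C (integrable_norm ik)).
- by move=> x _; rewrite normrM mulrC ler_wpM2r.
Qed.

(** Each clause of [plane_C11] integrates against [k] with the factor [int |k|], which replaces
    differentiation under the integral sign. *)
Lemma plane_C11_integral (k : T -> R) (phi phix phiy : T -> R * R -> R) (C : R) :
  mu.-integrable setT (EFin \o k) ->
  (forall w, plane_C11 C (phi w) (phix w) (phiy w)) ->
  (forall w z, [/\ `|phi w z| <= C, `|phix w z| <= C & `|phiy w z| <= C]) ->
  (forall z, [/\ measurable_fun setT (phi ^~ z), measurable_fun setT (phix ^~ z)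
     & measurable_fun setT (phiy ^~ z)]) ->
  plane_C11 (C * \int[mu]_w `|k w|) (fun z => \int[mu]_w (k w * phi w z))
    (fun z => \int[mu]_w (k w * phix w z)) (fun z => \int[mu]_w (k w * phiy w z)).
Proof.
move=> ik H Hb Hm.
have m0 z : measurable_fun setT (phi ^~ z) by have [] := Hm z.
have mx z : measurable_fun setT (phix ^~ z) by have [] := Hm z.
have my z : measurable_fun setT (phiy ^~ z) by have [] := Hm z.
have i0 z : mu.-integrable setT (EFin \o (fun w => k w * phi w z)).
  by apply: (@integrable_bounded_mul _ _ C) => // w; have [] := Hb w z.
have ix z : mu.-integrable setT (EFin \o (fun w => k w * phix w z)).
  by apply: (@integrable_bounded_mul _ _ C) => // w; have [] := Hb w z.
have iy z : mu.-integrable setT (EFin \o (fun w => k w * phiy w z)).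
  by apply: (@integrable_bounded_mul _ _ C) => // w; have [] := Hb w z.
have lip (p : T -> R * R -> R) z z' D : (forall z, measurable_fun setT (p ^~ z)) ->
    (forall z, mu.-integrable setT (EFin \o (fun w => k w * p w z))) ->
    (forall w, `|p w z - p w z'| <= D) ->
    `|\int[mu]_w (k w * p w z) - \int[mu]_w (k w * p w z')| <= D * \int[mu]_w `|k w|.
  move=> mp ip pD; rewrite -RintegralB//.
  rewrite (@eq_Rintegral _ _ _ mu setT (fun w => k w * (p w z - p w z'))).
    by apply: Rintegral_norm_le_bound => //; exact: measurable_funB.
  by move=> w _; rewrite mulrBr.
have quad (p q : T -> R * R -> R) z z' e D : (forall z, measurable_fun setT (p ^~ z)) ->
    (forall z, mu.-integrable setT (EFin \o (fun w => k w * p w z))) ->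
    (forall z, measurable_fun setT (q ^~ z)) ->
    (forall z, mu.-integrable setT (EFin \o (fun w => k w * q w z))) ->
    (forall w, `|p w z' - p w z - e * q w z| <= D) ->
    `|\int[mu]_w (k w * p w z') - \int[mu]_w (k w * p w z) - e * \int[mu]_w (k w * q w z)|
      <= D * \int[mu]_w `|k w|.
  move=> mp ip mq iq pD; rewrite -RintegralB// -RintegralZl// -RintegralB//; last 2 first.
  - exact: (integrableB measurableT (ip z') (ip z)).
  - exact: (integrableZl measurableT e (iq z)).
  rewrite (@eq_Rintegral _ _ _ mu setT (fun w => k w * (p w z' - p w z - e * q w z))).
    apply: Rintegral_norm_le_bound => //; apply: measurable_funB; first exact: measurable_funB.
    exact: measurable_funM.
  by move=> w _; ring.
move=> x y; split => [e|e|x' y'|x' y'|x' y'].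
- by rewrite mulrAC; apply: quad => // w; have [h _ _ _ _] := H w x y.
- by rewrite mulrAC; apply: quad => // w; have [_ h _ _ _] := H w x y.
- by rewrite mulrAC; apply: lip => // w; have [_ _ h _ _] := H w x y.
- by rewrite mulrAC; apply: lip => // w; have [_ _ _ h _] := H w x y.
- by rewrite mulrAC; apply: lip => // w; have [_ _ _ _ h] := H w x y.
Qed.

End Rintegral_tools.

(** * Fubini for real integrals under a product majorant *)

Section Rfubini.
Context d1 d2 (T1 : measurableType d1) (T2 : measurableType d2) (R : realType).
Variables (m1 : {sigma_finite_measure set T1 -> \bar R})
  (m2 : {sigma_finite_measure set T2 -> \bar R}).

Lemma prod_bounded_integrable (f : T1 * T2 -> R) (p : T1 -> R) (q : T2 -> R) :
  measurable_fun setT f -> m1.-integrable setT (EFin \o p) ->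
  m2.-integrable setT (EFin \o q) -> (forall x y, `|f (x, y)| <= p x * q y) ->
  (m1 \x m2)%E.-integrable setT (EFin \o f).
Proof.
move=> mf ip iq H.
have mq : measurable_fun setT q by apply/measurable_EFinP; exact: measurable_int iq.
have mp : measurable_fun setT p by apply/measurable_EFinP; exact: measurable_int ip.
apply/integrable12ltyP; first exact/measurable_EFinP.
have /integrableP[_ fp] := ip; have /integrableP[_ fq] := iq.
have -> : +oo%E = +oo%E :> \bar R by [].
apply: (@le_lt_trans _ _ (\int[m1]_x (`|(p x)%:E| * \int[m2]_y `|(q y)%:E|))%E).
  apply: ge0_le_integral => //.
  - by move=> x _; apply: integral_ge0.
  - apply: (@measurable_fun_fubini_tonelli_F _ _ _ _ _ m2 (fun z => `|(f z)%:E|)%E) => //.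
    by apply/measurable_EFinP; exact: measurableT_comp.
  - apply: emeasurable_funM; last exact: measurable_cst.
    by apply/measurable_EFinP; exact: measurableT_comp.
  - move=> x _; rewrite -ge0_integralZl//; last first.
      by apply/measurable_EFinP; exact: measurableT_comp.
    apply: ge0_le_integral => //.
    + apply/measurable_EFinP; apply: measurableT_comp => //.
      exact: (measurable_fun_pair2 x mf).
    + by apply: measurable_funeM; apply/measurable_EFinP; exact: measurableT_comp.
    + move=> y _; rewrite /= -EFinM lee_fin -normrM.
      by rewrite (le_trans (H x y))// ler_norm.
rewrite ge0_integralZr//; last 2 first.
- by apply/measurable_EFinP; exact: measurableT_comp.
- by apply: integral_ge0.
by rewrite lte_mul_pinfty// ?integral_ge0// ge0_fin_numE// integral_ge0.
Qed.

Lemma prod_bounded_integrable2 (f : T1 * T2 -> R) (p : T1 -> R) (q : T2 -> R) x :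
  measurable_fun setT f ->
  m2.-integrable setT (EFin \o q) -> (forall x y, `|f (x, y)| <= p x * q y) ->
  m2.-integrable setT (fun y => (f (x, y))%:E).
Proof.
move=> mf iq H.
apply: (@le_integrable _ _ _ m2 _ measurableT _ (fun y => (p x)%:E * (q y)%:E)%E).
- by apply/measurable_EFinP; exact: (measurable_fun_pair2 x mf).
- by move=> y _; rewrite /= lee_fin (le_trans (H x y))// ler_norm.
- exact: integrableZl.
Qed.

Lemma prod_bounded_integrable1 (f : T1 * T2 -> R) (p : T1 -> R) (q : T2 -> R) y :
  measurable_fun setT f ->
  m1.-integrable setT (EFin \o p) -> (forall x y, `|f (x, y)| <= p x * q y) ->
  m1.-integrable setT (fun x => (f (x, y))%:E).
Proof.
move=> mf iq H.
apply: (@le_integrable _ _ _ m1 _ measurableT _ (fun x => (q y)%:E * (p x)%:E)%E).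
- by apply/measurable_EFinP; exact: (measurable_fun_pair1 y mf).
- by move=> x _; rewrite /= lee_fin mulrC (le_trans (H x y))// ler_norm.
- exact: integrableZl.
Qed.

Lemma Rfubini12 (f : T1 * T2 -> R) (p : T1 -> R) (q : T2 -> R) :
  measurable_fun setT f -> m1.-integrable setT (EFin \o p) ->
  m2.-integrable setT (EFin \o q) -> (forall x y, `|f (x, y)| <= p x * q y) ->
  \int[(m1 \x m2)%E]_z f z = \int[m1]_x \int[m2]_y f (x, y).
Proof.
move=> mf ip iq H.
rewrite {1}/Rintegral -integral12_prod_meas1; last exact: prod_bounded_integrable mf ip iq H.
congr fine; apply: eq_integral => x _; rewrite /fubini_F /Rintegral fineK//.
by apply: integrable_fin_num => //; exact: prod_bounded_integrable2 mf iq H.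
Qed.

Lemma Rfubini21 (f : T1 * T2 -> R) (p : T1 -> R) (q : T2 -> R) :
  measurable_fun setT f -> m1.-integrable setT (EFin \o p) ->
  m2.-integrable setT (EFin \o q) -> (forall x y, `|f (x, y)| <= p x * q y) ->
  \int[(m1 \x m2)%E]_z f z = \int[m2]_y \int[m1]_x f (x, y).
Proof.
move=> mf ip iq H.
rewrite {1}/Rintegral -integral21_prod_meas1; last exact: prod_bounded_integrable mf ip iq H.
congr fine; apply: eq_integral => y _; rewrite /fubini_G /Rintegral fineK//.
by apply: integrable_fin_num => //; exact: prod_bounded_integrable1 mf ip H.
Qed.

End Rfubini.

(** * Calibrations *)

Section cutoff.
Context {R : realType}.
Implicit Types (x L K N s t : R).

(** A plateau: 1 on [[-L, L]], 0 outside [[-2L, 2L]], with derivative of order [1 / L]. *)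
Definition chi L x : R := sstep (L^-1 * x + 2) - sstep (L^-1 * x + - 1).
Definition dchi L x : R := L^-1 * dsstep (L^-1 * x + 2) - L^-1 * dsstep (L^-1 * x + - 1).

(** At every point at least one of the two steps has reached its constant value. *)
Lemma chi_itv L x : 0 <= chi L x <= 1.
Proof.
rewrite /chi; set u := L^-1 * x.
have /andP[a0 a1] := sstep_itv (u + 2); have /andP[b0 b1] := sstep_itv (u + - 1).
have [u1|u1] := leP u 1.
  by rewrite (@sstep_le0 _ (u + -1)) ?subr0; [apply/andP|lra].
by rewrite (@sstep_ge1 _ (u + 2)); [lra|lra].
Qed.

Lemma chi1 L x : 0 < L -> `|x| <= L -> chi L x = 1.
Proof.
move=> L0 xL; have : `|L^-1 * x| <= 1.
  by rewrite normrM gtr0_norm ?invr_gt0// -(mulVf (lt0r_neq0 L0)) ler_pM2l ?invr_gt0.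
rewrite ler_norml /chi; set u := L^-1 * x => h.
by rewrite sstep_ge1 ?sstep_le0 ?subr0//; lra.
Qed.

Lemma chi_out L x : 0 < L -> 2 * L < `|x| -> chi L x = 0 /\ dchi L x = 0.
Proof.
move=> L0 xL; have : 2 < `|L^-1 * x|.
  by rewrite normrM gtr0_norm ?invr_gt0// mulrC ltr_pdivlMr.
rewrite /chi /dchi; set u := L^-1 * x; rewrite lter_normr => /orP h.
have {}h : u <= - 2 \/ 2 <= u by case: h => h; [right|left]; lra.
case: h => h.
  by rewrite !sstep_le0 ?(@dsstep_out _ (u + 2)) ?(@dsstep_out _ (u + -1)) ?subrr ?mulr0 ?subrr//;
   by [left; lra|lra].
by rewrite !sstep_ge1 ?(@dsstep_out _ (u + 2)) ?(@dsstep_out _ (u + -1)) ?subrr ?mulr0 ?subrr//;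
  by [right; lra|lra].
Qed.

Lemma dchi_le L x : 0 < L -> `|dchi L x| <= 360 / L.
Proof.
move=> L0; rewrite /dchi -mulrBr normrM gtr0_norm ?invr_gt0// mulrC ler_wpM2r ?invr_ge0 ?(ltW L0)//.
have a0 := dsstep_ge0 (L^-1 * x + 2); have a1 := dsstep_le (L^-1 * x + 2).
have b0 := dsstep_ge0 (L^-1 * x + - 1); have b1 := dsstep_le (L^-1 * x + - 1).
rewrite ler_norml; lra.
Qed.

Lemma bounded_C11_chi L : {C | bounded_C11 C (chi L) (dchi L)}.
Proof.
have h1 := bounded_C11_affine L^-1 2 (@bounded_C11_sstep R).
have h2 := bounded_C11Z (-1) (bounded_C11_affine L^-1 (-1) (@bounded_C11_sstep R)).
have := bounded_C11D h1 h2; set C := (X in bounded_C11 X) => h.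
exists C; move: h; rewrite /bounded_C11 /chi /dchi => h x e.
by have := h x e; rewrite !mulN1r.
Qed.

Lemma measurable_chi L : measurable_fun setT (chi L).
Proof.
by have [C h] := bounded_C11_chi L; apply: continuous_measurable_fun; exact: bounded_C11_continuous h.
Qed.

Lemma measurable_dchi L : measurable_fun setT (dchi L).
Proof.
apply: measurable_funB; apply: measurable_funM => //;
  apply: (measurableT_comp measurable_dsstep); by apply: measurable_funD => //; exact: measurable_funM.
Qed.

(* The rising step of width [1/K] at [s], cut off at distance of order [L]. *)
Definition step_fun L K s x : R := chi L x * (sstep (K * x + - (K * s)) + - (1 / 2)).
Definition dstep_fun L K s x : R := dchi L x * (sstep (K * x + - (K * s)) + - (1 / 2)) +
  chi L x * (K * dsstep (K * x + - (K * s))).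

Lemma bounded_C11_step_fun L K : {C | forall s, bounded_C11 C (step_fun L K s) (dstep_fun L K s)}.
Proof.
have [C1 h1] := bounded_C11_chi L.
pose C2 : R := (180 + 180) * (1 + `|K| + K ^+ 2) + `|- (1 / 2)|.
have h2 s : bounded_C11 C2 (fun x => sstep (K * x + - (K * s)) + - (1 / 2))
    (fun x => K * dsstep (K * x + - (K * s))).
  have := bounded_C11D (bounded_C11_affine K (- (K * s)) (@bounded_C11_sstep R))
     (bounded_C11_cst (- (1 / 2))).
  rewrite /bounded_C11 => h x e; have := h x e; rewrite !addr0; exact.
exists (Num.max C1 C2 + 6 * Num.max C1 C2 * Num.max C1 C2) => s.
apply: bounded_C11M; last first.
  by apply: bounded_C11_le (h2 s); rewrite le_max lexx orbT.
by apply: bounded_C11_le h1; rewrite le_max lexx.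
Qed.

(** Centring the step makes a rise of 1 cost an amplitude of 1/2 only; hence a horizontal component
    of size [a] can carry the total divergence [2 * a] on a slice. *)
Lemma step_fun_le L K s x : `|step_fun L K s x| <= 1 / 2.
Proof.
have /andP[a0 a1] := chi_itv L x; have /andP[b0 b1] := sstep_itv (K * x + - (K * s)).
rewrite /step_fun normrM ger0_norm// -[leRHS]mul1r ler_pM// ler_norml; lra.
Qed.

Lemma step_fun_out L K s x : 0 < L -> 2 * L < `|x| -> step_fun L K s x = 0 /\ dstep_fun L K s x = 0.
Proof.
by move=> L0 xL; have [h1 h2] := chi_out L0 xL; rewrite /step_fun /dstep_fun h1 h2 !mul0r addr0.
Qed.

Lemma bounded_C11_mollifier N : {C | forall t,
  bounded_C11 C (fun y => mollifier N (y - t)) (fun y => N * (N * ddsstep (N * y + - (N * t))))}.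
Proof.
exists (`|N| * ((390 + 390) * (1 + `|N| + N ^+ 2))) => t.
have := bounded_C11Z N (bounded_C11_affine N (- (N * t)) (@bounded_C11_dsstep R)).
by rewrite /bounded_C11 => h x e; have := h x e; rewrite /mollifier !mulrBr.
Qed.

Lemma bounded_C11_sstep_scaled N : {C | forall t,
  bounded_C11 C (fun y => sstep (N * (y - t))) (fun y => mollifier N (y - t))}.
Proof.
exists ((180 + 180) * (1 + `|N| + N ^+ 2)) => t.
have := bounded_C11_affine N (- (N * t)) (@bounded_C11_sstep R).
by rewrite /bounded_C11 => h x e; have := h x e; rewrite /mollifier !mulrBr.
Qed.

Lemma measurable_ddsstep : measurable_fun setT (@ddsstep R).
Proof.
have mc : measurable_fun setT (@clamp R).
  by apply: measurable_maxr => //; exact: measurable_minr.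
rewrite /ddsstep /=; apply: measurable_funM; last first.
  by apply: measurable_funB => //; exact: measurable_funM.
apply: measurable_funM; last exact: measurable_funB.
exact: measurable_funM.
Qed.

Lemma measurable_dstep_fun2 L K :
  measurable_fun setT (fun z : R * R => dstep_fun L K z.1 z.2).
Proof.
have m1 : measurable_fun setT (fun z : R * R => K * z.2 + - (K * z.1)).
  apply: measurable_funD; [|apply: measurable_funN]; apply: measurable_funM => //;
  exact: measurable_snd || exact: measurable_fst.
apply: measurable_funD; apply: measurable_funM.
- exact: (measurableT_comp (measurable_dchi L) measurable_snd).
- by apply: measurable_funD => //; exact: (measurableT_comp measurable_sstep m1).
- exact: (measurableT_comp (measurable_chi L) measurable_snd).
- by apply: measurable_funM => //; exact: (measurableT_comp measurable_dsstep m1).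
Qed.

Lemma measurable_step_fun2 L K :
  measurable_fun setT (fun z : R * R => step_fun L K z.1 z.2).
Proof.
have m1 : measurable_fun setT (fun z : R * R => K * z.2 + - (K * z.1)).
  apply: measurable_funD; [|apply: measurable_funN]; apply: measurable_funM => //;
  exact: measurable_snd || exact: measurable_fst.
apply: measurable_funM; first exact: (measurableT_comp (measurable_chi L) measurable_snd).
by apply: measurable_funD => //; exact: (measurableT_comp measurable_sstep m1).
Qed.

End cutoff.

Section compact_box.
Context {R : realType}.
Notation mu := (@lebesgue_measure R).

Lemma integrable_box_indic (M C : R) :
  mu.-integrable setT (EFin \o (fun x => C * \1_(`[- M, M]%classic) x)).
Proof.
apply: (@integrableZl _ _ _ mu _ measurableT C (EFin \o \1_(`[- M, M]%classic))).
apply/integrableP; split; first by apply/measurable_EFinP; exact: measurable_indic.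
under eq_integral do rewrite gee0_abs ?lee_fin//.
rewrite integral_indic//= setIT lebesgue_measure_itv/=.
by case: ifP => _; rewrite ?ltry// -EFinB ltry.
Qed.

Lemma box_indicE (M x : R) : \1_(`[- M, M]%classic) x = (`|x| <= M)%R%:R :> R.
Proof. by rewrite indicE ler_norml; congr (nat_of_bool _)%:R;
  by apply/idP/idP; rewrite inE/= in_itv/=. Qed.

Lemma integrable_bounded_supp (f : R -> R) (M C : R) : measurable_fun setT f ->
  (forall x, `|f x| <= C) -> (forall x, M < `|x| -> f x = 0) ->
  mu.-integrable setT (EFin \o f).
Proof.
move=> mf fC fM.
apply: (@le_integrable _ _ _ mu _ measurableT _ (EFin \o (fun x => C * \1_(`[- M, M]%classic) x))).
- exact/measurable_EFinP.
- move=> x _; rewrite /= lee_fin box_indicE; have [xM|xM] := leP `|x| M.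
    by rewrite mulr1 (le_trans (fC x))// ler_norm.
  by rewrite fM// normr0.
- exact: integrable_box_indic.
Qed.

Lemma integrable2_bounded_supp (f : R * R -> R) (M C : R) : measurable_fun setT f ->
  (forall z, `|f z| <= C) -> (forall x y, M < `|x| \/ M < `|y| -> f (x, y) = 0) ->
  (mu \x mu)%E.-integrable setT (EFin \o f) /\
  (forall x y, `|f (x, y)| <= (C * \1_(`[- M, M]%classic) x) * (1 * \1_(`[- M, M]%classic) y)).
Proof.
move=> mf fC fM.
have H x y : `|f (x, y)| <= (C * \1_(`[- M, M]%classic) x) * (1 * \1_(`[- M, M]%classic) y).
  rewrite !box_indicE; have [xM|xM] := leP `|x| M; last by rewrite fM ?normr0 ?mulr0 ?mul0r//; left.
  have [yM|yM] := leP `|y| M; last by rewrite fM ?normr0 ?mulr0 ?mul0r//; right.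
  by rewrite !mulr1 fC.
split => //; apply: (@prod_bounded_integrable _ _ _ _ R mu mu f _ _ mf _ _ H);
  exact: integrable_box_indic.
Qed.

Lemma Rfubini_box (f : R * R -> R) (M C : R) : measurable_fun setT f ->
  (forall z, `|f z| <= C) -> (forall x y, M < `|x| \/ M < `|y| -> f (x, y) = 0) ->
  \int[(mu \x mu)%E]_z f z = \int[mu]_x \int[mu]_y f (x, y) /\
  \int[(mu \x mu)%E]_z f z = \int[mu]_y \int[mu]_x f (x, y).
Proof.
move=> mf fC fM; have [_ H] := integrable2_bounded_supp mf fC fM.
have i1 := integrable_box_indic M C; have i2 := integrable_box_indic M 1.
by split; [exact: (@Rfubini12 _ _ _ _ R mu mu f _ _ mf i1 i2 H)|
  exact: (@Rfubini21 _ _ _ _ R mu mu f _ _ mf i1 i2 H)].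
Qed.

End compact_box.

Lemma Rintegral_eq0 (R : realType) d (T : measurableType d) (m : {measure set T -> \bar R}) (f : T -> R) :
  (forall x, f x = 0) -> \int[m]_x f x = 0.
Proof.
move=> f0; rewrite (eq_Rintegral _ _ (g := fun=> 0)); first by rewrite /Rintegral integral0.
by move=> x _; rewrite f0.
Qed.

(** * Smoothing a calibration into an admissible field *)

Section calibration_field.
Context {R : realType}.
Notation mu := (@lebesgue_measure R).
Variables (alpha delta M C : R) (k : R -> R -> R) (w a : R -> R).
Hypothesis alpha0 : 0 <= alpha.
Hypothesis delta0 : 0 < delta.
Hypothesis M0 : 0 <= M.
Hypothesis mk : measurable_fun setT (fun z : R * R => k z.1 z.2).
Hypothesis k_itv : forall s t, 0 <= k s t <= C.
Hypothesis k_out : forall s t, [\/ M < `|s|, t < delta | M < t] -> k s t = 0.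
Hypothesis mw : measurable_fun setT w.
Hypothesis w_le : forall t, `|w t| <= C.
Hypothesis w_out : forall t, t < delta \/ M < t -> w t = 0.
Hypothesis w_int : \int[mu]_t w t = 0.

Definition primitive (t : R) : R := \int[mu]_r (w r * (r <= t)%R%:R).

(** [k s t] prescribes the horizontal divergence at [(s, t)] and [w t] the vertical one; a mass
    [2 * a t] on the slice needs a horizontal component of modulus at most [a t]. *)
Hypothesis ka : forall t, \int[mu]_s k s t <= 2 * a t.
Hypothesis aB : forall t, 0 < t -> a t ^+ 2 + primitive t ^+ 2 <= (t `^ alpha) ^+ 2.

Variables (K L : R).
Hypothesis L0 : 0 < L.

Let C0 : 0 <= C. Proof. by rewrite (le_trans _ (w_le 0)). Qed.

Let kC s t : `|k s t| <= C.
Proof. by have /andP[k0 k1] := k_itv s t; rewrite ger0_norm. Qed.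

Let k_out2 s t : M < `|s| \/ M < `|t| -> k s t = 0.
Proof.
move=> [h|h]; apply: k_out; first exact: Or31.
have [t0|t0] := leP 0 t; first by apply: Or33; rewrite ger0_norm in h.
by apply: Or32; exact: lt_trans delta0.
Qed.

Let w_out2 t : M < `|t| -> w t = 0.
Proof.
move=> h; apply: w_out.
have [t0|t0] := leP 0 t; first by right; rewrite ger0_norm in h.
by left; exact: lt_trans delta0.
Qed.

Let mk1 t : measurable_fun setT (k ^~ t).
Proof. exact: (measurable_fun_pair1 (t : R) mk). Qed.

Let ik1 t : mu.-integrable setT (EFin \o (k ^~ t)).
Proof.
apply: (@integrable_bounded_supp _ _ M C) => // s sM.
by apply: k_out2; left.
Qed.

Let iw : mu.-integrable setT (EFin \o w).
Proof. exact: (@integrable_bounded_supp _ _ M C). Qed.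

Let ik : (mu \x mu)%E.-integrable setT (EFin \o (fun z : R * R => k z.1 z.2)).
Proof.
by have [] := @integrable2_bounded_supp _ (fun z : R * R => k z.1 z.2) M C mk (fun z => kC _ _) k_out2.
Qed.

(* [density x t] is the limit of the divergence as the vertical smoothing vanishes. *)
Definition field_density (x t : R) : R :=
  \int[mu]_s (k s t * dstep_fun L K s x) + chi L x * w t.

(** Steps at the positions [s] with weights [k s t]: the horizontal component before vertical
    smoothing. *)
Let U x t : R := \int[mu]_s (k s t * step_fun L K s x).

Let D : R := projT1 (cid (let: exist C h := bounded_C11_step_fun L K in ex_intro
  (fun C => forall s, bounded_C11 C (step_fun L K s) (dstep_fun L K s)) C h)).

Let hD s : bounded_C11 D (step_fun L K s) (dstep_fun L K s).
Proof. by rewrite /D; case: cid. Qed.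

Let D0 : 0 <= D. Proof. exact: bounded_C11_ge0 (hD 0). Qed.

Let int_le (q : R -> R) t c : measurable_fun setT q -> (forall s, `|q s| <= c) ->
  `|\int[mu]_s (k s t * q s)| <= c * (2 * a t).
Proof.
move=> mq qc; rewrite (le_trans (Rintegral_norm_le_bound (ik1 t) mq qc))//.
rewrite ler_wpM2l ?(le_trans _ (qc 0))//.
apply: le_trans (ka t); rewrite le_eqVlt; apply/orP; left; apply/eqP.
by apply: eq_Rintegral => s _; rewrite ger0_norm//; have /andP[] := k_itv s t.
Qed.

Let a0 t : 0 <= a t.
Proof.
rewrite -(pmulr_rge0 _ (ltr0n R 2)) (le_trans _ (ka t))//.
by apply: Rintegral_ge0 => s _; have /andP[] := k_itv s t.
Qed.

Let k_int_le t : \int[mu]_s k s t <= C * (M + M).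
Proof.
have : \int[mu]_s k s t <= \int[mu]_s (C * \1_(`[- M, M]%classic) s).
  apply: le_Rintegral => //; first exact: integrable_box_indic.
  move=> s _; rewrite box_indicE; have [sM|sM] := leP `|s| M.
    by rewrite mulr1; have /andP[] := k_itv s t.
  by rewrite mulr0 k_out2//; left.
move=> /le_trans; apply.
rewrite RintegralZl//; last first.
  have := integrable_box_indic M 1; apply: eq_integrable => // x _ /=.
  by rewrite mul1r.
rewrite ler_wpM2l// /Rintegral integral_indic//= setIT lebesgue_measure_itv/=.
by case: ifP => _; rewrite -?EFinB/= ?opprK// addr_ge0.
Qed.

Let mU x : measurable_fun setT (U x).
Proof.
have : measurable_fun setT (fun z : R * R => k z.2 z.1 * step_fun L K z.2 x).
  apply: measurable_funM.
    by apply: (measurableT_comp mk (measurable_fun_pair measurable_snd measurable_fst)).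
  have := measurable_fun_pair1 x (measurable_step_fun2 L K).
  by move=> h; exact: (measurableT_comp h measurable_snd).
exact: (@measurable_fun_param_Rintegral _ _ _ _ R mu).
Qed.

Lemma measurable_field_density : measurable_fun setT (fun z : R * R => field_density z.1 z.2).
Proof.
apply: measurable_funD; last first.
  apply: measurable_funM; first exact: (measurableT_comp (measurable_chi L) measurable_fst).
  exact: (measurableT_comp mw measurable_snd).
apply: (@measurable_fun_param_Rintegral _ _ (R * R)%type (measurableTypeR R) R mu
  (fun z => k z.2 z.1.2 * dstep_fun L K z.2 z.1.1)).
apply: measurable_funM.
  have mp : measurable_fun setT (fun x : (R * R) * measurableTypeR R => (x.2, x.1.2)).
    apply: measurable_fun_pair; first exact: measurable_snd.
    exact: (measurableT_comp measurable_snd measurable_fst).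
  exact: (measurableT_comp mk mp).
have mp : measurable_fun setT (fun x : (R * R) * measurableTypeR R => (x.2, x.1.1)).
  apply: measurable_fun_pair; first exact: measurable_snd.
  exact: (measurableT_comp measurable_fst measurable_fst).
exact: (measurableT_comp (measurable_dstep_fun2 L K) mp).
Qed.

Let int_le2 (q : R -> R) t c : measurable_fun setT q -> (forall s, `|q s| <= c) ->
  `|\int[mu]_s (k s t * q s)| <= c * (C * (M + M)).
Proof.
move=> mq qc; rewrite (le_trans (Rintegral_norm_le_bound (ik1 t) mq qc))//.
rewrite ler_wpM2l ?(le_trans _ (qc 0))//.
apply: le_trans (k_int_le t); rewrite le_eqVlt; apply/orP; left; apply/eqP.
by apply: eq_Rintegral => s _; rewrite ger0_norm//; have /andP[] := k_itv s t.
Qed.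

Let mdstep x : measurable_fun setT (fun s => dstep_fun L K s x).
Proof. exact: (measurable_fun_pair1 (x : R) (measurable_dstep_fun2 L K)). Qed.

Let mstep x : measurable_fun setT (fun s => step_fun L K s x).
Proof. exact: (measurable_fun_pair1 (x : R) (measurable_step_fun2 L K)). Qed.

Lemma field_density_le x t : `|field_density x t| <= D * (C * (M + M)) + C.
Proof.
rewrite (le_trans (ler_normD _ _))// lerD//.
  by apply: int_le2 => // s; have [_ h _] := hD s x 0.
rewrite normrM -[leRHS]mul1r ler_pM//.
by have /andP[c0 c1] := chi_itv L x; rewrite ger0_norm.
Qed.

Lemma field_density_out x t : M + 2 * L < `|x| \/ M + 2 * L < `|t| -> field_density x t = 0.
Proof.
have L2 : 0 <= 2 * L by rewrite mulr_ge0// ltW.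
move=> [h|h]; rewrite /field_density.
  have hL : 2 * L < `|x| by apply: le_lt_trans h; rewrite lerDr.
  have [-> _] := chi_out L0 hL.
  rewrite mul0r addr0 (eq_Rintegral _ _ (g := cst 0)).
    by rewrite /Rintegral integral0.
  by move=> s _; have [_ ->] := step_fun_out K s L0 hL; rewrite mulr0.
have hM : M < `|t| by apply: le_lt_trans h; rewrite lerDl.
rewrite w_out2// mulr0 addr0 (eq_Rintegral _ _ (g := cst 0)).
  by rewrite /Rintegral integral0.
by move=> s _; rewrite k_out2 ?mul0r//; right.
Qed.

Section fixed_N.
Variable N : R.
Hypothesis N1 : 1 <= N.
Let N0 : 0 < N. Proof. exact: lt_le_trans N1. Qed.

Let mol2_int (q : R -> R) (c : R) (y : R) : measurable_fun setT q -> (forall s, `|q s| <= c) ->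
  \int[(mu \x mu)%E]_z (k z.1 z.2 * (q z.1 * mollifier N (y - z.2))) =
  moll N (fun t => \int[mu]_s (k s t * q s)) y.
Proof.
move=> mq qc.
have c0 : 0 <= c by rewrite (le_trans _ (qc 0)).
have mm : measurable_fun setT (fun z : R * R => mollifier N (y - z.2)).
  apply: (measurableT_comp (measurable_mollifier N)).
  by apply: measurable_funB => //; exact: measurable_snd.
have mf : measurable_fun setT (fun z : R * R => k z.1 z.2 * (q z.1 * mollifier N (y - z.2))).
  apply: measurable_funM => //; apply: measurable_funM => //.
  exact: (measurableT_comp mq measurable_fst).
have [||_ ->] := @Rfubini_box _ _ M (C * (c * (360 * N))) mf.
- move=> [s t] /=; rewrite normrM ler_pM// normrM ler_pM//.
  by rewrite ger0_norm ?mollifier_le ?mollifier_ge0 ?(ltW N0).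
- by move=> s t h /=; rewrite k_out2// mul0r.
apply: eq_Rintegral => t _; rewrite -RintegralZr//; last first.
  exact: (integrable_bounded_mul (ik1 t) mq qc).
by apply: eq_Rintegral => s _ /=; rewrite mulrA.
Qed.

Let mprimitive : measurable_fun setT primitive.
Proof.
apply: (@measurable_fun_param_Rintegral _ _ _ (measurableTypeR R) R mu
  (fun z : R * R => w z.2 * (z.2 <= z.1)%R%:R)).
apply: measurable_funM; first exact: (measurableT_comp mw measurable_snd).
have mb : measurable_fun setT (fun z : R * R => (z.2 <= z.1)%R).
  by apply: measurable_fun_ler; [exact: measurable_snd|exact: measurable_fst].
by apply: (measurableT_comp (f := fun b : bool => b%:R : R)).
Qed.

Let indle (r t : R) : `|(r <= t)%R%:R : R| <= 1.
Proof. by case: (r <= t); rewrite ?normr1 ?normr0. Qed.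

Let mindle (t : R) : measurable_fun setT (fun r : R => (r <= t)%R%:R : R).
Proof.
apply: (measurableT_comp (f := fun b : bool => b%:R : R)) => //.
exact: measurable_fun_ler.
Qed.

Let primitive_le t : `|primitive t| <= \int[mu]_r `|w r|.
Proof. by rewrite -[leRHS]mul1r; exact: (Rintegral_norm_le_bound iw (mindle t) (fun r => indle r t)). Qed.

Let primitive_out t : t < delta -> primitive t = 0.
Proof.
move=> td; rewrite /primitive (eq_Rintegral _ _ (g := cst 0)); first by rewrite /Rintegral integral0.
move=> r _; have [rt|_] := leP r t; last by rewrite mulr0.
by rewrite w_out ?mul0r//; left; exact: le_lt_trans rt td.
Qed.

(** A smooth step of width [1 / N] is the mollified jump, so smoothing every jump in the
    superposition amounts to mollifying the primitive. *)
Let moll_primitive y : \int[mu]_r (w r * sstep (N * (y - r))) = moll N primitive y.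
Proof.
have mm : measurable_fun setT (fun z : R * R => mollifier N (y - z.2)).
  apply: (measurableT_comp (measurable_mollifier N)).
  by apply: measurable_funB => //; exact: measurable_snd.
have mf : measurable_fun setT (fun z : R * R => w z.1 * ((z.1 <= z.2)%R%:R * mollifier N (y - z.2))).
  apply: measurable_funM; first exact: (measurableT_comp mw measurable_fst).
  apply: measurable_funM => //.
  apply: (measurableT_comp (f := fun b : bool => b%:R : R)) => //.
  by apply: measurable_fun_ler; [exact: measurable_fst|exact: measurable_snd].
have iaw : mu.-integrable setT (EFin \o (fun r => `|w r|)) by exact: integrable_norm iw.
have im := integrable_mollifier y N0.
have H r t : `|w r * ((r <= t)%R%:R * mollifier N (y - t))| <= `|w r| * mollifier N (y - t).
  rewrite normrM ler_wpM2l// normrM -[leRHS]mul1r ler_pM//.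
  by rewrite ger0_norm// mollifier_ge0// (ltW N0).
have e1 := @Rfubini12 _ _ _ _ R mu mu _ _ _ mf iaw im H.
have e2 := @Rfubini21 _ _ _ _ R mu mu _ _ _ mf iaw im H.
rewrite /moll (_ : (fun t => primitive t * mollifier N (y - t)) =
    (fun t => \int[mu]_r (w r * ((r <= t)%R%:R * mollifier N (y - t))))); last first.
  apply/funext => t; rewrite /primitive -RintegralZr//.
    by apply: eq_Rintegral => r _; rewrite mulrA.
  exact: (integrable_bounded_mul iw (mindle t) (fun r => indle r t)).
rewrite -[RHS]e2 e1; apply: eq_Rintegral => r _ /=.
have imt : mu.-integrable setT (EFin \o (fun t => (r <= t)%R%:R * mollifier N (y - t))).
  have mind : measurable_fun setT (fun t : R => (r <= t)%R%:R : R).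
    apply: (measurableT_comp (f := fun b : bool => b%:R : R)) => //.
    exact: measurable_fun_ler.
  have := integrable_bounded_mul im mind (fun t => indle r t).
  by apply: eq_integrable => // t _ /=; rewrite mulrC.
rewrite RintegralZl//; congr (_ * _); rewrite /Rintegral.
have [ry|yr] := leP r y; last first.
  rewrite sstep_le0; last by rewrite pmulr_rle0// subr_le0 ltW.
  rewrite (eq_integral (cst 0%E)) ?integral0// => t _; congr (_%:E).
  have [rt|_] := leP r t; last by rewrite mul0r.
  by rewrite mollifier_out ?mulr0//; left; rewrite subr_le0 ltW// (lt_le_trans yr).
rewrite -[LHS]/(fine (sstep (N * (y - r)))%:E) -(integral_mollifier_itv N0 ry); congr fine.
rewrite [LHS]integral_mkcond; apply: eq_integral => t _; rewrite patchE.
case: ifPn => [|tn].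
  by rewrite inE/= in_itv/= => /andP[-> _]; rewrite mul1r.
congr (_%:E); have [rt|_] := leP r t; last by rewrite mul0r.
rewrite mollifier_out ?mulr0//; left; rewrite subr_le0 ltW// ltNge.
by apply: contra tn => ty; rewrite inE/= in_itv/= rt.
Qed.

(** Jensen for the Euclidean norm: the averaged vector [(p, q)] is paired with itself,
    Cauchy-Schwarz is applied under the integral, and one factor [r = |(p, q)|] is divided out. *)
Let molU_bound x y : 0 < y ->
  moll N (U x) y ^+ 2 + (chi L x * moll N primitive y) ^+ 2 <= (y `^ alpha) ^+ 2.
Proof.
move=> y0.
have UC t : `|U x t| <= 1 / 2 * (C * (M + M)).
  by apply: int_le2 => // s; exact: step_fun_le.
have Ua t : `|U x t| <= a t.
  have := int_le t (mstep x) (fun s => step_fun_le L K s x).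
  by rewrite mulrA mul1r mulVf ?mul1r.
have iU := integrable_moll y N0 (mU x) UC.
have iP := integrable_moll y N0 mprimitive primitive_le.
set p := moll N (U x) y; set q := chi L x * moll N primitive y.
set r := Num.sqrt (p ^+ 2 + q ^+ 2).
have r0 : 0 <= r by exact: sqrtr_ge0.
have rE : r ^+ 2 = p ^+ 2 + q ^+ 2 by rewrite sqr_sqrtr// addr_ge0 ?sqr_ge0.
have ypow : 0 <= y `^ alpha by exact: powR_ge0.
suff H : p ^+ 2 + q ^+ 2 <= r * y `^ alpha.
  rewrite -rE; rewrite -rE expr2 in H.
  have [->|rn0] := eqVneq r 0; first by rewrite expr0n/= sqr_ge0.
  have rp : 0 < r by rewrite lt0r rn0.
  by rewrite ler_sqr ?nnegrE// -(ler_pM2l rp).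
have -> : p ^+ 2 + q ^+ 2 = \int[mu]_t (p * (U x t * mollifier N (y - t)) +
    q * chi L x * (primitive t * mollifier N (y - t))).
  rewrite RintegralD//; last 2 first.
  - exact: (integrableZl measurableT p iU).
  - exact: (integrableZl measurableT (q * chi L x) iP).
  rewrite !RintegralZl// -/(moll N (U x) y) -/(moll N primitive y) -/p.
  by rewrite !expr2 {2}/q; ring.
have -> : r * y `^ alpha = \int[mu]_t (r * y `^ alpha * mollifier N (y - t)).
  rewrite RintegralZl//; last exact: integrable_mollifier.
  by rewrite /Rintegral integral_mollifier// mulr1.
apply: le_Rintegral => //.
- exact: (integrableD measurableT (integrableZl measurableT p iU)
    (integrableZl measurableT (q * chi L x) iP)).
- exact: (integrableZl measurableT _ (integrable_mollifier y N0)).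
move=> t _.
(* The kernel is one-sided, so only [t < y] remains, where [t^alpha <= y^alpha]. *)
have [ty|ty] := leP (y - t) 0.
  by rewrite mollifier_out ?mulr0 ?addr0//; left.
rewrite (_ : _ + _ = (p * U x t + q * (chi L x * primitive t)) * mollifier N (y - t)); last by ring.
apply: ler_wpM2r; first by rewrite mollifier_ge0// ltW.
have /andP[c0 c1] := chi_itv L x.
have [t0|t0] := leP t 0.
  have -> : primitive t = 0 by apply: primitive_out; exact: le_lt_trans delta0.
  have -> : U x t = 0.
    by apply: Rintegral_eq0 => s; rewrite k_out ?mul0r//; apply: Or32; exact: le_lt_trans delta0.
  by rewrite !mulr0 addr0 mulr_ge0.
have cs : (p * U x t + q * (chi L x * primitive t)) ^+ 2 <=
    (p ^+ 2 + q ^+ 2) * ((U x t) ^+ 2 + (chi L x * primitive t) ^+ 2).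
  rewrite -subr_ge0 (_ : _ - _ = (p * (chi L x * primitive t) - q * U x t) ^+ 2); last by ring.
  exact: sqr_ge0.
have ub : (U x t) ^+ 2 + (chi L x * primitive t) ^+ 2 <= (y `^ alpha) ^+ 2.
  apply: (@le_trans _ _ (a t ^+ 2 + primitive t ^+ 2)).
    apply: lerD.
      by rewrite -[U x t ^+ 2]real_normK ?num_real// ler_sqr ?nnegrE// a0.
    rewrite exprMn -[leRHS]mul1r ler_wpM2r ?sqr_ge0// expr2.
    by rewrite -[leRHS]mulr1 ler_pM.
  apply: le_trans (aB t0) _; rewrite ler_sqr ?nnegrE ?powR_ge0//.
  by apply: ge0_ler_powR => //; rewrite ?nnegrE ?(ltW t0) ?(ltW y0)//; lra.
have := le_trans cs (ler_wpM2l (addr_ge0 (sqr_ge0 p) (sqr_ge0 q)) ub).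
rewrite -rE -exprMn => h.
have ry : 0 <= r * y `^ alpha by rewrite mulr_ge0.
rewrite (le_trans (ler_norm _))//.
by rewrite -(ler_sqr) ?nnegrE// real_normK ?num_real.
Qed.

(** The field superposes products of a horizontal step and a vertical mollifier with weights [k],
    and products of the cutoff and a vertical step with weights [w]. Its divergence is exactly the
    vertical mollification of [field_density]. *)
Lemma wperimeter_ge_moll (Omega : set (R * R)) :
  (\int[@leb2 R]_(z in Omega) (moll N (field_density z.1) z.2)%:E <= wperimeter alpha Omega)%E.
Proof.
have [E hE] := bounded_C11_mollifier N.
have [F hF] := bounded_C11_sstep_scaled N.
have [G hG] := bounded_C11_chi L.
pose D1 := Num.max D E; pose D2 := Num.max G F.
have hD1 s : bounded_C11 D1 (step_fun L K s) (dstep_fun L K s).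
  by apply: bounded_C11_le (hD s); rewrite le_max lexx.
have hE1 t : bounded_C11 D1 (fun y => mollifier N (y - t)) (fun y => N * (N * ddsstep (N * y + - (N * t)))).
  by apply: bounded_C11_le (hE t); rewrite le_max lexx orbT.
have hG2 : bounded_C11 D2 (chi L) (dchi L).
  by apply: bounded_C11_le hG; rewrite le_max lexx.
have hF2 t : bounded_C11 D2 (fun y => sstep (N * (y - t))) (fun y => mollifier N (y - t)).
  by apply: bounded_C11_le (hF t); rewrite le_max lexx orbT.
have prod_le (c u v : R) : 0 <= c -> `|u| <= c -> `|v| <= c -> `|u * v| <= 4 * c * c.
  move=> c0 uc vc; rewrite normrM; have := ler_pM (normr_ge0 u) (normr_ge0 v) uc vc.
  by have := mulr_ge0 c0 c0; lra.
have D1_0 := bounded_C11_ge0 (hD1 0); have D2_0 := bounded_C11_ge0 hG2.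
have mN (y : R) : measurable_fun setT (fun t : R => mollifier N (y - t)).
  by apply: (measurableT_comp (measurable_mollifier N)); exact: measurable_funB.
have mdN (y : R) : measurable_fun setT (fun t : R => N * (N * ddsstep (N * y + - (N * t)))).
  do 2 (apply: measurable_funM => //).
  apply: (measurableT_comp measurable_ddsstep); apply: measurable_funD => //.
  by apply: measurable_funN; exact: measurable_funM.
have mS (y : R) : measurable_fun setT (fun t : R => sstep (N * (y - t))).
  apply: (measurableT_comp measurable_sstep); apply: measurable_funM => //.
  exact: measurable_funB.
pose phi1 (o : R * R) (z : R * R) := step_fun L K o.1 z.1 * mollifier N (z.2 - o.2).
pose phi1x (o : R * R) (z : R * R) := dstep_fun L K o.1 z.1 * mollifier N (z.2 - o.2).
pose phi1y (o : R * R) (z : R * R) := step_fun L K o.1 z.1 *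
  (N * (N * ddsstep (N * z.2 + - (N * o.2)))).
pose phi2 (r : R) (z : R * R) := chi L z.1 * sstep (N * (z.2 - r)).
pose phi2x (r : R) (z : R * R) := dchi L z.1 * sstep (N * (z.2 - r)).
pose phi2y (r : R) (z : R * R) := chi L z.1 * mollifier N (z.2 - r).
have L2 : 0 <= 2 * L by rewrite mulr_ge0// ltW.
have iN1 : N^-1 <= 1 by rewrite invf_le1.
have b1 o z : [/\ `|phi1 o z| <= 4 * D1 * D1, `|phi1x o z| <= 4 * D1 * D1 & `|phi1y o z| <= 4 * D1 * D1].
  have [a1 a2 _] := hD1 o.1 z.1 0; have [c1 c2 _] := hE1 o.2 z.2 0.
  by split; exact: prod_le.
have b2 r z : [/\ `|phi2 r z| <= 4 * D2 * D2, `|phi2x r z| <= 4 * D2 * D2 & `|phi2y r z| <= 4 * D2 * D2].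
  have [a1 a2 _] := hG2 z.1 0; have [c1 c2 _] := hF2 r z.2 0.
  by split; exact: prod_le.
have m1 z : [/\ measurable_fun setT (phi1 ^~ z), measurable_fun setT (phi1x ^~ z) &
    measurable_fun setT (phi1y ^~ z)].
  by split; apply: measurable_funM; exact: (measurableT_comp (mstep z.1) measurable_fst) ||
    exact: (measurableT_comp (mdstep z.1) measurable_fst) ||
    exact: (measurableT_comp (mN z.2) measurable_snd) ||
    exact: (measurableT_comp (mdN z.2) measurable_snd).
have m2 z : [/\ measurable_fun setT (phi2 ^~ z), measurable_fun setT (phi2x ^~ z) &
    measurable_fun setT (phi2y ^~ z)].
  by split; apply: measurable_funM => //; exact: (mS z.2) || exact: (mN z.2).
have H1 := @plane_C11_integral _ _ _ (mu \x mu)%E (fun z : R * R => k z.1 z.2) phi1 phi1x phi1y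
  (4 * D1 * D1) ik (fun o => plane_C11_prod (hD1 o.1) (hE1 o.2)) b1 m1.
have H2 := @plane_C11_integral _ _ _ mu w phi2 phi2x phi2y
  (4 * D2 * D2) iw (fun r => plane_C11_prod hG2 (hF2 r)) b2 m2.
pose u1 (z : R * R) : R := \int[(mu \x mu)%E]_o (k o.1 o.2 * phi1 o z).
pose u2 (z : R * R) : R := \int[mu]_r (w r * phi2 r z).
have u1E x y : u1 (x, y) = moll N (U x) y.
  exact: (mol2_int (q := fun s => step_fun L K s x) y (mstep x) (fun s => step_fun_le L K s x)).
have u2E x y : u2 (x, y) = chi L x * moll N primitive y.
  rewrite -moll_primitive -RintegralZl//; last first.
    apply: (@integrable_bounded_mul _ _ _ mu w (fun r => sstep (N * (y - r))) 1);
      [exact: iw|exact: mS|move=> r].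
    by have /andP[? ?] := sstep_itv (N * (y - r)); rewrite ger0_norm.
  by apply: eq_Rintegral => r _; rewrite /phi2 /=; ring.
have supp x y : [\/ M + 1 + 2 * L < `|x|, y < delta | M + 1 + 2 * L < y] ->
    u1 (x, y) = 0 /\ u2 (x, y) = 0.
  case=> h.
  - have hL : 2 * L < `|x| by apply: le_lt_trans h; rewrite lerDr addr_ge0.
    (split; apply: Rintegral_eq0) => [p|r].
      by rewrite /phi1 /= (step_fun_out _ _ L0 hL).1 mul0r mulr0.
    by rewrite /phi2 /= (chi_out L0 hL).1 mul0r mulr0.
  - (split; apply: Rintegral_eq0) => [p|r].
      have [od|od] := ltP p.2 delta; first by rewrite k_out ?mul0r//; apply: Or32.
      by rewrite /phi1 /= mollifier_out ?mulr0//; left; lra.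
    have [rd|rd] := ltP r delta; first by rewrite w_out ?mul0r//; left.
    by rewrite /phi2 /= sstep_le0 ?mulr0// pmulr_rle0//; lra.
  - split.
      apply: Rintegral_eq0 => o.
      have [oM|oM] := ltP M o.2; first by rewrite k_out ?mul0r//; apply: Or33.
      by rewrite /phi1 /= mollifier_out ?mulr0//; right; lra.
    (* Above the support every vertical step is complete, and [u2] is the cutoff times the total
       integral of [w]: mean 0 is what makes the support compact. *)
    have -> : u2 (x, y) = \int[mu]_r (chi L x * w r); last by rewrite RintegralZl// w_int mulr0.
    apply: eq_Rintegral => r _; rewrite /phi2 /=.
    have [rM|rM] := ltP M r; first by rewrite w_out ?mul0r ?mulr0//; right.
    have Nyr : 1 <= N * (y - r).
      by rewrite -(mulfV (lt0r_neq0 N0)) ler_pM2l//; lra.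
    by rewrite (sstep_ge1 Nyr) mulr1 mulrC.
have bd x y : 0 < y -> u1 (x, y) ^+ 2 + u2 (x, y) ^+ 2 <= (y `^ alpha) ^+ 2.
  by move=> y0; rewrite u1E u2E; exact: molU_bound.
have := wperimeter_ge_field Omega H1 H2 delta0 supp bd.
apply: le_trans; rewrite le_eqVlt; apply/orP; left; apply/eqP.
apply: eq_integral => -[x y] _; congr (_%:E) => /=.
have dD s : `|dstep_fun L K s x| <= D by have [_ h _] := hD s x 0.
rewrite (mol2_int (q := fun s => dstep_fun L K s x) y (mdstep x) dD).
have -> : \int[mu]_r (w r * phi2y r (x, y)) = \int[mu]_r ((chi L x * w r) * mollifier N (y - r)).
  by apply: eq_Rintegral => r _; rewrite /phi2y /=; ring.
rewrite /moll -RintegralD//; last 2 first.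
- apply: (integrable_moll y N0 (C := D * (C * (M + M)))); last by move=> t; exact: int_le2.
  have : measurable_fun setT (fun z : R * R => k z.2 z.1 * dstep_fun L K z.2 x).
    apply: measurable_funM.
      exact: (measurableT_comp mk (measurable_fun_pair measurable_snd measurable_fst)).
    exact: (measurableT_comp (mdstep x) measurable_snd).
  exact: (@measurable_fun_param_Rintegral _ _ _ _ R mu).
- apply: (integrable_moll y N0 (C := C)); first exact: measurable_funM.
  move=> t; have /andP[c0 c1] := chi_itv L x.
  by rewrite normrM -[leRHS]mul1r ler_pM// ger0_norm.
by apply: eq_Rintegral => t _; rewrite /field_density mulrDl.
Qed.

End fixed_N.

(** The mollified densities converge in L1 of the plane, which bounds the error on the arbitrary set
    [Omega']. *)
Lemma wperimeter_ge_density (Omega : set (R * R))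
    (Omega' Z : set (measurableTypeR R * measurableTypeR R)) :
  lebesgue_measurable2 Omega -> measurable Omega' -> measurable Z -> @leb2_borel R Z = 0%E ->
  (forall z, ~ Z z -> (Omega z <-> Omega' z)) ->
  ((\int[@leb2_borel R]_(z in Omega') field_density z.1 z.2)%:E <= wperimeter alpha Omega)%E.
Proof.
move=> mO mO' mZ Z0 ZO.
pose H := field_density.
have HC x t : `|H x t| <= D * (C * (M + M)) + C by exact: field_density_le.
have Hout x t : M + 2 * L < `|x| \/ M + 2 * L < `|t| -> H x t = 0 by exact: field_density_out.
have mH : measurable_fun setT (fun z : R * R => H z.1 z.2) by exact: measurable_field_density.
have mHx x : measurable_fun setT (H x) by exact: (measurable_fun_pair2 (x : R) mH).
have cv := moll2_L1_cvg mH HC Hout.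
have mm n : measurable_fun setT (fun z : R * R => moll n.+1%:R (H z.1) z.2) by exact: measurable_moll2.
have iH : (mu \x mu)%E.-integrable setT (EFin \o (fun z : R * R => H z.1 z.2)).
  by have [] := @integrable2_bounded_supp _ (fun z : R * R => H z.1 z.2) _ _ mH (fun z => HC _ _) Hout.
have im n : (mu \x mu)%E.-integrable setT (EFin \o (fun z : R * R => moll n.+1%:R (H z.1) z.2)).
  have [] := @integrable2_bounded_supp _ (fun z : R * R => moll n.+1%:R (H z.1) z.2) (M + 2 * L + 1)
    (D * (C * (M + M)) + C) (mm n) => //.
  - by move=> [x y] /=; apply: moll_norm_le.
  - move=> x y /= [h|h].
      rewrite /moll; apply: Rintegral_eq0 => t; rewrite Hout ?mul0r//; left; lra.
    apply: (moll_out _ _ h); first by rewrite ler1n.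
    by move=> t ht; rewrite Hout//; right.
have iHO : (@leb2_borel R).-integrable Omega' (EFin \o (fun z : R * R => H z.1 z.2)).
  exact: integrableS iH.
have imO n : (@leb2_borel R).-integrable Omega' (EFin \o (fun z : R * R => moll n.+1%:R (H z.1) z.2)).
  exact: integrableS (im n).
apply/lee_addgt0Pr => e e0.
have [n _ hn] : \forall n \near \oo,
    (\int[mu]_x \int[mu]_y `|moll n.+1%:R (H x) y - H x y|%:E < e%:E)%E.
  move/fine_cvgP : cv => [fn /cvgrPdist_lt/(_ e e0) hc].
  near=> n.
  have ffn : (\int[mu]_x \int[mu]_y `|moll n.+1%:R (H x) y - H x y|%:E)%E \is a fin_num.
    by near: n; exact: fn.
  rewrite -(fineK ffn) lte_fin.
  have : `|0 - fine (\int[mu]_x \int[mu]_y `|moll n.+1%:R (H x) y - H x y|%:E)%E| < e.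
    by near: n; exact: hc.
  by rewrite sub0r normrN; apply: le_lt_trans; exact: ler_norm.
have {}hn := hn n (leqnn n).
have h1 : ((\int[@leb2_borel R]_(z in Omega') moll n.+1%:R (H z.1) z.2)%:E <= wperimeter alpha Omega)%E.
  apply: le_trans (wperimeter_ge_moll (N := n.+1%:R) _ Omega); last by rewrite ler1n.
  rewrite (leb2_integral mO mO' mZ Z0 ZO (f := fun z => (moll n.+1%:R (H z.1) z.2)%:E)).
    rewrite /Rintegral fineK//; apply: integrable_fin_num; [exact: mO'|exact: imO].
  by apply/measurable_EFinP; exact: mm.
apply: (@le_trans _ _ ((\int[@leb2_borel R]_(z in Omega') moll n.+1%:R (H z.1) z.2)%:E + e%:E)%E); last first.
  exact: leeD2r.
rewrite -EFinD lee_fin -lerBlDl -RintegralB//.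
have iB : (@leb2_borel R).-integrable Omega'
    (EFin \o (fun z : R * R => H z.1 z.2 - moll n.+1%:R (H z.1) z.2)).
  exact: (integrableB mO' iHO (imO n)).
apply: (le_trans (ler_norm _)); apply: (le_trans (le_normr_Rintegral mO' iB)).
rewrite -lee_fin /Rintegral fineK; last first.
  by apply: integrable_fin_num; [exact: mO'|exact: (integrable_norm iB)].
apply: le_trans (ltW hn).
have mabs : measurable_fun setT (fun z : R * R => `|moll n.+1%:R (H z.1) z.2 - H z.1 z.2|%:E)%E.
  by apply/measurable_EFinP; apply: measurableT_comp => //; exact: measurable_funB.
have ft := @fubini_tonelli1 _ _ _ _ R mu mu
  (fun z : R * R => `|moll n.+1%:R (H z.1) z.2 - H z.1 z.2|%:E)%E mabs.
have {}ft := ft (fun z => normr_ge0 _).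
under eq_integral do rewrite distrC.
rewrite -[leRHS]ft.
by apply: ge0_subset_integral.
Unshelve. all: by end_near. Qed.

End calibration_field.

(** * The calibration inequality without smoothing *)

Section calibration_bound.
Context {R : realType}.
Notation mu := (@lebesgue_measure R).
Notation T2 := (measurableTypeR R * measurableTypeR R)%type.
Variables (alpha : R) (Omega : set (R * R)) (Omega' Z : set T2).
Hypothesis alpha0 : 0 <= alpha.
Hypothesis mO : lebesgue_measurable2 Omega.
Hypothesis mO' : measurable Omega'.
Hypothesis mZ : measurable Z.
Hypothesis Z0 : @leb2_borel R Z = 0%E.
Hypothesis ZO : forall z, ~ Z z -> (Omega z <-> Omega' z).

Definition strip (delta M : R) : set T2 := setT `*` `[delta, M]%classic.

Lemma measurable_strip delta M : measurable (strip delta M).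
Proof. by apply: measurableX => //; exact: measurable_itv. Qed.

Hypothesis strip_fin : forall delta M, 0 < delta ->
  (@leb2_borel R (Omega' `&` strip delta M) < +oo)%E.

Lemma integrable_strip (delta M C : R) (f : T2 -> R) : 0 < delta ->
  measurable_fun setT f -> (forall z, `|f z| <= C) ->
  (forall z, z.2 < delta \/ M < z.2 -> f z = 0) ->
  (@leb2_borel R).-integrable Omega' (EFin \o f).
Proof.
move=> d0 mf fC fout.
have mS := measurable_strip delta M.
apply: (@le_integrable _ _ _ (@leb2_borel R) Omega' mO' _ (fun z => (C * \1_(strip delta M) z)%:E)).
- by apply/measurable_EFinP; apply: measurable_funTS.
- move=> z _; rewrite /= lee_fin indicE.
  have [zS|zS] := boolP (z \in strip delta M).
    by rewrite mulr1 (le_trans (fC z))// ler_norm.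
  rewrite fout ?normr0//; apply: contrapT => /not_orP[h1 h2]; move/negP: zS; apply.
  by rewrite inE; split => //=; rewrite in_itv/= !leNgt; apply/andP; split; apply/negP.
- apply: (integrableZl mO' C (f := EFin \o \1_(strip delta M))).
  apply/integrableP; split; first by apply/measurable_EFinP; exact: measurable_indic.
  under eq_integral do rewrite gee0_abs ?lee_fin//.
  rewrite integral_indic//= setIC; exact: strip_fin.
Qed.

Section density_limit.
Variables (delta M C : R) (k : R -> R -> R) (w a : R -> R).
Hypothesis delta0 : 0 < delta.
Hypothesis M0 : 0 <= M.
Hypothesis mk : measurable_fun setT (fun z : R * R => k z.1 z.2).
Hypothesis k_itv : forall s t, 0 <= k s t <= C.
Hypothesis k_out : forall s t, [\/ M < `|s|, t < delta | M < t] -> k s t = 0.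
Hypothesis mw : measurable_fun setT w.
Hypothesis w_le : forall t, `|w t| <= C.
Hypothesis w_out : forall t, t < delta \/ M < t -> w t = 0.
Hypothesis w_int : \int[mu]_t w t = 0.
Hypothesis ka : forall t, \int[mu]_s k s t <= 2 * a t.
Hypothesis aB : forall t, 0 < t -> a t ^+ 2 + primitive w t ^+ 2 <= (t `^ alpha) ^+ 2.

Let C0 : 0 <= C. Proof. by rewrite (le_trans _ (w_le 0)). Qed.
Let kC s t : `|k s t| <= C.
Proof. by have /andP[k0 k1] := k_itv s t; rewrite ger0_norm. Qed.
Let k_out2 s t : M < `|s| \/ M < `|t| -> k s t = 0.
Proof.
move=> [h|h]; apply: k_out; first exact: Or31.
have [t0|t0] := leP 0 t; first by apply: Or33; rewrite ger0_norm in h.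
by apply: Or32; exact: lt_trans delta0.
Qed.

Let ik1 t : mu.-integrable setT (EFin \o (k ^~ t)).
Proof.
apply: (@integrable_bounded_supp _ _ M C) => //.
  exact: (measurable_fun_pair1 (t : R) mk).
by move=> s sM; apply: k_out2; left.
Qed.

(** Step width and cutoff scale are tied together, [K = L = n + 1], so that a single limit removes
    both. *)
Let fd (n : nat) := field_density k w n.+1%:R n.+1%:R.
Let mfd n : measurable_fun setT (fun z : T2 => fd n z.1 z.2).
Proof. exact: measurable_field_density. Qed.

Let mol n (z : T2) := moll n.+1%:R (k ^~ z.2) z.1.
Let mmol n : measurable_fun setT (mol n).
Proof.
have mk' : measurable_fun setT (fun z : R * R => k z.2 z.1).
  exact: (measurableT_comp mk (measurable_fun_pair measurable_snd measurable_fst)).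
have := measurable_moll2 n.+1%:R (f := fun t s => k s t) mk'.
move=> h; exact: (measurableT_comp h (measurable_fun_pair measurable_snd measurable_fst)).
Qed.

Let V (n : nat) x t := \int[mu]_s (k s t * (sstep (n.+1%:R * x + - (n.+1%:R * s)) + - (1 / 2))).

Let Vb n x t : `|V n x t| <= C * (M + M).
Proof.
have mS : measurable_fun setT (fun s : R => sstep (n.+1%:R * x + - (n.+1%:R * s)) + - (1 / 2) : R).
  apply: measurable_funD => //; apply: (measurableT_comp measurable_sstep).
  by apply: measurable_funD => //; apply: measurable_funN; exact: measurable_funM.
have Sb s : `|sstep (n.+1%:R * x + - (n.+1%:R * s)) + - (1 / 2)| <= (1 : R).
  by have /andP[h1 h2] := sstep_itv (n.+1%:R * x + - (n.+1%:R * s)); rewrite ler_norml; lra.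
apply: le_trans (Rintegral_norm_le_bound (ik1 t) mS Sb) _; rewrite mul1r.
have : \int[mu]_s `|k s t| <= \int[mu]_s (C * \1_(`[- M, M]%classic) s).
  apply: le_Rintegral => //; first exact: (integrable_norm (ik1 t)).
    exact: integrable_box_indic.
  move=> s _; rewrite box_indicE; have [sM|sM] := leP `|s| M; first by rewrite mulr1.
  by rewrite mulr0 k_out2 ?normr0//; left.
move=> /le_trans; apply.
rewrite RintegralZl//; last first.
  have := integrable_box_indic M 1; apply: eq_integrable => // x0 _ /=.
  by rewrite mul1r.
rewrite ler_wpM2l// /Rintegral integral_indic//= setIT lebesgue_measure_itv/=.
by case: ifP => _; rewrite -?EFinB/= ?opprK// addr_ge0.
Qed.

(** The derivative of the cutoff gives a term tending to 0; the derivative of the step is a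
    mollifier, so the second term is [k] smoothed in the horizontal variable; the third is the
    vertical divergence. *)
Let fdE n x t : fd n x t = dchi n.+1%:R x * V n x t + chi n.+1%:R x * mol n (x, t) +
  chi n.+1%:R x * w t.
Proof.
rewrite /fd /field_density; congr (_ + _).
have mS : measurable_fun setT (fun s : R => sstep (n.+1%:R * x + - (n.+1%:R * s)) + - (1 / 2) : R).
  apply: measurable_funD => //; apply: (measurableT_comp measurable_sstep).
  by apply: measurable_funD => //; apply: measurable_funN; exact: measurable_funM.
have Sb s : `|sstep (n.+1%:R * x + - (n.+1%:R * s)) + - (1 / 2)| <= (1 : R).
  by have /andP[h1 h2] := sstep_itv (n.+1%:R * x + - (n.+1%:R * s)); rewrite ler_norml; lra.
have i1 := integrable_bounded_mul (ik1 t) mS Sb.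
have i2 := integrable_moll x (ltr0Sn R n) (measurable_fun_pair1 (t : R) mk) (fun s => kC s t).
rewrite /V /mol /moll -!RintegralZl// -RintegralD//; last 2 first.
- exact: (integrableZl measurableT _ i1).
- exact: (integrableZl measurableT _ i2).
by apply: eq_Rintegral => s _; rewrite /dstep_fun /mollifier !mulrBr; ring.
Qed.

Let iw : (@leb2_borel R).-integrable Omega' (EFin \o (fun z : T2 => w z.2)).
Proof.
apply: (@integrable_strip delta M C) => //; first exact: (measurableT_comp mw measurable_snd).
by move=> z; exact: w_out.
Qed.

Let ik : (@leb2_borel R).-integrable Omega' (EFin \o (fun z : T2 => k z.1 z.2)).
Proof.
apply: (@integrable_strip delta M C) => //.
by move=> z [h|h]; apply: k_out; [apply: Or32|apply: Or33].
Qed.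

Let imol n : (@leb2_borel R).-integrable Omega' (EFin \o (fun z : T2 => chi n.+1%:R z.1 * mol n z)).
Proof.
apply: (@integrable_strip delta M C) => //.
- apply: measurable_funM => //; exact: (measurableT_comp (measurable_chi _) measurable_fst).
- move=> z; rewrite normrM -[leRHS]mul1r ler_pM//.
    by have /andP[h1 h2] := chi_itv n.+1%:R z.1; rewrite ger0_norm.
  apply: moll_norm_le => //; exact: (measurable_fun_pair1 (z.2 : R) mk).
- move=> z h; rewrite /mol /moll Rintegral_eq0 ?mulr0// => s.
  by rewrite k_out ?mul0r//; case: h => h; [apply: Or32|apply: Or33].
Qed.

Let rest n (z : T2) := dchi n.+1%:R z.1 * V n z.1 z.2 + chi n.+1%:R z.1 * w z.2.

Let restE n z : rest n z = fd n z.1 z.2 - chi n.+1%:R z.1 * mol n z.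
Proof. by rewrite fdE /rest; case: z => x t /=; ring. Qed.

Let mrest n : measurable_fun setT (rest n).
Proof.
have -> : rest n = (fun z => fd n z.1 z.2 - chi n.+1%:R z.1 * mol n z).
  by apply/funext => z; rewrite restE.
apply: measurable_funB => //; apply: measurable_funM => //.
exact: (measurableT_comp (measurable_chi _) measurable_fst).
Qed.

Let rest_le n z : `|rest n z| <= 360 * (C * (M + M)) + C.
Proof.
rewrite (le_trans (ler_normD _ _))// lerD// normrM; last first.
  rewrite -[leRHS]mul1r ler_pM//.
  by have /andP[h1 h2] := chi_itv n.+1%:R z.1; rewrite ger0_norm.
apply: ler_pM => //.
apply: le_trans (dchi_le _ _) _; first by rewrite ltr0Sn.
rewrite ler_pdivrMr ?ltr0Sn//; have : (1 : R) <= n.+1%:R by rewrite ler1n.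
by move=> n1; lra.
Qed.

Let rest_out n z : z.2 < delta \/ M < z.2 -> rest n z = 0.
Proof.
move=> h; rewrite /rest w_out// mulr0 addr0 /V Rintegral_eq0 ?mulr0// => s.
by rewrite k_out ?mul0r//; case: h => h; [apply: Or32|apply: Or33].
Qed.

(** The derivative of the cutoff is at most [360 / (n + 1)], and a multiple of the indicator of the
    strip, which has finite measure inside [Omega'], dominates. *)
Let rest_cvg : (\int[@leb2_borel R]_(z in Omega') (rest n z)%:E)%E @[n --> \oo] -->
  (\int[@leb2_borel R]_(z in Omega') (w z.2)%:E)%E.
Proof.
have [|||||_ _ +] := @dominated_convergence _ _ _ (@leb2_borel R) Omega' mO'
  (fun n z => (rest n z)%:E) (fun z => (w z.2)%:E)
  (fun z => ((360 * (C * (M + M)) + C) * \1_(strip delta M) z)%:E) => //.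
- by move=> n; apply/measurable_EFinP; exact: measurable_funTS.
- apply/measurable_EFinP; apply: measurable_funTS.
  exact: (measurableT_comp mw measurable_snd).
- apply: aeW => z _; apply: cvg_EFin; first exact: nearW.
  rewrite /= /rest -[X in _ --> X]add0r; apply: cvgD.
    apply/norm_cvg0P.
    have hh : 360 * (C * (M + M)) * harmonic n @[n --> \oo] --> (0 : R).
      by rewrite -[X in _ --> X](mulr0 (360 * (C * (M + M)))); apply: cvgM; [exact: cvg_cst|exact: cvg_harmonic].
    apply: squeeze_cvgr (cvg_cst _) hh; apply: nearW => n.
    by rewrite normr_ge0/= normrM mulrAC ler_pM//; exact: dchi_le.
  apply: cvg_near_cst; near=> n; rewrite chi1 ?mul1r//.
  rewrite (@le_trans _ _ n%:R) ?ler_nat//; near: n; exact: nbhs_infty_ger.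
- apply: (@integrable_strip delta M (360 * (C * (M + M)) + C)) => //.
  + apply: measurable_funM => //; apply: measurable_indic; exact: measurable_strip.
  + move=> z; rewrite normrM -[leRHS]mulr1 ler_pM//.
      have CM := mulr_ge0 C0 (addr_ge0 M0 M0).
      have h : 0 <= 360 * (C * (M + M)) + C.
        have C1 : 0 <= C := C0; apply: addr_ge0 C1; apply: mulr_ge0 CM; lra.
      by rewrite (ger0_norm h).
    by rewrite indicE; case: (_ \in _); rewrite ?normr1 ?normr0.
  + move=> z h; rewrite indicE; have [|_] := boolP (z \in _); last by rewrite mulr0.
    by rewrite inE => -[_]; rewrite /= in_itv/= => /andP[h1 h2]; case: h; lra.
- apply: aeW => z n _; rewrite /= lee_fin indicE.
  have [zS|zS] := boolP (z \in strip delta M); first by rewrite mulr1.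
  rewrite mulr0 rest_out ?normr0//; apply: contrapT => /not_orP[h1 h2]; move/negP: zS; apply.
  by rewrite inE; split => //=; rewrite in_itv/= !leNgt; apply/andP; split; apply/negP.
Unshelve. all: by end_near. Qed.

(** Once [n] exceeds [M] the cutoff is 1 on the support of the smoothed density, and L1 convergence
    on the plane controls the integral over [Omega']. *)
Let mol_cvg : (\int[@leb2_borel R]_(z in Omega') (chi n.+1%:R z.1 * mol n z)%:E)%E @[n --> \oo] -->
  (\int[@leb2_borel R]_(z in Omega') (k z.1 z.2)%:E)%E.
Proof.
have mk' : measurable_fun setT (fun z : R * R => k z.2 z.1).
  exact: (measurableT_comp mk (measurable_fun_pair measurable_snd measurable_fst)).
have cv := @moll2_L1_cvg _ (fun t s => k s t) C M mk' (fun t s => kC s t).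
have {}cv := cv (fun t s h => k_out2 (match h with or_introl p => or_intror p | or_intror p => or_introl p end)).
have fink : (\int[@leb2_borel R]_(z in Omega') (k z.1 z.2)%:E)%E \is a fin_num.
  by apply: integrable_fin_num; [exact: mO'|exact: ik].
suff : `|\int[@leb2_borel R]_(z in Omega') (chi n.+1%:R z.1 * mol n z)%:E -
    \int[@leb2_borel R]_(z in Omega') (k z.1 z.2)%:E|%E @[n --> \oo] --> 0%E.
  by move/cvg_abse0P/sube_cvg0; apply.
apply: squeeze_cvge (cvg_cst _) cv; near=> n.
rewrite abse_ge0/= -(integralB mO' (imol n) ik).
have iB : (@leb2_borel R).-integrable Omega'
    (EFin \o (fun z : T2 => chi n.+1%:R z.1 * mol n z - k z.1 z.2)).
  exact: (integrableB mO' (imol n) ik).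
apply: le_trans (le_abse_integral _ mO' _) _; first exact: (measurable_int _ iB).
have mabs : measurable_fun setT (fun z : T2 => `|mol n z - k z.1 z.2|%:E).
  by apply/measurable_EFinP; apply: measurableT_comp => //; exact: measurable_funB.
have ft := @fubini_tonelli2 _ _ _ _ R mu mu (fun z : T2 => `|mol n z - k z.1 z.2|%:E) mabs.
have {}ft := ft (fun z => normr_ge0 _).
rewrite -[leRHS]ft.
have E (z : T2) : chi n.+1%:R z.1 * mol n z = mol n z.
  have [zn|zn] := leP `|z.1| n.+1%:R; first by rewrite chi1 ?mul1r.
  rewrite /mol (@moll_out _ _ _ M) ?mulr0 ?ler1n//.
    by move=> s sM; apply: k_out2; left.
  apply: le_lt_trans zn; rewrite -natr1 lerD2r; near: n; exact: nbhs_infty_ger.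
rewrite (@eq_integral _ _ _ _ _ (fun z : T2 => `|mol n z - k z.1 z.2|%:E)); last first.
  by move=> z _ /=; rewrite E.
by apply: ge0_subset_integral.
Unshelve. all: by end_near. Qed.

Lemma wperimeter_ge_limit_density :
  ((\int[@leb2_borel R]_(z in Omega') k z.1 z.2 + \int[@leb2_borel R]_(z in Omega') w z.2)%:E
    <= wperimeter alpha Omega)%E.
Proof.
have fink : (\int[@leb2_borel R]_(z in Omega') (k z.1 z.2)%:E)%E \is a fin_num.
  by apply: integrable_fin_num; [exact: mO'|exact: ik].
have finw : (\int[@leb2_borel R]_(z in Omega') (w z.2)%:E)%E \is a fin_num.
  by apply: integrable_fin_num; [exact: mO'|exact: iw].
have irest n : (@leb2_borel R).-integrable Omega' (EFin \o rest n).
  by apply: (@integrable_strip delta M (360 * (C * (M + M)) + C)) => // z; exact: rest_out.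
have cv : (\int[@leb2_borel R]_(z in Omega') (fd n z.1 z.2)%:E)%E @[n --> \oo] -->
   (\int[@leb2_borel R]_(z in Omega') (k z.1 z.2)%:E + \int[@leb2_borel R]_(z in Omega') (w z.2)%:E)%E.
  rewrite (_ : (fun n => _) = (fun n => \int[@leb2_borel R]_(z in Omega') (chi n.+1%:R z.1 * mol n z)%:E +
    \int[@leb2_borel R]_(z in Omega') (rest n z)%:E)%E).
    by apply: cvgeD; [exact: fin_num_adde_defl|exact: mol_cvg|exact: rest_cvg].
  apply/funext => n; rewrite -(integralD mO' (imol n) (irest n)); apply: eq_integral => z _.
  by rewrite -EFinD restE addrC subrK.
rewrite EFinD /Rintegral !fineK//.
apply: cvge_le cv; apply: nearW => n.
have ifd : (@leb2_borel R).-integrable Omega' (EFin \o (fun z : T2 => fd n z.1 z.2)).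
  have := integrableD mO' (imol n) (irest n); apply: eq_integrable => // z _ /=.
  by rewrite -EFinD restE addrC subrK.
have := wperimeter_ge_density alpha0 delta0 M0 mk k_itv k_out mw w_le w_out w_int ka aB
  n.+1%:R (ltr0Sn R n) mO mO' mZ Z0 ZO.
rewrite /Rintegral fineK//.
by apply: integrable_fin_num; [exact: mO'|exact: ifd].
Qed.

End density_limit.
Definition slice (t : R) : \bar R := mu (ysection Omega' t).

Lemma measurable_slice : measurable_fun setT slice.
Proof. exact: measurable_fun_ysection. Qed.

(** Truncation to [|s| <= n + 1], because a slice of [Omega'] may have infinite length. *)
Let On (n : nat) : set T2 := Omega' `&` (`[- n.+1%:R, n.+1%:R]%classic `*` setT).

Let mOn n : measurable (On n).
Proof. by apply: measurableI => //; apply: measurableX => //; exact: measurable_itv. Qed.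

Let ysOn n t : ysection (On n) t = ysection Omega' t `&` `[- n.+1%:R, n.+1%:R]%classic.
Proof.
apply/seteqP; split => x; rewrite /ysection/= !in_setE /On.
  by move=> [h1 [h2 _]].
by move=> [h1 h2].
Qed.

Let mys t : measurable (ysection Omega' t). Proof. exact: measurable_ysection. Qed.

Let slice_n (n : nat) (t : R) : R := fine (mu (ysection (On n) t)).

Let slice_nE n t : (slice_n n t)%:E = mu (ysection (On n) t).
Proof.
rewrite fineK// ge0_fin_numE// ysOn.
apply: (@le_lt_trans _ _ (mu `[- n.+1%:R, n.+1%:R]%classic)).
  by apply: le_measure; rewrite ?inE//; apply: measurableI => //; exact: measurable_itv.
by rewrite lebesgue_measure_itv/=; case: ifP => _; rewrite ?ltry// -EFinB ltry.
Qed.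

Let mslice_n n : measurable_fun setT (slice_n n).
Proof.
apply: (measurableT_comp (fine_measurable measurableT)).
exact: (measurable_fun_ysection mu (mOn n)).
Qed.

Let slice_n_ge0 n t : 0 <= slice_n n t. Proof. exact: fine_ge0. Qed.

Let slice_cvg t : (slice_n n t)%:E @[n --> \oo] --> slice t.
Proof.
under eq_fun do rewrite slice_nE.
have -> : slice t = mu (\bigcup_n ysection (On n) t).
  congr (mu _); apply/seteqP; split => x; last first.
    by move=> [n _]; rewrite ysOn => -[].
  move=> h; exists (Num.trunc `|x|) => //; rewrite ysOn; split => //.
  by rewrite /= in_itv/= -ler_norml; apply/ltW/truncnS_gt.
apply: nondecreasing_cvg_mu.
- by move=> n; exact: measurable_ysection.
- by apply: bigcupT_measurable => n; exact: measurable_ysection.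
- apply/nondecreasing_seqP => n; apply/subsetPset; rewrite !ysOn; apply: setIS => x.
  rewrite /= !in_itv/= -!ler_norml => /le_trans; apply.
  by rewrite ler_nat.
Qed.

Let slice_eq0 t : slice t = 0%E -> forall n, slice_n n t = 0.
Proof.
move=> t0 n; rewrite /slice_n; suff -> : mu (ysection (On n) t) = 0%E by [].
apply/eqP; rewrite eq_le measure_ge0 andbT -t0; apply: le_measure; rewrite ?inE//.
  exact: measurable_ysection.
by rewrite ysOn; exact: subIsetl.
Qed.

(** The mass [2 * a t] is spread uniformly over the truncated slice. Slices no longer than
    [1 / (n + 1)] are left out so that the density stays bounded; in the limit every slice of
    positive length takes part. *)
Lemma calibration_bound (delta M C : R) (w a : R -> R) : 0 < delta -> 0 <= M ->
  measurable_fun setT a -> (forall t, 0 <= a t <= C) ->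
  (forall t, t < delta \/ M < t -> a t = 0) ->
  measurable_fun setT w -> (forall t, `|w t| <= C) ->
  (forall t, t < delta \/ M < t -> w t = 0) -> \int[mu]_t w t = 0 ->
  (forall t, 0 < t -> a t ^+ 2 + primitive w t ^+ 2 <= (t `^ alpha) ^+ 2) ->
  ((2 * \int[mu]_t (a t * \1_[set t | slice t != 0%E] t) +
    \int[@leb2_borel R]_(z in Omega') w z.2)%:E <= wperimeter alpha Omega)%E.
Proof.
move=> d0 M0 ma a_itv a_out mw w_le w_out w_int aB.
have C0 : 0 <= C by rewrite (le_trans _ (w_le 0)).
pose b n t : R := (n.+1%:R^-1 < slice_n n t)%R%:R.
pose k n s t : R := 2 * a t / slice_n n t * b n t * \1_(On n) (s, t).
have mb n : measurable_fun setT (b n).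
  apply: (measurableT_comp (f := fun b : bool => b%:R : R)) => //.
  exact: (measurable_fun_ltr (measurable_cst _) (mslice_n n)).
have bE n t : b n t = 0 \/ (b n t = 1 /\ n.+1%:R^-1 < slice_n n t).
  by rewrite /b; case: ltP => h; [right|left].
have mcoef n : measurable_fun setT (fun t => 2 * a t / slice_n n t * b n t).
  apply: measurable_funM => //; apply: measurable_funM; first exact: measurable_funM.
  rewrite (_ : (fun t => (slice_n n t)^-1) = (fun t => slice_n n t `^ (-1))).
    exact: (measurableT_comp (measurable_powR (-1)) (mslice_n n)).
  by apply/funext => t; rewrite powR_inv1.
have mk n : measurable_fun setT (fun z : R * R => k n z.1 z.2).
  apply: measurable_funM; first exact: (measurableT_comp (mcoef n) measurable_snd).
  have := measurable_indic (D := setT) (mOn n) (R := R).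
  rewrite (_ : (fun x : R * R => \1_(On n) (x.1, x.2)) = \1_(On n))//.
  by apply/funext => -[].
have coef_itv n t : 0 <= 2 * a t / slice_n n t * b n t <= 2 * C * n.+1%:R.
  have /andP[a0 aC] := a_itv t.
  have [->|[-> h]] := bE n t; first by rewrite mulr0 lexx !mulr_ge0.
  have s0 : 0 < slice_n n t by apply: lt_trans h; rewrite invr_gt0.
  rewrite mulr1 divr_ge0 ?mulr_ge0//= ler_pM ?mulr_ge0 ?invr_ge0 ?(ltW s0)//.
    by rewrite ler_pM2l.
  by rewrite -[leRHS]invrK lef_pV2 ?posrE ?invr_gt0// ltW.
have k_itv n s t : 0 <= k n s t <= 2 * C * n.+1%:R.
  have /andP[h1 h2] := coef_itv n t.
  rewrite /k indicE; case: (_ \in _); first by rewrite mulr1 h1.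
  by rewrite mulr0 lexx !mulr_ge0.
have k_out n s t : [\/ M + n.+1%:R < `|s|, t < delta | M + n.+1%:R < t] -> k n s t = 0.
  have n0 : 0 <= n.+1%:R :> R by [].
  rewrite /k; case=> h.
  - rewrite indicE; have [|_] := boolP (_ \in _); last by rewrite mulr0.
    rewrite inE => -[_ [+ _]]; rewrite /= in_itv/= -ler_norml => h2.
    by exfalso; lra.
  - by rewrite a_out ?mulr0 ?mul0r//; left.
  - by rewrite a_out ?mulr0 ?mul0r//; right; lra.
have kint n t : \int[mu]_s k n s t = 2 * a t * b n t.
  have i1 : mu.-integrable setT (EFin \o (fun s => \1_(On n) (s, t) : R)).
    apply/integrableP; split.
      apply/measurable_EFinP; have := measurable_indic (D := setT) (mOn n) (R := R).
      by move=> h; exact: (measurable_fun_pair1 (t : R) h).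
    under eq_integral do rewrite gee0_abs ?lee_fin//.
    rewrite (_ : (fun s => _) = (fun s => (\1_(ysection (On n) t) s)%:E)).
      by rewrite integral_indic//= ?setIT -?slice_nE ?ltry//; exact: measurable_ysection.
    by apply/funext => s; rewrite !indicE mem_ysection.
  rewrite /k RintegralZl//.
  have -> : \int[mu]_s \1_(On n) (s, t) = slice_n n t.
    rewrite /Rintegral (_ : (fun s => _) = (fun s => (\1_(ysection (On n) t) s)%:E)).
      by rewrite integral_indic//= ?setIT//; exact: measurable_ysection.
    by apply/funext => s; rewrite !indicE mem_ysection.
  have [->|[-> h]] := bE n t; first by rewrite !mulr0 mul0r.
  have s0 : 0 < slice_n n t by apply: lt_trans h; rewrite invr_gt0.
  by rewrite !mulr1 mulfVK// gt_eqF.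
have kOint n : \int[@leb2_borel R]_(z in Omega') k n z.1 z.2 = \int[mu]_t (2 * a t * b n t).
  rewrite Rintegral_mkcond.
  have E : ((fun z : T2 => k n z.1 z.2) \_ Omega') = (fun z => k n z.1 z.2).
    apply/funext => -[s t]; rewrite patchE; case: ifPn => // h.
    rewrite /k indicE; have [|_] := boolP (_ \in _); last by rewrite mulr0.
    by rewrite inE => -[+ _]; move/mem_set; rewrite (negbTE h).
  rewrite E.
  have kC z : `|k n z.1 z.2| <= 2 * C * n.+1%:R.
    by have /andP[h1 h2] := k_itv n z.1 z.2; rewrite ger0_norm.
  have kO s t : M + n.+1%:R < `|s| \/ M + n.+1%:R < `|t| -> k n s t = 0.
    move=> [h|h]; apply: k_out; first exact: Or31.
    have [t0|t0] := leP 0 t; first by apply: Or33; rewrite ger0_norm in h.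
    by apply: Or32; exact: lt_trans d0.
  have [_ ->] := @Rfubini_box _ (fun z : R * R => k n z.1 z.2) (M + n.+1%:R) _ (mk n) kC kO.
  by apply: eq_Rintegral => t _; rewrite kint.
have bnd n : ((\int[mu]_t (2 * a t * b n t) + \int[@leb2_borel R]_(z in Omega') w z.2)%:E
    <= wperimeter alpha Omega)%E.
  rewrite -kOint.
  have CC : C <= Num.max C (2 * C * n.+1%:R) by rewrite le_max lexx.
  apply: (@wperimeter_ge_limit_density delta (M + n.+1%:R) (Num.max C (2 * C * n.+1%:R)) (k n) w a) => //.
  - by rewrite addr_ge0.
  - by move=> s t; have /andP[h1 h2] := k_itv n s t; rewrite h1/= le_max h2 orbT.
  - exact: k_out.
  - by move=> t; exact: le_trans (w_le t) CC.
  - move=> t [h|h]; apply: w_out; first by left.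
    by right; apply: le_lt_trans h; rewrite lerDl.
  - move=> t; rewrite kint; have /andP[h1 h2] := a_itv t.
    by have [->|[-> _]] := bE n t; rewrite ?mulr1// mulr0 mulr_ge0.
have m2ab n : measurable_fun setT (fun t => 2 * a t * b n t).
  exact: (measurable_funM (measurable_funM (measurable_cst (2 : R)) ma) (mb n)).
pose lim t : R := 2 * a t * \1_[set t | slice t != 0%E] t.
have mset : measurable [set t | slice t != 0%E].
  rewrite -[X in measurable X]setTI; apply: emeasurable_neq => //; exact: measurable_slice.
have [|||||ilim _ +] := @dominated_convergence _ _ _ mu setT measurableT
  (fun n t => (2 * a t * b n t)%:E) (fun t => (lim t)%:E)
  (fun t => (2 * C * \1_(`[- M, M]%classic) t)%:E) => //.
- by move=> n; apply/measurable_EFinP; exact: m2ab.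
- apply/measurable_EFinP; apply: measurable_funM; first exact: measurable_funM.
  exact: measurable_indic.
- apply: aeW => t _; apply: cvg_EFin; first exact: nearW.
  rewrite /= /lim indicE; have [t0|t0] := eqVneq (slice t) 0%E.
    rewrite memNset/=; last by rewrite t0 eqxx.
    apply: cvg_near_cst; apply: nearW => n /=; have [->//|[_]] := bE n t.
    by rewrite slice_eq0// ltNge invr_ge0 ler0n.
  rewrite mem_set//; apply: cvg_near_cst.
  have : (0 < slice t)%E by rewrite lt_neqAle eq_sym t0 measure_ge0.
  have [e e0 es] : exists2 e : R, 0 < e & (e%:E < slice t)%E.
    have : (0 < slice t)%E by rewrite lt_neqAle eq_sym t0 measure_ge0.
    case: (slice t) => [r|_|//].
      by rewrite lte_fin => r0; exists (r / 2); rewrite ?lte_fin; lra.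
    by exists 1; rewrite ?ltry.
  move=> _; near=> n; rewrite /= /b.
  suff -> : n.+1%:R^-1 < slice_n n t by [].
  apply: (@lt_trans _ _ e); first by near: n; exact: near_infty_natSinv_lt (PosNum e0).
  rewrite -lte_fin; near: n; apply: (@slice_cvg t [set x | (e%:E < x)%E]); apply: open_nbhs_nbhs; split => //; exact: open_ereal_gt_ereal.
- have := integrableZl measurableT (2 * C) (integrable_box_indic M 1).
  by apply: eq_integrable => // x0 _ /=; rewrite mul1r EFinM.
- apply: aeW => t n _; rewrite lee_fin box_indicE.
  have /andP[h1 h2] := a_itv t.
  have [tM|tM] := leP `|t| M; last first.
    rewrite a_out ?mulr0 ?mul0r ?normr0//.
    have [t0|t0] := leP 0 t; first by right; rewrite ger0_norm in tM.
    by left; exact: lt_trans d0.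
  by rewrite mulr1; have [->|[-> _]] := bE n t; rewrite ?mulr0 ?normr0 ?mulr_ge0// mulr1 ger0_norm ?mulr_ge0// ler_pM2l.
move=> cv.
have i2 n : mu.-integrable setT (EFin \o (fun t => 2 * a t * b n t)).
  apply: (@integrable_bounded_supp _ _ M (2 * C)).
  - by exact: m2ab.
  - move=> t; have /andP[h1 h2] := a_itv t.
    by have [->|[-> _]] := bE n t; rewrite ?mulr0 ?normr0 ?mulr_ge0// mulr1 ger0_norm ?mulr_ge0// ler_pM2l.
  - move=> t tM; rewrite a_out ?mulr0 ?mul0r//.
    have [t0|t0] := leP 0 t; first by right; rewrite ger0_norm in tM.
    by left; exact: lt_trans d0.
have finl : (\int[mu]_t (lim t)%:E)%E \is a fin_num.
  by apply: integrable_fin_num; [exact: measurableT|exact: ilim].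
rewrite -RintegralZl//; last first.
  have := integrableZl measurableT 2^-1 ilim; apply: eq_integrable => // t _.
  by rewrite /= -EFinM /lim; congr EFin; rewrite !mulrA mulVf// mul1r.
have -> : \int[mu]_x (2 * (a x * \1_[set t | slice t != 0%E] x)) = \int[mu]_x lim x.
  by apply: eq_Rintegral => t _; rewrite /lim mulrA.
rewrite EFinD {1}/Rintegral fineK//.
have cv2 := cvgeD (fin_num_adde_defl _ (erefl : (\int[@leb2_borel R]_(z in Omega') w z.2)%:E \is a fin_num)) cv (cvg_cst (\int[@leb2_borel R]_(z in Omega') w z.2)%:E).
apply: cvge_le (cv2 _ _); apply: nearW => n.
have := bnd n; rewrite EFinD {1}/Rintegral fineK//.
by apply: integrable_fin_num; [exact: measurableT|exact: i2].
Unshelve. all: by end_near. Qed.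

End calibration_bound.

(** * One-dimensional integrals *)

Section FTC_open.
Context {R : realType}.
Notation mu := (@lebesgue_measure R).
Variables (a b la lb : R) (f F : R -> R).
Hypothesis ab : a < b.
Hypothesis cf : forall x, a < x < b -> {for x, continuous f}.
Hypothesis dF : forall x, a < x < b -> is_derive x 1 F (f x).
Hypothesis Fa : F x @[x --> a^'+] --> la.
Hypothesis Fb : F x @[x --> b^'-] --> lb.

(** The denominator exceeds 2, so that [a + e n < b - e n] from the first index on. *)
Let e (n : nat) : R := (b - a) / n.+3%:R.
Let e_gt0 n : 0 < e n. Proof. by rewrite divr_gt0 ?subr_gt0. Qed.
Let e_lt n : a + e n < b - e n.
Proof.
have : e n * n.+3%:R = b - a by rewrite /e divfK.
have := ler0n R n; rewrite -[n.+3]addn3 natrD => n0; have := e_gt0 n => e0.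
rewrite mulrDr => h; have := mulr_ge0 (ltW e0) n0; lra.
Qed.
Let e_cvg : e n @[n --> \oo] --> 0.
Proof.
rewrite -[X in _ --> X](mulr0 (b - a)); apply: cvgM; first exact: cvg_cst.
have := @cvg_harmonic R; rewrite -(cvg_shiftn 2)/=; apply: cvg_trans.
by apply: near_eq_cvg; apply: nearW => n; rewrite /harmonic/= addn2.
Qed.
Let I (n : nat) : set R := `[a + e n, b - e n]%classic.
Let I_sub n : I n `<=` `]a, b[%classic.
Proof.
move=> x; rewrite /I/= !in_itv/= => /andP[h1 h2]; have := e_gt0 n => e0.
by apply/andP; split; lra.
Qed.
Let e_dec n m : (n <= m)%N -> e m <= e n.
Proof.
move=> nm; apply: ler_wpM2l; first by rewrite subr_ge0 ltW.
by rewrite lef_pV2 ?posrE// ler_nat.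
Qed.
Let I_nd : nondecreasing_seq I.
Proof.
move=> n m nm; apply/subsetPset => x; rewrite /I/= !in_itv/= => /andP[h1 h2].
by have := e_dec nm => h; apply/andP; split; lra.
Qed.
Let I_near x : a < x < b -> \forall n \near \oo, I n x.
Proof.
move=> /andP[ax xb].
have d0 : 0 < Num.min (x - a) (b - x) by rewrite lt_min !subr_gt0 ax.
near=> n; rewrite /I/= in_itv/=.
have : e n < Num.min (x - a) (b - x).
  by near: n; apply: (cvgr_lt _ e_cvg).
by rewrite lt_min => /andP[h1 h2]; apply/andP; split; lra.
Unshelve. all: by end_near. Qed.
Let I_bigcup : \bigcup_n I n = `]a, b[%classic.
Proof.
apply/seteqP; split => x; first by move=> [n _]; exact: I_sub.
rewrite /= in_itv/= => /I_near[n _ h]; exists n => //; exact: h n (leqnn n).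
Qed.
Let mI n : measurable (I n). Proof. exact: measurable_itv. Qed.
Let mf : measurable_fun `]a, b[%classic f.
Proof.
apply: open_continuous_measurable_fun; first exact: interval_open.
by move=> x; rewrite inE/= in_itv/=; exact: cf.
Qed.
Let FTC_I n : (\int[mu]_(x in I n) (f x)%:E = (F (b - e n))%:E - (F (a + e n))%:E)%E.
Proof.
have h x : a + e n <= x <= b - e n -> a < x < b.
  by have := e_gt0 n => e0 /andP[h1 h2]; apply/andP; split; lra.
have cF x : a + e n <= x <= b - e n -> {for x, continuous F}.
  move=> /h /dF d; apply: differentiable_continuous; apply/derivable1_diffP.
  exact: (@ex_derive _ _ _ _ _ _ _ d).
apply: continuous_FTC2 => //.
- apply: continuous_in_subspaceT => x; rewrite inE/= in_itv/= => /h; exact: cf.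
- split.
  + move=> x; rewrite in_itv/= => /andP[h1 h2].
    have /h/dF d : a + e n <= x <= b - e n by rewrite !ltW.
    exact: (@ex_derive _ _ _ _ _ _ _ d).
  + by apply: cvg_at_right_filter; apply: cF; rewrite lexx ltW.
  + by apply: cvg_at_left_filter; apply: cF; rewrite lexx ltW.
- move=> x; rewrite in_itv/= => /andP[h1 h2]; rewrite derive1E.
  have /h/dF d : a + e n <= x <= b - e n by rewrite !ltW.
  exact: (@derive_val _ _ _ _ _ _ _ d).
Qed.
Let F_cvg : ((F (b - e n))%:E - (F (a + e n))%:E)%E @[n --> \oo] --> (lb - la)%:E.
Proof.
rewrite (_ : (fun n => _) = (fun n => (F (b - e n) - F (a + e n))%:E)); last by apply/funext => n; rewrite EFinB.
apply: cvg_EFin; first exact: nearW.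
apply: cvgB.
  apply: (proj1 (cvg_at_leftP _ _ _) Fb (fun n => b - e n)); split.
    by move=> n; rewrite gtrBl.
  by rewrite -[X in _ --> X]subr0; apply: cvgB => //; exact: cvg_cst.
apply: (proj1 (cvg_at_rightP _ _ _) Fa (fun n => a + e n)); split.
  by move=> n; rewrite ltrDl.
by rewrite -[X in _ --> X]addr0; apply: cvgD => //; exact: cvg_cst.
Qed.

(** Monotone convergence along the closed subintervals; integrability is a consequence. *)
Lemma ge0_FTC_open : (forall x, a < x < b -> 0 <= f x) ->
  (\int[mu]_(x in `]a, b[) (f x)%:E = (lb - la)%:E)%E.
Proof.
move=> f0.
have := @ge0_nondecreasing_set_cvg_integral _ (measurableTypeR R) R I (EFin \o f) mu I_nd mI.
rewrite I_bigcup => /(_ _ _) cv.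
apply: (cvg_unique _ (cv _ _)) => //.
- by move=> n; apply/measurable_EFinP; apply: measurable_funS mf => //; exact: I_sub.
- by move=> n x /I_sub; rewrite /= in_itv/= lee_fin; exact: f0.
- rewrite /= (_ : (fun i => _) = (fun n => (F (b - e n))%:E - (F (a + e n))%:E)%E); first exact: F_cvg.
  by apply/funext => n; rewrite -FTC_I.
Qed.

(** The same exhaustion with dominated convergence, for integrands of variable sign. *)
Lemma integrable_FTC_open : mu.-integrable `]a, b[ (EFin \o f) ->
  (\int[mu]_(x in `]a, b[) (f x)%:E = (lb - la)%:E)%E.
Proof.
move=> intf.
have [|||||_ _ cv] := @dominated_convergence _ _ _ mu `]a, b[%classic (measurable_itv _)
  (fun n => (EFin \o f) \_ (I n)) (EFin \o f) (abse \o (EFin \o f)).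
- move=> n; apply: measurable_funTS; apply/(measurable_restrictT _ (mI n)).
  by apply/measurable_EFinP; apply: measurable_funS mf => //; exact: I_sub.
- exact/measurable_EFinP.
- apply: aeW => x; rewrite /= in_itv/= => xab; apply: cvg_near_cst.
  by near=> n; rewrite patchE mem_set//; near: n; exact: I_near.
- exact: integrable_abse.
- apply: aeW => x n _; rewrite patchE; case: ifP => // _; rewrite abse0; exact: abse_ge0.
apply: (cvg_unique _ cv) => //.
rewrite /= (_ : (fun n => _) = (fun n => (F (b - e n))%:E - (F (a + e n))%:E)%E); first exact: F_cvg.
apply/funext => n; rewrite -FTC_I [RHS]integral_mkcond [LHS]integral_mkcond; apply: eq_integral => x _.
rewrite !patchE; case: ifPn => // h; case: ifPn => // h2; exfalso.
by move/negP: h; apply; rewrite inE; apply: (I_sub (n := n)); rewrite inE in h2.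
Unshelve. all: by end_near. Qed.

End FTC_open.

Section powR_integral.
Context {R : realType}.
Notation mu := (@lebesgue_measure R).

Lemma powR_continuous (p x : R) : 0 < x -> {for x, continuous (fun t : R => t `^ p)}.
Proof.
move=> x0; apply: differentiable_continuous; apply/derivable1_diffP.
exact: (@ex_derive _ _ _ _ _ _ _ (is_derive1_powR p x0)).
Qed.

Lemma powR_continuous_right0 (p : R) : 0 < p -> t `^ p @[t --> 0^'+] --> (0 : R).
Proof. exact: powR_cvg0. Qed.

Lemma integral_powR (p a b : R) : 0 < p + 1 -> 0 <= a -> a <= b ->
  (\int[mu]_(t in `]a, b[) (t `^ p)%:E = ((b `^ (p + 1) - a `^ (p + 1)) / (p + 1))%:E)%E.
Proof.
move=> p0 a0; rewrite le_eqVlt => /predU1P[->|ab].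
  by rewrite set_itvoo0 integral_set0 subrr mul0r.
rewrite mulrBl; apply: (@ge0_FTC_open _ _ _ _ _ _ (fun t => t `^ (p + 1) / (p + 1))) => //.
- by move=> x /andP[ax _]; apply: powR_continuous; exact: le_lt_trans ax.
- move=> x /andP[ax _]; have x0 : 0 < x by exact: le_lt_trans ax.
  have -> : x `^ p = (p + 1)^-1 *: ((p + 1) * x `^ (p + 1 - 1)).
    by rewrite addrK /GRing.scale/= mulrA mulVf ?mul1r// gt_eqF.
  have := @is_deriveZ _ _ _ _ (p + 1)^-1 _ _ _ (is_derive1_powR (p + 1) x0).
  congr (is_derive _ _ _ _); apply/funext => t; exact: mulrC.
- apply: cvgM; last exact: cvg_cst.
  move: a0; rewrite le_eqVlt => /predU1P[<-|a0].
    by rewrite powR0 ?gt_eqF//; exact: powR_continuous_right0.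
  by apply: cvg_at_right_filter; exact: powR_continuous.
- apply: cvgM; last exact: cvg_cst.
  by apply: cvg_at_left_filter; apply: powR_continuous; exact: le_lt_trans ab.
- by move=> x _; exact: powR_ge0.
Qed.

End powR_integral.

(** * Partial calibrations and the geometric grid *)

Section interval_test_functions.
Context {R : realType}.
Notation mu := (@lebesgue_measure R).
Implicit Types (lo hi c C : R) (w v : R -> R).

(** The support []lo, hi]] is half-open so that functions on consecutive cells do not overlap. *)
Definition test_fun lo hi C w := [/\ measurable_fun setT w, (forall t, `|w t| <= C) &
  (forall t, t <= lo \/ hi < t -> w t = 0)].

Lemma test_fun_integrable lo hi C w : 0 < lo -> test_fun lo hi C w -> mu.-integrable setT (EFin \o w).
Proof.
move=> lo0 [mw wC wout]; apply: (@integrable_bounded_supp _ _ hi C) => // t th; apply: wout.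
have [t0|t0] := leP 0 t; first by right; rewrite ger0_norm in th.
by left; apply: ltW; exact: lt_trans lo0.
Qed.

Lemma test_funD lo hi C D w v : test_fun lo hi C w -> test_fun lo hi D v ->
  test_fun lo hi (C + D) (fun t => w t + v t).
Proof.
move=> [mw wC wo] [mv vC vo]; split.
- exact: measurable_funD.
- by move=> t; rewrite (le_trans (ler_normD _ _))// lerD.
- by move=> t h; rewrite wo// vo// addr0.
Qed.

Lemma test_fun_sub lo hi lo' hi' C w : lo' <= lo -> hi <= hi' ->
  test_fun lo hi C w -> test_fun lo' hi' C w.
Proof.
move=> hl hh [mw wC wo]; split => // t [h|h]; apply: wo.
  by left; exact: le_trans hl.
by right; exact: le_lt_trans h.
Qed.

Lemma test_fun_indic lo hi C w (A : set R) : measurable A -> test_fun lo hi C w ->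
  test_fun lo hi C (fun t => w t * \1_A t).
Proof.
move=> mA [mw wC wo]; split.
- by apply: measurable_funM => //; exact: measurable_indic.
- move=> t; rewrite normrM indicE; case: (_ \in _); first by rewrite normr1 mulr1.
  by rewrite normr0 mulr0 (le_trans _ (wC t)).
- by move=> t h; rewrite wo// mul0r.
Qed.

Lemma test_fun_primitive lo hi C w t : 0 < lo -> test_fun lo hi C w ->
  mu.-integrable setT (EFin \o (fun r => w r * (r <= t)%R%:R)).
Proof.
move=> lo0 tw; apply: (@test_fun_integrable lo hi C) => //.
have := @test_fun_indic lo hi C w [set` `]-oo, t]] (measurable_itv _) tw.
congr (test_fun _ _ _ _); apply/funext => r; rewrite indicE; congr (_ * _%:R).
by congr (nat_of_bool _); apply/idP/idP; rewrite inE/= in_itv.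
Qed.

Lemma primitiveD lo hi C D w v t : 0 < lo -> test_fun lo hi C w -> test_fun lo hi D v ->
  primitive (fun r => w r + v r) t = primitive w t + primitive v t.
Proof.
move=> lo0 tw tv; rewrite /primitive -RintegralD//; last 2 first.
- exact: (test_fun_primitive _ lo0 tw).
- exact: (test_fun_primitive _ lo0 tv).
by apply: eq_Rintegral => r _; rewrite mulrDl.
Qed.

Lemma primitive_before lo hi C w t : test_fun lo hi C w -> t <= lo -> primitive w t = 0.
Proof.
move=> [_ _ wo] tlo; apply: Rintegral_eq0 => r.
have [rt|rt] := leP r t; last by rewrite mulr0.
by rewrite wo ?mul0r//; left; exact: le_trans tlo.
Qed.

Lemma primitive_after lo hi C w t : test_fun lo hi C w -> hi <= t ->
  primitive w t = \int[mu]_r w r.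
Proof.
move=> [_ _ wo] hit; apply: eq_Rintegral => r _.
have [rt|rt] := leP r t; first by rewrite mulr1.
by rewrite wo ?mul0r//; right; exact: le_lt_trans rt.
Qed.

Lemma test_fun0 lo hi C : 0 <= C -> test_fun lo hi C (fun=> 0).
Proof. by move=> C0; split=> [|t|t _//]; [exact: measurable_cst|rewrite normr0]. Qed.

(** The primitive climbs from 0 to 1 and moves only on [A]: this is the tool for changing the value
    of V on a chosen set of heights. *)
Lemma test_fun_normalized_indic lo hi (A : set R) : measurable A -> A `<=` `]lo, hi]%classic ->
  (0 < mu A)%E ->
  let u := (fun t => (fine (mu A))^-1 * \1_A t) in
  [/\ test_fun lo hi (fine (mu A))^-1 u, \int[mu]_t u t = 1 &
    forall t, 0 < lo -> 0 <= primitive u t <= 1].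
Proof.
move=> mA sA A0 /=.
have fA : (mu A < +oo)%E.
  apply: (@le_lt_trans _ _ (mu `]lo, hi]%classic)); first by apply: le_measure; rewrite ?inE.
  by rewrite lebesgue_measure_itv/=; case: ifP => _; rewrite ?ltry// -EFinB ltry.
have A1 : 0 < fine (mu A) by rewrite fine_gt0// A0.
have tu : test_fun lo hi (fine (mu A))^-1 (fun t => (fine (mu A))^-1 * \1_A t).
  split.
  - by apply: measurable_funM => //; exact: measurable_indic.
  - move=> t; rewrite ger0_norm; last by rewrite mulr_ge0// invr_ge0 ltW.
    rewrite indicE; case: (_ \in _); first by rewrite mulr1.
    by rewrite mulr0 invr_ge0 ltW.
  - move=> t h; rewrite indicE memNset ?mulr0// => /sA; rewrite /= in_itv/= => /andP[h1 h2].
    by case: h => h; [have := lt_le_trans h1 h|have := lt_le_trans h h2]; rewrite ltxx.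
have i1 : mu.-integrable setT (EFin \o (\1_A : R -> R)).
  apply/integrableP; split; first by apply/measurable_EFinP; exact: measurable_indic.
  by under eq_integral do rewrite gee0_abs ?lee_fin//; rewrite integral_indic//= setIT.
have int1 : \int[mu]_t ((fine (mu A))^-1 * \1_A t) = 1.
  rewrite RintegralZl//= /Rintegral integral_indic//= setIT mulVf// gt_eqF//.
split => // t lo0; apply/andP; split.
  by apply: Rintegral_ge0 => r _; rewrite !mulr_ge0// invr_ge0 ltW.
rewrite -int1; apply: le_Rintegral => //.
- exact: (test_fun_primitive t lo0 tu).
- exact: (test_fun_integrable lo0 tu).
- move=> r _; rewrite ler_piMr ?lern1 ?leq_b1//.
  by rewrite mulr_ge0// invr_ge0 ltW.
Qed.

End interval_test_functions.

(** * Gluing partial calibrations *)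

Section reachability.
Context {R : realType}.
Notation mu := (@lebesgue_measure R).
Notation T2 := (measurableTypeR R * measurableTypeR R)%type.
Variables (alpha : R) (Omega' : set T2).
Hypothesis alpha0 : 0 <= alpha.
Hypothesis mO' : measurable Omega'.
Hypothesis strip_fin : forall delta M, 0 < delta ->
  (@leb2_borel R (Omega' `&` strip delta M) < +oo)%E.

Let E := [set t | slice Omega' t != 0%E].
Let L (w : R -> R) := \int[@leb2_borel R]_(z in Omega') w z.2.

Lemma measurable_slice_neq0 : measurable [set t | slice Omega' t != 0%E].
Proof.
rewrite -[X in measurable X]setTI; apply: emeasurable_neq => //; exact: measurable_slice.
Qed.

Lemma test_fun_integrable2 (lo hi C : R) w : 0 < lo -> test_fun lo hi C w ->
  (@leb2_borel R).-integrable Omega' (EFin \o (fun z : T2 => w z.2)).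
Proof.
move=> lo0 [mw wC wo]; apply: (@integrable_strip _ _ mO' strip_fin lo hi C) => //.
- exact: (measurableT_comp mw measurable_snd).
- by move=> z [h|h]; apply: wo; [left; exact: ltW|right].
Qed.

Lemma area_functional_ge0 (g : R -> R) : measurable_fun setT g -> (forall t, 0 <= g t) ->
  (\int[@leb2_borel R]_(z in Omega') (g z.2)%:E = \int[mu]_t ((g t)%:E * slice Omega' t))%E.
Proof.
move=> mg g0; rewrite integral_mkcond.
pose f (z : T2) : \bar R := ((g z.2)%:E * (\1_Omega' z)%:E)%E.
have -> : ((fun z : T2 => (g z.2)%:E) \_ Omega') = f.
  apply/funext => z; rewrite patchE /f indicE; case: (_ \in _); first by rewrite mule1.
  by rewrite mule0.
have mf : measurable_fun setT f.
  apply: emeasurable_funM; apply/measurable_EFinP; last exact: measurable_indic.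
  exact: (measurableT_comp mg measurable_snd).
have f0 z : (0 <= f z)%E by rewrite mule_ge0 ?lee_fin.
rewrite /leb2_borel (@fubini_tonelli2 _ _ _ _ R mu mu f mf f0).
apply: eq_integral => t _; rewrite /fubini_G /f/= ge0_integralZl_EFin//.
- congr (_ * _)%E; have mS : measurable (ysection Omega' t) by exact: measurable_ysection.
  rewrite /slice -(setIT (ysection Omega' t)) -integral_indic//.
  by apply: eq_integral => x _; rewrite !indicE mem_ysection.
- apply/measurable_EFinP.
  exact: (measurable_fun_pair1 (t : R) (measurable_indic (D := setT) mO' (R := R))).
Qed.

Lemma area_functionalD (lo hi C D : R) w v : 0 < lo -> test_fun lo hi C w -> test_fun lo hi D v ->
  L (fun t => w t + v t) = L w + L v.
Proof.
move=> lo0 tw tv; rewrite /L -RintegralD//.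
- exact: (test_fun_integrable2 lo0 tw).
- exact: (test_fun_integrable2 lo0 tv).
Qed.

(* [w] and [a] are a partial calibration built on the strip (lo, c]: the
   primitive of [w] has reached the value [b], and [S] is the perimeter bound
   obtained so far. *)
Definition reach (lo c b S : R) := exists C w a,
  [/\ test_fun lo c C w, test_fun lo c C a & forall t, 0 <= a t] /\
  [/\ \int[mu]_t w t = b,
      forall t, 0 < t -> t <= c -> a t ^+ 2 + primitive w t ^+ 2 <= (t `^ alpha) ^+ 2 &
      S <= 2 * \int[mu]_t (a t * \1_E t) + L w].

Lemma reach0 lo c : reach lo c 0 0.
Proof.
exists 0, (fun=> 0), (fun=> 0); split; first by split => //; exact: test_fun0.
have i0 : \int[mu]_t (0 : R) = 0 by exact: Rintegral_eq0.
split => //.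
- move=> t t0 _; rewrite /primitive Rintegral_eq0 => [|r]; last by rewrite mul0r.
  by rewrite expr0n addr0 sqr_ge0.
- rewrite Rintegral_eq0 => [|r]; last by rewrite mul0r.
  by rewrite mulr0 add0r /L /Rintegral integral0.
Qed.

Lemma reach_le lo c b S S' : S' <= S -> reach lo c b S -> reach lo c b S'.
Proof.
move=> SS [C [w [a [h [h1 h2 h3]]]]]; exists C, w, a; split => //; split => //.
exact: le_trans h3.
Qed.

(** The supports are disjoint: up to [c] only the old pair is active, above [c] only the new one,
    with the old primitive frozen at [b]. *)
Lemma reach_extend lo c c' b S C v e : 0 < lo -> lo <= c -> c <= c' ->
  reach lo c b S -> test_fun c c' C v -> test_fun c c' C e -> (forall t, 0 <= e t) ->
  (forall t, c < t -> t <= c' -> e t ^+ 2 + (b + primitive v t) ^+ 2 <= (t `^ alpha) ^+ 2) ->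
  reach lo c' (b + \int[mu]_t v t) (S + (2 * \int[mu]_t (e t * \1_E t) + L v)).
Proof.
move=> lo0 loc cc' [D [w [a [[tw ta a0] [intw aw SS]]]]] tv te e0 ev.
have c0 : 0 < c by exact: lt_le_trans loc.
have tw' := test_fun_sub (lexx lo) cc' tw; have ta' := test_fun_sub (lexx lo) cc' ta.
have tv' := test_fun_sub loc (lexx c') tv; have te' := test_fun_sub loc (lexx c') te.
exists (D + C), (fun t => w t + v t), (fun t => a t + e t); split.
  by split; [exact: test_funD|exact: test_funD|move=> t; rewrite addr_ge0].
have mE := measurable_slice_neq0.
split.
- rewrite RintegralD ?intw//; [exact: test_fun_integrable tw|exact: test_fun_integrable tv].
- move=> t t0 tc'; rewrite (primitiveD _ lo0 tw' tv').
  have [tc|tc] := leP t c.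
    rewrite (primitive_before tv tc) addr0; case: te => _ _ ->; last by left.
    by rewrite addr0; exact: aw.
  rewrite (primitive_after tw (ltW tc)) intw; case: ta => _ _ ->; last by right.
  by rewrite add0r; exact: ev.
- rewrite (area_functionalD lo0 tw' tv').
  rewrite (_ : \int[mu]_t ((a t + e t) * _) = \int[mu]_t (a t * \1_E t) + \int[mu]_t (e t * \1_E t)).
    by rewrite mulrDr [leRHS]addrACA lerD2r.
  rewrite -RintegralD//.
  + by apply: eq_Rintegral => t _; rewrite mulrDl.
  + exact: (test_fun_integrable lo0 (test_fun_indic mE ta)).
  + exact: (test_fun_integrable c0 (test_fun_indic mE te)).
Qed.

(* In a cell where the slice vanishes on a set of positive measure the
   primitive can be moved freely at no cost. *)
Lemma reach_dead lo c c' b b' S : 0 < lo -> lo <= c -> c <= c' ->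
  (0 < mu (`]c, c']%classic `&` ~` E))%E ->
  `|b| <= c `^ alpha -> `|b'| <= c `^ alpha -> reach lo c b S -> reach lo c' b' S.
Proof.
move=> lo0 loc cc' N0 bc b'c rS.
have c0 : 0 < c by exact: lt_le_trans loc.
have mN : measurable (`]c, c']%classic `&` ~` E).
  by apply: measurableI; [exact: measurable_itv|apply: measurableC; exact: measurable_slice_neq0].
have [tu iu pu] := test_fun_normalized_indic mN (@subIsetl _ _ _) N0.
set A := `]c, c']%classic `&` ~` E in mN N0 tu iu pu.
pose u t : R := (fine (mu A))^-1 * \1_A t; rewrite -/u in iu.
pose v t := (b' - b) * u t.
have tv : test_fun c c' (`|b' - b| * (fine (mu A))^-1) v.
  case: tu => mu' uC uo; split.
  - exact: measurable_funM.
  - by move=> t; rewrite /v normrM; apply: ler_wpM2l => //; exact: uC.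
  - by move=> t h; rewrite /v /u uo// mulr0.
have pv t : primitive v t = (b' - b) * primitive u t.
  rewrite /primitive -RintegralZl//; last exact: (test_fun_primitive t c0 tu).
  by apply: eq_Rintegral => r _; rewrite mulrA.
have iv : \int[mu]_t v t = b' - b.
  by rewrite /v RintegralZl ?iu ?mulr1//; exact: (test_fun_integrable c0 tu).
(* The mass sits at heights whose slice has length 0, so it contributes nothing to the integral over
   [Omega']. *)
have Lv : L v = 0.
  have Lu : L u = 0.
    rewrite /L /Rintegral area_functional_ge0//; last 2 first.
    - by case: tu.
    - by move=> t; rewrite mulr_ge0// invr_ge0 fine_ge0.
    rewrite integral0_eq// => t _; rewrite /u indicE.
    have [|_] := boolP (t \in A); last by rewrite mulr0 mul0e.
    by rewrite inE => -[_ /negP]; rewrite negbK => /eqP ->; rewrite mule0.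
  rewrite /L /v RintegralZl ?[X in _ * X]Lu ?mulr0//.
  exact: (test_fun_integrable2 c0 tu).
have t0 : test_fun c c' (`|b' - b| * (fine (mu A))^-1) (fun=> 0).
  by apply: test_fun0; rewrite mulr_ge0// invr_ge0 fine_ge0.
have := @reach_extend lo c c' b S _ v (fun=> 0) lo0 loc cc' rS tv t0 (fun=> lexx 0).
rewrite iv Lv addrC subrK Rintegral_eq0 => [|t]; last by rewrite mul0r.
rewrite mulr0 !addr0; apply.
move=> t ct tc'; rewrite expr0n/= add0r pv -[leLHS]real_normK ?num_real//.
rewrite lerXn2r ?nnegrE// ?powR_ge0//.
apply: (@le_trans _ _ (c `^ alpha)); last by apply: ge0_ler_powR; rewrite ?nnegrE// ltW// (lt_trans c0).
have /andP[p0 p1] := pu t c0; rewrite -/(primitive u t) in p0 p1.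
(* The primitive stays on the segment between [b] and [b'], hence its modulus stays at most
   [c^alpha]. *)
have -> : b + (b' - b) * primitive u t = (1 - primitive u t) * b + primitive u t * b' by ring.
have p1' : 0 <= 1 - primitive u t by rewrite subr_ge0.
have {}p0 : 0 <= primitive u t := p0.
rewrite (le_trans (ler_normD _ _))// !normrM (ger0_norm p0) (ger0_norm p1').
apply: (@le_trans _ _ ((1 - primitive u t) * c `^ alpha + primitive u t * c `^ alpha)).
  by apply: lerD; apply: ler_wpM2l.
by rewrite -mulrDl subrK mul1r.
Qed.

(** The primitive rises by [c^alpha] on the thick slices of [D], which yields at least
    [c^alpha * eps], and falls by the same amount on slices of length 0, which is free. *)
Lemma reach_gain lo c c' S eps (D : set R) : 0 < lo -> lo <= c -> c <= c' -> 0 <= eps ->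
  measurable D -> D `<=` `]c, c']%classic -> (0 < mu D)%E ->
  (forall t, D t -> (eps%:E <= slice Omega' t)%E) ->
  (0 < mu (`]c, c']%classic `&` ~` E))%E ->
  reach lo c 0 S -> reach lo c' 0 (S + c `^ alpha * eps).
Proof.
move=> lo0 loc cc' eps0 mD sD D0 De N0 rS.
have c0 : 0 < c by exact: lt_le_trans loc.
have mN : measurable (`]c, c']%classic `&` ~` E).
  by apply: measurableI; [exact: measurable_itv|apply: measurableC; exact: measurable_slice_neq0].
have [tu iu pu] := test_fun_normalized_indic mN (@subIsetl _ _ _) N0.
set A := `]c, c']%classic `&` ~` E in mN N0 tu iu pu.
have [td id pd] := test_fun_normalized_indic mD sD D0.
pose u t : R := (fine (mu A))^-1 * \1_A t; rewrite -/u in iu.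
pose d t : R := (fine (mu D))^-1 * \1_D t; rewrite -/d in id.
pose q := c `^ alpha.
have q0 : 0 <= q by exact: powR_ge0.
have scale (k C : R) (f : R -> R) : 0 <= C -> test_fun c c' C f -> test_fun c c' (`|k| * C) (fun t => k * f t).
  move=> C0 [mf fC fo]; split.
  - exact: measurable_funM.
  - by move=> t; rewrite normrM; apply: ler_wpM2l.
  - by move=> t h; rewrite fo// mulr0.
have iA0 : 0 <= (fine (mu A))^-1 by rewrite invr_ge0 fine_ge0.
have iD0 : 0 <= (fine (mu D))^-1 by rewrite invr_ge0 fine_ge0.
have tdq := scale q _ _ iD0 td; have tuq := scale (- q) _ _ iA0 tu.
have tv := test_funD tdq tuq.
have prim_scale (k C : R) (f : R -> R) t : test_fun c c' C f -> primitive (fun t => k * f t) t = k * primitive f t.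
  move=> tf; rewrite /primitive -RintegralZl//; last exact: (test_fun_primitive t c0 tf).
  by apply: eq_Rintegral => r _; rewrite mulrA.
have Lscale (k C : R) (f : R -> R) : test_fun c c' C f -> L (fun t => k * f t) = k * L f.
  by move=> tf; rewrite /L RintegralZl//; exact: (test_fun_integrable2 c0 tf).
have u0 t : 0 <= u t by rewrite mulr_ge0.
have d0 t : 0 <= d t by rewrite mulr_ge0.
have Lu : L u = 0.
  rewrite /L /Rintegral area_functional_ge0//; last by case: tu.
  rewrite integral0_eq// => t _; rewrite /u indicE.
  have [|_] := boolP (t \in A); last by rewrite mulr0 mul0e.
  by rewrite inE => -[_ /negP]; rewrite negbK => /eqP ->; rewrite mule0.
have Ld : eps <= L d.
  rewrite /L /Rintegral -lee_fin fineK; last first.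
    by apply: integrable_fin_num; [exact: mO'|exact: (test_fun_integrable2 c0 td)].
  rewrite area_functional_ge0//; last by case: td.
  have -> : eps%:E = (\int[mu]_t ((eps * d t)%:E))%E.
    have h : \int[mu]_t (eps * d t) = eps by rewrite RintegralZl// ?id ?mulr1//; exact: (test_fun_integrable c0 td).
    rewrite -[in LHS]h /Rintegral fineK//; apply: integrable_fin_num; first exact: measurableT.
    exact: (test_fun_integrable c0 (scale eps _ _ iD0 td)).
  apply: ge0_le_integral => //.
  - by move=> t _; rewrite lee_fin mulr_ge0.
  - by apply/measurable_EFinP; case: (scale eps _ _ iD0 td).
  - apply: emeasurable_funM; last exact: measurable_slice.
    by apply/measurable_EFinP; case: td.
  - move=> t _; rewrite mulrC EFinM /d indicE.
    have [|_] := boolP (t \in D); last by rewrite mulr0 !mul0e.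
    by rewrite inE => tD; apply: lee_wpmul2l; [rewrite lee_fin mulr_ge0|exact: De].
rewrite -/u in tu tuq; rewrite -/d in td tdq; rewrite -/u -/d in tv.
have := @reach_extend lo c c' 0 S _ _ (fun=> 0) lo0 loc cc' rS tv (test_fun0 _ _ _) (fun=> lexx 0).
rewrite (area_functionalD c0 tdq tuq) (Lscale _ _ _ td) (Lscale _ _ _ tu) [X in - q * X]Lu mulr0 addr0.
rewrite (@Rintegral_eq0 _ _ _ mu (fun t => 0 * _)); last by move=> t; rewrite mul0r.
rewrite mulr0 !add0r; have -> : \int[mu]_t (q * d t + - q * u t) = 0.
  rewrite RintegralD//; [|exact: (test_fun_integrable c0 tdq)|exact: (test_fun_integrable c0 tuq)].
  have intZ (k C : R) (f : R -> R) : test_fun c c' C f -> \int[mu]_t (k * f t) = k * \int[mu]_t f t.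
    by move=> tf; rewrite RintegralZl//; exact: (test_fun_integrable c0 tf).
  by rewrite (intZ _ _ _ td) (intZ _ _ _ tu) iu id; ring.
move=> h; apply: (@reach_le _ _ _ (S + q * L d)); first by rewrite lerD2l ler_wpM2l.
apply: h; first by rewrite addr_ge0// mulr_ge0.
move=> t ct tc'; rewrite expr0n/= !add0r (primitiveD _ c0 tdq tuq) (prim_scale _ _ _ _ td) (prim_scale _ _ _ _ tu).
rewrite -[leLHS]real_normK ?num_real// lerXn2r ?nnegrE// ?powR_ge0//.
apply: (@le_trans _ _ q); last by apply: ge0_ler_powR; rewrite ?nnegrE// ltW// (lt_trans c0).
have /andP[p0 p1] := pu t c0; have /andP[p2 p3] := pd t c0.
rewrite -/(primitive u t) in p0 p1; rewrite -/(primitive d t) in p2 p3.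
(* [D] and the empty slices may interleave; both primitives lie in [[0, 1]], so their difference
   lies in [[-1, 1]]. *)
rewrite mulNr -mulrBr normrM ger0_norm// -[leRHS]mulr1 ler_wpM2l// ler_norml.
by apply/andP; split; lra.
Qed.

Lemma reach_perimeter (P : \bar R) lo c S :
  (forall (delta M C : R) (w a : R -> R), 0 < delta -> 0 <= M ->
    measurable_fun setT a -> (forall t, 0 <= a t <= C) ->
    (forall t, t < delta \/ M < t -> a t = 0) ->
    measurable_fun setT w -> (forall t, `|w t| <= C) ->
    (forall t, t < delta \/ M < t -> w t = 0) -> \int[mu]_t w t = 0 ->
    (forall t, 0 < t -> a t ^+ 2 + primitive w t ^+ 2 <= (t `^ alpha) ^+ 2) ->
    ((2 * \int[mu]_t (a t * \1_E t) + L w)%:E <= P)%E) ->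
  0 < lo -> lo <= c -> reach lo c 0 S -> (S%:E <= P)%E.
Proof.
move=> cal lo0 loc [C [w [a [[tw ta a0] [iw aw SS]]]]].
apply: (@le_trans _ _ (2 * \int[mu]_t (a t * \1_E t) + L w)%:E); first by rewrite lee_fin.
have [mw wC wo] := tw; have [ma aC ao] := ta.
apply: (cal lo c C w a) => //.
- by rewrite (le_trans _ loc)// ltW.
- by move=> t; rewrite a0/= (le_trans (ler_norm _)).
- by move=> t [h|h]; apply: ao; [left; exact: ltW|right].
- by move=> t [h|h]; apply: wo; [left; exact: ltW|right].
- move=> t t0; have [tc|tc] := leP t c; first exact: aw.
  by rewrite ao; [rewrite (primitive_after tw (ltW tc)) iw expr0n addr0 sqr_ge0|right].
Qed.

End reachability.

Lemma measurable_sqrt_comp (R : realType) d (T : measurableType d) (f : T -> R) :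
  measurable_fun setT f -> measurable_fun setT (fun x => Num.sqrt (f x)).
Proof.
by apply: measurableT_comp; apply: continuous_measurable_fun; exact: sqrt_continuous.
Qed.

(** * Layer-cake formula and power inequalities *)

Section layer_cake.
Context {R : realType}.
Notation mu := (@lebesgue_measure R).

Lemma layer_cake (c d : R) (g h : R -> R) : measurable_fun setT g -> measurable_fun setT h ->
  (forall t, 0 <= g t) -> (forall t, c < t < d -> 0 <= h t <= 1) ->
  (\int[mu]_(t in `]c, d[) (g t * h t)%:E =
   \int[mu]_(u in `]0%R, 1%R[) \int[mu]_(t in `]c, d[) (g t * (u <= h t)%R%:R)%:E)%E.
Proof.
move=> mg mh g0 h01.
pose f (z : R * R) : R := \1_(`]0, 1[%classic) z.1 * (\1_(`]c, d[%classic) z.2 * (g z.2 * (z.1 <= h z.2)%R%:R)).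
have mf : measurable_fun setT (EFin \o f).
  apply/measurable_EFinP; apply: measurable_funM.
    by apply: (measurableT_comp _ measurable_fst); apply: measurable_indic.
  apply: measurable_funM.
    by apply: (measurableT_comp _ measurable_snd); apply: measurable_indic.
  apply: measurable_funM; first exact: (measurableT_comp mg measurable_snd).
  apply: (measurableT_comp (f := fun b : bool => b%:R : R)) => //.
  exact: (measurable_fun_ler measurable_fst (measurableT_comp mh measurable_snd)).
have f0 z : (0 <= (EFin \o f) z)%E by rewrite lee_fin !mulr_ge0.
have F12 := @fubini_tonelli _ _ _ _ R mu mu (EFin \o f) mf f0.
transitivity (\int[mu]_t \int[mu]_u (f (u, t))%:E)%E; last first.
  rewrite -F12 [RHS]integral_mkcond; apply: eq_integral => u _.
  rewrite patchE; case: ifPn => hu.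
    rewrite [RHS]integral_mkcond; apply: eq_integral => t _; rewrite patchE /f/= indicE hu mul1r.
    by rewrite indicE; case: ifPn => _; rewrite ?mul1r// mul0r.
  by rewrite integral0_eq// => t _; rewrite /f/= indicE (negbTE hu) mul0r.
rewrite [LHS]integral_mkcond; apply: eq_integral => t _; rewrite patchE; case: ifPn => ht; last first.
  by rewrite integral0_eq// => u _; rewrite /f/= [X in _ * (X * _)]indicE (negbTE ht) mul0r mulr0.
have /h01/andP[h0 h1] : c < t < d by rewrite inE/= in_itv in ht.
have -> : (fun u => (f (u, t))%:E) = (fun u => (g t)%:E * (\1_(`]0, 1[%classic `&` `]-oo, h t]%classic) u)%:E)%E.
  apply/funext => u; rewrite /f/= [X in _ * (X * _)]indicE ht mul1r -EFinM; congr EFin.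
  rewrite mulrCA; congr (_ * _); rewrite indicI/= !indicE; congr (_ * _%:R); congr nat_of_bool.
  by apply/idP/idP; rewrite inE/= in_itv.
have mI : measurable (`]0, 1[%classic `&` `]-oo, h t]%classic : set R) by exact: measurableI.
have i0 u : setT u -> (0 <= (\1_(`]0, 1[%classic `&` `]-oo, h t]%classic) u : R)%:E)%E by rewrite lee_fin.
have mi : measurable_fun setT (fun u => (\1_(`]0, 1[%classic `&` `]-oo, h t]%classic) u : R)%:E).
  by apply/measurable_EFinP; exact: measurable_indic.
rewrite ge0_integralZl_EFin; [|exact: measurableT|exact: i0|exact: mi|exact: g0].
rewrite integral_indic// setIT EFinM; congr (_ * _)%E.
move: h1; rewrite le_eqVlt => /predU1P[->|h1].
  have -> : `]0, 1[%classic `&` `]-oo, (1 : R)]%classic = `]0, 1[%classic.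
    apply/seteqP; split => x; first by move=> [].
    by rewrite /= !in_itv/= => /andP[x0 x1]; rewrite x0 x1 ltW.
  transitivity (mu `]0%R, 1%R[%classic) => //.
  by rewrite lebesgue_measure_itv/= lte_fin ltr01 -EFinB subr0.
have -> : `]0, 1[%classic `&` `]-oo, h t]%classic = `]0, h t]%classic.
  apply/seteqP; split => x; rewrite /= !in_itv/=; first by move=> [/andP[-> _] ->].
  by move=> /andP[x0 xh]; rewrite x0 xh (le_lt_trans xh).
transitivity (mu `]0%R, h t]%classic) => //.
rewrite lebesgue_measure_itv/= lte_fin; case: ltP => h2; first by rewrite -EFinB subr0.
by congr EFin; apply/eqP; rewrite eq_le h2 h0.
Qed.

End layer_cake.

Section power_lemmas.
Context {R : realType}.

Lemma powR_expr2 (x p : R) : (x `^ p) ^+ 2 = x `^ (2 * p).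
Proof. by rewrite -powR_mulrn ?powR_ge0// -powRrM mulrC. Qed.

Lemma powR_le (p x y : R) : 0 <= p -> 0 <= x -> x <= y -> x `^ p <= y `^ p.
Proof. by move=> p0 x0 xy; apply: ge0_ler_powR; rewrite ?nnegrE// (le_trans x0). Qed.

Lemma powR_le1 (p x : R) : 0 <= p -> 0 <= x -> x <= 1 -> x `^ p <= 1.
Proof. by move=> p0 x0 x1; have := powR_le p0 x0 x1; rewrite powR1. Qed.

(* [t = y_- / y_+] is the ratio of the end points of a superlevel set. *)
Lemma level_ratio (alpha gamma t : R) : 0 <= alpha -> 0 < gamma -> gamma <= alpha + 1 ->
  0 < t -> t <= 1 -> let r := (alpha + 1) / gamma in
  ((1 - t `^ (alpha + gamma)) / (1 + t `^ alpha)) `^ r <= 1 - t `^ (alpha + 1).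
Proof.
move=> a0 g0 ga t0 t1; set r := (alpha + 1) / gamma.
have tp p : 0 <= p -> 0 < t `^ p <= 1 by move=> p0; rewrite powR_gt0//= powR_le1// ltW.
(* The exponent is at least 1 because [gamma <= alpha + 1], which also gives [tg]. The inequality is
   proved without the exponent in [key]; raising a number of [[0, 1]] to the power [r] can only
   lower it. *)
have r1 : 1 <= r by rewrite ler_pdivlMr// mul1r.
have ag0 : 0 <= alpha + gamma by rewrite addr_ge0// ltW.
have a10 : 0 <= alpha + 1 by rewrite addr_ge0.
have /andP[h1 h1'] := tp _ a0; have /andP[h2 h2'] := tp _ ag0; have /andP[h3 h3'] := tp _ a10.
have tg : t `^ (alpha + 1) <= t `^ gamma by apply: ger_powR; rewrite ?t0.
have E1 : t `^ (alpha + gamma) = t `^ alpha * t `^ gamma by rewrite powRD// (gt_eqF t0) implybT.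
have E2 : t `^ (alpha + 1) = t `^ alpha * t by rewrite powRD ?powRr1// ?ltW// (gt_eqF t0) implybT.
have key : (1 - t `^ (alpha + gamma)) / (1 + t `^ alpha) <= 1 - t `^ (alpha + 1).
  rewrite ler_pdivrMr; last by lra.
  have : 0 <= t `^ alpha * (1 - t - t `^ (alpha + 1) + t `^ gamma).
    by apply: mulr_ge0; [exact: ltW|lra].
  by rewrite E1; set q := t `^ (alpha + 1) in E2 *; rewrite -/q in E2; rewrite !mulrDr mulrN E2; nra.
have z0 : 0 <= (1 - t `^ (alpha + gamma)) / (1 + t `^ alpha).
  by apply: divr_ge0; lra.
apply: (@le_trans _ _ ((1 - t `^ (alpha + 1)) `^ r)).
  by apply: ge0_ler_powR; rewrite ?nnegrE//; lra.
have [->|z1] := eqVneq (1 - t `^ (alpha + 1)) 0; first by rewrite powR0//; apply/eqP => r0; move: r1; rewrite r0 ler10.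
apply: ge1r_powR => //; rewrite lt_neqAle eq_sym z1/=; apply/andP; split; lra.
Qed.

End power_lemmas.

(** * Comparison of an interval with one starting at height 0 *)

Section profile_integral.
Context {R : realType}.
Notation mu := (@lebesgue_measure R).
Variables (alpha gamma : R).
Hypothesis alpha0 : 0 <= alpha.
Hypothesis gamma0 : 0 < gamma.
Hypothesis gamma_le : gamma <= alpha + 1.

Let r := (alpha + 1) / gamma.
Let s := alpha + gamma.
Let s0 : 0 < s. Proof. by rewrite /s ltr_wpDl. Qed.
Let a1 : 0 < alpha + 1. Proof. by rewrite ltr_wpDl. Qed.
Let r0 : 0 < r. Proof. by rewrite divr_gt0. Qed.

(** For [r = 1] this is the area of a quarter of the unit disc; in general it is half of a value of
    the Beta function. *)
Definition disc_integral : \bar R :=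
  (\int[mu]_(u in `]0%R, 1%R[) ((Num.sqrt (1 - u ^+ 2)) `^ r)%:E)%E.

(** The quotient is [l * t^gamma - k / t^alpha], whose two terms are both nondecreasing. *)
Lemma ratio_nondecreasing (l k t1 t2 : R) : 0 <= l -> 0 <= k -> 0 < t1 -> t1 <= t2 ->
  (l * t1 `^ s - k) / t1 `^ alpha <= (l * t2 `^ s - k) / t2 `^ alpha.
Proof.
move=> l0 k0 t10 t12; have t20 : 0 < t2 by exact: lt_le_trans t12.
have E t : 0 < t -> (l * t `^ s - k) / t `^ alpha = l * t `^ gamma - k / t `^ alpha.
  move=> t0; rewrite /s powRD ?(gt_eqF t0) ?implybT//.
  by field; rewrite gt_eqF// powR_gt0.
rewrite !E// lerB//.
  by apply: ler_wpM2l => //; apply: powR_le => //; exact: ltW.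
rewrite ler_wpM2l// lef_pV2 ?posrE ?powR_gt0//.
by apply: powR_le => //; exact: ltW.
Qed.

(* The function [X t = (l t^s - k) / t^alpha] has modulus at most [sg] on an
   interval whose weighted length is at least that of the level set of [l t^gamma]. *)
Lemma level_set_bound (l k sg y z : R) : 0 < l -> 0 < sg -> 0 < y -> y <= z ->
  l * z `^ s - k = sg * z `^ alpha -> l * y `^ s - k = - sg * y `^ alpha ->
  (sg / l) `^ r <= z `^ (alpha + 1) - y `^ (alpha + 1).
Proof.
move=> l0 sg0 y0 yz hz hy.
have z0 : 0 < z by exact: lt_le_trans yz.
pose t := y / z.
have t0 : 0 < t by rewrite divr_gt0.
have t1 : t <= 1 by rewrite ler_pdivrMr// mul1r.
have yE : y = z * t by rewrite /t mulrCA mulfV ?mulr1// gt_eqF.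
have zp p : 0 < z `^ p by exact: powR_gt0.
have tp p : 0 < t `^ p by exact: powR_gt0.
have yp p : y `^ p = z `^ p * t `^ p by rewrite yE powRM// ltW.
have h : l * (z `^ s * (1 - t `^ s)) = sg * (z `^ alpha * (1 + t `^ alpha)).
  by move: hz hy; rewrite !yp; lra.
have h2 : sg / l = z `^ gamma * ((1 - t `^ s) / (1 + t `^ alpha)).
  have zs : z `^ s = z `^ alpha * z `^ gamma by rewrite /s powRD// (gt_eqF z0) implybT.
  have h3 : l * (z `^ gamma * (1 - t `^ s)) = sg * (1 + t `^ alpha).
    apply: (mulfI (lt0r_neq0 (zp alpha))); rewrite [RHS]mulrCA -h zs; ring.
  have ta := tp alpha.
  apply: (mulIf (lt0r_neq0 l0)); rewrite divfK ?gt_eqF//.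
  have nz : 1 + t `^ alpha != 0 by rewrite gt_eqF// addr_gt0.
  apply: (mulIf nz); rewrite -h3; field; exact: nz.
rewrite h2 powRM ?powR_ge0//; last first.
  have ts1 : t `^ s <= 1 by apply: powR_le1 => //; exact: ltW.
  by apply: divr_ge0; [rewrite subr_ge0|rewrite addr_ge0// ltW].
rewrite -powRrM (_ : gamma * r = alpha + 1); last by rewrite /r mulrCA mulfV ?mulr1// gt_eqF.
rewrite yp -[X in _ <= X - _]mulr1 -mulrBr ler_wpM2l ?powR_ge0//.
exact: level_ratio.
Qed.

Let K_coef (l : R) : 0 < l -> forall u, 0 < u < 1 ->
  (Num.sqrt (1 - u ^+ 2) / l) `^ r / (alpha + 1) = l^-1 `^ r / (alpha + 1) * Num.sqrt (1 - u ^+ 2) `^ r.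
Proof.
move=> l0 u _; rewrite powRM ?sqrtr_ge0 ?invr_ge0 ?ltW//; ring.
Qed.

Let K_integral (l : R) : 0 < l ->
  (\int[mu]_(u in `]0%R, 1%R[) ((Num.sqrt (1 - u ^+ 2) / l) `^ r / (alpha + 1))%:E =
   (l^-1 `^ r / (alpha + 1))%:E * disc_integral)%E.
Proof.
move=> l0; rewrite /disc_integral -ge0_integralZl_EFin//.
- by apply: eq_integral => u; rewrite inE/= in_itv/= => u01; rewrite -EFinM K_coef.
- apply/measurable_EFinP; apply: measurable_funTS.
  apply: (measurableT_comp (measurable_powR r)).
  apply: measurable_sqrt_comp.
  exact: measurable_funB.
- by rewrite divr_ge0 ?powR_ge0// ltW.
Qed.

Let sqrt_factor (t b : R) : 0 < t ->
  Num.sqrt ((t `^ alpha) ^+ 2 - b ^+ 2) = t `^ alpha * Num.sqrt (1 - (b * t `^ (- alpha)) ^+ 2).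
Proof.
move=> t0; have ta : 0 < t `^ alpha by exact: powR_gt0.
rewrite -[X in X * _]ger0_norm; last exact: ltW.
rewrite -sqrtr_sqr -sqrtrM ?sqr_ge0//; congr Num.sqrt; rewrite powRN.
by field; rewrite gt_eqF.
Qed.

(** For [x ^+ 2 > 1] the left root is 0 by convention and both sides are false. *)
Let sqrt_level (u x : R) : 0 < u < 1 -> (u <= Num.sqrt (1 - x ^+ 2)) = (`|x| <= Num.sqrt (1 - u ^+ 2)).
Proof.
move=> /andP[u0 u1].
have h : 0 <= 1 - u ^+ 2 by rewrite subr_ge0 expr_le1// ltW.
have -> : (`|x| <= Num.sqrt (1 - u ^+ 2)) = (x ^+ 2 <= 1 - u ^+ 2).
  rewrite -sqrtr_sqr ler_sqrt//.
rewrite -{1}(ger0_norm (ltW u0)) -sqrtr_sqr; have [h2|h2] := leP 0 (1 - x ^+ 2).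
  by rewrite ler_sqrt//; apply/idP/idP; lra.
rewrite (@ler0_sqrtr _ (1 - x ^+ 2)) ?(ltW h2)//; apply/idP/idP; last by nra.
by rewrite sqrtr_sqr ger0_norm ?(ltW u0)//; lra.
Qed.

(** Put [X = V / t^alpha], monotone from -1 at [c] to 1 at [d]. The level [u] of [sqrt (1 - X^2)] is
    exceeded between points where [X = - sg] and [X = sg]; [level_set_bound] estimates the weighted
    length of this interval, and the layer-cake formula integrates over [u]. *)
Lemma interval_integral_ge (c d l : R) : 0 < c -> c < d -> 0 < l ->
  l * (d `^ s - c `^ s) = c `^ alpha + d `^ alpha ->
  ((l^-1 `^ r / (alpha + 1))%:E * disc_integral <= \int[mu]_(t in `]c, d[)
    (Num.sqrt ((t `^ alpha) ^+ 2 - (l * (t `^ s - c `^ s) - c `^ alpha) ^+ 2))%:E)%E.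
Proof.
move=> c0 cd l0 hd; rewrite -K_integral//.
pose X t := (l * (t `^ s - c `^ s) - c `^ alpha) * t `^ (- alpha).
have mX : measurable_fun setT X.
  apply: measurable_funM; last exact: measurable_powR.
  apply: measurable_funB => //; apply: measurable_funM => //.
  by apply: measurable_funB => //; exact: measurable_powR.
have mh : measurable_fun setT (fun t => Num.sqrt (1 - X t ^+ 2)).
  apply: measurable_sqrt_comp.
  by apply: measurable_funB => //; exact: measurable_funX.
have -> : (\int[mu]_(t in `]c, d[)
    (Num.sqrt ((t `^ alpha) ^+ 2 - (l * (t `^ s - c `^ s) - c `^ alpha) ^+ 2))%:E =
    \int[mu]_(t in `]c, d[) (t `^ alpha * Num.sqrt (1 - X t ^+ 2))%:E)%E.
  apply: eq_integral => t; rewrite inE/= in_itv/= => /andP[ct _].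
  by rewrite sqrt_factor// (lt_trans c0).
have h01 t : 0 <= Num.sqrt (1 - X t ^+ 2) <= 1.
  by rewrite sqrtr_ge0/= -[leRHS]sqrtr1 ler_sqrt// gerBl sqr_ge0.
rewrite (layer_cake (measurable_powR alpha) mh (fun t => powR_ge0 t alpha) (fun t _ => h01 t)).
have k0 : 0 <= l * c `^ s + c `^ alpha by rewrite addr_ge0 ?mulr_ge0 ?powR_ge0// ltW.
have Xm t1 t2 : 0 < t1 -> t1 <= t2 -> X t1 <= X t2.
  move=> t10 t12; have := ratio_nondecreasing (ltW l0) k0 t10 t12.
  by rewrite /X !powRN; congr (_ <= _); congr (_ / _); ring.
have cX x : x \in `[c, d] -> {for x, continuous X}.
  rewrite in_itv/= => /andP[cx _]; have x0 : 0 < x by exact: lt_le_trans cx.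
  apply: cvgM; last exact: powR_continuous.
  apply: cvgB; last exact: cvg_cst.
  apply: cvgM; first exact: cvg_cst.
  by apply: cvgB; [exact: powR_continuous|exact: cvg_cst].
have Xc : X c = -1.
  by rewrite /X subrr mulr0 sub0r powRN mulNr mulfV// gt_eqF// powR_gt0.
have d0 : 0 < d by exact: lt_trans cd.
have Xd : X d = 1.
  by rewrite /X hd addrAC subrr add0r powRN mulfV// gt_eqF// powR_gt0.
have level v : -1 <= v <= 1 -> exists2 y, c <= y <= d & X y = v.
  move=> /andP[v1 v2].
  have [|||y] := @IVT R X c d v.
  - exact: ltW.
  - by apply: continuous_in_subspaceT => x; rewrite inE; exact: cX.
  - rewrite Xc Xd; apply/andP; split; first by rewrite ge_min v1.
    by rewrite le_max v2 orbT.
  by rewrite in_itv/= => ycd <-; exists y.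
pose u_le (z : R * R) := z.1 <= Num.sqrt (1 - X z.2 ^+ 2).
apply: ge0_le_integral => //.
- by move=> u _; rewrite lee_fin divr_ge0 ?powR_ge0// ltW.
- apply/measurable_EFinP; apply: measurable_funTS.
  apply: measurable_funM => //; apply: (measurableT_comp (measurable_powR r)).
  apply: measurable_funM => //.
  apply: measurable_sqrt_comp.
  exact: measurable_funB.
- have mb : measurable_fun setT (fun z : R * R => (u_le z)%R%:R : R).
    apply: (measurableT_comp (f := fun b : bool => b%:R : R)) => //.
    exact: (measurable_fun_ler measurable_fst (measurableT_comp mh measurable_snd)).
  have mg : measurable_fun setT (fun z : R * R => (\1_(`]c, d[%classic) z.2 * (z.2 `^ alpha * (u_le z)%R%:R))%:E).
    apply/measurable_EFinP; apply: measurable_funM.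
      by apply: (measurableT_comp _ measurable_snd); exact: measurable_indic.
    by apply: measurable_funM => //; exact: (measurableT_comp (measurable_powR _) measurable_snd).
  apply: measurable_funTS; have := measurable_fun_param_integral mu mg.
  congr measurable_fun; apply/funext => u; rewrite [RHS]integral_mkcond; apply: eq_integral => t _.
  by rewrite patchE/= indicE; case: ifPn => _; rewrite ?mul1r// mul0r.
move=> u; rewrite /= in_itv/= => u01; have /andP[u0 u1] := u01.
set sg := Num.sqrt (1 - u ^+ 2).
have sg0 : 0 < sg by rewrite sqrtr_gt0 subr_gt0 expr_lt1// ltW.
have sg1 : sg <= 1 by rewrite -[leRHS]sqrtr1 ler_sqrt// gerBl sqr_ge0.
have [|z /andP[cz zd] Xz] := level sg; first by apply/andP; split; lra.
have [|y /andP[cy yd] Xy] := level (- sg); first by apply/andP; split; lra.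
have y0 : 0 < y by exact: lt_le_trans cy.
have z0 : 0 < z by exact: lt_le_trans cz.
have yz : y <= z.
  rewrite leNgt; apply/negP => zy; have := Xm z y z0 (ltW zy); rewrite Xz Xy; lra.
have Xmul v t : 0 < t -> X t = v -> l * t `^ s - (l * c `^ s + c `^ alpha) = v * t `^ alpha.
  move=> t0 <-; rewrite /X powRN -mulrA mulVf ?mulr1 ?gt_eqF ?powR_gt0//; ring.
have lb := level_set_bound l0 sg0 y0 yz (Xmul _ _ z0 Xz) (Xmul _ _ y0 Xy).
apply: (@le_trans _ _ (\int[mu]_(t in `]y, z[) (t `^ alpha)%:E)%E).
  rewrite integral_powR// ?lee_fin; last exact: ltW.
  by rewrite ler_pM2r ?invr_gt0.
rewrite [leLHS]integral_mkcond [leRHS]integral_mkcond; apply: ge0_le_integral => //.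
- by move=> t _; rewrite patchE; case: ifP => // _; rewrite lee_fin powR_ge0.
- apply/(measurable_restrictT _ (measurable_itv _)); apply/measurable_EFinP.
  by apply: measurable_funTS; exact: measurable_powR.
- apply/(measurable_restrictT _ (measurable_itv _)); apply/measurable_EFinP.
  apply: measurable_funTS; apply: measurable_funM; first exact: measurable_powR.
  apply: (measurableT_comp (f := fun b : bool => b%:R : R)) => //.
  exact: (measurable_fun_ler (measurable_cst u) mh).
move=> t _; rewrite !patchE; case: ifPn; last first.
  by move=> _; case: ifP => // _; rewrite lee_fin mulr_ge0// powR_ge0.
rewrite inE/= in_itv/= => /andP[yt tz].
rewrite mem_set ?lee_fin/=; last by rewrite in_itv/=; apply/andP; split; lra.
rewrite sqrt_level// -/sg (_ : `|X t| <= sg) ?mulr1//.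
have t0 : 0 < t by exact: lt_trans yt.
by rewrite ler_norml -Xy -Xz (Xm _ _ y0 (ltW yt)) (Xm _ _ t0 (ltW tz)).
Qed.

(** Here [X = l * t^gamma] and the superlevel sets are []0, z]] with [z^gamma = sg / l], so the
    weighted lengths are exact. *)
Lemma initial_interval_integral (d l : R) : 0 < d -> 0 < l -> l * d `^ gamma = 1 ->
  (\int[mu]_(t in `]0%R, d[) (Num.sqrt ((t `^ alpha) ^+ 2 - (l * t `^ s) ^+ 2))%:E =
   (l^-1 `^ r / (alpha + 1))%:E * disc_integral)%E.
Proof.
move=> d0 l0 hd; rewrite -K_integral//.
pose X t := l * t `^ gamma.
have mX : measurable_fun setT X.
  by apply: measurable_funM => //; exact: measurable_powR.
have mh : measurable_fun setT (fun t => Num.sqrt (1 - X t ^+ 2)).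
  apply: measurable_sqrt_comp.
  by apply: measurable_funB => //; exact: measurable_funX.
have -> : (\int[mu]_(t in `]0%R, d[) (Num.sqrt ((t `^ alpha) ^+ 2 - (l * t `^ s) ^+ 2))%:E =
    \int[mu]_(t in `]0%R, d[) (t `^ alpha * Num.sqrt (1 - X t ^+ 2))%:E)%E.
  apply: eq_integral => t; rewrite inE/= in_itv/= => /andP[t0 _]; rewrite sqrt_factor//; congr (_ * Num.sqrt (1 - _ ^+ 2))%:E.
  rewrite /X -mulrA -powRD; last by rewrite (gt_eqF t0) implybT.
  by congr (_ * _ `^ _); rewrite /s; ring.
have h01 t : 0 <= Num.sqrt (1 - X t ^+ 2) <= 1.
  by rewrite sqrtr_ge0/= -[leRHS]sqrtr1 ler_sqrt// gerBl sqr_ge0.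
rewrite (layer_cake (measurable_powR alpha) mh (fun t => powR_ge0 t alpha) (fun t _ => h01 t)).
apply: eq_integral => u; rewrite inE/= in_itv/= => u01; have /andP[u0 u1] := u01.
set sg := Num.sqrt (1 - u ^+ 2).
have sg0 : 0 < sg by rewrite sqrtr_gt0 subr_gt0 expr_lt1// ltW.
have sg1 : sg < 1.
  by rewrite -[ltRHS]sqrtr1 ltr_sqrt// ltrBlDr ltrDl exprn_gt0.
pose z := (sg / l) `^ gamma^-1.
have sl0 : 0 < sg / l by rewrite divr_gt0.
have z0 : 0 < z by exact: powR_gt0.
have zg : z `^ gamma = sg / l by rewrite -powRrM mulVf ?gt_eqF// powRr1// ltW.
have lt_gamma t1 t2 : 0 <= t1 -> 0 <= t2 -> (t1 <= t2) = (t1 `^ gamma <= t2 `^ gamma).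
  move=> h1 h2; apply/idP/idP; first by apply: powR_le => //; exact: ltW.
  by apply: contraTT; rewrite -!ltNge => h; apply: gt0_ltr_powR; rewrite ?nnegrE.
have zd : z < d.
  rewrite ltNge lt_gamma; [|exact: ltW|exact: ltW].
  by rewrite zg ler_pdivlMr// mulrC hd leNgt sg1.
rewrite [LHS]integral_mkcond.
transitivity (\int[mu]_(t in `]0%R, z]) (t `^ alpha)%:E)%E.
  rewrite [RHS]integral_mkcond; apply: eq_integral => t _; rewrite !patchE.
  case: ifPn => h1; case: ifPn => h2 //.
  - rewrite inE/= in_itv/= in h1; rewrite inE/= in_itv/= in h2.
    have /andP[t0 td] := h1; have /andP[_ tz] := h2.
    rewrite sqrt_level// ger0_norm; last by rewrite mulr_ge0 ?powR_ge0// ltW.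
    have -> : X t <= sg; last by rewrite mulr1.
    by rewrite /X mulrC -ler_pdivlMr// -zg -lt_gamma// ltW.
  - rewrite inE/= in_itv/= in h1; move/negP: h2; rewrite inE/= in_itv/=.
    have /andP[t0 td] := h1; rewrite t0/= => /negP tz.
    rewrite sqrt_level// ger0_norm; last by rewrite mulr_ge0 ?powR_ge0// ltW.
    have -> : (X t <= sg) = false; last by rewrite mulr0.
    apply/negbTE; move: tz; apply: contra.
    by rewrite /X mulrC -ler_pdivlMr// -zg -lt_gamma// ltW.
  - rewrite inE/= in_itv/= in h2; move/negP: h1; rewrite inE/= in_itv/=.
    by have /andP[t0 tz] := h2; rewrite t0/= (le_lt_trans tz).
rewrite -integral_itv_bndo_bndc; last first.
  by apply/measurable_EFinP; apply: measurable_funTS; exact: measurable_powR.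
rewrite integral_powR//; last exact: ltW.
rewrite powR0 ?gt_eqF// subr0 /z -powRrM; congr (_ `^ _ / _)%:E.
by rewrite /r mulrC.
Qed.

End profile_integral.

Section power_test_function.
Context {R : realType}.
Notation mu := (@lebesgue_measure R).

(** A power is monotone in one direction or the other, so one of the end values dominates; the sum
    covers exponents of both signs. *)
Lemma powR_between (p c t d : R) : 0 < c -> c <= t -> t <= d -> t `^ p <= c `^ p + d `^ p.
Proof.
move=> c0 ct td; have t0 : 0 < t by exact: lt_le_trans ct.
have d0 : 0 < d by exact: lt_le_trans td.
have [p0|p0] := leP 0 p.
  by apply: (@le_trans _ _ (d `^ p)); [exact: powR_le (ltW t0) td|rewrite lerDr powR_ge0].
apply: (@le_trans _ _ (c `^ p)); last by rewrite lerDl powR_ge0.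
rewrite -[p]opprK ![_ `^ (- - p)]powRN lef_pV2 ?posrE ?powR_gt0//.
by apply: powR_le => //; [rewrite oppr_ge0 ltW|exact: ltW].
Qed.

Lemma test_fun_powR (p q c d : R) : 0 < c ->
  test_fun c d (`|q| * (c `^ p + d `^ p)) (fun t => q * t `^ p * \1_(`]c, d]%classic) t).
Proof.
move=> c0; split.
- apply: measurable_funM; last exact: measurable_indic.
  by apply: measurable_funM => //; exact: measurable_powR.
- move=> t; rewrite indicE; have [|_] := boolP (_ \in _); last first.
    by rewrite mulr0 normr0 mulr_ge0// addr_ge0 ?powR_ge0.
  rewrite inE/= in_itv/= => /andP[ct td]; rewrite mulr1 normrM ler_wpM2l//.
  by rewrite ger0_norm ?powR_ge0// powR_between// ltW.
- move=> t h; rewrite indicE memNset ?mulr0//= in_itv/= => /andP[ct td].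
  by case: h => h; [have := lt_le_trans ct h|have := lt_le_trans h td]; rewrite ltxx.
Qed.

Lemma Rintegral_powR_indic (p q c d : R) : 0 < p + 1 -> 0 < c -> c <= d ->
  \int[mu]_t (q * t `^ p * \1_(`]c, d]%classic) t) = q * ((d `^ (p + 1) - c `^ (p + 1)) / (p + 1)).
Proof.
move=> p0 c0 cd.
have i1 := test_fun_integrable c0 (test_fun_powR p 1 d c0).
have -> : \int[mu]_t (q * t `^ p * \1_(`]c, d]%classic) t) = q * \int[mu]_t (1 * t `^ p * \1_(`]c, d]%classic) t).
  by rewrite -RintegralZl//; apply: eq_Rintegral => t _; rewrite mul1r mulrA.
congr (_ * _); rewrite /Rintegral.
rewrite (_ : (\int[mu]_t _)%E = (\int[mu]_(t in `]c, d]) (t `^ p)%:E)%E); last first.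
  rewrite [RHS]integral_mkcond; apply: eq_integral => t _; rewrite patchE mul1r indicE.
  by case: ifPn => _; rewrite ?mulr1// mulr0.
rewrite -integral_itv_bndo_bndc; last first.
  by apply/measurable_EFinP; apply: measurable_funTS; exact: measurable_powR.
by rewrite integral_powR// ltW.
Qed.

Lemma primitive_powR_indic (p q c d t : R) : 0 < p + 1 -> 0 < c -> c <= t -> t <= d ->
  primitive (fun t => q * t `^ p * \1_(`]c, d]%classic) t) t =
  q * ((t `^ (p + 1) - c `^ (p + 1)) / (p + 1)).
Proof.
move=> p0 c0 ct td; rewrite -Rintegral_powR_indic//.
apply: eq_Rintegral => r _; rewrite -mulrA; congr (_ * _).
rewrite !indicE -natrM; congr _%:R; rewrite mulnb; congr nat_of_bool.
apply/andP/idP; rewrite !inE/= !in_itv/=; first by move=> [/andP[-> _] ->].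
by move=> /andP[-> rt]; rewrite rt (le_trans rt).
Qed.

End power_test_function.

(** * The calibration on a geometric grid *)

Section grid.
Context {R : realType}.
Notation mu := (@lebesgue_measure R).
Notation T2 := (measurableTypeR R * measurableTypeR R)%type.
Variables (alpha gamma : R) (Omega' : set T2).
Hypothesis alpha0 : 0 <= alpha.
Hypothesis gamma0 : 0 < gamma.
Hypothesis mO' : measurable Omega'.
Hypothesis strip_fin : forall delta M, 0 < delta ->
  (@leb2_borel R (Omega' `&` strip delta M) < +oo)%E.

Let E := [set t | slice Omega' t != 0%E].
Let L (w : R -> R) := \int[@leb2_borel R]_(z in Omega') w z.2.
Let s := alpha + gamma.
Let s0 : 0 < s. Proof. by rewrite /s ltr_wpDl. Qed.

Variables (lo rho : R).
Hypothesis lo0 : 0 < lo.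
Hypothesis rho1 : 1 < rho.

Definition grid (i : nat) : R := lo * rho ^+ i.
Definition cell (i : nat) : set R := `]grid i, grid i.+1]%classic.
(** A cell that is not live contains a nonnegligible set of empty slices, which is the hypothesis of
    [reach_dead]. *)
Definition live (i : nat) : bool := mu (cell i `&` ~` E) == 0%E.

Lemma grid0 : grid 0 = lo. Proof. by rewrite /grid expr0 mulr1. Qed.

(* The left end of the maximal run of live cells ending at [grid i]. *)
Fixpoint run_start (i : nat) : nat :=
  if i is j.+1 then (if live j then run_start j else j.+1) else 0%N.

Lemma run_start_le i : (run_start i <= i)%N.
Proof. by elim: i => //= i IH; case: ifP => // _; exact: leqW. Qed.

Lemma run_startP i j : (run_start i <= j < i)%N -> live j /\ run_start j = run_start i.
Proof.
elim: i => [|i IH]; first by rewrite ltn0 andbF.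
rewrite /=; case: ifPn => [li|_ /andP[h1 h2]]; last by have := leq_trans h2 h1; rewrite ltnn.
move=> /andP[h1]; rewrite ltnS leq_eqVlt => /orP[/eqP -> //|h2].
by apply: IH; rewrite h1 h2.
Qed.

Let rho0 : 0 < rho. Proof. exact: lt_trans rho1. Qed.
Lemma grid_gt0 i : 0 < grid i. Proof. by rewrite mulr_gt0// exprn_gt0. Qed.
Lemma grid_le i j : (i <= j)%N -> grid i <= grid j.
Proof. by move=> ij; rewrite ler_pM2l// ler_weXn2l// ltW. Qed.
Lemma grid_lt i j : (i < j)%N -> grid i < grid j.
Proof. by move=> ij; rewrite ltr_pM2l// ltr_eXn2l. Qed.
Let grid_lo i : lo <= grid i.
Proof. by have := @grid_le 0 i isT; rewrite {1}/grid expr0 mulr1. Qed.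

(** The price of discretization. Scaling by [theta] makes the value [- theta * (grid j.+1)^alpha],
    wanted at the end of a dead cell, equal to [- (grid j)^alpha], which is admissible throughout
    the cell. *)
Definition theta := rho `^ (- alpha).
Lemma theta_gt0 : 0 < theta. Proof. exact: powR_gt0. Qed.
Lemma theta_le1 : theta <= 1.
Proof.
rewrite /theta powRN invf_le1 ?powR_gt0//.
by have := powR_le alpha0 ler01 (ltW rho1); rewrite powR1.
Qed.
Let theta_grid i : theta * grid i.+1 `^ alpha = grid i `^ alpha.
Proof.
rewrite /grid exprSr mulrA powRM ?(ltW rho0)//; last exact: ltW (grid_gt0 i).
by rewrite /theta mulrCA powRN mulVf ?mulr1// gt_eqF// powR_gt0.
Qed.

Variable l : R.
Hypothesis l0 : 0 < l.

(** A run from index 0 begins at 0, where the primitive has to start; any later run follows a dead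
    cell, in which the primitive has been brought down to the lowest value allowed up to the factor
    [theta]. *)
Definition base (k : nat) : R := if k is _.+1 then grid k `^ alpha else 0.
Definition ramp (k : nat) (t : R) : R := l * (t `^ s - grid k `^ s) - base k.

Variable m : nat.
Hypothesis feasible : forall i, (i <= m)%N -> ramp (run_start i) (grid i) <= grid i `^ alpha.

Let base_ge0 k : 0 <= base k. Proof. by case: k => //= k; exact: powR_ge0. Qed.
Let base_le k : base k <= grid k `^ alpha. Proof. by case: k => //=; exact: powR_ge0. Qed.

(** The quotient of the ramp by [t^alpha] is nondecreasing, so only the ends matter: it is at least
    -1 at [grid k] and at most 1 at [grid i]. *)
Lemma ramp_le k i t : (k <= i)%N -> grid k <= t -> t <= grid i -> ramp k (grid i) <= grid i `^ alpha ->
  `|ramp k t| <= t `^ alpha.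
Proof.
move=> ki kt ti fi; have t0 : 0 < t by exact: lt_le_trans (grid_gt0 k) kt.
have i0 := grid_gt0 i; have k0 := grid_gt0 k.
have kap0 : 0 <= l * grid k `^ s + base k by rewrite addr_ge0// mulr_ge0 ?powR_ge0// ltW.
have rE u : ramp k u = l * u `^ s - (l * grid k `^ s + base k) by rewrite /ramp; ring.
have up := ratio_nondecreasing alpha0 gamma0 (ltW l0) kap0 t0 ti.
have dn := ratio_nondecreasing alpha0 gamma0 (ltW l0) kap0 k0 kt.
rewrite -!rE in up dn.
have ta : 0 < t `^ alpha by exact: powR_gt0.
rewrite ler_norml; apply/andP; split.
  rewrite -[leRHS](divfK (lt0r_neq0 ta)) -mulN1r ler_pM2r//; apply: le_trans dn.
  rewrite ler_pdivlMr ?powR_gt0// mulN1r /ramp subrr mulr0 sub0r lerN2.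
  exact: base_le.
rewrite -[leLHS](divfK (lt0r_neq0 ta)) -[leRHS]mul1r ler_pM2r//; apply: le_trans up _.
by rewrite ler_pdivrMr ?powR_gt0// mul1r.
Qed.

Definition ramp_height (k : nat) (t : R) : R := Num.sqrt ((t `^ alpha) ^+ 2 - ramp k t ^+ 2).

Lemma ramp_height_ge0 k t : 0 <= ramp_height k t. Proof. exact: sqrtr_ge0. Qed.

Lemma measurable_ramp_height k : measurable_fun setT (ramp_height k).
Proof.
apply: measurable_sqrt_comp; apply: measurable_funB; apply: measurable_funX.
  exact: measurable_powR.
apply: measurable_funB => //; apply: measurable_funM => //.
by apply: measurable_funB => //; exact: measurable_powR.
Qed.

Lemma ramp_height_le k t : ramp_height k t <= t `^ alpha.
Proof.
rewrite -[leRHS]ger0_norm ?powR_ge0// -sqrtr_sqr /ramp_height.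
by apply: ler_wsqrtr; rewrite gerBl sqr_ge0.
Qed.

Lemma test_fun_ramp_height k c d : 0 < c ->
  test_fun c d (theta * d `^ alpha) (fun t => theta * ramp_height k t * \1_(`]c, d]%classic) t).
Proof.
move=> c0; have th0 := ltW theta_gt0; split.
- apply: measurable_funM; last exact: measurable_indic.
  by apply: measurable_funM => //; exact: measurable_ramp_height.
- move=> t; rewrite ger0_norm; last by rewrite !mulr_ge0// ramp_height_ge0.
  rewrite indicE; have [|_] := boolP (_ \in _); last by rewrite mulr0 mulr_ge0// powR_ge0.
  rewrite inE/= in_itv/= => /andP[ct td]; rewrite mulr1 ler_wpM2l//.
  rewrite (le_trans (ramp_height_le _ _))// powR_le//; apply: ltW; exact: lt_trans ct.
- move=> t h; rewrite indicE memNset ?mulr0//= in_itv/= => /andP[ct td].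
  by case: h => h; [have := lt_le_trans ct h|have := lt_le_trans h td]; rewrite ltxx.
Qed.

Let v (j : nat) (t : R) : R := theta * l * s * t `^ (s - 1) * \1_(cell j) t.
Let e (j : nat) (t : R) : R := theta * ramp_height (run_start j) t * \1_(cell j) t.

Definition cell_gain (j : nat) : R := if live j then
  2 * \int[mu]_t (e j t * \1_E t) + L (v j) else 0.

(** Induction on cells: a live cell continues the current ramp and collects its gain, a dead cell
    resets the primitive to the start of the next ramp. *)
Lemma reach_grid i : (i <= m)%N ->
  reach alpha Omega' lo (grid i) (theta * ramp (run_start i) (grid i)) (\sum_(0 <= j < i) cell_gain j).
Proof.
elim: i => [_|j IH jm].
  rewrite big_geq//= /ramp subrr mulr0 subr0 mulr0; exact: reach0.
have {IH} rj := IH (ltnW jm).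
have j0 := grid_gt0 j; have jj := grid_lt (ltnSn j).
have th0 := theta_gt0; have th1 := theta_le1.
have s1 : 0 < s - 1 + 1 by rewrite subrK.
rewrite big_nat_recr//= {2}/cell_gain; case: ifPn => lj; last first.
  rewrite addr0; apply: (reach_dead alpha0 mO' strip_fin lo0 (grid_lo j) (ltW jj) _ _ _ rj).
  - by rewrite lt_neqAle eq_sym lj measure_ge0.
  - rewrite normrM (ger0_norm (ltW th0)) -[leRHS]mul1r ler_pM ?(ltW th0)//.
    by apply: (@ramp_le _ j) => //; [exact: run_start_le|exact: grid_le (run_start_le j)|exact: feasible (ltnW jm)].
  - rewrite /ramp subrr mulr0 sub0r mulrN normrN theta_grid ger0_norm ?powR_ge0//.
set k := run_start j.
have kj : (k <= j)%N by exact: run_start_le.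
have fj : ramp k (grid j.+1) <= grid j.+1 `^ alpha by have := feasible jm; rewrite /= lj.
have tv := test_fun_powR (s - 1) (theta * l * s) (grid j.+1) j0.
have te := test_fun_ramp_height k (grid j.+1) j0.
pose C := Num.max (`|theta * l * s| * (grid j `^ (s - 1) + grid j.+1 `^ (s - 1))) (theta * grid j.+1 `^ alpha).
have upC c d C1 C2 (f : R -> R) : C1 <= C2 -> test_fun c d C1 f -> test_fun c d C2 f.
  by move=> h [mf fC fo]; split => // t; exact: le_trans h.
have tv' : test_fun (grid j) (grid j.+1) C (v j) by apply: upC tv; rewrite le_max lexx.
have te' : test_fun (grid j) (grid j.+1) C (e j) by apply: upC te; rewrite le_max lexx orbT.
have e0 t : 0 <= e j t by rewrite !mulr_ge0// ?(ltW th0)// ramp_height_ge0.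
have := reach_extend mO' strip_fin lo0 (grid_lo j) (ltW jj) rj tv' te' e0.
rewrite /v/= Rintegral_powR_indic ?(ltW jj)// subrK.
rewrite (_ : theta * ramp k (grid j) + _ = theta * ramp k (grid j.+1)); last first.
  by rewrite /ramp; field; rewrite gt_eqF.
apply => t jt tj; rewrite primitive_powR_indic ?(ltW jt)// subrK.
rewrite (_ : theta * ramp k (grid j) + _ = theta * ramp k t); last first.
  by rewrite /ramp; field; rewrite gt_eqF.
rewrite /e indicE mem_set ?mulr1; last by rewrite /cell/= in_itv/= jt tj.
have kt : grid k <= t by exact: le_trans (grid_le kj) (ltW jt).
have rt := ramp_le (leqW kj) kt tj fj.
have t0 : 0 < t by exact: lt_trans jt.
rewrite -/k !exprMn -mulrDr sqr_sqrtr; last first.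
  by rewrite subr_ge0 -[ramp k t ^+ 2]real_normK ?num_real// lerXn2r ?nnegrE ?powR_ge0.
rewrite subrK -[leRHS]mul1r ler_wpM2r ?sqr_ge0// expr_le1// ltW//.
Qed.

Fixpoint live_set (n : nat) : set R :=
  if n is j.+1 then (if live j then live_set j `|` cell j else live_set j) else set0.

Lemma live_setP n t : live_set n t <-> exists2 j, (j < n)%N & live j /\ cell j t.
Proof.
elim: n => [|n IH] /=; first by split => // -[].
split.
  case: ifPn => ln; last by move=> /IH[j jn h]; exists j => //; exact: ltnW.
  by move=> [/IH[j jn h]|h]; [exists j => //; exact: ltnW|exists n].
move=> [j]; rewrite ltnS leq_eqVlt => /orP[/eqP -> [-> h]|jn [lj h]]; first by right.
by case: ifPn => _; [left|]; apply/IH; exists j.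
Qed.

Lemma measurable_live_set n : measurable (live_set n).
Proof.
elim: n => [|n IH] /=; first exact: measurable0.
by case: ifP => _ //; apply: measurableU => //; exact: measurable_itv.
Qed.

Lemma live_set_sub n : live_set n `<=` `]lo, grid n]%classic.
Proof.
move=> t /live_setP[j jn [_]]; rewrite /cell/= !in_itv/= => /andP[h1 h2].
by rewrite (le_lt_trans (grid_lo j) h1)/= (le_trans h2)// grid_le.
Qed.

Definition live_area (n : nat) : R := L (fun t => t `^ (s - 1) * \1_(live_set n) t).

Let test_live n : test_fun lo (grid n) (lo `^ (s - 1) + grid n `^ (s - 1))
  (fun t => t `^ (s - 1) * \1_(live_set n) t).
Proof.
have := test_fun_indic (measurable_live_set n) (test_fun_powR (s - 1) 1 (grid n) lo0).
rewrite normr1 mul1r; congr test_fun; apply/funext => t; rewrite mul1r -mulrA; congr (_ * _).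
rewrite !indicE -natrM mulnb; congr _%:R; congr nat_of_bool.
apply/andP/idP; first by case.
by rewrite !inE => h; split => //; exact: live_set_sub.
Qed.

Let cell_disj n t : live_set n t -> cell n t -> False.
Proof.
move=> /live_set_sub; rewrite /cell/= !in_itv/= => /andP[_ h1] /andP[h2 _].
by have := lt_le_trans h2 h1; rewrite ltxx.
Qed.

Lemma sum_live_area n :
  \sum_(0 <= j < n) (if live j then L (v j) else 0) = theta * l * s * live_area n.
Proof.
elim: n => [|n IH].
  rewrite big_geq// /live_area /L /Rintegral integral0_eq ?mulr0// => z _.
  by rewrite indicE in_set0 mulr0.
rewrite big_nat_recr//= IH /live_area/=; case: ifPn => ln; last by rewrite addr0.
have LZ (q lo1 hi C : R) (f : R -> R) : 0 < lo1 -> test_fun lo1 hi C f -> L (fun t => q * f t) = q * L f.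
  by move=> h tf; rewrite /L RintegralZl//; exact: (test_fun_integrable2 mO' strip_fin h tf).
have tl := test_fun_sub (lexx lo) (grid_le (leqnSn n)) (test_live n).
have t1 := test_fun_powR (s - 1) 1 (grid n.+1) (grid_gt0 n).
have t1' := test_fun_sub (grid_lo n) (lexx _) t1.
have -> : L (v n) = theta * l * s * L (fun t => 1 * t `^ (s - 1) * \1_(cell n) t).
  rewrite -(LZ _ _ _ _ _ (grid_gt0 n) t1); congr L; apply/funext => t.
  by rewrite /v mul1r mulrA.
rewrite -mulrDr; congr (_ * _).
transitivity (L (fun t => t `^ (s - 1) * \1_(live_set n) t + 1 * t `^ (s - 1) * \1_(cell n) t)).
  by rewrite -(area_functionalD mO' strip_fin lo0 tl t1').
congr L; apply/funext => t; rewrite mul1r -mulrDr; congr (_ * _); rewrite !indicE in_setU.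
have [h1|h1] := boolP (t \in live_set n); have [h2|h2] := boolP (t \in cell n) => /=; rewrite ?addr0 ?add0r//.
by exfalso; rewrite !inE in h1 h2; exact: cell_disj h1 h2.
Qed.

Let e_ge0 j t : 0 <= e j t.
Proof. by rewrite !mulr_ge0// ?ramp_height_ge0// ltW// theta_gt0. Qed.

Let test_e j : test_fun (grid j) (grid j.+1) (theta * grid j.+1 `^ alpha) (e j).
Proof. exact: test_fun_ramp_height (grid_gt0 j). Qed.

Let e_live j : live j -> \int[mu]_t (e j t * \1_E t) = \int[mu]_t e j t.
Proof.
move=> lj; have mE := measurable_slice_neq0 mO'.
rewrite /Rintegral; congr fine; apply: ae_eq_integral => //.
- apply/measurable_EFinP; apply: measurable_funM; last exact: measurable_indic.
  by case: (test_e j).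
- by apply/measurable_EFinP; case: (test_e j).
exists (cell j `&` ~` E); split.
- by apply: measurableI; [exact: measurable_itv|exact: measurableC].
- exact/eqP.
- move=> t /= /not_implyP[_ h]; apply: contrapT => /not_andP h2; apply: h; congr EFin.
  have [hE|hE] := pselect (E t); first by rewrite indicE mem_set// mulr1.
  have hc : ~ cell j t by case: h2 => // /contrapT.
  by rewrite /e ![in \1_(cell j) t]indicE memNset// !mulr0 mul0r.
Qed.

Lemma run_integral i n : (run_start i <= n <= i)%N ->
  \sum_(run_start i <= j < n) \int[mu]_t (e j t * \1_E t) =
  \int[mu]_t (theta * ramp_height (run_start i) t * \1_(`]grid (run_start i), grid n]%classic) t).
Proof.
set k := run_start i; elim: n => [|n IH].
  rewrite leqn0 => /andP[/eqP k0 _]; rewrite k0 big_geq// Rintegral_eq0// => t.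
  by rewrite indicE memNset ?mulr0//= in_itv/= => /andP[/lt_le_trans h /h]; rewrite ltxx.
rewrite leq_eqVlt => /andP[/orP[/eqP ->|kn] ni].
  rewrite big_geq// Rintegral_eq0// => t.
  by rewrite indicE memNset ?mulr0//= in_itv/= => /andP[/lt_le_trans h /h]; rewrite ltxx.
have kn' : (k <= n)%N by rewrite -ltnS.
have [ln kn2] : live n /\ run_start n = k by apply: run_startP; rewrite -/k kn' ni.
rewrite big_nat_recr//= IH ?kn' ?(ltnW ni)// (e_live ln) /e kn2.
rewrite -RintegralD//; last 2 first.
- exact: (test_fun_integrable (grid_gt0 k) (test_fun_ramp_height k (grid n) (grid_gt0 k))).
- exact: (test_fun_integrable (grid_gt0 n) (test_fun_ramp_height k (grid n.+1) (grid_gt0 n))).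
apply: eq_Rintegral => t _; rewrite -mulrDr; congr (_ * _).
have h1 := grid_le kn'; have h2 := grid_le (leqnSn n).
rewrite !indicE /cell.
have -> : (t \in `]grid k, grid n]%classic) = (grid k < t <= grid n).
  by apply/idP/idP; rewrite inE/= in_itv.
have -> : (t \in `]grid n, grid n.+1]%classic) = (grid n < t <= grid n.+1).
  by apply/idP/idP; rewrite inE/= in_itv.
have -> : (t \in `]grid k, grid n.+1]%classic) = (grid k < t <= grid n.+1).
  by apply/idP/idP; rewrite inE/= in_itv.
have [tn|tn] := leP t (grid n).
  by rewrite (le_trans tn h2) !andbT addr0.
by rewrite andbF (le_lt_trans h1 tn)/= add0r.
Qed.

(** The area terms of all live cells are kept; among the nonnegative height terms only those of the
    run ending at [grid i] are. *)
Lemma reach_run i : (i <= m)%N ->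
  reach alpha Omega' lo (grid m) (theta * ramp (run_start m) (grid m))
    (theta * l * s * live_area m +
     2 * \int[mu]_t (theta * ramp_height (run_start i) t * \1_(`]grid (run_start i), grid i]%classic) t)).
Proof.
move=> im; apply: reach_le (reach_grid (leqnn m)).
set k := run_start i; have ki : (k <= i)%N by exact: run_start_le.
pose h j := if live j then 2 * \int[mu]_t (e j t * \1_E t) else 0.
have h0 j : 0 <= h j.
  rewrite /h; case: ifP => // _; rewrite mulr_ge0//; apply: Rintegral_ge0 => t _.
  by rewrite mulr_ge0.
rewrite (eq_bigr (fun j => (if live j then L (v j) else 0) + h j)); last first.
  by move=> j _; rewrite /cell_gain /h; case: ifP => _; rewrite ?addr0// addrC.
rewrite big_split/= sum_live_area lerD2l.
rewrite (@big_cat_nat _ _ _ k 0 m) ?(leq_trans ki)//= (@big_cat_nat _ _ _ i k m)//=.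
rewrite -(@run_integral i i); last by rewrite ki leqnn.
rewrite mulr_sumr.
have -> : \sum_(k <= j < i) h j = \sum_(k <= j < i) 2 * \int[mu]_t (e j t * \1_E t).
  apply: eq_big_nat => j kji; rewrite /h.
  by have [-> _] := run_startP (i := i) (j := j) kji.
have hs a b : 0 <= \sum_(a <= j < b) h j by apply: sumr_ge0.
by rewrite addrCA lerDl addr_ge0.
Qed.

End grid.

(** * The lower bound for the perimeter *)

Section weighted_am_gm.
Context {R : realType}.

(** Weighted AM-GM with weights [p] and [1 - p]; the relation [r * (1 - p) = p] makes the powers of
    [l] cancel. *)
Lemma am_gm_scaled (p r a A g l : R) : 0 < p -> p < 1 -> r * (1 - p) = p ->
  0 <= a -> 0 <= A -> 0 <= g -> 0 < l ->
  (a / p) `^ p * (g / (1 - p)) `^ (1 - p) * A `^ p <= l * a * A + l^-1 `^ r * g.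
Proof.
move=> p0 p1 hr a0 A0 g0 l0.
have q0 : 0 < 1 - p by rewrite subr_gt0.
pose x := l * a * A / p; pose y := l^-1 `^ r * g / (1 - p).
have x0 : 0 <= x by rewrite divr_ge0 ?mulr_ge0 ?(ltW l0) ?(ltW p0).
have y0 : 0 <= y by rewrite divr_ge0 ?mulr_ge0 ?powR_ge0 ?(ltW q0).
have hpq : (p^-1)^-1 + ((1 - p)^-1)^-1 = 1 by rewrite !invrK addrC subrK.
have := @conjugate_powR R (x `^ p) (y `^ (1 - p)) p^-1 (1 - p)^-1 (powR_ge0 _ _) (powR_ge0 _ _).
rewrite !invr_gt0 => /(_ p0 q0 hpq).
rewrite -!powRrM !mulfV ?gt_eqF// !powRr1// !invrK => h.
have -> : l * a * A + l^-1 `^ r * g = x * p + y * (1 - p) by rewrite /x /y !divfK ?gt_eqF.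
apply: le_trans h; rewrite le_eqVlt; apply/orP; left; apply/eqP.
have -> : x = l * (a / p) * A by rewrite /x; field; rewrite gt_eqF.
have -> : y = l^-1 `^ r * (g / (1 - p)) by rewrite /y mulrA.
have ap0 : 0 <= a / p by rewrite divr_ge0// ltW.
have gp0 : 0 <= g / (1 - p) by rewrite divr_ge0// ltW.
have li0 : 0 <= l^-1 by rewrite invr_ge0 ltW.
have la0 : 0 <= l * (a / p) by rewrite mulr_ge0// ltW.
rewrite (powRM p la0 A0) (powRM p (ltW l0) ap0) (powRM (1 - p) (powR_ge0 _ _) gp0) -powRrM hr.
have E : l `^ p * l^-1 `^ p = 1 by rewrite -powRM ?(ltW l0)// mulfV ?powR1// gt_eqF.
rewrite -[LHS]mul1r -E; ring.
Qed.

End weighted_am_gm.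

(** * Choice of the slope *)

Section grid_bound.
Context {R : realType}.
Notation mu := (@lebesgue_measure R).
Notation T2 := (measurableTypeR R * measurableTypeR R)%type.
Variables (alpha gamma : R) (Omega' : set T2) (P : \bar R).
Hypothesis alpha0 : 0 <= alpha.
Hypothesis gamma0 : 0 < gamma.
Hypothesis gamma_le : gamma <= alpha + 1.
Hypothesis mO' : measurable Omega'.
Hypothesis strip_fin : forall delta M, 0 < delta ->
  (@leb2_borel R (Omega' `&` strip delta M) < +oo)%E.
Let E := [set t | slice Omega' t != 0%E].
Let L (w : R -> R) := \int[@leb2_borel R]_(z in Omega') w z.2.
Hypothesis cal : forall (delta M C : R) (w a : R -> R), 0 < delta -> 0 <= M ->
    measurable_fun setT a -> (forall t, 0 <= a t <= C) ->
    (forall t, t < delta \/ M < t -> a t = 0) ->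
    measurable_fun setT w -> (forall t, `|w t| <= C) ->
    (forall t, t < delta \/ M < t -> w t = 0) -> \int[mu]_t w t = 0 ->
    (forall t, 0 < t -> a t ^+ 2 + primitive w t ^+ 2 <= (t `^ alpha) ^+ 2) ->
    ((2 * \int[mu]_t (a t * \1_E t) + L w)%:E <= P)%E.

Let s := alpha + gamma.
Let r := (alpha + 1) / gamma.
(** With [s = beta + 1] this is the exponent in the isoperimetric quotient. *)
Let p := (alpha + 1) / (s + 1).
Let s0 : 0 < s. Proof. by rewrite /s ltr_wpDl. Qed.
Let a1 : 0 < alpha + 1. Proof. by rewrite ltr_wpDl. Qed.
Let p0 : 0 < p. Proof. by rewrite divr_gt0// addr_gt0. Qed.
Let p1 : p < 1. Proof. have s1 : 0 < s + 1 by rewrite addr_gt0.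
by rewrite /p ltr_pdivrMr// mul1r ltrD2r /s ltrDl. Qed.
Let rp : r * (1 - p) = p.
Proof.
have g_neq0 : gamma != 0 by rewrite gt_eqF.
have sn : alpha + gamma + 1 != 0 by rewrite gt_eqF// addr_gt0.
by rewrite /r /p /s; field; rewrite g_neq0 sn.
Qed.

Lemma disc_integral_fin_num : disc_integral alpha gamma \is a fin_num.
Proof.
have r0 : 0 <= r by rewrite divr_ge0// ltW.
have nn (u : R) : (0 <= (Num.sqrt (1 - u ^+ 2) `^ r)%:E)%E by rewrite lee_fin powR_ge0.
rewrite ge0_fin_numE; last exact: integral_ge0.
apply: (@le_lt_trans _ _ (\int[mu]_(u in `]0%R, 1%R[) (cst 1%E) u)%E); last first.
  rewrite integral_cst// mul1e; apply: (@le_lt_trans _ _ (mu `]0%R, 1%R[%classic)) => //.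
  by rewrite lebesgue_measure_itv/= lte_fin ltr01 -EFinB ltry.
apply: ge0_le_integral => //.
- apply/measurable_EFinP; apply: measurable_funTS.
  apply: (measurableT_comp (measurable_powR r)).
  by apply: measurable_sqrt_comp; exact: measurable_funB.
move=> u _; rewrite lee_fin powR_le1 ?sqrtr_ge0//.
by rewrite -[leRHS]sqrtr1 ler_sqrt// gerBl sqr_ge0.
Qed.

Definition disc_const : R := fine (disc_integral alpha gamma).

Lemma disc_const_ge0 : 0 <= disc_const.
Proof. by apply: fine_ge0; apply: integral_ge0 => u _; rewrite lee_fin powR_ge0. Qed.

(* The constant obtained by optimizing the slope [l] of the calibration. *)
Definition isop_const : R :=
  (s / p) `^ p * ((2 * disc_const / (alpha + 1)) / (1 - p)) `^ (1 - p).

Variables (lo rho : R) (m : nat).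
Hypothesis lo0 : 0 < lo.
Hypothesis rho1 : 1 < rho.
Notation grid := (grid lo rho).
Notation run_start := (run_start Omega' lo rho).

(** The value of [l] at which the ramp of a later run touches [t^alpha] at [grid i]. For a run from
    index 0 it is the slope of an interval starting at height 0, slightly below the touching value,
    so that [initial_interval_integral] applies. *)
Let slope (i : nat) : R := if run_start i is 0%N then grid i `^ (- gamma)
  else (grid (run_start i) `^ alpha + grid i `^ alpha) / (grid i `^ s - grid (run_start i) `^ s).

Let grid_pow_lt i j : (i < j)%N -> 0 < grid j `^ s - grid i `^ s.
Proof.
move=> ij; have g0 n : 0 <= grid n by rewrite ltW//; exact: grid_gt0.
by rewrite subr_gt0; apply: gt0_ltr_powR; rewrite ?nnegrE//; exact: grid_lt.
Qed.

Let slope_gt0 i : (run_start i < i)%N -> 0 < slope i.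
Proof.
rewrite /slope => ri; have g0 j : 0 < grid j by exact: grid_gt0.
case E1 : (run_start i) => [|k]; first exact: powR_gt0.
rewrite E1 in ri; apply: divr_gt0; last exact: grid_pow_lt.
by rewrite addr_gt0 ?powR_gt0.
Qed.

Let slope_feasible l i : 0 < l -> ((run_start i < i)%N -> l <= slope i) ->
  ramp alpha gamma lo rho l (run_start i) (grid i) <= grid i `^ alpha.
Proof.
move=> l0 ls; have g0 j : 0 < grid j by exact: grid_gt0.
have := run_start_le Omega' lo rho i; rewrite leq_eqVlt => /orP[/eqP ->|ri].
  rewrite /ramp subrr mulr0 sub0r (le_trans _ (powR_ge0 _ _))// oppr_le0.
  by rewrite /base; case: (i) => // n; exact: powR_ge0.
have {ls} := ls ri; rewrite /slope /ramp /base.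
case E1 : (run_start i) => [|k].
  rewrite powRN => ls; rewrite subr0; apply: (@le_trans _ _ (l * grid i `^ s)).
    by rewrite ler_wpM2l ?(ltW l0)// gerBl powR_ge0.
  have -> : grid i `^ s = grid i `^ alpha * grid i `^ gamma by rewrite /s powRD// (gt_eqF (g0 i)) implybT.
  rewrite mulrCA -[leRHS]mulr1 ler_wpM2l ?powR_ge0//.
  by rewrite -ler_pdivlMr ?powR_gt0// div1r.
rewrite E1 in ri; rewrite ler_pdivlMr ?grid_pow_lt//.
by move=> h; rewrite lerBlDr [leRHS]addrC.
Qed.

(** A run from [lo] is compared with the interval from 0: the part below [lo] carries at most
    [lo^(alpha + 1) / (alpha + 1)], and subtracting [lo^s] lowers the ramp, hence raises the height.
    For the other runs [interval_integral_ge] is already stronger. *)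
Let height_integral l i : 0 < l -> (run_start i < i)%N -> l = slope i ->
  l^-1 `^ r * (disc_const / (alpha + 1)) - lo `^ (alpha + 1) / (alpha + 1) <=
  \int[mu]_t (ramp_height alpha gamma lo rho l (run_start i) t *
     \1_(`]grid (run_start i), grid i]%classic) t).
Proof.
move=> l0 ri ls; set k := run_start i.
have k0 : 0 < grid k by exact: grid_gt0.
have i0 : 0 < grid i by exact: grid_gt0.
have ki : grid k < grid i by exact: grid_lt.
have mh := measurable_ramp_height alpha gamma lo rho l k.
have h0 t : (0 <= (ramp_height alpha gamma lo rho l k t)%:E)%E by rewrite lee_fin ramp_height_ge0.
have mhe D : measurable_fun D (fun t => (ramp_height alpha gamma lo rho l k t)%:E).
  by apply/measurable_EFinP; exact: measurable_funTS.
have fin : (\int[mu]_(t in `]grid k, grid i[) (ramp_height alpha gamma lo rho l k t)%:E <= (grid i `^ (alpha + 1) / (alpha + 1))%:E)%E.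
  apply: (@le_trans _ _ (\int[mu]_(t in `]grid k, grid i[) (t `^ alpha)%:E)%E).
    apply: ge0_le_integral => //.
    - exact: mhe.
    - by apply/measurable_EFinP; apply: measurable_funTS; exact: measurable_powR.
    - by move=> t _; rewrite lee_fin ramp_height_le.
  rewrite integral_powR ?(ltW k0) ?(ltW ki)// lee_fin ler_pM2r ?invr_gt0// gerBl powR_ge0.
  done.
have -> : \int[mu]_t (ramp_height alpha gamma lo rho l k t * \1_(`]grid k, grid i]%classic) t) =
    fine (\int[mu]_(t in `]grid k, grid i[) (ramp_height alpha gamma lo rho l k t)%:E)%E.
  rewrite /Rintegral; congr fine; rewrite integral_itv_bndo_bndc// [RHS]integral_mkcond.
  apply: eq_integral => t _; rewrite patchE indicE; case: ifPn => _; rewrite ?mulr1// mulr0//.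
rewrite -lee_fin fineK; last first.
  by rewrite ge0_fin_numE ?integral_ge0// (le_lt_trans fin)// ltry.
have dE : disc_integral alpha gamma = disc_const%:E by rewrite fineK// disc_integral_fin_num.
rewrite /slope -/k in ls.
have [kE|kN] := eqVneq k 0%N.
  rewrite kE in ls fin h0 mhe ki k0 *.
  have g0 : grid 0 = lo by exact: grid0.
  have hd : l * grid i `^ gamma = 1 by rewrite ls powRN mulVf// gt_eqF// powR_gt0.
  have := initial_interval_integral alpha0 gamma0 i0 l0 hd; rewrite dE -EFinM -/s -/r => I0.
  have lei : lo < grid i by rewrite -[ltLHS]g0.
  have : (\int[mu]_(t in `]0%R, grid i[) (Num.sqrt ((t `^ alpha) ^+ 2 - (l * t `^ s) ^+ 2))%:E <=
    (lo `^ (alpha + 1) / (alpha + 1))%:E + \int[mu]_(t in `]grid 0, grid i[) (ramp_height alpha gamma lo rho l 0 t)%:E)%E.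
    have -> : ((lo `^ (alpha + 1) / (alpha + 1))%:E = \int[mu]_(t in `]0%R, lo[) (t `^ alpha)%:E)%E.
      by rewrite integral_powR ?(ltW lo0)// powR0 ?gt_eqF// subr0.
    rewrite [X in (_ <= X + _)%E]integral_itv_bndo_bndc; last by apply/measurable_EFinP; apply: measurable_funTS; exact: measurable_powR.
    rewrite g0 [X in (_ <= X + _)%E]integral_mkcond [X in (_ <= _ + X)%E]integral_mkcond [leLHS]integral_mkcond.
    have mp : measurable_fun setT ((fun t => (t `^ alpha)%:E) \_ `]0%R, lo]).
      apply/(measurable_restrictT _ (measurable_itv _)).
      by apply/measurable_EFinP; apply: measurable_funTS; exact: measurable_powR.
    have mr : measurable_fun setT ((fun t => (ramp_height alpha gamma lo rho l 0 t)%:E) \_ `]lo, grid i[).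
      by apply/(measurable_restrictT _ (measurable_itv _)).
    have pp (t : R) : (0 <= ((fun t => (t `^ alpha)%:E) \_ `]0%R, lo]) t)%E.
      by rewrite patchE; case: ifP => // _; rewrite lee_fin powR_ge0.
    have pr (t : R) : (0 <= ((fun t => (ramp_height alpha gamma lo rho l 0 t)%:E) \_ `]lo, grid i[) t)%E.
      by rewrite patchE; case: ifP.
    rewrite -ge0_integralD//; apply: ge0_le_integral => //.
    - by move=> t _; rewrite patchE; case: ifP => // _; rewrite lee_fin sqrtr_ge0.
    - apply/(measurable_restrictT _ (measurable_itv _)); apply/measurable_EFinP; apply: measurable_funTS.
      apply: measurable_sqrt_comp; apply: measurable_funB; apply: measurable_funX; first exact: measurable_powR.
      by apply: measurable_funM => //; exact: measurable_powR.
    - exact: emeasurable_funD.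
    move=> t _; rewrite [in leLHS]patchE; case: ifPn => [|_]; last exact: adde_ge0.
    rewrite inE/= in_itv/= => /andP[t0 ti].
    have [tl|tl] := leP t lo.
      rewrite [X in (_ <= X + _)%E]patchE mem_set/=; last by rewrite in_itv/= t0 tl.
      apply: (@le_trans _ _ (t `^ alpha)%:E); last exact: leeDl.
      by rewrite lee_fin -[leRHS]ger0_norm ?powR_ge0// -sqrtr_sqr ler_wsqrtr// gerBl sqr_ge0.
    rewrite [X in (_ <= _ + X)%E]patchE mem_set/=; last by rewrite in_itv/= tl ti.
    apply: (@le_trans _ _ (ramp_height alpha gamma lo rho l 0 t)%:E); last exact: leeDr.
    rewrite lee_fin /ramp_height /ramp /base subr0 g0 ler_wsqrtr// lerD2l lerN2.
    have lt : lo `^ s <= t `^ s by apply: powR_le; rewrite ltW.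
    rewrite lerXn2r ?nnegrE ?mulr_ge0 ?powR_ge0 ?(ltW l0) ?subr_ge0//.
    by rewrite ler_wpM2l ?(ltW l0)// gerBl powR_ge0.
  rewrite I0 addeC -leeBlDr// -EFinB; apply: le_trans.
  by rewrite mulrA mulrAC lexx.
have hd : l * (grid i `^ s - grid k `^ s) = grid k `^ alpha + grid i `^ alpha.
  move: ls; have := grid_pow_lt ri; rewrite -/k; case: (k) kN => // n _ kn ->.
  by rewrite divfK// gt_eqF.
have := interval_integral_ge alpha0 gamma0 gamma_le k0 ki l0 hd; rewrite dE -EFinM -/s -/r.
have -> : (\int[mu]_(t in `]grid k, grid i[) (ramp_height alpha gamma lo rho l k t)%:E =
  \int[mu]_(t in `]grid k, grid i[) (Num.sqrt (t `^ alpha ^+ 2 - (l * (t `^ s - grid k `^ s) - grid k `^ alpha) ^+ 2))%:E)%E.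
  by apply: eq_integral => t _; rewrite /ramp_height /ramp /base; case: (k) kN.
apply: le_trans; rewrite lee_fin mulrA mulrAC gerBl divr_ge0 ?powR_ge0// ltW//.
Qed.

Notation live_area := (live_area alpha gamma Omega' lo rho).

(** The gap above [grid m] is where the primitive returns to 0, as [reach_perimeter] requires. *)
Lemma grid_bound (M' : R) : grid m <= M' -> (0 < mu (`]grid m, M']%classic `&` ~` E))%E ->
  ((theta alpha rho * (isop_const * live_area m `^ p - 2 * (lo `^ (alpha + 1) / (alpha + 1))))%:E <= P)%E.
Proof.
move=> gM N0.
have th0 := theta_gt0 alpha rho1.
have P0 : (0 <= P)%E.
  by apply: (reach_perimeter cal lo0 (lexx lo)); exact: reach0.
have lo1 : 0 <= 2 * (lo `^ (alpha + 1) / (alpha + 1)) by rewrite mulr_ge0// divr_ge0 ?powR_ge0// ltW.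
(* Without any live cell the live area is 0 and the left side is nonpositive. *)
have [[i im ri]|none] := pselect (exists2 i, (i <= m)%N & (run_start i < i)%N); last first.
  apply: le_trans P0; rewrite lee_fin pmulr_rle0//.
  have -> : live_area m = 0.
    transitivity (\int[@leb2_borel R]_(z in Omega') (z.2 `^ (s - 1) * \1_(live_set Omega' lo rho m) z.2)) => //.
    rewrite /Rintegral integral0_eq// => z _.
    rewrite indicE memNset ?mulr0// => /live_setP[j jm [lj _]]; apply: none.
    by exists j.+1 => //=; rewrite lj ltnS run_start_le.
  by rewrite powR0 ?gt_eqF// mulr0 sub0r oppr_le0.
pose f (j : 'I_m.+1) := slope j.
pose Q (j : 'I_m.+1) := (run_start j < j)%N.
have Qi : Q (Ordinal (im : (i < m.+1)%N)) by [].
(* The least of finitely many slopes is feasible for every run and is the exact slope of the run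
   ending at [grid i0]. *)
have [i0 Qi0 mini0] := @Order.TotalTheory.arg_minP _ _ _ (Ordinal (im : (i < m.+1)%N)) Q f Qi.
set l := f i0.
have l0 : 0 < l by exact: slope_gt0.
have fe j : (j <= m)%N -> ramp alpha gamma lo rho l (run_start j) (grid j) <= grid j `^ alpha.
  move=> jm; apply: slope_feasible => // rj; exact: (mini0 (Ordinal (jm : (j < m.+1)%N))).
have i0m : (i0 <= m)%N by rewrite -ltnS.
have rr := reach_run alpha0 gamma0 mO' strip_fin lo0 rho1 l0 fe i0m.
have lom : lo <= grid m by have := @grid_le _ lo rho lo0 rho1 0 m isT; rewrite grid0.
have gm0 := grid_gt0 lo0 rho1 m.
have rend : reach alpha Omega' lo M' 0 (theta alpha rho * l * s * live_area m +
     2 * \int[mu]_t (theta alpha rho * ramp_height alpha gamma lo rho l (run_start i0) t * \1_(`]grid (run_start i0), grid i0]%classic) t)).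
  apply: (reach_dead alpha0 mO' strip_fin lo0 lom gM N0 _ _ rr); last by rewrite normr0 powR_ge0.
  rewrite normrM (ger0_norm (ltW th0)) -[leRHS]mul1r ler_pM ?(ltW th0)//.
    exact: theta_le1.
  have rm := run_start_le Omega' lo rho m.
  by apply: (ramp_le alpha0 gamma0 lo0 rho1 l0 rm) => //; [exact: grid_le|exact: fe].
apply: le_trans (reach_perimeter cal lo0 (le_trans lom gM) rend).
rewrite lee_fin.
have -> : \int[mu]_t (theta alpha rho * ramp_height alpha gamma lo rho l (run_start i0) t * \1_(`]grid (run_start i0), grid i0]%classic) t) =
   theta alpha rho * \int[mu]_t (ramp_height alpha gamma lo rho l (run_start i0) t * \1_(`]grid (run_start i0), grid i0]%classic) t).
  have k0 := grid_gt0 lo0 rho1 (run_start i0).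
  have ih := test_fun_integrable k0 (test_fun_ramp_height gamma alpha0 lo rho1 l (run_start i0) (grid i0) k0).
  rewrite -RintegralZl//; first by apply: eq_Rintegral => t _; rewrite mulrA.
  have := integrableZl measurableT (theta alpha rho)^-1 ih; apply: eq_integrable => // t _.
  by rewrite /= -EFinM !mulrA mulVf ?mul1r// gt_eqF.
have hI := height_integral l0 Qi0 erefl.
have A0 : 0 <= live_area m.
  by apply: Rintegral_ge0 => z _; rewrite mulr_ge0 ?powR_ge0.
have g0 : 0 <= 2 * disc_const / (alpha + 1) by rewrite divr_ge0 ?mulr_ge0 ?disc_const_ge0// ltW.
have := am_gm_scaled p0 p1 rp (ltW s0) A0 g0 l0; rewrite -/isop_const => am.
rewrite [leRHS](_ : _ = theta alpha rho * (l * s * live_area m + 2 * \int[mu]_t (ramp_height alpha gamma lo rho l (run_start i0) t * \1_(`]grid (run_start i0), grid i0]%classic) t))); last by ring.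
rewrite ler_pM2l//.
set I := \int[mu]_t _ in hI *.
have E2 : l^-1 `^ r * (2 * disc_const / (alpha + 1)) = 2 * (l^-1 `^ r * (disc_const / (alpha + 1))) by ring.
rewrite E2 in am; lra.
Qed.

End grid_bound.

(** * Passage to the limit along grids *)

Section perimeter_lower_bound.
Context {R : realType}.
Notation mu := (@lebesgue_measure R).
Notation T2 := (measurableTypeR R * measurableTypeR R)%type.
Variables (alpha gamma : R) (Omega' : set T2) (P : \bar R).
Hypothesis alpha0 : 0 <= alpha.
Hypothesis gamma0 : 0 < gamma.
Hypothesis gamma_le : gamma <= alpha + 1.
Hypothesis mO' : measurable Omega'.
Hypothesis sub_half_plane : forall z, Omega' z -> 0 < z.2.
Let s := alpha + gamma.
Let A := (\int[@leb2_borel R]_(z in Omega') (z.2 `^ (s - 1))%:E)%E.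
Hypothesis A_gt0 : (0 < A)%E.
Hypothesis A_fin : (A < +oo)%E.
Let E := [set t | slice Omega' t != 0%E].
Let L (w : R -> R) := \int[@leb2_borel R]_(z in Omega') w z.2.
Hypothesis cal : forall (delta M C : R) (w a : R -> R), 0 < delta -> 0 <= M ->
    measurable_fun setT a -> (forall t, 0 <= a t <= C) ->
    (forall t, t < delta \/ M < t -> a t = 0) ->
    measurable_fun setT w -> (forall t, `|w t| <= C) ->
    (forall t, t < delta \/ M < t -> w t = 0) -> \int[mu]_t w t = 0 ->
    (forall t, 0 < t -> a t ^+ 2 + primitive w t ^+ 2 <= (t `^ alpha) ^+ 2) ->
    ((2 * \int[mu]_t (a t * \1_E t) + L w)%:E <= P)%E.

(** The weight [y^(s - 1)] is bounded below by a positive constant on the strip, whatever the sign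
    of its exponent. *)
Lemma finite_strip (delta M : R) : 0 < delta ->
  (@leb2_borel R (Omega' `&` strip delta M) < +oo)%E.
Proof.
move=> d0; pose q := s - 1; pose c := (delta `^ (- q) + M `^ (- q))^-1.
have c1 : 0 < delta `^ (- q) + M `^ (- q) by rewrite ltr_pwDl ?powR_gt0 ?powR_ge0.
have c0 : 0 < c by rewrite invr_gt0.
have mS : measurable (Omega' `&` strip delta M) by apply: measurableI => //; exact: measurable_strip.
have mp (D : set T2) : measurable D -> measurable_fun D (fun z : T2 => (z.2 `^ q)%:E).
  move=> mD; apply/measurable_EFinP; apply: measurable_funTS.
  exact: (measurableT_comp (measurable_powR q) measurable_snd).
have h : (c%:E * @leb2_borel R (Omega' `&` strip delta M) <= A)%E.
  rewrite -integral_cst//; apply: (@le_trans _ _ (\int[@leb2_borel R]_(z in Omega' `&` strip delta M) (z.2 `^ q)%:E)%E).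
    apply: ge0_le_integral => //.
    - by move=> z _; rewrite lee_fin ltW.
    - exact: mp.
    - move=> z [_ [_ ]]; rewrite /= in_itv/= => /andP[h1 h2]; rewrite lee_fin /c.
      have z0 : 0 < z.2 by exact: lt_le_trans h1.
      rewrite -[leRHS]invrK lef_pV2 ?posrE ?invr_gt0 ?powR_gt0//.
      by rewrite -powRN; exact: powR_between.
  apply: ge0_subset_integral => //; first exact: mp.
  by move=> z _; rewrite lee_fin powR_ge0.
rewrite ltey; apply/negP => /eqP oo; move: (le_lt_trans h A_fin).
by rewrite oo gt0_muley ?lte_fin// ltxx.
Qed.

Let reach_le_P lo c S : 0 < lo -> lo <= c -> reach alpha Omega' lo c 0 S -> (S%:E <= P)%E.
Proof. exact: (reach_perimeter cal). Qed.

Hypothesis P_fin : (P < +oo)%E.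

Let mE : measurable E. Proof. exact: measurable_slice_neq0. Qed.

(** If almost every height above [g] had a slice of positive length, the choice [a = g^alpha],
    [w = 0] on []g, M']] would give [P >= 2 * g^alpha * (M' - g)] for all [M']. *)
Lemma gap_beyond (g : R) : 0 < g ->
  exists2 M', g <= M' & (0 < mu (`]g, M']%classic `&` ~` E))%E.
Proof.
move=> g0; apply: contrapT => none.
have N0 M' : g <= M' -> mu (`]g, M']%classic `&` ~` E) = 0%E.
  move=> gM; apply/eqP; rewrite eq_le measure_ge0 andbT leNgt; apply/negP => h.
  by apply: none; exists M'.
have ga0 : 0 < g `^ alpha by exact: powR_gt0.
have lb M' : g <= M' -> ((2 * (g `^ alpha * (M' - g)))%:E <= P)%E.
  move=> gM; have tp := test_fun_powR 0 (g `^ alpha) M' g0.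
  have te : test_fun g M' (`|g `^ alpha| * 2) (fun t => g `^ alpha * \1_(`]g, M']%classic) t).
    move: tp; rewrite !powRr0; congr test_fun; apply/funext => t.
    by rewrite powRr0 mulr1.
  have C0 : 0 <= `|g `^ alpha| * 2 by rewrite mulr_ge0.
  have e0 t : 0 <= g `^ alpha * \1_(`]g, M']%classic) t by rewrite mulr_ge0// ltW.
  have p0 t : primitive (fun=> 0) t = 0 :> R by apply: Rintegral_eq0 => u; rewrite mul0r.
  have := reach_extend mO' finite_strip g0 (lexx g) gM (reach0 alpha Omega' g g) (test_fun0 g M' C0) te e0.
  rewrite Rintegral_eq0// !add0r => /(_ _)/(reach_le_P g0 gM) h; apply: le_trans (h _); last first.
    move=> t gt tM; rewrite p0 addr0 expr0n addr0 indicE mem_set ?mulr1; last by rewrite /= in_itv/= gt.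
    rewrite lerXn2r ?nnegrE ?powR_ge0// powR_le// ltW//.
  have L0 : L (fun=> 0) = 0 by rewrite /L /Rintegral integral0.
  rewrite lee_fin [X in _ <= _ + X]L0 addr0 ler_pM2l//.
  have -> : \int[mu]_t (g `^ alpha * \1_(`]g, M']%classic) t * \1_E t) =
      \int[mu]_t (g `^ alpha * \1_(`]g, M']%classic) t).
    rewrite /Rintegral; congr fine; apply: ae_eq_integral => //.
    - by apply/measurable_EFinP; apply: measurable_funM; [case: te|exact: measurable_indic].
    - by apply/measurable_EFinP; case: te.
    exists (`]g, M']%classic `&` ~` E); split.
    - by apply: measurableI; [exact: measurable_itv|exact: measurableC].
    - exact: N0.
    - move=> t /= /not_implyP[_ h2]; apply: contrapT => /not_andP h3; apply: h2; congr EFin.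
      have [hE|hE] := pselect (E t); first by rewrite [in X in _ * X = _]indicE mem_set// mulr1.
      have hc : ~ (t \in `]g, M']) by case: h3 => // /contrapT.
      by rewrite [in \1_(`]g, M']%classic) t]indicE memNset// !mulr0 mul0r.
  rewrite RintegralZl//; last first.
    apply: (test_fun_integrable g0 (C := 1) (hi := M')); split; first exact: measurable_indic.
      by move=> t; rewrite indicE; case: (_ \in _); rewrite ?normr1 ?normr0.
    move=> t h2; rewrite indicE memNset//= in_itv/= => /andP[h3 h4].
    by case: h2 => h2; [have := lt_le_trans h3 h2|have := lt_le_trans h2 h4]; rewrite ltxx.
  rewrite /Rintegral integral_indic//= setIT ler_pM2l// lebesgue_measure_itv/= lte_fin.
  case: ltP => h2; first by rewrite -EFinB.
  by rewrite subr_le0.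
have P0 : (0 <= P)%E by apply: (reach_le_P g0 (lexx g)); exact: reach0.
move: lb P0 P_fin; case: P => // Pr lb P0 _; rewrite lee_fin in P0.
(* At this height the lower bound is [Pr + 1]. *)
have := lb (g + (Pr + 1) / (2 * g `^ alpha)).
rewrite addrC addrK lee_fin addrC lerDl divr_ge0 ?addr_ge0 ?mulr_ge0 ?(ltW ga0)// => /(_ isT).
have -> : 2 * (g `^ alpha * ((Pr + 1) / (2 * g `^ alpha))) = Pr + 1.
  by field; rewrite gt_eqF.
by rewrite gerDl ler10.
Qed.

(** An open substitute for [E]: every sufficiently small cell around one of its points is live. *)
Definition essential : set R := [set t | exists2 e : R, 0 < e & mu (`]t - e, t + e[%classic `&` ~` E) = 0%E].

Let null_mono (B B' : set R) : measurable B -> measurable B' -> B `<=` B' ->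
  mu (B' `&` ~` E) = 0%E -> mu (B `&` ~` E) = 0%E.
Proof.
move=> mB mB' BB h; apply/eqP; rewrite eq_le measure_ge0 andbT -h; apply: le_measure; rewrite ?inE.
- by apply: measurableI => //; exact: measurableC.
- by apply: measurableI => //; exact: measurableC.
- by apply: setSI.
Qed.

Lemma open_essential : open essential.
Proof.
rewrite openE => t [e e0 te]; exists (e / 2) => /=; first by rewrite divr_gt0.
move=> u; rewrite /= ltr_norml => /andP[h1 h2].
exists (e / 2); first by rewrite divr_gt0.
apply: null_mono te; [exact: measurable_itv|exact: measurable_itv|].
by move=> x; rewrite /= !in_itv/= => /andP[h3 h4]; apply/andP; split; lra.
Qed.

(* Every short cell meeting a nonnegligible part of [slice > eps] outside the
   essential set lets the calibration gain [eps * delta ^ alpha]. *)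
Lemma nonessential_bounded (eps delta M : R) : 0 < eps -> 0 < delta -> delta < M ->
  mu ([set t | (eps%:E < slice Omega' t)%E] `&` (`]delta, M]%classic `\` essential)) = 0%E.
Proof.
move=> eps0 d0 dM; set D := _ `&` _.
have mess : measurable essential by apply: open_measurable; exact: open_essential.
have mD : measurable D.
  apply: measurableI; last by apply: measurableD => //; exact: measurable_itv.
  rewrite -[X in measurable X]setTI; apply: emeasurable_fun_o_infty => //; exact: measurable_slice.
have Dfin : (mu D < +oo)%E.
  apply: (@le_lt_trans _ _ (mu `]delta, M]%classic)).
    by apply: le_measure; rewrite ?inE//; move=> t [_ []].
  by rewrite lebesgue_measure_itv/= lte_fin dM -EFinB ltry.
apply/eqP; apply: contrapT => /negP/eqP D0.
have {}D0 : 0 < fine (mu D) by rewrite fine_gt0// Dfin andbT lt_neqAle measure_ge0 andbT eq_sym; apply/eqP.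
have fin_sub (B : set R) : measurable B -> B `<=` D -> mu B \is a fin_num.
  move=> mB BD; rewrite ge0_fin_numE//; apply: le_lt_trans Dfin.
  by apply: le_measure; rewrite ?inE.
(* Induction on equal cells of length [h]. A cell meeting [D] in positive measure gains at least
   [delta^alpha * eps], hence at least its share of the total, because that measure is at most [h].
   The total grows without bound as [h] tends to 0. *)
have bound (K : nat) : ((delta `^ alpha * eps * (fine (mu D) / ((M - delta) / K.+1%:R)))%:E <= P)%E.
  pose h := (M - delta) / K.+1%:R.
  have h0 : 0 < h by rewrite divr_gt0 ?subr_gt0.
  pose c (i : nat) := delta + h * i%:R.
  have cS i : c i.+1 = c i + h by rewrite /c -natr1; ring.
  have cd i : delta <= c i by rewrite lerDl mulr_ge0// ltW.
  have cK : c K.+1 = M by rewrite /c /h divfK// addrC subrK.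
  have DK : D = D `&` `]delta, c K.+1]%classic.
    by rewrite cK; apply/seteqP; split=> t; [move=> Dt; split => //; case: Dt => _ []|case].
  suff : reach alpha Omega' delta (c K.+1) 0 (delta `^ alpha * eps * (fine (mu (D `&` `]delta, c K.+1]%classic)) / h)).
    by rewrite -DK => /(reach_le_P d0 (cd _)).
  elim: K.+1 => [|i IH].
    rewrite /c mulr0 addr0 set_itvoc0// setI0 measure0 mul0r mulr0; exact: reach0.
  have mDi : measurable (D `&` `]delta, c i]%classic) by apply: measurableI => //; exact: measurable_itv.
  have mDc : measurable (D `&` `]c i, c i.+1]%classic) by apply: measurableI => //; exact: measurable_itv.
  have ccS : c i <= c i.+1 by rewrite cS lerDl ltW.
  have split_mu : mu (D `&` `]delta, c i.+1]%classic) = (mu (D `&` `]delta, c i]%classic) + mu (D `&` `]c i, c i.+1]%classic))%E.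
    rewrite -measureU//; last first.
      apply/seteqP; split => t // [[_ h1] [_ h2]]; move: h1 h2; rewrite /= !in_itv/= => /andP[_ h1] /andP[h2 _].
      by have := lt_le_trans h2 h1; rewrite ltxx.
    rewrite -setIUr; congr (mu (D `&` _)); apply/seteqP; split => t /=; rewrite !in_itv/=.
      move=> /andP[h1 h2]; have [h3|h3] := leP t (c i); first by left; rewrite h1.
      by right; rewrite h2.
    move=> [/andP[h1 h2]|/andP[h1 h2]]; first by rewrite h1 (le_trans h2).
    by rewrite h2 (le_lt_trans (cd i)).
  have f1 := fin_sub _ mDi (@subIsetl _ _ _); have f2 := fin_sub _ mDc (@subIsetl _ _ _).
  rewrite split_mu fineD//.
  set x := fine (mu (D `&` `]c i, c i.+1]%classic)).
  have xh : x <= h.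
    rewrite -lee_fin /x fineK//.
    apply: (@le_trans _ _ (mu `]c i, c i.+1]%classic)).
      by apply: le_measure; rewrite ?inE//; exact: subIsetr.
    rewrite lebesgue_measure_itv/= lte_fin cS ltrDl h0 -EFinB lee_fin; lra.
  have [x0|x0] := leP x 0.
    have x00 : x = 0 by apply/eqP; rewrite eq_le x0 fine_ge0.
    rewrite x00 addr0.
    have p0 t : primitive (fun=> 0) t = 0 :> R by apply: Rintegral_eq0 => u; rewrite mul0r.
    have := reach_extend mO' finite_strip d0 (cd i) ccS IH (test_fun0 _ _ (lexx 0)) (test_fun0 _ _ (lexx 0)) (fun=> lexx 0).
    rewrite !Rintegral_eq0// => [|t]; last by rewrite mul0r.
    have L0 : \int[@leb2_borel R]_(z in Omega') (0 : R) = 0 by rewrite /Rintegral integral0.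
    rewrite mulr0 L0 !addr0; apply => t _ _.
    by rewrite p0 addr0 expr0n/= addr0 sqr_ge0.
  have Dc0 : (0 < mu (D `&` `]c i, c i.+1]%classic))%E.
    by rewrite lt_neqAle measure_ge0 andbT eq_sym; apply/eqP => h1; move: x0; rewrite /x h1 ltxx.
  (* If almost every slice over the cell had positive length, the interior of the cell would be
     essential and [D] could meet the cell only at its right end. *)
  have dead : (0 < mu (`]c i, c i.+1]%classic `&` ~` E))%E.
    rewrite lt_neqAle measure_ge0 andbT eq_sym; apply/eqP => null.
    have : (mu (D `&` `]c i, c i.+1]%classic) <= mu [set c i.+1])%E.
      apply: le_measure; rewrite ?inE// => t [[_ [_ nU]]]; rewrite /= in_itv/= => /andP[h1 h2].
      apply/eqP; rewrite eq_le h2 leNgt; apply/negP => h3; apply: nU.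
      exists (Num.min (t - c i) (c i.+1 - t)); first by rewrite lt_min !subr_gt0 h1.
      apply: null_mono null; [exact: measurable_itv|exact: measurable_itv|].
      move=> u; rewrite /= !in_itv/= => /andP[h4 h5].
      have m1 : Num.min (t - c i) (c i.+1 - t) <= t - c i by rewrite ge_min lexx.
      have m2 : Num.min (t - c i) (c i.+1 - t) <= c i.+1 - t by rewrite ge_min lexx orbT.
      by apply/andP; split; lra.
    by rewrite lebesgue_measure_set1 leNgt Dc0.
  have Deps t : (D `&` `]c i, c i.+1]%classic) t -> (eps%:E <= slice Omega' t)%E by move=> [[/ltW]].
  have := reach_gain alpha0 mO' finite_strip d0 (cd i) ccS (ltW eps0) mDc (@subIsetr _ _ _) Dc0 Deps dead IH.
  apply: reach_le; rewrite mulrDl mulrDr lerD2l mulrAC ler_wpM2r ?(ltW eps0)//.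
  rewrite -[leRHS]mulr1; apply: ler_pM; first exact: powR_ge0.
  - by rewrite divr_ge0 ?(ltW x0) ?(ltW h0).
  - by apply: powR_le => //; exact: ltW.
  - by rewrite ler_pdivrMr// mul1r.
have P0 : (0 <= P)%E by apply: (reach_le_P d0 (lexx delta)); exact: reach0.
move: bound P0 P_fin; case: P => // Pr bound P0 _; rewrite lee_fin in P0.
pose q := delta `^ alpha * eps * fine (mu D) / (M - delta).
have q0 : 0 < q by rewrite divr_gt0 ?subr_gt0// !mulr_gt0// powR_gt0.
(* The bound for [K.+1] cells is [q * K.+1], which exceeds [Pr] for this [K]. *)
have := bound (Num.trunc (Pr / q)); rewrite lee_fin leNgt => /negP; apply.
set K := Num.trunc _; have : Pr / q < K.+1%:R by exact: truncnS_gt.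
rewrite ltr_pdivrMr//; congr (_ < _); rewrite /q.
by rewrite invf_div; ring.
Qed.

Let weight (t : R) : \bar R := ((t `^ (s - 1))%:E * slice Omega' t)%E.

Let weight_ge0 t : (0 <= weight t)%E.
Proof. by rewrite mule_ge0 ?lee_fin ?powR_ge0. Qed.

Let measurable_weight : measurable_fun setT weight.
Proof.
apply: emeasurable_funM; last exact: measurable_slice.
by apply/measurable_EFinP; exact: measurable_powR.
Qed.

Let integral_weight : (\int[mu]_t weight t = A)%E.
Proof.
exact/esym/(area_functional_ge0 mO' (measurable_powR (s - 1)) (fun t => powR_ge0 t (s - 1))).
Qed.

Let slice_le0 t : t <= 0 -> slice Omega' t = 0%E.
Proof.
move=> t0; rewrite /slice; have -> : ysection Omega' t = set0; last exact: measure0.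
apply/seteqP; split => x //; rewrite /ysection/= in_setE => /sub_half_plane/=.
by rewrite ltNge t0.
Qed.

(** Thickness and height are exhausted by countably many sets covered by [nonessential_bounded]. The
    upper end [n + 2] makes the interval of heights nondegenerate already for [n = 0]. *)
Lemma ae_essential : {ae mu, forall t, slice Omega' t != 0%E -> 0 < t /\ essential t}.
Proof.
pose D (n : nat) := [set t | ((n.+1%:R^-1)%:E < slice Omega' t)%E] `&` (`]n.+1%:R^-1, n.+2%:R]%classic `\` essential).
have lt2 (n : nat) : n.+1%:R^-1 < n.+2%:R :> R.
  by apply: (@le_lt_trans _ _ 1); [rewrite invf_le1 ?ler1n|rewrite ltr1n].
have nD n : mu.-negligible (D n).
  have mess : measurable essential by apply: open_measurable; exact: open_essential.
  have mD : measurable (D n).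
    apply: measurableI; last by apply: measurableD => //; exact: measurable_itv.
    rewrite -[X in measurable X]setTI; apply: emeasurable_fun_o_infty => //; exact: measurable_slice.
  by exists (D n); split => //; apply: nonessential_bounded; rewrite ?invr_gt0.
have := negligible_bigcup nD; apply: negligibleS => t /= /not_implyP[t0 h].
have {}t0 : (0 < slice Omega' t)%E by rewrite lt_neqAle eq_sym t0 measure_ge0.
have tp : 0 < t by rewrite ltNge; apply/negP => /slice_le0 h1; rewrite h1 ltxx in t0.
have nU : ~ essential t by move=> hU; apply: h.
have [e e0 es] : exists2 e : R, 0 < e & (e%:E < slice Omega' t)%E.
  move: t0; case: (slice Omega' t) => [x|_|//].
    by rewrite lte_fin => r0; exists (x / 2); rewrite ?lte_fin; lra.
  by exists 1; rewrite ?ltry.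
near \oo => n; exists n => //; split => /=.
  apply: lt_trans es; rewrite lte_fin; near: n; exact: near_infty_natSinv_lt (PosNum e0).
split => //; rewrite in_itv/=; apply/andP; split.
  near: n; exact: near_infty_natSinv_lt (PosNum tp).
have : t <= n%:R by near: n; exact: nbhs_infty_ger.
by move=> /le_trans; apply; rewrite ler_nat (leq_trans (leqnSn n)).
Unshelve. all: by end_near. Qed.

Let lo (n : nat) : R := n.+1%:R^-1.
Let rho (n : nat) : R := 1 + n.+1%:R^-1.
(** The cube lets the grid reach arbitrarily high: by Bernoulli, [lo * rho^m] is at least
    [(1 + (n + 1)^2) / (n + 1)], which exceeds [n + 1]. *)
Let m (n : nat) : nat := (n.+1 ^ 3)%N.

Let lo_gt0 n : 0 < lo n. Proof. by rewrite invr_gt0. Qed.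
Let rho_gt1 n : 1 < rho n. Proof. by rewrite ltrDl invr_gt0. Qed.

Let grid_large n : n.+1%:R <= grid (lo n) (rho n) (m n).
Proof.
have bern (x : R) k : 0 <= x -> 1 + k%:R * x <= (1 + x) ^+ k.
  move=> x0; elim: k => [|k IH]; first by rewrite mul0r addr0 expr0.
  rewrite exprS -natr1; apply: (@le_trans _ _ ((1 + x) * (1 + k%:R * x))).
    have : 0 <= k%:R * x * x by rewrite !mulr_ge0.
    lra.
  by rewrite ler_wpM2l// addr_ge0.
have i0 : 0 <= n.+1%:R^-1 :> R by rewrite invr_ge0.
apply: (@le_trans _ _ (lo n * (1 + (m n)%:R * n.+1%:R^-1))); last first.
  by rewrite ler_wpM2l ?(ltW (lo_gt0 n))// bern.
have n0 : n.+1%:R != 0 :> R by rewrite pnatr_eq0.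
have -> : lo n * (1 + (m n)%:R * n.+1%:R^-1) = n.+1%:R^-1 + n.+1%:R.
  by rewrite /lo /m natrX; field; rewrite addrC natr1.
by rewrite lerDr.
Qed.

Let live_n n := live_set Omega' (lo n) (rho n) (m n).

(** The cell containing [t] is shorter than [t / (n + 1)], hence eventually lies in the
    neighbourhood of [t] where almost every slice has positive length. *)
Let live_near t : 0 < t -> essential t -> \forall n \near \oo, live_n n t.
Proof.
move=> t0 [e e0 te]; have te0 : 0 < e / t by rewrite divr_gt0.
near=> n.
have lot : lo n < t by near: n; exact: near_infty_natSinv_lt (PosNum t0).
have tn : t <= n%:R by near: n; exact: nbhs_infty_ger.
have tg : t <= grid (lo n) (rho n) (m n) by rewrite (le_trans tn)// (le_trans _ (grid_large n))// ler_nat.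
have ten : t * n.+1%:R^-1 < e.
  by rewrite mulrC -ltr_pdivlMr//; near: n; exact: near_infty_natSinv_lt (PosNum te0).
have [j jm /andP[jt tj]] : exists2 j, (j < m n)%N & grid (lo n) (rho n) j < t <= grid (lo n) (rho n) j.+1.
  elim: (m n) tg => [|k IH tk].
    by rewrite /grid expr0 mulr1 => /(lt_le_trans lot); rewrite ltxx.
  have [tk'|kt] := leP t (grid (lo n) (rho n) k); last by exists k => //; rewrite kt tk.
  by have [j jk h] := IH tk'; exists j => //; exact: ltnW.
apply/live_setP; exists j => //; split; last by rewrite /cell/= in_itv/= jt tj.
apply/eqP; apply: null_mono te; [exact: measurable_itv|exact: measurable_itv|].
have gS : grid (lo n) (rho n) j.+1 = grid (lo n) (rho n) j + grid (lo n) (rho n) j * n.+1%:R^-1.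
  by rewrite /grid exprSr /rho; ring.
have gj0 := grid_gt0 (lo_gt0 n) (rho_gt1 n) j.
have i0 : 0 < n.+1%:R^-1 :> R by rewrite invr_gt0.
have gle : grid (lo n) (rho n) j * n.+1%:R^-1 <= t * n.+1%:R^-1 by rewrite ler_wpM2r// ltW.
move=> u; rewrite /cell /= !in_itv/= => /andP[h1 h2].
move: tj h2 h1 jt gle ten; rewrite gS.
set x := grid _ _ j; set y := x * n.+1%:R^-1; set v := t * n.+1%:R^-1; clearbody x y v.
by move=> h3 h4 h5 h6 h7 h8; apply/andP; split; lra.
Unshelve. all: by end_near. Qed.

Let area_n (n : nat) : R := live_area alpha gamma Omega' (lo n) (rho n) (m n).

Let integral_live n :
  (\int[mu]_t ((t `^ (s - 1) * \1_(live_n n) t)%:E * slice Omega' t) = (area_n n)%:E)%E.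
Proof.
have ml : measurable (live_n n).
  exact: measurable_live_set.
have mf : measurable_fun setT (fun t : R => t `^ (s - 1) * \1_(live_n n) t).
  by apply: measurable_funM; [exact: measurable_powR|exact: measurable_indic].
have f0 t : 0 <= t `^ (s - 1) * \1_(live_n n) t by rewrite mulr_ge0// powR_ge0.
rewrite -(area_functional_ge0 mO' mf f0) /area_n /live_area /Rintegral fineK//.
rewrite ge0_fin_numE; last by apply: integral_ge0 => z _; rewrite lee_fin.
apply: le_lt_trans A_fin; apply: ge0_le_integral => //.
- by move=> z _; rewrite lee_fin.
- apply/measurable_EFinP; apply: measurable_funTS; exact: (measurableT_comp mf measurable_snd).
- apply/measurable_EFinP; apply: measurable_funTS.
  exact: (measurableT_comp (measurable_powR _) measurable_snd).
- by move=> z _; rewrite lee_fin -[leRHS]mulr1 ler_wpM2l ?powR_ge0// indicE; case: (_ \in _).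
Qed.

(** Almost every height with a slice of positive length is eventually in a live cell, and the full
    weight dominates. *)
Let area_cvg : area_n n @[n --> \oo] --> fine A.
Proof.
have Afin : A \is a fin_num by rewrite ge0_fin_numE// ltW.
have [|||||_ _ cv] := @dominated_convergence _ _ _ mu setT measurableT
  (fun n t => ((t `^ (s - 1) * \1_(live_n n) t)%:E * slice Omega' t)%E) weight weight.
- move=> n; apply: emeasurable_funM; last exact: measurable_slice.
  apply/measurable_EFinP; apply: measurable_funM; first exact: measurable_powR.
  by apply: measurable_indic; exact: measurable_live_set.
- exact: measurable_weight.
- have [Z [mZ Z0 ZS]] := ae_essential; exists Z; split => //; apply: subset_trans ZS => t /=.
  apply: contra_not => h _.
  have [t0|/h[tp te]] := eqVneq (slice Omega' t) 0%E.
    by rewrite /weight t0 mule0; under eq_fun do rewrite mule0; exact: cvg_cst.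
  apply: cvg_near_cst; near=> n; rewrite /weight indicE mem_set ?mulr1//.
  by near: n; exact: live_near.
- apply/integrableP; split; first exact: measurable_weight.
  by under eq_integral do rewrite gee0_abs//; rewrite integral_weight.
- apply: aeW => t n _; rewrite gee0_abs; last by rewrite mule_ge0// lee_fin mulr_ge0// powR_ge0.
  apply: lee_wpmul2r => //; rewrite lee_fin -[leRHS]mulr1 ler_wpM2l ?powR_ge0// indicE.
have := cv; rewrite integral_weight.
rewrite (_ : (fun n => _) = (fun n => (area_n n)%:E)); last by apply/funext => n; rewrite integral_live.
by rewrite -[X in _ --> X](fineK Afin) => /fine_cvgP[].
Unshelve. all: by end_near. Qed.

(** As [rho] tends to 1 and [lo] to 0, both the factor [theta] and the correction below [lo]
    disappear. *)
Theorem perimeter_ge :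
  ((isop_const alpha gamma * fine A `^ ((alpha + 1) / (s + 1)))%:E <= P)%E.
Proof.
set p := (alpha + 1) / (s + 1).
have A0 : 0 < fine A by rewrite fine_gt0// A_gt0.
have bound n : ((theta alpha (rho n) * (isop_const alpha gamma * area_n n `^ p -
    2 * (lo n `^ (alpha + 1) / (alpha + 1))))%:E <= P)%E.
  have [M' gM N0] := gap_beyond (grid_gt0 (lo_gt0 n) (rho_gt1 n) (m n)).
  exact: (grid_bound alpha0 gamma0 gamma_le mO' finite_strip cal (lo_gt0 n) (rho_gt1 n) gM N0).
have lo_cvg : lo n @[n --> \oo] --> (0 : R) by exact: cvg_harmonic.
have rho_cvg : rho n @[n --> \oo] --> (1 : R).
  by rewrite -[X in _ --> X]addr0; apply: cvgD => //; exact: cvg_cst.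
have a1 : 0 < alpha + 1 by rewrite ltr_wpDl.
have th_cvg : theta alpha (rho n) @[n --> \oo] --> (1 : R).
  have h := @powR_continuous R (- alpha) 1 ltr01.
  rewrite (_ : 1 = 1 `^ (- alpha)); last by rewrite powR1.
  exact: (continuous_cvg _ h rho_cvg).
have lop_cvg : lo n `^ (alpha + 1) @[n --> \oo] --> (0 : R).
  apply: (@squeeze_cvgr _ _ _ _ (fun=> 0) lo); [|exact: cvg_cst|exact: lo_cvg].
  apply: nearW => n; rewrite powR_ge0/= ge1r_powR//; last by rewrite lerDr.
  by rewrite lo_gt0/= invf_le1// ler1n.
have area_p : area_n n `^ p @[n --> \oo] --> fine A `^ p.
  exact: (continuous_cvg _ (powR_continuous A0) area_cvg).
have cv : theta alpha (rho n) * (isop_const alpha gamma * area_n n `^ p -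
    2 * (lo n `^ (alpha + 1) / (alpha + 1))) @[n --> \oo] --> isop_const alpha gamma * fine A `^ p.
  rewrite -[X in _ --> X]mul1r; apply: cvgM => //.
  rewrite -[X in _ --> X]subr0; apply: cvgB; first by apply: cvgM => //; exact: cvg_cst.
  rewrite (_ : 0 = 2 * (0 / (alpha + 1))); last by rewrite mul0r mulr0.
  apply: cvgM; first exact: cvg_cst.
  by apply: cvgM => //; exact: cvg_cst.
have ecv : (theta alpha (rho n) * (isop_const alpha gamma * area_n n `^ p -
    2 * (lo n `^ (alpha + 1) / (alpha + 1))))%:E @[n --> \oo] --> (isop_const alpha gamma * fine A `^ p)%:E.
  by apply: cvg_EFin; [exact: nearW|exact: cv].
by apply: (cvge_le _ ecv); apply: nearW.
Qed.

End perimeter_lower_bound.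

(** * The optimal profile *)

Section bounded_interval.
Context {R : realType}.
Notation mu := (@lebesgue_measure R).

Lemma lebesgue_itv_fin (a b : bool) (u v : R) : (mu [set` Interval (BSide a u) (BSide b v)] < +oo)%E.
Proof. by rewrite lebesgue_measure_itv/=; case: ifP => _; rewrite ?ltry// -EFinB ltry. Qed.

Lemma integrable_bounded_itv (a b : bool) (u v C : R) (f : R -> R) :
  measurable_fun [set` Interval (BSide a u) (BSide b v)] f -> (forall x, `|f x| <= C) ->
  mu.-integrable [set` Interval (BSide a u) (BSide b v)] (EFin \o f).
Proof.
move=> mf fC; apply: measurable_bounded_integrable => //; first exact: lebesgue_itv_fin.
exists C; split; first exact: num_real.
by move=> M CM x _ /=; rewrite (le_trans (fC x))// ltW.
Qed.

End bounded_interval.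

(** * The profile and its derivative *)

Section profile_function.
Context {R : realType}.
Notation mu := (@lebesgue_measure R).
Variable g : R.
Hypothesis g0 : 0 < g.

Definition profile_slope (t : R) : R := t `^ g / Num.sqrt (1 - t `^ (2 * g)).
Notation psi := profile_slope.

Definition profile_fun (y : R) : R := \int[mu]_(t in `]y, 1[) psi t.

Let g2 : 0 < 2 * g. Proof. by rewrite mulr_gt0. Qed.

Lemma pow_lt1 (q t : R) : 0 < q -> 0 < t -> t < 1 -> 0 < 1 - t `^ q.
Proof.
move=> q0 t0 t1; have -> : 1 = 1 `^ q :> R by rewrite powR1.
by rewrite subr_gt0; apply: gt0_ltr_powR; rewrite ?nnegrE// ltW.
Qed.

Let root_gt0 (t : R) : 0 < t -> t < 1 -> 0 < Num.sqrt (1 - t `^ (2 * g)).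
Proof. by move=> t0 t1; rewrite sqrtr_gt0 pow_lt1. Qed.

Lemma is_derive_root (t : R) : 0 < t -> t < 1 ->
  is_derive t 1 (fun t => Num.sqrt (1 - t `^ (2 * g)))
    (- g * (t `^ (2 * g - 1) / Num.sqrt (1 - t `^ (2 * g)))).
Proof.
move=> t0 t1; have h := pow_lt1 g2 t0 t1.
have d1 : is_derive t 1 (fun t => 1 - t `^ (2 * g)) (0 - 2 * g * t `^ (2 * g - 1)).
  exact: is_deriveB (is_derive_cst _ _ _) (is_derive1_powR _ t0).
have := @is_derive1_comp _ Num.sqrt (fun t => 1 - t `^ (2 * g)) t _ _ (is_derive1_sqrt h) d1.
congr is_derive; have := root_gt0 t0 t1 => r0.
by field; rewrite gt_eqF.
Qed.

Let root_continuous (t : R) : 0 < t -> {for t, continuous (fun t => Num.sqrt (1 - t `^ (2 * g)))}.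
Proof.
move=> t0; apply: (@continuous_comp _ _ _ (fun t => 1 - t `^ (2 * g)) Num.sqrt); last exact: sqrt_continuous.
by apply: cvgB; [exact: cvg_cst|exact: powR_continuous].
Qed.

(** With the exponent [2g - 1] the integrand has an elementary primitive; it is the integrable
    majorant near [t = 1] for the other powers. *)
Lemma integral_root_slope (y : R) : 0 <= y -> y < 1 ->
  (\int[mu]_(t in `]y, 1%R[) (t `^ (2 * g - 1) / Num.sqrt (1 - t `^ (2 * g)))%:E =
   (Num.sqrt (1 - y `^ (2 * g)) / g)%:E)%E.
Proof.
move=> y0 y1.
pose F t := - g^-1 * Num.sqrt (1 - t `^ (2 * g)).
transitivity ((0 - - g^-1 * Num.sqrt (1 - y `^ (2 * g)))%:E); last first.
  by congr EFin; rewrite sub0r mulNr opprK mulrC.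
apply: (@ge0_FTC_open R y 1 (- g^-1 * Num.sqrt (1 - y `^ (2 * g))) 0
  (fun t => t `^ (2 * g - 1) / Num.sqrt (1 - t `^ (2 * g))) F y1).
- move=> t /andP[yt t1]; have t0 : 0 < t by exact: le_lt_trans yt.
  apply: cvgM; first exact: powR_continuous.
  by apply: cvgV; [rewrite gt_eqF// root_gt0|exact: root_continuous].
- move=> t /andP[yt t1]; have t0 : 0 < t by exact: le_lt_trans yt.
  have := @is_deriveZ _ _ _ _ (- g^-1) _ _ _ (is_derive_root t0 t1).
  congr is_derive; rewrite /GRing.scale/= mulrA mulrNN mulVf ?mul1r// gt_eqF//.
- apply: cvgM; first exact: cvg_cst.
  apply: (@continuous_cvg _ _ _ _ _ (fun x => 1 - x `^ (2 * g)) Num.sqrt); first exact: sqrt_continuous.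
  apply: cvgB; first exact: cvg_cst.
  move: y0; rewrite le_eqVlt => /predU1P[<-|y0].
    by rewrite powR0 ?gt_eqF//; exact: powR_cvg0.
  by apply: cvg_at_right_filter; exact: powR_continuous.
- rewrite -[X in _ --> X](_ : - g^-1 * Num.sqrt (1 - 1 `^ (2 * g)) = 0); last first.
    by rewrite powR1 subrr sqrtr0 mulr0.
  by apply: cvgM; [exact: cvg_cst|apply: cvg_at_left_filter; exact: root_continuous].
- by move=> t /andP[_ t1]; rewrite divr_ge0 ?powR_ge0 ?sqrtr_ge0.
Qed.

Lemma profile_slope_ge0 t : 0 <= psi t.
Proof. by rewrite divr_ge0 ?powR_ge0 ?sqrtr_ge0. Qed.

Lemma profile_slope_continuous (t : R) : 0 < t -> t < 1 -> {for t, continuous psi}.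
Proof.
move=> t0 t1; apply: cvgM; first exact: powR_continuous.
by apply: cvgV; [rewrite gt_eqF// root_gt0|exact: root_continuous].
Qed.

Lemma measurable_root_slope (q : R) : measurable_fun setT (fun t : R => t `^ q / Num.sqrt (1 - t `^ (2 * g))).
Proof.
apply: measurable_funM; first exact: measurable_powR.
rewrite (_ : (fun t => _) = (fun t => Num.sqrt (1 - t `^ (2 * g)) `^ (-1))); last first.
  by apply/funext => t; rewrite powR_inv1// sqrtr_ge0.
apply: (measurableT_comp (measurable_powR (-1))); apply: measurable_sqrt_comp.
by apply: measurable_funB => //; exact: measurable_powR.
Qed.

Lemma profile_slope_le (y t : R) : 0 < y -> y <= t -> t <= 1 ->
  psi t <= (y `^ (1 - g) + 1) * (t `^ (2 * g - 1) / Num.sqrt (1 - t `^ (2 * g))).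
Proof.
move=> y0 yt t1; have t0 : 0 < t by exact: lt_le_trans yt.
rewrite mulrA ler_wpM2r ?invr_ge0 ?sqrtr_ge0//.
have -> : t `^ g = t `^ (1 - g) * t `^ (2 * g - 1).
  by rewrite -powRD ?(gt_eqF t0) ?implybT//; congr (_ `^ _); ring.
by rewrite ler_wpM2r ?powR_ge0//; have := powR_between (1 - g) y0 yt t1; rewrite powR1.
Qed.

Lemma integrable_profile_slope (y : R) : 0 < y -> mu.-integrable `]y, 1[ (EFin \o psi).
Proof.
move=> y0; have [y1|y1] := ltP y 1; last by rewrite set_itv_ge ?bnd_simp -?leNgt//; exact: integrable_set0.
have mp : measurable_fun `]y, 1[ (EFin \o psi).
  by apply/measurable_EFinP; apply: measurable_funTS; exact: measurable_root_slope.
apply: (@le_integrable _ _ _ mu _ _ _ (fun t => ((y `^ (1 - g) + 1) * (t `^ (2 * g - 1) / Num.sqrt (1 - t `^ (2 * g))))%:E)) => //.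
  move=> t; rewrite /= in_itv/= => /andP[yt t1]; rewrite lee_fin.
  rewrite (ger0_norm (profile_slope_ge0 t)) ger0_norm ?profile_slope_le ?(ltW yt) ?(ltW t1)//.
  by rewrite !mulr_ge0 ?addr_ge0 ?powR_ge0 ?invr_ge0 ?sqrtr_ge0.
suff : mu.-integrable `]y, 1[ (EFin \o (fun t => t `^ (2 * g - 1) / Num.sqrt (1 - t `^ (2 * g)))).
  exact: integrableZl.
apply/integrableP; split.
  by apply/measurable_EFinP; apply: measurable_funTS; exact: measurable_root_slope.
under eq_integral => t _ do rewrite /= ger0_norm ?divr_ge0 ?powR_ge0 ?sqrtr_ge0//.
by rewrite integral_root_slope ?ltry// ltW.
Qed.

Lemma profile_fun_ge0 y : 0 <= profile_fun y.
Proof. by apply: Rintegral_ge0 => t _; exact: profile_slope_ge0. Qed.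

Lemma profile_fun_gt0 (y : R) : 0 < y -> y < 1 -> 0 < profile_fun y.
Proof.
move=> y0 y1; have ip := integrable_profile_slope y0.
apply: (@lt_le_trans _ _ (\int[mu]_(t in `]y, 1[) (cst (y `^ g) t))).
  rewrite Rintegral_cst// (_ : fine _ = 1 - y); last first.
    by transitivity (fine (mu `]y, 1[%classic)) => //; rewrite lebesgue_measure_itv/= lte_fin y1.
  by rewrite mulr_gt0 ?powR_gt0 ?subr_gt0.
apply: le_Rintegral => //.
  by apply: (@integrable_bounded_itv _ _ _ _ _ `|y `^ g|) => //; exact: measurable_cst.
move=> t; rewrite /= in_itv/= => /andP[yt t1]; have t0 : 0 < t by exact: lt_trans yt.
rewrite /psi -[leLHS]mulr1; apply: ler_pM; rewrite ?powR_ge0//.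
  by apply: powR_le; exact: ltW.
rewrite invf_ge1 ?root_gt0//.
by rewrite -[leRHS]sqrtr1 ler_sqrt// gerBl powR_ge0.
Qed.

Lemma profile_fun_split (y0 t : R) : 0 < y0 -> y0 <= t -> t < 1 ->
  profile_fun t = profile_fun y0 - \int[mu]_(u in `]y0, t]) psi u.
Proof.
move=> y00 yt t1; rewrite /profile_fun.
rewrite -(@Rintegral_itvB R psi (BRight y0) (BLeft 1) t) ?opprB ?addrCA ?subrr ?addr0//.
- exact: integrable_profile_slope.
Qed.

(** Near [t] the profile is a constant minus an integral with fixed lower end [y0 < t], to which the
    fundamental theorem applies. *)
Lemma is_derive_profile_fun (t : R) : 0 < t -> t < 1 -> is_derive t 1 profile_fun (- psi t).
Proof.
move=> t0 t1; pose y0 := t / 2; pose u := (t + 1) / 2.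
have y00 : 0 < y0 by rewrite /y0; lra.
have yt : y0 < t by rewrite /y0; lra.
have tu : t < u by rewrite /u; lra.
have u1 : u < 1 by rewrite /u; lra.
have iu : mu.-integrable `]y0, u] (EFin \o psi).
  apply: integrableS (integrable_profile_slope y00) => //.
  by move=> x; rewrite /= !in_itv/= => /andP[-> h]; exact: le_lt_trans u1.
have [dF dE] := continuous_FTC1 tu iu (yt : (BRight y0 < BRight t)%O) (profile_slope_continuous t0 t1).
have d1 : is_derive t 1 (fun x => \int[mu]_(v in `]y0, x]) psi v) (psi t).
  by split; [exact: dF|rewrite -derive1E].
have d2 := is_deriveB (is_derive_cst (profile_fun y0) t (1 : R)) d1.
rewrite sub0r in d2.
apply: near_eq_is_derive d2; near=> x.
rewrite (@profile_fun_split y0 x)//.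
- by apply: ltW; near: x; exact: lt_nbhsr.
- by near: x; exact: lt_nbhsl.
Unshelve. all: by end_near. Qed.

Lemma profile_fun_continuous (t : R) : 0 < t -> t < 1 -> {for t, continuous profile_fun}.
Proof.
move=> t0 t1; apply: differentiable_continuous; apply/derivable1_diffP.
exact: (@ex_derive _ _ _ _ _ _ _ (is_derive_profile_fun t0 t1)).
Qed.

Lemma profile_fun_cvg1 : profile_fun t @[t --> 1^'-] --> (0 : R).
Proof.
pose C : R := (1 / 2) `^ (1 - g) + 1.
have h : C * (Num.sqrt (1 - t `^ (2 * g)) / g) @[t --> (1 : R)^'-] --> (0 : R).
  rewrite -[X in _ --> X](_ : C * (Num.sqrt (1 - 1 `^ (2 * g)) / g) = 0); last first.
    by rewrite powR1 subrr sqrtr0 mul0r mulr0.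
  apply: cvgM; first exact: cvg_cst.
  by apply: cvgM; [apply: cvg_at_left_filter; exact: root_continuous|exact: cvg_cst].
apply: squeeze_cvgr (cvg_cst _) h; near=> t; rewrite profile_fun_ge0/=.
have t12 : 1 / 2 < t by near: t; apply: nbhs_left_gt; lra.
have t1 : t < 1 by near: t; exact: nbhs_left_lt.
have t0 : 0 < t by lra.
rewrite -lee_fin -[leRHS]EFinM /profile_fun /Rintegral fineK; last first.
  by apply: integrable_fin_num; [exact: measurable_itv|exact: integrable_profile_slope].
rewrite EFinM -integral_root_slope ?(ltW t0)// -ge0_integralZl_EFin//.
- apply: ge0_le_integral => //.
  + by move=> u _; rewrite lee_fin profile_slope_ge0.
  + by apply/measurable_EFinP; apply: measurable_funTS; exact: measurable_root_slope.
  + apply/measurable_EFinP; apply: measurable_funM => //.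
    by apply: measurable_funTS; exact: measurable_root_slope.
  + move=> u; rewrite /= in_itv/= => /andP[tu u1]; rewrite lee_fin.
    by apply: profile_slope_le; lra.
- by move=> u _; rewrite lee_fin divr_ge0 ?powR_ge0 ?sqrtr_ge0.
- by apply/measurable_EFinP; apply: measurable_funTS; exact: measurable_root_slope.
- by rewrite addr_ge0 ?powR_ge0.
Unshelve. all: by end_near. Qed.

(** The change of variable [x = f(t)], [dx = - psi dt]. Horizontal slices are thereby parametrized
    by the height of the boundary point above them, which avoids the inverse of the profile. *)
Lemma profile_substitution (q : R -> R) (C y : R) : continuous q -> (forall x, `|q x| <= C) ->
  0 < y -> y < 1 ->
  \int[mu]_(t in `]y, 1[) (psi t * q (profile_fun t)) = \int[mu]_(x in `]0, profile_fun y[) q x.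
Proof.
move=> cq qC y0 y1; have C0 : 0 <= C by rewrite (le_trans _ (qC 0)).
have mq : measurable_fun setT q by exact: continuous_measurable_fun.
have iq (a b : bool) (u v : R) : mu.-integrable [set` Interval (BSide a u) (BSide b v)] (EFin \o q).
  by apply: (@integrable_bounded_itv _ _ _ _ _ C) => //; exact: measurable_funTS.
(* Basing the primitive at -1 makes it continuous at 0, the limit of the profile at height 1. *)
pose G x := \int[mu]_(u in `]-1, x]) q u.
have dG (x : R) : -1 < x -> is_derive x 1 G (q x).
  move=> x1; have xx : x < x + 1 by rewrite ltrDl.
  have [dG dE] := continuous_FTC1 xx (iq false false (-1) (x + 1)) (x1 : (BRight (-1) < BRight x)%O) (cq x).
  by split; [exact: dG|rewrite -derive1E].
have cG (x : R) : -1 < x -> {for x, continuous G}.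
  move=> x1; apply: differentiable_continuous; apply/derivable1_diffP.
  exact: (@ex_derive _ _ _ _ _ _ _ (dG _ x1)).
have fp (t : R) : 0 < t -> t < 1 -> -1 < profile_fun t.
  by move=> t0 t1; rewrite (lt_trans _ (profile_fun_gt0 t0 t1))// ltrN10.
have ip := integrable_profile_slope y0.
have mqf : measurable_fun `]y, 1[ (fun t => q (profile_fun t)).
  apply: (measurableT_comp mq); apply: open_continuous_measurable_fun; first exact: interval_open.
  move=> t; rewrite inE/= in_itv/= => /andP[yt t1]; apply: profile_fun_continuous => //.
  exact: lt_trans yt.
transitivity (- G 0 - - G (profile_fun y)); last first.
  rewrite opprK addrC -(@Rintegral_itvB R q (BRight (-1)) (BLeft (profile_fun y)) 0) ?bnd_simp//.
  - by rewrite /G -Rintegral_itv_bndo_bndc//; exact: (iq false true).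
  - by rewrite profile_fun_gt0.
rewrite /Rintegral (_ : (\int[mu]_(t in _) _)%E = (- G 0 - - G (profile_fun y))%:E)//.
apply: (@integrable_FTC_open R y 1 _ _ _ (fun t => - G (profile_fun t))) => //.
- move=> t /andP[yt t1]; have t0 : 0 < t by exact: lt_trans yt.
  apply: cvgM; first exact: profile_slope_continuous.
  apply: (@continuous_cvg _ _ _ _ _ profile_fun q); first exact: cq.
  exact: profile_fun_continuous.
- move=> t /andP[yt t1]; have t0 : 0 < t by exact: lt_trans yt.
  have := is_deriveN (is_derive1_comp (dG _ (fp _ t0 t1)) (is_derive_profile_fun t0 t1)).
  by congr is_derive; rewrite mulrN opprK mulrC.
- apply: cvgN; apply: (@continuous_cvg _ _ _ _ _ profile_fun G); first exact: cG (fp _ y0 y1).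
  by apply: cvg_at_right_filter; exact: profile_fun_continuous.
- apply: cvgN; apply: (@continuous_cvg _ _ _ _ _ profile_fun G); first by apply: cG; rewrite ltrN10.
  exact: profile_fun_cvg1.
- apply: (@le_integrable _ _ _ mu _ _ _ (fun t => (C * psi t)%:E)) => //.
  + apply/measurable_EFinP; apply: measurable_funM => //.
    by apply: measurable_funTS; exact: measurable_root_slope.
  + move=> t _; rewrite lee_fin normrM mulrC (ger0_norm (profile_slope_ge0 t)).
    have cp : 0 <= C * psi t by rewrite mulr_ge0// profile_slope_ge0.
    by rewrite (ger0_norm cp); apply: ler_wpM2r; [exact: profile_slope_ge0|exact: qC].
  + have mI : measurable (`]y, 1[%classic : set (measurableTypeR R)) by exact: measurable_itv.
    by have := integrableZl mI C ip; apply: eq_integrable => // t _; rewrite /= EFinM.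
Qed.

End profile_function.

(** * Components of compactly supported fields *)

Section components.
Context {R : realType}.

Lemma is_derive_fst (V : normedModType R) (f : V -> R * R) (z e : V) (d : R * R) :
  is_derive z e f d -> is_derive z e (fst \o f) d.1.
Proof.
move=> [fd fE].
have c : (fun h : R => h^-1 *: (((fst \o f) \o shift z) (h *: e) - (fst \o f) z)) @ 0^' --> d.1.
  rewrite -fE; have h : {for 'D_e f z, continuous (@fst R R)} by exact: cvg_fst.
  exact: (@continuous_cvg _ _ _ _ _ _ (@fst R R) _ h fd).
by apply: DeriveDef; [apply/cvg_ex; exists d.1|exact/cvg_lim].
Qed.

Lemma is_derive_snd (V : normedModType R) (f : V -> R * R) (z e : V) (d : R * R) :
  is_derive z e f d -> is_derive z e (snd \o f) d.2.
Proof.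
move=> [fd fE].
have c : (fun h : R => h^-1 *: (((snd \o f) \o shift z) (h *: e) - (snd \o f) z)) @ 0^' --> d.2.
  rewrite -fE; have h : {for 'D_e f z, continuous (@snd R R)} by exact: cvg_snd.
  exact: (@continuous_cvg _ _ _ _ _ _ (@snd R R) _ h fd).
by apply: DeriveDef; [apply/cvg_ex; exists d.2|exact/cvg_lim].
Qed.

Lemma is_derive_slice_x (f : R * R -> R) (x y d : R) :
  is_derive (x, y) (@e_x R) f d -> is_derive x 1 (fun s => f (s, y)) d.
Proof.
have E : (fun h : R => h^-1 *: ((f \o shift (x, y)) (h *: @e_x R) - f (x, y))) =
    (fun h : R => h^-1 *: (((fun s => f (s, y)) \o shift x) (h *: (1 : R)) - f (x, y))).
  apply/funext => h; rewrite /= [h *: e_x R]surjective_pairing /e_x /=.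
  by congr (_ *: (f _ - _)); congr (_, _); rewrite /GRing.scale/= mulr0 add0r.
by move=> [fd fE]; split; [rewrite /derivable -E|rewrite -fE /derive E].
Qed.

Lemma is_derive_slice_y (f : R * R -> R) (x y d : R) :
  is_derive (x, y) (@e_y R) f d -> is_derive y 1 (fun t => f (x, t)) d.
Proof.
have E : (fun h : R => h^-1 *: ((f \o shift (x, y)) (h *: @e_y R) - f (x, y))) =
    (fun h : R => h^-1 *: (((fun t => f (x, t)) \o shift y) (h *: (1 : R)) - f (x, y))).
  apply/funext => h; rewrite /= [h *: e_y R]surjective_pairing /e_y /=.
  by congr (_ *: (f _ - _)); congr (_, _); rewrite /GRing.scale/= mulr0 add0r.
by move=> [fd fE]; split; [rewrite /derivable -E|rewrite -fE /derive E].
Qed.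

Lemma lipschitz_of_derivative (f df : R -> R) (C x y : R) : (forall t : R, is_derive t 1 f (df t)) ->
  (forall t, `|df t| <= C) -> `|f x - f y| <= C * `|x - y|.
Proof.
move=> dF dC; wlog xy : x y / y <= x.
  move=> H; have [/H//|/ltW/H] := leP y x.
  by rewrite distrC [`|y - x|]distrC.
have cf : continuous f.
  move=> t; apply: differentiable_continuous; apply/derivable1_diffP.
  exact: (@ex_derive _ _ _ _ _ _ _ (dF t)).
have [c _ ->] := MVT_segment xy (fun t _ => dF t) (continuous_subspaceT cf).
by rewrite normrM ler_wpM2r.
Qed.

Lemma bounded_of_compact (f : R * R -> R) (K : set (R * R)) : compact K -> continuous f ->
  (forall z, ~ K z -> f z = 0) -> exists2 C, 0 <= C & forall z, `|f z| <= C.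
Proof.
move=> cK cf f0.
have : bounded_set (f @` K).
  by apply: compact_bounded; apply: continuous_compact => //; exact: continuous_subspaceT.
move=> [M [_ HM]]; exists (`|M| + 1); first by rewrite addr_ge0.
move=> z; have [Kz|nKz] := pselect (K z); last by rewrite f0// normr0 addr_ge0.
apply: (HM (`|M| + 1)); last by exists z.
by rewrite (le_lt_trans (ler_norm M))// ltrDl.
Qed.

Lemma compact_half_plane (K : set (R * R)) : compact K -> K `<=` @half_plane R ->
  exists delta M, [/\ 0 < delta, 0 <= M & forall z, K z -> [/\ `|z.1| <= M, delta <= z.2 & z.2 <= M]].
Proof.
move=> cK Kh; have [M [_ HM]] := compact_bounded cK.
have c2 : compact (snd @` K).
  apply: continuous_compact => //; apply: continuous_subspaceT => z.
  exact: cvg_snd.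
have n0 : ~ (snd @` K) 0.
  by move=> [z /Kh]; rewrite /half_plane/= => z0 zE; rewrite zE ltxx in z0.
have : open (~` (snd @` K)) by apply: closed_openC; apply: compact_closed c2; exact: Rhausdorff.
rewrite openE => /(_ 0 n0) [delta /= d0 hd].
exists delta, (`|M| + 1); split; [exact: d0|by rewrite addr_ge0|].
move=> z Kz; have z0 := Kh _ Kz; rewrite /half_plane/= in z0.
have hM : `|z| <= `|M| + 1.
  by apply: (HM (`|M| + 1)) => //; rewrite (le_lt_trans (ler_norm M))// ltrDl.
have [h1 h2] : `|z.1| <= `|M| + 1 /\ `|z.2| <= `|M| + 1.
  by split; apply: le_trans hM; rewrite prod_normE/= le_max lexx ?orbT.
split => //; last by rewrite -(ger0_norm (ltW z0)).
rewrite leNgt; apply/negP => zd; apply: (hd z.2); last by exists z.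
by rewrite /= sub0r normrN ger0_norm// ltW.
Qed.

(** Off the support the field and its partials vanish, so bounds and continuity extend from the
    half-plane to the whole plane. *)
Lemma C1c_half_plane_components (v : R * R -> R * R) : C1c_half_plane v ->
  exists (b1 b2 b1x b2y : R * R -> R) (C delta M : R),
  [/\ forall z, v z = (b1 z, b2 z), 0 < delta & 0 <= M] /\
  [/\ forall z, is_derive z (@e_x R) b1 (b1x z), forall z, is_derive z (@e_y R) b2 (b2y z),
      (forall z, [/\ `|b1 z| <= C, `|b2 z| <= C, `|b1x z| <= C & `|b2y z| <= C]),
      [/\ continuous b1, continuous b2, continuous b1x & continuous b2y] &
      (forall z, [\/ M < `|z.1|, z.2 < delta | M < z.2] -> [/\ b1 z = 0, b2 z = 0, b1x z = 0 & b2y z = 0])].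
Proof.
move=> [C1 cK Kh]; set K := closure _ in cK Kh.
have oK : open (~` K) by apply: closed_openC; exact: closed_closure.
have v0 z : ~ K z -> v z = 0.
  by move=> nK; apply/eqP/negPn/negP => h; apply: nK; apply: subset_closure.
have near0 z : ~ K z -> \forall w \near z, v w = (cst 0 : R * R -> R * R) w.
  by move=> nK; have : nbhs z (~` K) by [apply: open_nbhs_nbhs; split]; apply: filterS => w; exact: v0.
have der0 z e : ~ K z -> is_derive z e v 0.
  move=> nK; apply: (near_eq_is_derive (f := cst 0)) (is_derive_cst _ _ _).
  by apply: filterS (near0 _ nK) => w ->.
have dx z : is_derive z (@e_x R) v ('D_(@e_x R) v z).
  have [hz|hz] := pselect (half_plane z); first by have [h _ _ _] := C1 _ hz; exact/derivableP.
  have nK : ~ K z by move=> /Kh.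
  by have h := der0 z (@e_x R) nK; rewrite derive_val.
have dy z : is_derive z (@e_y R) v ('D_(@e_y R) v z).
  have [hz|hz] := pselect (half_plane z); first by have [_ h _ _] := C1 _ hz; exact/derivableP.
  have nK : ~ K z by move=> /Kh.
  by have h := der0 z (@e_y R) nK; rewrite derive_val.
have D0 z e : ~ K z -> 'D_e v z = 0 by move=> nK; have h := der0 z e nK; rewrite derive_val.
have D0c z e : ~ K z -> {for z, continuous ('D_e v)}.
  move=> nK; apply: (@near_eq_continuous_at _ _ (cst 0)); last exact: cst_continuous.
  by have : nbhs z (~` K) by [apply: open_nbhs_nbhs; split]; apply: filterS => w; exact: D0.
have cdx : continuous ('D_(@e_x R) v).
  move=> z; have [hz|hz] := pselect (half_plane z); first by have [_ _ h _] := C1 _ hz.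
  by apply: D0c => /Kh.
have cdy : continuous ('D_(@e_y R) v).
  move=> z; have [hz|hz] := pselect (half_plane z); first by have [_ _ _ h] := C1 _ hz.
  by apply: D0c => /Kh.
have c1 (f : R * R -> R * R) : continuous f -> continuous (fst \o f).
  by move=> cf z; apply: continuous_comp; [exact: cf|exact: cvg_fst].
have c2 (f : R * R -> R * R) : continuous f -> continuous (snd \o f).
  by move=> cf z; apply: continuous_comp; [exact: cf|exact: cvg_snd].
have dx1 z := is_derive_fst (dx z); have dx2 z := is_derive_snd (dx z).
have dy1 z := is_derive_fst (dy z); have dy2 z := is_derive_snd (dy z).
have bd (f : R * R -> R) : continuous f -> (forall z, ~ K z -> f z = 0) -> exists2 C, 0 <= C & forall z, `|f z| <= C.
  exact: bounded_of_compact.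
have K1 e z : ~ K z -> (fst \o 'D_e v) z = 0 by move=> nK; rewrite /= D0.
have K2 e z : ~ K z -> (snd \o 'D_e v) z = 0 by move=> nK; rewrite /= D0.
have [A1 A10 bA1] := bd _ (c1 _ cdx) (K1 _).
have [A2 A20 bA2] := bd _ (c2 _ cdx) (K2 _).
have [A3 A30 bA3] := bd _ (c1 _ cdy) (K1 _).
have [A4 A40 bA4] := bd _ (c2 _ cdy) (K2 _).
(* [C1_on] speaks of the partial derivatives and their continuity; continuity of the field itself
   comes from their boundedness. *)
have lip (f fx fy : R * R -> R) (B1 B2 : R) : 0 <= B1 -> 0 <= B2 ->
    (forall z, is_derive z (@e_x R) f (fx z)) -> (forall z, is_derive z (@e_y R) f (fy z)) ->
    (forall z, `|fx z| <= B1) -> (forall z, `|fy z| <= B2) -> continuous f.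
  move=> B10 B20 fxd fyd hx hy; apply: (@lip_prod_continuous _ _ (B1 + B2)) => x y x' y'.
  have -> : f (x, y) - f (x', y') = (f (x, y) - f (x', y)) + (f (x', y) - f (x', y')) by ring.
  rewrite (le_trans (ler_normD _ _))// mulrDr lerD//.
    apply: (le_trans (@lipschitz_of_derivative (fun s => f (s, y)) (fun s => fx (s, y)) B1 x x' _ _)).
    - by move=> t; apply: is_derive_slice_x; exact: fxd.
    - by move=> t; exact: hx.
    - by rewrite ler_wpM2r// lerDl.
  apply: (le_trans (@lipschitz_of_derivative (fun s => f (x', s)) (fun s => fy (x', s)) B2 y y' _ _)).
  - by move=> t; apply: is_derive_slice_y; exact: fyd.
  - by move=> t; exact: hy.
  - by rewrite ler_wpM2r// lerDr.
have cb1 : continuous (fst \o v) := lip _ _ _ _ _ A10 A30 dx1 dy1 bA1 bA3.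
have cb2 : continuous (snd \o v) := lip _ _ _ _ _ A20 A40 dx2 dy2 bA2 bA4.
have K3 z : ~ K z -> (fst \o v) z = 0 by move=> nK; rewrite /= v0.
have K4 z : ~ K z -> (snd \o v) z = 0 by move=> nK; rewrite /= v0.
have [A5 A50 bA5] := bd _ cb1 K3.
have [A6 A60 bA6] := bd _ cb2 K4.
have [delta [M [d0 M0 hK]]] := compact_half_plane cK Kh.
exists (fst \o v), (snd \o v), (fst \o 'D_(@e_x R) v), (snd \o 'D_(@e_y R) v), (A5 + A6 + A1 + A4), delta, M.
split; first by split => // z; exact: surjective_pairing.
split; [exact: dx1|exact: dy2| | |].
- by move=> z; split; [apply: le_trans (bA5 z) _|apply: le_trans (bA6 z) _|apply: le_trans (bA1 z) _|apply: le_trans (bA4 z) _]; lra.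
- exact (And4 cb1 cb2 (c1 _ cdx) (c2 _ cdy)).
- move=> z hz; have nK : ~ K z.
    by move=> /hK[h1 h2 h3]; case: hz; rewrite ltNge ?h1 ?h2 ?h3.
  exact (And4 (K3 _ nK) (K4 _ nK) (K1 _ _ nK) (K2 _ _ nK)).
Qed.

End components.

Section continuous_measurable_plane.
Context {R : realType}.
Notation T2 := (measurableTypeR R * measurableTypeR R)%type.

(** Measurability is for the product sigma-algebra: rounding the first coordinate down to multiples
    of [1 / (n + 1)] leaves countably many functions of the second coordinate, and continuity gives
    the pointwise limit. *)
Lemma continuous_measurable_plane (f : R * R -> R) : continuous f ->
  measurable_fun setT (f : T2 -> R).
Proof.
move=> cf; pose fl (n : nat) (x : R) : R := (Num.floor (x * n.+1%:R))%:~R / n.+1%:R.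
have n0 n : 0 < n.+1%:R :> R by [].
have fl1 n x : fl n x <= x by rewrite ler_pdivrMr// Num.Theory.floor_le.
have fl2 n x : x < fl n x + n.+1%:R^-1.
  have -> : fl n x + n.+1%:R^-1 = ((Num.floor (x * n.+1%:R))%:~R + 1) / n.+1%:R by rewrite mulrDl mul1r.
  rewrite ltr_pdivlMr//.
  by have := Num.Theory.floorD1_gt (x * n.+1%:R); rewrite intrD.
have mfl n : measurable_fun setT (fun z : T2 => f (fl n z.1, z.2)).
  move=> _ B mB; rewrite setTI.
  have -> : (fun z : T2 => f (fl n z.1, z.2)) @^-1` B =
      \bigcup_(k in [set: int]) ([set x : R | Num.floor (x * n.+1%:R) = k] `*` [set y : R | B (f (k%:~R / n.+1%:R, y))]).
    apply/seteqP; split => z /=; first by move=> h; exists (Num.floor (z.1 * n.+1%:R)).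
    by move=> [k _ [/= kE]]; rewrite /fl kE.
  apply: countable_bigcupT_measurable => [|k]; first exact: countableP.
  apply: measurableX.
    have -> : [set x : R | Num.floor (x * n.+1%:R) = k] = `[k%:~R / n.+1%:R, (k + 1)%:~R / n.+1%:R[%classic.
      apply/seteqP; split => x /=; rewrite in_itv/= ler_pdivrMr// ltr_pdivlMr//.
        by move=> <-; rewrite Num.Theory.floor_le Num.Theory.floorD1_gt.
      by move=> h; apply/eqP; rewrite Num.Theory.floor_eq.
    exact: measurable_itv.
  have := @continuous_measurable_fun R (fun y => f (k%:~R / n.+1%:R, y)).
  move=> h; rewrite -[X in measurable X]setTI; apply: h => // y.
  have c : (k%:~R / n.+1%:R : R, u) @[u --> y] --> (k%:~R / n.+1%:R : R, y).
    have h1 : (k%:~R / n.+1%:R : R) @[_ --> y] --> (k%:~R / n.+1%:R : R) by exact: cvg_cst.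
    have h2 : (u : R) @[u --> y] --> y by exact: cvg_id.
    exact: (cvg_pair h1 h2).
  have fy : {for (k%:~R / n.+1%:R : R, y), continuous f} by exact: cf.
  exact: cvg_comp c fy.
apply: (@measurable_fun_cvg _ _ _ setT (fun n z => f (fl n z.1, z.2))) => // z _.
have c1 : fl n z.1 @[n --> \oo] --> (z.1 : R).
  have h : z.1 - harmonic n @[n --> \oo] --> (z.1 : R).
    rewrite -[X in _ --> X]subr0; apply: cvgB; [exact: cvg_cst|exact: cvg_harmonic].
  apply: squeeze_cvgr h (cvg_cst _); apply: nearW => n; rewrite fl1 andbT lerBlDr.
  exact: ltW.
have c2 : (z.2 : R) @[_ --> \oo] --> (z.2 : R) by exact: cvg_cst.
have fz : {for (z.1 : R, z.2 : R), continuous f} by exact: cf.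
have c : (fl n z.1, z.2 : R) @[n --> \oo] --> (z.1 : R, z.2 : R) by exact: cvg_pair c1 c2.
have -> : f z = f (z.1, z.2) by rewrite -surjective_pairing.
exact: cvg_comp c fz.
Qed.

End continuous_measurable_plane.

Section reflection.
Context {R : realType}.
Notation mu := (@lebesgue_measure R).

Lemma integral_symmetric_itv (q : R -> R) (a C : R) : 0 < a -> continuous q -> (forall x, `|q x| <= C) ->
  \int[mu]_(x in `]- a, a[) q x = \int[mu]_(x in `]0, a[) q x + \int[mu]_(x in `]0, a[) q (- x).
Proof.
move=> a0 cq qC.
have mq D : measurable_fun D (q : R -> R).
  by apply: measurable_funTS; exact: continuous_measurable_fun.
have mqe D : measurable_fun D (EFin \o q) by apply/measurable_EFinP.
have cqN : continuous (q \o -%R).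
  by move=> x; apply: continuous_comp; [exact: opp_continuous|exact: cq].
have mqN D : measurable_fun D (EFin \o (q \o -%R)).
  by apply/measurable_EFinP; apply: measurable_funTS; exact: continuous_measurable_fun.
have iq (a1 b1 : bool) (u v : R) : mu.-integrable [set` Interval (BSide a1 u) (BSide b1 v)] (EFin \o q).
  by apply: (@integrable_bounded_itv _ _ _ _ _ C).
have aN : - a < 0 by rewrite oppr_lt0.
have := @Rintegral_itvB R q (BRight (- a)) (BLeft a) 0 (iq _ _ _ _).
rewrite !bnd_simp => /(_ (ltW aN) a0) H.
rewrite -H; suff -> : \int[mu]_(t in `]- a, 0]) q t = \int[mu]_(x in `]0, a[) q (- x) by rewrite subrK.
rewrite -(Rintegral_itv_bndo_bndc (iq _ _ _ _)) /Rintegral.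
congr fine; have := @integration_by_substitution_oppr R q 0 a (ltW a0).
rewrite oppr0 => /(_ (continuous_subspaceT cq)) H2.
rewrite -(@integral_itv_bndoo R (- a) 0 (EFin \o q) true false (mqe _)) H2.
exact: (@integral_itv_bndoo R 0 a (EFin \o (q \o -%R)) true false (mqN _)).
Qed.

End reflection.

Section minimizer_perimeter.
Context {R : realType}.
Notation mu := (@lebesgue_measure R).
Notation T2 := (measurableTypeR R * measurableTypeR R)%type.
Variables (alpha g : R).
Hypothesis alpha0 : 0 <= alpha.
Hypothesis g0 : 0 < g.
Notation psi := (profile_slope g).
Notation f := (profile_fun g).

Definition profile_region : set (R * R) := [set z | `|z.1| < f z.2 /\ 0 < z.2 < 1].

(** Cut off outside []0, 1[], the interval on which the profile is shown to be continuous, to obtain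
    a function measurable on the line. *)
Let f0 (y : R) : R := f y * \1_(`]0, 1[%classic) y.

Let f0E y : 0 < y -> y < 1 -> f0 y = f y.
Proof. by move=> y0 y1; rewrite /f0 indicE mem_set ?mulr1//= in_itv/= y0 y1. Qed.

Lemma measurable_profile : measurable_fun setT f0.
Proof.
have -> : f0 = f \_ `]0, 1[.
  by apply/funext => y; rewrite /f0 patchE indicE; case: ifPn => _; rewrite ?mulr1// mulr0.
apply/(measurable_restrictT _ (measurable_itv _)).
apply: open_continuous_measurable_fun; first exact: interval_open.
by move=> y; rewrite inE/= in_itv/= => /andP[y0 y1]; exact: profile_fun_continuous.
Qed.

Lemma profile_regionE : profile_region = [set z | `|z.1| < f0 z.2].
Proof.
apply/seteqP; split => z; rewrite /profile_region/=.
  by move=> [h /andP[y0 y1]]; rewrite f0E.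
rewrite {1}/f0 indicE; have [|_] := boolP (_ \in _); last by rewrite mulr0 ltNge normr_ge0.
by rewrite inE/= in_itv/= mulr1.
Qed.

Lemma measurable_profile_region : measurable (profile_region : set T2).
Proof.
rewrite profile_regionE.
have m1 : measurable_fun setT (fun z : T2 => `|z.1|).
  by apply: measurableT_comp => //; exact: measurable_fst.
have m2 : measurable_fun setT (fun z : T2 => f0 z.2).
  exact: (measurableT_comp measurable_profile measurable_snd).
have := measurable_fun_ltr m1 m2 measurableT (Y := [set true]).
by rewrite setTI; apply.
Qed.

Lemma lebesgue_measurable_profile_region : lebesgue_measurable2 profile_region.
Proof. exact: (@caratheodory_measurable_mu_ext _ _ _ (@leb2_borel R) _ measurable_profile_region). Qed.

(** [t^alpha] times the arc length element [sqrt (1 + psi^2)] of the curve [x = f(t)], since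
    [1 + psi^2 = 1 / (1 - t^(2g))]. *)
Definition arc_weight (t : R) : R := t `^ alpha / Num.sqrt (1 - t `^ (2 * g)).

Lemma arc_weight_ge0 t : 0 <= arc_weight t.
Proof. by rewrite divr_ge0 ?powR_ge0 ?sqrtr_ge0. Qed.

Let g2 : 0 < 2 * g. Proof. by rewrite mulr_gt0. Qed.

Let root_gt0 (t : R) : 0 < t -> t < 1 -> 0 < Num.sqrt (1 - t `^ (2 * g)).
Proof. by move=> t0 t1; rewrite sqrtr_gt0 pow_lt1. Qed.

(** With [q] the root, [q^2 <= q] reads [1 <= q + t^(2g)]. The majorant is integrable by
    [integral_root_slope]. *)
Lemma arc_weight_le (t : R) : 0 < t -> t < 1 ->
  arc_weight t <= 1 + t `^ (2 * g - 1) / Num.sqrt (1 - t `^ (2 * g)).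
Proof.
move=> t0 t1; have r0 := root_gt0 t0 t1; set q := Num.sqrt _ in r0 *.
have q2 : q ^+ 2 = 1 - t `^ (2 * g) by rewrite sqr_sqrtr// ltW// pow_lt1.
have q1 : q <= 1 by rewrite -[leRHS]sqrtr1 ler_sqrt// gerBl powR_ge0.
have ta1 : t `^ alpha <= 1 by apply: powR_le1 => //; exact: ltW.
have tE : t `^ (2 * g) = t `^ (2 * g - 1) * t.
  rewrite -[RHS](_ : t `^ (2 * g - 1) * t `^ 1 = _); last by rewrite powRr1// ltW.
  by rewrite -powRD ?(gt_eqF t0) ?implybT// subrK.
have p0 : 0 <= t `^ (2 * g - 1) by exact: powR_ge0.
rewrite /arc_weight -/q ler_pdivrMr// mulrDl mul1r divfK ?gt_eqF//.
have h : 1 <= q + t `^ (2 * g).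
  have : q ^+ 2 <= q by rewrite expr2 ger_pMl.
  by rewrite q2; lra.
have h2 : t `^ (2 * g) <= t `^ (2 * g - 1) by rewrite tE ger_pMr ?ltW// powR_gt0.
lra.
Qed.

Lemma integrable_arc_weight : mu.-integrable `]0, 1[ (EFin \o arc_weight).
Proof.
have mI : measurable (`]0, 1[%classic : set (measurableTypeR R)) by exact: measurable_itv.
have i1 : mu.-integrable `]0, 1[ (EFin \o (fun=> (1 : R))).
  by apply: (@integrable_bounded_itv _ _ _ _ _ 1) => [|x]; [exact: measurable_cst|rewrite normr1].
have i2 : mu.-integrable `]0, 1[ (EFin \o (fun t : R => t `^ (2 * g - 1) / Num.sqrt (1 - t `^ (2 * g)))).
  apply/integrableP; split.
    by apply/measurable_EFinP; apply: measurable_funTS; exact: measurable_root_slope.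
  under eq_integral => t _ do rewrite /= ger0_norm ?divr_ge0 ?powR_ge0 ?sqrtr_ge0//.
  by rewrite integral_root_slope// ltry.
apply: le_integrable (integrableD mI i1 i2) => //.
  by apply/measurable_EFinP; apply: measurable_funTS; exact: measurable_root_slope.
move=> t; rewrite /= in_itv/= => /andP[t0 t1]; rewrite lee_fin.
rewrite (ger0_norm (arc_weight_ge0 t)) ger0_norm ?arc_weight_le//.
by rewrite addr_ge0// divr_ge0 ?powR_ge0 ?sqrtr_ge0.
Qed.

(* Cauchy-Schwarz against the unit normal [(1, psi) / sqrt (1 + psi^2)] *)
Lemma flux_le (t b1 b2 : R) : 0 < t -> t < 1 -> b1 ^+ 2 + b2 ^+ 2 <= 1 ->
  `|t `^ alpha * (b1 + psi t * b2)| <= arc_weight t.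
Proof.
move=> t0 t1 hb; have r0 := root_gt0 t0 t1.
rewrite normrM ger0_norm ?powR_ge0// ler_wpM2l ?powR_ge0//.
have q2 : Num.sqrt (1 - t `^ (2 * g)) ^+ 2 = 1 - t `^ (2 * g) by rewrite sqr_sqrtr// ltW// pow_lt1.
rewrite -(@ler_pXn2r _ 2) ?nnegrE ?invr_ge0 ?sqrtr_ge0// real_normK ?num_real//.
have pE : psi t ^+ 2 = t `^ (2 * g) * (Num.sqrt (1 - t `^ (2 * g)))^-1 ^+ 2.
  by rewrite exprMn powR_expr2.
have e1 : (Num.sqrt (1 - t `^ (2 * g)))^-1 ^+ 2 = 1 + psi t ^+ 2.
  rewrite pE exprVn q2; field; rewrite gt_eqF// pow_lt1//.
rewrite e1; set k := psi t.
have : (b1 + k * b2) ^+ 2 <= (1 + k ^+ 2) * (b1 ^+ 2 + b2 ^+ 2).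
  have : 0 <= (b2 - k * b1) ^+ 2 by exact: sqr_ge0.
  nra.
move=> /le_trans; apply; rewrite -[leRHS]mulr1 ler_wpM2l// addr_ge0 ?sqr_ge0//.
Qed.

End minimizer_perimeter.

(** * Divergence theorem on the region bounded by the profile *)

Section flux.
Context {R : realType}.
Notation mu := (@lebesgue_measure R).
Notation T2 := (measurableTypeR R * measurableTypeR R)%type.
Variables (alpha g : R).
Hypothesis alpha0 : 0 <= alpha.
Hypothesis g0 : 0 < g.
Notation psi := (profile_slope g).
Notation f := (profile_fun g).
Variables (b1 b2 b1x b2y : R * R -> R) (C delta M : R).
Hypothesis delta0 : 0 < delta.
Hypothesis M0 : 0 <= M.
Hypothesis db1 : forall z, is_derive z (@e_x R) b1 (b1x z).
Hypothesis db2 : forall z, is_derive z (@e_y R) b2 (b2y z).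
Hypothesis b_le : forall z, [/\ `|b1 z| <= C, `|b2 z| <= C, `|b1x z| <= C & `|b2y z| <= C].
Hypothesis b_cont : [/\ continuous b1, continuous b2, continuous b1x & continuous b2y].
Hypothesis b_supp : forall z, [\/ M < `|z.1|, z.2 < delta | M < z.2] ->
  [/\ b1 z = 0, b2 z = 0, b1x z = 0 & b2y z = 0].

Definition flux_x (z : R * R) : R := z.2 `^ alpha * b1x z.
Definition flux_y (z : R * R) : R := alpha * z.2 `^ (alpha - 1) * b2 z + z.2 `^ alpha * b2y z.

Let C0 : 0 <= C. Proof. by have [h _ _ _] := b_le (0, 0); rewrite (le_trans _ h). Qed.

Let pow_bound q := delta `^ q + M `^ q.
Let pow_bound_ge0 q : 0 <= pow_bound q. Proof. by rewrite addr_ge0 ?powR_ge0. Qed.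

Definition flux_bound : R := pow_bound alpha * C + (alpha * pow_bound (alpha - 1) * C + pow_bound alpha * C).
Let D := flux_bound.

Let term_bound (q : R) (b : R * R -> R) : (forall z, `|b z| <= C) ->
  (forall z, [\/ M < `|z.1|, z.2 < delta | M < z.2] -> b z = 0) ->
  forall z, `|z.2 `^ q * b z| <= pow_bound q * C.
Proof.
move=> bC b0 z; have [h|h] := ltP z.2 delta.
  by rewrite b0 ?mulr0 ?normr0 ?mulr_ge0//; apply: Or32.
have [h2|h2] := ltP M z.2.
  by rewrite b0 ?mulr0 ?normr0 ?mulr_ge0//; apply: Or33.
rewrite normrM ger0_norm ?powR_ge0//; apply: ler_pM => //; first exact: powR_ge0.
exact: powR_between.
Qed.

Lemma flux_x_le z : `|flux_x z| <= D.
Proof.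
have h := term_bound alpha (b := b1x) (fun z => let: And4 _ _ h _ := b_le z in h)
  (fun z hz => let: And4 _ _ h _ := b_supp hz in h) z.
rewrite (le_trans h)// lerDl addr_ge0// ?mulr_ge0//.
Qed.

Lemma flux_y_le z : `|flux_y z| <= D.
Proof.
have h1 := term_bound alpha (b := b2y) (fun z => let: And4 _ _ _ h := b_le z in h)
  (fun z hz => let: And4 _ _ _ h := b_supp hz in h) z.
have h2 := term_bound (alpha - 1) (b := b2) (fun z => let: And4 _ h _ _ := b_le z in h)
  (fun z hz => let: And4 _ h _ _ := b_supp hz in h) z.
rewrite (le_trans (ler_normD _ _))// /D /flux_bound.
apply: (@le_trans _ _ (alpha * pow_bound (alpha - 1) * C + pow_bound alpha * C)).
  apply: lerD => //; rewrite -!mulrA normrM (ger0_norm alpha0) ler_wpM2l//.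
by rewrite lerDr mulr_ge0.
Qed.

Lemma flux_x_out z : [\/ M < `|z.1|, z.2 < delta | M < z.2] -> flux_x z = 0.
Proof. by move=> /b_supp[_ _ h _]; rewrite /flux_x h mulr0. Qed.

Lemma flux_y_out z : [\/ M < `|z.1|, z.2 < delta | M < z.2] -> flux_y z = 0.
Proof. by move=> /b_supp[_ h _ h2]; rewrite /flux_y h h2 !mulr0 addr0. Qed.

Lemma measurable_flux_x : measurable_fun setT (flux_x : T2 -> R).
Proof.
apply: measurable_funM; first exact: (measurableT_comp (measurable_powR _) measurable_snd).
by apply: continuous_measurable_plane; case: b_cont.
Qed.

Lemma measurable_flux_y : measurable_fun setT (flux_y : T2 -> R).
Proof.
apply: measurable_funD; apply: measurable_funM.
- by apply: measurable_funM => //; exact: (measurableT_comp (measurable_powR _) measurable_snd).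
- by apply: continuous_measurable_plane; case: b_cont.
- exact: (measurableT_comp (measurable_powR _) measurable_snd).
- by apply: continuous_measurable_plane; case: b_cont.
Qed.

Lemma integrable_flux (d : R * R -> R) : measurable_fun setT (d : T2 -> R) -> (forall z, `|d z| <= D) ->
  (forall z, [\/ M < `|z.1|, z.2 < delta | M < z.2] -> d z = 0) ->
  (@leb2_borel R).-integrable (profile_region g) (EFin \o d).
Proof.
move=> md dD d0.
have out x y : M < `|x| \/ M < `|y| -> d (x, y) = 0.
  move=> [h|h]; apply: d0 => /=; first exact: Or31.
  have [t0|t0] := leP 0 y; first by apply: Or33; rewrite ger0_norm in h.
  by apply: Or32; exact: lt_trans delta0.
have [i _] := integrable2_bounded_supp md dD out.
apply: (integrableS measurableT _ _ i) => //; exact: measurable_profile_region.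
Qed.

Lemma integral_profile_region (d : R * R -> R) : measurable_fun setT (d : T2 -> R) -> (forall z, `|d z| <= D) ->
  (forall z, [\/ M < `|z.1|, z.2 < delta | M < z.2] -> d z = 0) ->
  \int[@leb2_borel R]_(z in profile_region g) d z =
  \int[mu]_(y in `]0, 1[) \int[mu]_(x in `]- f y, f y[) d (x, y).
Proof.
move=> md dD d0.
have mO := measurable_profile_region g0.
have mr : measurable_fun setT ((d : T2 -> R) \_ (profile_region g)).
  by apply/(measurable_restrictT _ mO); exact: measurable_funTS.
have rD z : `|(d \_ (profile_region g)) z| <= D.
  by rewrite patchE; case: ifP => // _; rewrite normr0 (le_trans _ (dD (0, 0))).
have out x y : M < `|x| \/ M < `|y| -> (d \_ (profile_region g)) (x, y) = 0.
  move=> h; rewrite patchE; case: ifP => // _; case: h => h; apply: d0 => /=; first exact: Or31.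
  have [t0|t0] := leP 0 y; first by apply: Or33; rewrite ger0_norm in h.
  by apply: Or32; exact: lt_trans delta0.
have [_ E] := Rfubini_box mr rD out.
rewrite Rintegral_mkcond E [RHS]Rintegral_mkcond.
apply: eq_Rintegral => y _; rewrite patchE; case: ifPn => hy; last first.
  rewrite Rintegral_eq0// => x; rewrite patchE memNset// => -[_ /= y01].
  by move/negP: hy; apply; rewrite inE/= in_itv.
rewrite [RHS]Rintegral_mkcond; apply: eq_Rintegral => x _; rewrite !patchE.
have y01 : 0 < y < 1 by rewrite inE/= in_itv/= in hy.
congr (if _ then _ else _); apply/idP/idP; rewrite !inE /profile_region/= in_itv/= ltr_norml.
  by move=> [].
by move=> ->.
Qed.

Let slice_x_continuous (b : R * R -> R) y : continuous b -> continuous (fun x : R => b (x, y)).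
Proof.
move=> cb x; have h1 : (u : R) @[u --> x] --> x by exact: cvg_id.
have h2 : (y : R) @[_ --> x] --> (y : R) by exact: cvg_cst.
have c : (u, y) @[u --> x] --> (x, y) by exact: cvg_pair h1 h2.
have fy : {for (x, y), continuous b} by exact: cb.
exact: cvg_comp c fy.
Qed.

Let slice_y_continuous (b : R * R -> R) x : continuous b -> continuous (fun y : R => b (x, y)).
Proof.
move=> cb y; have h2 : (u : R) @[u --> y] --> y by exact: cvg_id.
have h1 : (x : R) @[_ --> y] --> (x : R) by exact: cvg_cst.
have c : (x, u) @[u --> y] --> (x, y) by exact: cvg_pair h1 h2.
have fy : {for (x, y), continuous b} by exact: cb.
exact: cvg_comp c fy.
Qed.

Let scale_continuous (k : R) (b : R -> R) (x : R) : {for x, continuous b} ->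
  {for x, continuous (fun u : R => k * b u)}.
Proof. by move=> cb; apply: continuousM => //; exact: cst_continuous. Qed.

Lemma integral_flux_x :
  \int[@leb2_borel R]_(z in profile_region g) flux_x z =
  \int[mu]_(y in `]0, 1[) (y `^ alpha * (b1 (f y, y) - b1 (- f y, y))).
Proof.
rewrite (integral_profile_region measurable_flux_x flux_x_le flux_x_out).
apply: eq_Rintegral => y; rewrite inE/= in_itv/= => /andP[y0 y1].
have [c1 _ c1x _] := b_cont.
have fy0 := profile_fun_gt0 g0 y0 y1.
have ab : - f y < f y by rewrite (lt_trans _ fy0)// oppr_lt0.
have cflux : continuous (fun x : R => flux_x (x, y)).
  have h : continuous (fun x : R => y `^ alpha * b1x (x, y)).
    by move=> x; apply: scale_continuous; exact: slice_x_continuous.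
  exact: h.
have cb : continuous (fun x : R => y `^ alpha * b1 (x, y)).
  by move=> x; apply: scale_continuous; exact: slice_x_continuous.
rewrite mulrBr {1}/Rintegral.
rewrite (_ : (\int[mu]_(x in _) _)%E = (y `^ alpha * b1 (f y, y) - y `^ alpha * b1 (- f y, y))%:E)//.
apply: (@integrable_FTC_open R _ _ _ _ _ (fun x => y `^ alpha * b1 (x, y)) ab).
- by move=> x _; exact: cflux.
- move=> x _; have d1 : is_derive x 1 (fun s => b1 (s, y)) (b1x (x, y)) by apply: is_derive_slice_x.
  exact: (@is_deriveZ _ _ _ _ (y `^ alpha) _ _ _ d1).
- by apply: cvg_at_right_filter; exact: cb.
- by apply: cvg_at_left_filter; exact: cb.
- apply: (@integrable_bounded_itv _ _ _ _ _ D); last by move=> x; exact: flux_x_le.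
  by apply: measurable_funTS; exact: continuous_measurable_fun.
Qed.

(** Folding the slice at [x = 0] leaves an integral over []0, f y[], to which the substitution
    [x = f(t)] applies. *)
Let Q (x y : R) : R := flux_y (x, y) + flux_y (- x, y).

Let Q_le x y : `|Q x y| <= D + D.
Proof. by rewrite (le_trans (ler_normD _ _))// lerD// flux_y_le. Qed.

Let Q_out x y : y < delta -> Q x y = 0.
Proof. by move=> h; rewrite /Q !flux_y_out ?addr0//; apply: Or32. Qed.

Let flux_y_slice_continuous y : continuous (fun x : R => flux_y (x, y)).
Proof.
have [_ c2 _ c2y] := b_cont.
have h1 : continuous (fun x : R => alpha * y `^ (alpha - 1) * b2 (x, y)).
  by move=> x; apply: scale_continuous; exact: slice_x_continuous.
have h2 : continuous (fun x : R => y `^ alpha * b2y (x, y)).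
  by move=> x; apply: scale_continuous; exact: slice_x_continuous.
by move=> x; exact: (cvgD (h1 x) (h2 x)).
Qed.

Let Q_continuous y : continuous (Q ^~ y).
Proof.
move=> x; apply: cvgD; first exact: flux_y_slice_continuous.
apply: (@continuous_comp _ _ _ (@GRing.opp R) (fun x : R => flux_y (x, y))); first exact: opp_continuous.
exact: flux_y_slice_continuous.
Qed.

Let mQ : measurable_fun setT (fun z : T2 => Q z.1 z.2).
Proof.
apply: measurable_funD; first by have := measurable_flux_y; congr measurable_fun; apply/funext => -[].
have h : measurable_fun setT (fun z : T2 => ((- (z.1 : R) : measurableTypeR R), z.2) : T2).
  by apply: measurable_fun_pair; [apply: (measurableT_comp (@oppr_measurable R setT) measurable_fst)|exact: measurable_snd].
exact: (measurableT_comp measurable_flux_y h).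
Qed.

Let inner_x y : 0 < y -> y < 1 ->
  \int[mu]_(x in `]- f y, f y[) flux_y (x, y) = \int[mu]_(t in `]y, 1[) (psi t * Q (f t) y).
Proof.
move=> y0 y1; have fy0 := profile_fun_gt0 g0 y0 y1.
rewrite (integral_symmetric_itv fy0 (flux_y_slice_continuous (y := y)) (fun x => flux_y_le (x, y))).
rewrite (profile_substitution g0 (Q_continuous (y := y)) (fun x => Q_le x y) y0 y1).
have mc : measurable_fun setT (fun x : R => flux_y (x, y)).
  exact: (continuous_measurable_fun (flux_y_slice_continuous (y := y))).
rewrite -RintegralD//; apply: (@integrable_bounded_itv _ _ _ _ _ D) => [|x]; try exact: flux_y_le.
  exact: measurable_funTS.
by apply: measurable_funTS; apply: (measurableT_comp mc); exact: measurable_funN.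
Qed.

Let inner_y x t : 0 < t ->
  \int[mu]_(y in `]0, t[) Q x y = t `^ alpha * (b2 (x, t) + b2 (- x, t)).
Proof.
move=> t0; have [_ c2 _ c2y] := b_cont.
have mQx : measurable_fun setT (Q x) by exact: (measurable_fun_pair2 (x : R) mQ).
pose F y := y `^ alpha * (b2 (x, y) + b2 (- x, y)).
have E : (\int[mu]_(y in `]0%R, t[) (Q x y)%:E)%E = (F t - 0)%:E; last by rewrite /Rintegral E subr0.
apply: (@integrable_FTC_open R 0 t 0 (F t) (Q x) F t0).
- move=> y /andP[y0 _].
  have h u : {for y, continuous (fun y => flux_y (u, y))}.
    have h : {for y, continuous (fun y : R => alpha * y `^ (alpha - 1) * b2 (u, y) + y `^ alpha * b2y (u, y))}.
      apply: continuousD; apply: continuousM; try exact: slice_y_continuous; last exact: powR_continuous.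
      by apply: scale_continuous; exact: powR_continuous.
    exact: h.
  by apply: cvgD; exact: h.
- move=> y /andP[y0 _].
  have d u : is_derive y 1 (fun s => b2 (u, s)) (b2y (u, y)) by apply: is_derive_slice_y.
  have := is_deriveM (is_derive1_powR alpha y0) (is_deriveD (d x) (d (- x))).
  have -> : Q x y = y `^ alpha *: (b2y (x, y) + b2y (- x, y)) + (b2 (x, y) + b2 (- x, y)) *: (alpha * y `^ (alpha - 1)).
    by rewrite /Q /flux_y /GRing.scale/=; ring.
  exact.
- apply: cvg_near_cst; near=> y.
  have yd : y < delta by near: y; exact: nbhs_right_lt.
  have b20 u : b2 (u, y) = 0 by have [|_ h _ _] := @b_supp (u, y) => //; apply: Or32.
  by rewrite /F !b20 addr0 mulr0.
- apply: cvg_at_left_filter; apply: cvgM; first exact: powR_continuous.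
  by apply: cvgD; exact: slice_y_continuous.
- apply: (@integrable_bounded_itv _ _ _ _ _ (D + D)) => [|y]; last exact: Q_le.
  exact: measurable_funTS.
Unshelve. all: by end_near. Qed.

(** The substitution [x = f(t)] turns the folded region into the triangle [0 < y < t < 1]. After
    exchanging the integrals, the inner one is in [y] at fixed [x = f(t)] and is evaluated by the
    fundamental theorem; the end [y = 0] lies off the support. *)
Lemma integral_flux_y :
  \int[@leb2_borel R]_(z in profile_region g) flux_y z =
  \int[mu]_(t in `]0, 1[) (psi t * (t `^ alpha * (b2 (f t, t) + b2 (- f t, t)))).
Proof.
rewrite (integral_profile_region measurable_flux_y flux_y_le flux_y_out).
pose f0 (y : R) : R := f y * \1_(`]0, 1[%classic) y.
pose p (t : R) : R := (D + D) * (psi t * \1_(`]delta / 2, 1[%classic) t).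
(* The cut at [delta / 2] puts [psi] within reach of [integrable_profile_slope] and does not change
   the integral, because [Q] vanishes at heights below [delta]. *)
pose Phi (z : R * R) : R := psi z.1 * \1_(`]delta / 2, 1[%classic) z.1 * ((0 < z.2)%R%:R * (z.2 < z.1)%R%:R) * Q (f0 z.1) z.2.
have d20 : 0 < delta / 2 by rewrite divr_gt0.
have mPhi : measurable_fun setT (Phi : T2 -> R).
  apply: measurable_funM; [apply: measurable_funM; [apply: measurable_funM|apply: measurable_funM]|].
  - exact: (measurableT_comp (measurable_root_slope _ _) measurable_fst).
  - by apply: (measurableT_comp _ measurable_fst); exact: measurable_indic.
  - apply: (measurableT_comp (f := fun b : bool => b%:R : R)) => //.
    exact: (measurable_fun_ltr (measurable_cst _) measurable_snd).
  - apply: (measurableT_comp (f := fun b : bool => b%:R : R)) => //.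
    exact: (measurable_fun_ltr measurable_snd measurable_fst).
  - have h : measurable_fun setT (fun z : T2 => ((f0 z.1 : measurableTypeR R), z.2) : T2).
      apply: measurable_fun_pair; last exact: measurable_snd.
      exact: (measurableT_comp (measurable_profile g0) measurable_fst).
    exact: (measurableT_comp mQ h).
have ip : mu.-integrable setT (EFin \o p).
  have i1 := integrable_profile_slope g0 d20.
  have i2 : mu.-integrable setT ((EFin \o psi) \_ `]delta / 2, 1[).
    have mI : measurable (`]delta / 2, 1[%classic : set (measurableTypeR R)) by exact: measurable_itv.
    by apply/(integrable_mkcond _ mI).
  have := integrableZl measurableT (D + D) i2; apply: eq_integrable => // t _.
  rewrite /p /= patchE indicE EFinM; case: ifPn => _; rewrite ?mulr1 ?mulr0//.
have iq : mu.-integrable setT (EFin \o (\1_(`[- 1, 1]%classic) : R -> R)).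
  have := integrable_box_indic (1 : R) 1; apply: eq_integrable => // t _.
  by rewrite /= mul1r.
have PhiD x y : `|Phi (x, y)| <= p x * \1_(`[- 1, 1]%classic) y.
  rewrite /Phi /p /= !indicE !mem_setE !in_itv/=.
  have D0 : 0 <= D + D by rewrite (le_trans _ (Q_le 0 0)).
  have [/andP[x1 x2]|_] := boolP (delta / 2 < x < 1); last by rewrite !(mulr0, mul0r) normr0.
  have pos : 0 <= (D + D) * (psi x * 1) * (-1 <= y <= 1)%R%:R.
    by rewrite mulr_ge0// mulr1 mulr_ge0// profile_slope_ge0.
  have [y0|_] := ltP 0 y; last by rewrite !(mulr0, mul0r) normr0.
  have [yx|_] := ltP y x; last by rewrite !(mulr0, mul0r) normr0.
  have -> : -1 <= y <= 1 by rewrite (ltW (lt_trans yx x2)) andbT (le_trans _ (ltW y0))// lerN10.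
  by rewrite !mulr1 normrM ger0_norm ?profile_slope_ge0// mulrC ler_wpM2r ?profile_slope_ge0// Q_le.
have F12 := @Rfubini12 _ _ _ _ R mu mu Phi p _ mPhi ip iq PhiD.
have F21 := @Rfubini21 _ _ _ _ R mu mu Phi p _ mPhi ip iq PhiD.
transitivity (\int[mu]_y \int[mu]_t Phi (t, y)); last first.
  rewrite -F21 F12 [RHS]Rintegral_mkcond; apply: eq_Rintegral => t _; rewrite patchE mem_setE in_itv/=.
  have [t01|/negbTE t01] := boolP (0 < t < 1); last first.
    rewrite Rintegral_eq0// => y; rewrite /Phi indicE mem_setE in_itv/=.
    have [/andP[h1 h2]|_] := boolP (delta / 2 < t < 1); last by rewrite !(mulr0, mul0r).
    by move: t01; rewrite h2 (lt_trans d20 h1).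
  have [t0 t1] := andP t01.
  have [td|td] := leP t (delta / 2).
    have b20 u : b2 (u, t) = 0.
      have [|_ h _ _] := @b_supp (u, t) => //; apply: Or32; rewrite /= (le_lt_trans td)//.
      by rewrite ltr_pdivrMr// ltr_pMr// ltr1n.
    rewrite !b20 addr0 !mulr0; rewrite Rintegral_eq0// => y.
    by rewrite /Phi indicE mem_setE in_itv/= ltNge td/= !(mulr0, mul0r).
  rewrite -inner_y// -RintegralZl//; last first.
    apply: (@integrable_bounded_itv _ _ _ _ _ (D + D)) => [|y]; last exact: Q_le.
    by apply: measurable_funTS; exact: (measurable_fun_pair2 (f t : R) mQ).
  rewrite [RHS]Rintegral_mkcond; apply: eq_Rintegral => y _; rewrite patchE mem_setE in_itv/=.
  rewrite /Phi /f0 !indicE !mem_setE !in_itv/= t01 td t1/= !mulr1.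
  by case: (0 < y); case: (y < t); rewrite /= ?mulr1 ?mulr0 ?mul0r.
rewrite [LHS]Rintegral_mkcond; apply: eq_Rintegral => y _; rewrite patchE mem_setE in_itv/=.
have [y01|/negbTE y01] := boolP (0 < y < 1); last first.
  rewrite [RHS]Rintegral_eq0// => t; rewrite /Phi indicE mem_setE in_itv/=.
  have [/andP[h1 h2]|_] := boolP (delta / 2 < t < 1); last by rewrite !(mulr0, mul0r).
  have [y0|_] := ltP 0 y; last by rewrite !(mulr0, mul0r).
  have [yt|_] := ltP y t; last by rewrite !(mulr0, mul0r).
  by move: y01; rewrite y0 (lt_trans yt h2).
have [y0 y1] := andP y01.
rewrite inner_x// [LHS]Rintegral_mkcond; apply: eq_Rintegral => t _; rewrite patchE mem_setE in_itv/=.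
rewrite /Phi y0/= mul1r.
have [yd|yd] := ltP y delta; first by rewrite !Q_out// !mulr0; case: ifP.
have [yt|yt] := ltP y t; last by rewrite /= !(mulr0, mul0r).
have dt : delta / 2 < t.
  by rewrite (le_lt_trans _ yt)// (le_trans _ yd)// ler_pdivrMr// ler_pMr// ler1n.
rewrite /f0 !indicE !mem_setE !in_itv/= dt (lt_trans y0 yt)/= mulr1.
by case: (t < 1); rewrite /= ?mulr1 ?mulr0 ?mul0r.
Qed.

End flux.

(** * Upper bound for the perimeter of the minimizer *)

Section profile_perimeter.
Context {R : realType}.
Notation mu := (@lebesgue_measure R).
Notation T2 := (measurableTypeR R * measurableTypeR R)%type.
Variables (alpha g : R).
Hypothesis alpha0 : 0 <= alpha.
Hypothesis g0 : 0 < g.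
Notation psi := (profile_slope g).
Notation f := (profile_fun g).

Let measurable_on_profile (b : R * R -> R) (k : R) : continuous b ->
  measurable_fun (`]0, 1[%classic : set (measurableTypeR R)) (fun y : R => b (k * f y, y)).
Proof.
move=> cb; pose f0 (y : R) : R := f y * \1_(`]0, 1[%classic) y.
have h : measurable_fun setT (fun y : measurableTypeR R => ((k * f0 y : measurableTypeR R), y) : T2).
  apply: measurable_fun_pair; last exact: measurable_id.
  by apply: measurable_funM => //; exact: measurable_profile.
apply: (eq_measurable_fun (fun y : R => b (k * f0 y, y))); last first.
  by apply: measurable_funTS; exact: (measurableT_comp (continuous_measurable_plane cb) h).
by move=> y; rewrite inE/= => y01; rewrite /f0 indicE mem_set// mulr1.
Qed.

(** The constraint on the field is imposed in the region only; it passes to the boundary point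
    [x = k * f t] by continuity along the slice. *)
Let boundary_bound (b1 b2 : R * R -> R) (t k : R) : continuous b1 -> continuous b2 ->
  (forall z, profile_region g z -> b1 z ^+ 2 + b2 z ^+ 2 <= 1) -> 0 < t -> t < 1 -> `|k| = 1 ->
  b1 (k * f t, t) ^+ 2 + b2 (k * f t, t) ^+ 2 <= 1.
Proof.
move=> c1 c2 hb t0 t1 k1; have ft := profile_fun_gt0 g0 t0 t1.
pose q (x : R) : R := b1 (k * x, t) ^+ 2 + b2 (k * x, t) ^+ 2.
have cb (b : R * R -> R) : continuous b -> {for f t, continuous (fun x : R => b (k * x, t))}.
  move=> cb; have h1 : (k * u : R) @[u --> f t] --> k * f t by apply: cvgMr; exact: cvg_id.
  have h2 : (t : R) @[_ --> f t] --> (t : R) by exact: cvg_cst.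
  have c : (k * u, t) @[u --> f t] --> (k * f t, t) by exact: cvg_pair h1 h2.
  have fy : {for (k * f t, t), continuous b} by exact: cb.
  exact: cvg_comp c fy.
have cq : {for f t, continuous q}.
  exact: (cvgD (cvgM (cb _ c1) (cb _ c1)) (cvgM (cb _ c2) (cb _ c2))).
have cl : q x @[x --> (f t)^'-] --> q (f t) by apply: cvg_at_left_filter; exact: cq.
apply: (cvgr_to_le cl); near=> x; apply: hb; split; last by rewrite /= t0 t1.
rewrite /= normrM k1 mul1r ger0_norm; first by near: x; exact: nbhs_left_lt.
by near: x; apply: nbhs_left_ge.
Unshelve. all: by end_near. Qed.

Lemma wperimeter_profile_le :
  (wperimeter alpha (profile_region g) <= (2 * \int[mu]_(t in `]0, 1[) arc_weight alpha g t)%:E)%E.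
Proof.
apply: ge_ereal_sup => _ [v [Cv vle] <-].
have [b1 [b2 [b1x [b2y [C [delta [M [[vE d0 M0] [db1 db2 b_le b_cont b_supp]]]]]]]]] :=
  C1c_half_plane_components Cv.
have divE z : profile_region g z -> divergence (fun z => z.2 `^ alpha *: v z) z =
    flux_x alpha b1x z + flux_y alpha b2 b2y z.
  move=> [_ /andP[z0 _]]; rewrite /divergence; congr (_ + _).
    have -> : fst \o (fun z : R * R => z.2 `^ alpha *: v z) = (fun w : R * R => w.2 `^ alpha) * b1.
      by apply/funext => w; rewrite /= vE.
    have [_ ->] := is_deriveM (is_derive_powR_x alpha z0) (db1 z).
    by rewrite /GRing.scale/= mulr0 addr0.
  have -> : snd \o (fun z : R * R => z.2 `^ alpha *: v z) = (fun w : R * R => w.2 `^ alpha) * b2.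
    by apply/funext => w; rewrite /= vE.
  have [_ ->] := is_deriveM (is_derive_powR_y alpha z0) (db2 z).
  by rewrite /GRing.scale/= addrC mulrC.
have hb z : profile_region g z -> b1 z ^+ 2 + b2 z ^+ 2 <= 1.
  move=> /vle; rewrite /enorm2 vE/= -{1}sqrtr1 ler_sqrt//.
have mx := measurable_flux_x alpha b_cont.
have my := measurable_flux_y alpha b_cont.
have C0 : 0 <= C by have [h _ _ _] := b_le (0, 0); rewrite (le_trans _ h).
have [c1 c2 _ _] := b_cont.
have mO := measurable_profile_region g0.
have ix := integrable_flux g0 d0 mx (flux_x_le alpha0 d0 b_le b_supp)
  (fun z => flux_x_out alpha b_supp (z := z)).
have iy := integrable_flux g0 d0 my (flux_y_le alpha0 d0 b_le b_supp)
  (fun z => flux_y_out alpha b_supp (z := z)).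
have -> : (\int[@leb2 R]_(z in profile_region g) (divergence (fun z => z.2 `^ alpha *: v z) z)%:E =
  \int[@leb2 R]_(z in profile_region g) (flux_x alpha b1x z + flux_y alpha b2 b2y z)%:E)%E.
  by apply: eq_integral => z; rewrite inE => /divE ->.
rewrite (leb2_integral (lebesgue_measurable_profile_region g0) mO measurable0 (measure0 _)); last 2 first.
- by move=> z _.
- by apply/measurable_EFinP; exact: measurable_funD.
have ixy : (@leb2_borel R).-integrable (profile_region g)
    (EFin \o (fun z => flux_x alpha b1x z + flux_y alpha b2 b2y z)).
  by have := integrableD mO ix iy; apply: eq_integrable.
rewrite -[leLHS]fineK; last by have := integrable_fin_num mO ixy.
rewrite lee_fin -/(Rintegral _ _ _) RintegralD//.
rewrite (integral_flux_x alpha0 g0 d0 db1 b_le b_cont b_supp).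
rewrite (integral_flux_y alpha0 g0 d0 db2 b_le b_cont b_supp).
pose j1 t := t `^ alpha * (b1 (f t, t) - b1 (- f t, t)).
pose j2 t := psi t * (t `^ alpha * (b2 (f t, t) + b2 (- f t, t))).
have mI : measurable (`]0, 1[%classic : set (measurableTypeR R)) by exact: measurable_itv.
have iw := integrable_arc_weight alpha0 g0.
have m1 (b : R * R -> R) : continuous b -> measurable_fun (`]0, 1[%classic : set (measurableTypeR R)) (fun y : R => b (f y, y)).
  by move=> cb; have := measurable_on_profile 1 cb; congr measurable_fun; apply/funext => y; rewrite mul1r.
have mN1 (b : R * R -> R) : continuous b -> measurable_fun (`]0, 1[%classic : set (measurableTypeR R)) (fun y : R => b (- f y, y)).
  by move=> cb; have := measurable_on_profile (- 1) cb; congr measurable_fun; apply/funext => y; rewrite mulN1r.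
have mp q : measurable_fun (`]0, 1[%classic : set (measurableTypeR R)) (fun y : R => y `^ q).
  by apply: measurable_funTS; exact: measurable_powR.
have mj1 : measurable_fun (`]0, 1[%classic : set (measurableTypeR R)) j1.
  by apply: measurable_funM => //; apply: measurable_funB; [exact: m1|exact: mN1].
have mj2 : measurable_fun (`]0, 1[%classic : set (measurableTypeR R)) j2.
  apply: measurable_funM; first by apply: measurable_funTS; exact: measurable_root_slope.
  by apply: measurable_funM => //; apply: measurable_funD; [exact: m1|exact: mN1].
have ij1 : mu.-integrable `]0, 1[ (EFin \o j1).
  pose d t := \1_(`]0, 1[%classic : set R) t * j1 t.
  have : mu.-integrable `]0, 1[ (EFin \o d).
    apply: (@integrable_bounded_itv _ _ _ _ _ (C + C)) => [|t].
      by apply: measurable_funM => //; apply: measurable_funTS; exact: measurable_indic.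
    rewrite /d indicE mem_setE in_itv/=; have [/andP[t0 t1]|_] := boolP (0 < t < 1); last by rewrite mul0r normr0 addr_ge0.
    rewrite mul1r normrM ger0_norm ?powR_ge0// -[leRHS]mul1r; apply: ler_pM; rewrite ?powR_ge0//.
      by apply: powR_le1 => //; exact: ltW.
    by rewrite (le_trans (ler_normB _ _))// lerD//; [have [] := b_le (f t, t)|have [] := b_le (- f t, t)].
  apply: eq_integrable => // t ht; rewrite /d /= indicE mem_set ?mul1r//.
  by rewrite inE in ht.
have jle t : 0 < t -> t < 1 -> `|j1 t + j2 t| <= arc_weight alpha g t + arc_weight alpha g t.
  move=> t0 t1.
  (* Regrouped by side: the right boundary has normal direction [(1, psi)], the left one
     [(-1, psi)]. *)
  have -> : j1 t + j2 t = t `^ alpha * (b1 (f t, t) + psi t * b2 (f t, t)) +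
      t `^ alpha * (- b1 (- f t, t) + psi t * b2 (- f t, t)) by rewrite /j1 /j2; ring.
  rewrite (le_trans (ler_normD _ _))// lerD//; apply: flux_le => //.
    by have := boundary_bound c1 c2 hb t0 t1 (normr1 _); rewrite mul1r.
  by have := boundary_bound c1 c2 hb t0 t1 (normrN1 _); rewrite mulN1r sqrrN.
have iww : mu.-integrable `]0, 1[ (EFin \o (fun t => arc_weight alpha g t + arc_weight alpha g t)).
  by have := integrableD mI iw iw; apply: eq_integrable.
(* [psi] is unbounded near 1, so integrability of [j2] is deduced from that of [j1] and from the
   bound on the sum. *)
have ij2 : mu.-integrable `]0, 1[ (EFin \o j2).
  have i3 := integrableD mI (integrable_abse ij1) iww.
  apply: (le_integrable mI _ _ i3) => [|t]; first exact/measurable_EFinP.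
  rewrite /= in_itv/= => /andP[t0 t1].
  rewrite lee_fin (ger0_norm (addr_ge0 _ _)) ?addr_ge0 ?arc_weight_ge0//.
  have -> : j2 t = (j1 t + j2 t) - j1 t by ring.
  by rewrite (le_trans (ler_normB _ _))// addrC lerD// jle.
have ij : mu.-integrable `]0, 1[ (EFin \o (fun t => j1 t + j2 t)).
  by have := integrableD mI ij1 ij2; apply: eq_integrable.
rewrite -(RintegralD mI ij1 ij2) -RintegralZl//.
have iw2 : mu.-integrable `]0, 1[ (EFin \o (fun t => 2 * arc_weight alpha g t)).
  by have := integrableZl mI 2 iw; apply: eq_integrable.
apply: (le_Rintegral mI ij iw2) => t; rewrite /= in_itv/= => /andP[t0 t1].
by rewrite (le_trans (ler_norm _))// (le_trans (jle _ t0 t1))// mulr2n mulrDl mul1r.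
Qed.

End profile_perimeter.

(** * The constants *)

Section powR_substitution.
Context {R : realType}.
Notation mu := (@lebesgue_measure R).
Variables (q : R) (G : R -> R).
Hypothesis q0 : 0 < q.
Hypothesis cG : forall x, 0 < x < 1 -> {for x, continuous G}.
Hypothesis G0 : forall x, 0 < x < 1 -> 0 <= G x.

(** The shift by 2 gives [e n <= 1 / 2], so that [[e n, 1 - e n]] is never empty. *)
Let e (n : nat) : R := n.+2%:R^-1.
Let e_gt0 n : 0 < e n. Proof. by rewrite invr_gt0. Qed.
Let e_le n : e n <= 1 - e n.
Proof.
have h : e n <= 2^-1 by rewrite lef_pV2 ?posrE// ler_nat.
lra.
Qed.
Let e_lt1 n : 1 - e n < 1. Proof. by rewrite gtrBl. Qed.
Let e_dec n m : (n <= m)%N -> e m <= e n.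
Proof. by move=> nm; rewrite lef_pV2 ?posrE// ler_nat. Qed.
Let I (n : nat) : set R := `[e n, 1 - e n]%classic.
Let J (n : nat) : set R := `[e n `^ q, (1 - e n) `^ q]%classic.
Let mI n : measurable (I n). Proof. exact: measurable_itv. Qed.
Let mJ n : measurable (J n). Proof. exact: measurable_itv. Qed.

Let powlt (x y : R) : 0 <= x -> x < y -> x `^ q < y `^ q.
Proof. by move=> x0 xy; apply: gt0_ltr_powR; rewrite ?nnegrE ?(le_trans x0 (ltW xy)). Qed.
Let powle (x y : R) : 0 <= x -> x <= y -> x `^ q <= y `^ q.
Proof. by move=> x0 xy; rewrite ge0_ler_powR ?nnegrE ?(le_trans x0 xy)// ltW. Qed.

Let I_sub n : I n `<=` `]0, 1[%classic.
Proof.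
move=> x; rewrite /I/= !in_itv/= => /andP[h1 h2].
by rewrite (lt_le_trans (e_gt0 n) h1) (le_lt_trans h2 (e_lt1 n)).
Qed.
Let J_sub n : J n `<=` `]0, 1[%classic.
Proof.
move=> x; rewrite /J/= !in_itv/= => /andP[h1 h2].
rewrite (lt_le_trans _ h1) ?powR_gt0 ?e_gt0// (le_lt_trans h2)//.
by rewrite -subr_gt0 pow_lt1// (lt_le_trans (e_gt0 n) (e_le n)).
Qed.
Let I_nd : nondecreasing_seq I.
Proof.
move=> n m nm; apply/subsetPset => x; rewrite /I/= !in_itv/= => /andP[h1 h2].
by have := e_dec nm => h; apply/andP; split; lra.
Qed.
Let J_nd : nondecreasing_seq J.
Proof.
move=> n m nm; apply/subsetPset => x; rewrite /J/= !in_itv/= => /andP[h1 h2].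
have h := e_dec nm; apply/andP; split.
  by apply: le_trans h1; apply: powle => //; exact: ltW.
apply: (le_trans h2); apply: powle; first by rewrite (le_trans (ltW (e_gt0 n)) (e_le n)).
lra.
Qed.
Let I_ex x : 0 < x < 1 -> exists n, e n <= x <= 1 - e n.
Proof.
move=> /andP[x0 x1].
have d0 : 0 < Num.min x (1 - x) by rewrite lt_min x0 subr_gt0.
have [n _ /(_ n (leqnn n))/=] := near_infty_natSinv_lt (PosNum d0).
rewrite lt_min => /andP[h1 h2]; exists n.
have h : e n <= n.+1%:R^-1 by rewrite lef_pV2 ?posrE// ler_nat.
by rewrite (le_trans h (ltW h1))/= lerBrDr addrC -lerBrDr (le_trans h (ltW h2)).
Qed.
Let I_bigcup : \bigcup_n I n = `]0, 1[%classic.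
Proof.
apply/seteqP; split => x; first by move=> [n _]; exact: I_sub.
by rewrite /= in_itv/= => /I_ex[n h]; exists n => //; rewrite /I/= in_itv.
Qed.
Let J_bigcup : \bigcup_n J n = `]0, 1[%classic.
Proof.
apply/seteqP; split => x; first by move=> [n _]; exact: J_sub.
rewrite /= in_itv/= => /andP[x0 x1].
have xq : x = (x `^ q^-1) `^ q by rewrite -powRrM mulVf ?gt_eqF// powRr1// ltW.
have /I_ex[n /andP[h1 h2]] : 0 < x `^ q^-1 < 1.
  by rewrite powR_gt0//= -subr_gt0 pow_lt1// invr_gt0.
exists n => //; rewrite /J/= in_itv/= xq; apply/andP; split; apply: powle => //.
  by rewrite ltW.
exact: powR_ge0.
Qed.

Let dpow x : 0 < x -> (derive1 (fun x : R => x `^ q)) x = q * x `^ (q - 1).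
Proof. by move=> x0; rewrite derive1E; have [_ ->] := is_derive1_powR q x0. Qed.

Let dpow_continuous x : 0 < x -> {for x, continuous (derive1 (fun x : R => x `^ q))}.
Proof.
move=> x0; apply: (near_eq_continuous_at (f := fun x => q * x `^ (q - 1))).
  by near=> y; apply: dpow; near: y; exact: lt_nbhsr.
by apply: continuousM; [exact: cst_continuous|exact: powR_continuous].
Unshelve. all: by end_near. Qed.

Let subst_n n : (\int[mu]_(x in J n) (G x)%:E = \int[mu]_(x in I n) (G (x `^ q) * (q * x `^ (q - 1)))%:E)%E.
Proof.
have c0 : 0 < 1 - e n by rewrite (lt_le_trans (e_gt0 n) (e_le n)).
rewrite /J (@integration_by_substitution_increasing _ (fun x => x `^ q) G _ _ (e_le n)).
- apply: eq_integral => x; rewrite inE/= in_itv/= => /andP[h1 _].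
  by rewrite -dpow// (lt_le_trans (e_gt0 n) h1).
- by move=> x y; rewrite !in_itv/= => /andP[h1 _] _ xy; apply: powlt => //; rewrite (le_trans (ltW (e_gt0 n)) h1).
- by move=> x; rewrite in_itv/= => /andP[h1 _]; apply: dpow_continuous; exact: lt_trans h1.
- by apply/cvg_ex; exists ((derive1 (fun x : R => x `^ q)) (e n)); apply: cvg_at_right_filter; exact: dpow_continuous.
- by apply/cvg_ex; exists ((derive1 (fun x : R => x `^ q)) (1 - e n)); apply: cvg_at_left_filter; exact: dpow_continuous.
- split.
  + move=> x; rewrite in_itv/= => /andP[h1 _].
    exact: (@ex_derive _ _ _ _ _ _ _ (is_derive1_powR q (lt_trans (e_gt0 n) h1))).
  + by apply: cvg_at_right_filter; exact: powR_continuous.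
  + by apply: cvg_at_left_filter; exact: powR_continuous.
- apply: continuous_in_subspaceT => x; rewrite inE/= => h; apply: cG.
  by have := @J_sub n x; rewrite /J/= !in_itv/=; apply; rewrite in_itv/= in h.
Qed.

(** [G] may be singular at both ends: the substitution is made on [[e n, 1 - e n]] and both sides
    pass to the limit by monotone convergence. *)
Lemma powR_substitution :
  (\int[mu]_(x in `]0%R, 1%R[) (G x)%:E = \int[mu]_(x in `]0%R, 1%R[) (G (x `^ q) * (q * x `^ (q - 1)))%:E)%E.
Proof.
have pow01 (x : R) : 0 < x < 1 -> 0 < x `^ q < 1.
  by move=> /andP[x0 x1]; rewrite powR_gt0//= -subr_gt0 pow_lt1.
have mG : measurable_fun (`]0, 1[%classic : set (measurableTypeR R)) G.
  apply: open_continuous_measurable_fun; first exact: interval_open.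
  by move=> x; rewrite inE/= in_itv/=; exact: cG.
have mGq : measurable_fun (`]0, 1[%classic : set (measurableTypeR R)) (fun x => G (x `^ q) * (q * x `^ (q - 1))).
  apply: open_continuous_measurable_fun; first exact: interval_open.
  move=> x; rewrite inE/= in_itv/= => x01; have /andP[x0 _] := x01.
  have h : {for x, continuous (fun x : R => G (x `^ q) * (q * x `^ (q - 1)))}.
    apply: continuousM; last by apply: continuousM; [exact: cst_continuous|exact: powR_continuous].
    apply: (@continuous_comp _ _ _ (fun x : R => x `^ q) G); first exact: powR_continuous.
    by apply: cG; exact: pow01.
  exact: h.
have := @ge0_nondecreasing_set_cvg_integral _ (measurableTypeR R) R J (EFin \o G) mu J_nd mJ.
rewrite J_bigcup => /(_ _ _) cv1.
have := @ge0_nondecreasing_set_cvg_integral _ (measurableTypeR R) R I (EFin \o (fun x => G (x `^ q) * (q * x `^ (q - 1)))) mu I_nd mI.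
rewrite I_bigcup => /(_ _ _) cv2.
apply: (cvg_unique _ (cv1 _ _) _) => //.
- by move=> n; apply/measurable_EFinP; apply: measurable_funS mG => //; exact: J_sub.
- by move=> n x /J_sub; rewrite /= in_itv/= lee_fin; exact: G0.
rewrite /= (_ : (fun i => _) = (fun n => \int[mu]_(x in I n) (G (x `^ q) * (q * x `^ (q - 1)))%:E)%E); last first.
  by apply/funext => n; exact: subst_n.
apply: cv2.
- by move=> n; apply/measurable_EFinP; apply: measurable_funS mGq => //; exact: I_sub.
- move=> n x /I_sub; rewrite /= in_itv/= lee_fin => x01.
  by rewrite mulr_ge0 ?mulr_ge0 ?powR_ge0 ?(ltW q0)// G0// pow01.
Qed.

End powR_substitution.

(** * Relations between the arc integrals *)

Section arc_integrals.
Context {R : realType}.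
Notation mu := (@lebesgue_measure R).
Variables (alpha g : R).
Hypothesis alpha0 : 0 <= alpha.
Hypothesis g0 : 0 < g.
Hypothesis g_le : g <= alpha + 1.
Let p := (alpha + 1) / (alpha + g + 1).
Notation w := (arc_weight alpha g).
Notation W := (\int[mu]_(t in `]0, 1[) w t).

Let g2 : 0 < 2 * g. Proof. by rewrite mulr_gt0. Qed.
Let a1 : 0 < alpha + 1. Proof. by rewrite ltr_wpDl. Qed.
Let root_continuous (t : R) : 0 < t -> {for t, continuous (fun t => Num.sqrt (1 - t `^ (2 * g)))}.
Proof.
move=> t0; apply: (@continuous_comp _ _ _ (fun t => 1 - t `^ (2 * g)) Num.sqrt); last exact: sqrt_continuous.
by apply: cvgB; [exact: cvg_cst|exact: powR_continuous].
Qed.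
Let root_gt0 (t : R) : 0 < t -> t < 1 -> 0 < Num.sqrt (1 - t `^ (2 * g)).
Proof. by move=> t0 t1; rewrite sqrtr_gt0 pow_lt1. Qed.

(** [i + j] is the arc weight, and [(alpha + 1) * i - g * j] is the derivative of
    [t^(alpha + 1) * sqrt (1 - t^(2g))], which vanishes at both ends. These two linear relations
    determine the integrals of [i] and [j] from [W]. *)
Let i (t : R) : R := t `^ alpha * Num.sqrt (1 - t `^ (2 * g)).
Let j (t : R) : R := t `^ (2 * g) * w t.
Let mI : measurable (`]0, 1[%classic : set (measurableTypeR R)).
Proof. exact: measurable_itv. Qed.
Let iw := integrable_arc_weight alpha0 g0.

Let ijE (t : R) : 0 < t -> t < 1 -> i t + j t = w t.
Proof.
move=> t0 t1; have r0 := root_gt0 t0 t1; rewrite /i /j /arc_weight.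
have q2 : t `^ (2 * g) = 1 - Num.sqrt (1 - t `^ (2 * g)) ^+ 2.
  by rewrite sqr_sqrtr; [rewrite opprB addrC subrK|exact: ltW (pow_lt1 g2 t0 t1)].
by rewrite {2}q2; field; rewrite gt_eqF.
Qed.

Let i_ge0 t : 0 <= i t. Proof. by rewrite mulr_ge0 ?powR_ge0 ?sqrtr_ge0. Qed.
Let j_ge0 t : 0 <= j t. Proof. by rewrite mulr_ge0 ?powR_ge0 ?arc_weight_ge0. Qed.

Let w_continuous (t : R) : 0 < t -> t < 1 -> {for t, continuous w}.
Proof.
move=> t0 t1; apply: cvgM; first exact: powR_continuous.
by apply: cvgV; [rewrite gt_eqF// root_gt0|exact: root_continuous].
Qed.
Let i_continuous (t : R) : 0 < t -> {for t, continuous i}.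
Proof. by move=> t0; apply: continuousM; [exact: powR_continuous|exact: root_continuous]. Qed.
Let j_continuous (t : R) : 0 < t -> t < 1 -> {for t, continuous j}.
Proof. by move=> t0 t1; apply: continuousM; [exact: powR_continuous|exact: w_continuous]. Qed.

Let le_w_integrable (h : R -> R) : (forall t, 0 < t -> t < 1 -> {for t, continuous h}) ->
  (forall t, 0 < t -> t < 1 -> 0 <= h t <= w t) -> mu.-integrable `]0, 1[ (EFin \o h).
Proof.
move=> ch hw; apply: le_integrable iw => //.
  apply/measurable_EFinP; apply: open_continuous_measurable_fun; first exact: interval_open.
  by move=> x; rewrite inE/= in_itv/= => /andP[x0 x1]; exact: ch.
move=> t; rewrite /= in_itv/= => /andP[t0 t1]; have /andP[h1 h2] := hw _ t0 t1.
by rewrite lee_fin !ger0_norm ?arc_weight_ge0.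
Qed.

Let ii : mu.-integrable `]0, 1[ (EFin \o i).
Proof.
apply: le_w_integrable => t t0 t1; first exact: i_continuous.
by rewrite i_ge0 -ijE// lerDl j_ge0.
Qed.

Lemma integrable_arc_pow : mu.-integrable `]0, 1[ (EFin \o j).
Proof.
apply: le_w_integrable => t t0 t1; first exact: j_continuous.
by rewrite j_ge0 -ijE// lerDr i_ge0.
Qed.
Let jj := integrable_arc_pow.

Let IJ : \int[mu]_(t in `]0, 1[) i t + \int[mu]_(t in `]0, 1[) j t = W.
Proof.
rewrite -RintegralD//; apply: eq_Rintegral => t; rewrite inE/= in_itv/= => /andP[t0 t1].
exact: ijE.
Qed.

Let IJ_FTC : (alpha + 1) * \int[mu]_(t in `]0, 1[) i t = g * \int[mu]_(t in `]0, 1[) j t.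
Proof.
apply/eqP; rewrite -subr_eq0; apply/eqP.
rewrite -!RintegralZl// -RintegralB//; last 2 first.
- by have := integrableZl mI (alpha + 1) ii; apply: eq_integrable.
- by have := integrableZl mI g jj; apply: eq_integrable.
pose F t := t `^ (alpha + 1) * Num.sqrt (1 - t `^ (2 * g)).
pose h t := (alpha + 1) * i t - g * j t.
have E : (\int[mu]_(t in `]0%R, 1%R[) (h t)%:E = (0 - 0)%:E)%E; last by rewrite /Rintegral E subr0.
apply: (@integrable_FTC_open R 0 1 0 0 h F ltr01).
- move=> t /andP[t0 t1]; apply: continuousB; apply: continuousM; try exact: cst_continuous.
    exact: i_continuous.
  exact: j_continuous.
- move=> t /andP[t0 t1]; have r0 := root_gt0 t0 t1.
  have := is_deriveM (is_derive1_powR (alpha + 1) t0) (is_derive_root g0 t0 t1).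
  congr is_derive; rewrite /GRing.scale/= /h /i /j /arc_weight addrK.
  move: r0; set q := Num.sqrt _ => r0.
  have -> : t `^ (alpha + 1) = t `^ alpha * t by rewrite powRD ?powRr1 ?(ltW t0)//; apply/implyP => _; rewrite gt_eqF.
  have -> : t `^ (2 * g) = t `^ (2 * g - 1) * t.
    by rewrite -{3}(powRr1 (ltW t0)) -powRD ?subrK//; apply/implyP => _; rewrite gt_eqF.
  by field; rewrite gt_eqF.
- rewrite -[X in _ --> X](mul0r (Num.sqrt (1 - 0 `^ (2 * g)))); apply: cvgM; first exact: powR_cvg0.
  apply: (@continuous_cvg _ _ _ _ _ (fun x => 1 - x `^ (2 * g)) Num.sqrt); first exact: sqrt_continuous.
  by apply: cvgB; [exact: cvg_cst|rewrite powR0 ?gt_eqF//; exact: powR_cvg0].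
- rewrite -[X in _ --> X](_ : 1 `^ (alpha + 1) * Num.sqrt (1 - 1 `^ (2 * g)) = 0); last first.
    by rewrite !powR1 subrr sqrtr0 mulr0.
  by apply: cvgM; apply: cvg_at_left_filter; [exact: powR_continuous|exact: root_continuous].
- have := integrableB mI (integrableZl mI (alpha + 1) ii) (integrableZl mI g jj).
  by apply: eq_integrable.
Qed.

Let s1 : 0 < alpha + g + 1. Proof. by rewrite addrAC addr_gt0. Qed.

Lemma integral_arc_pow : \int[mu]_(t in `]0, 1[) (t `^ (2 * g) * w t) = p * W.
Proof.
have h1 := IJ; have h2 := IJ_FTC; rewrite /j /= in h1 h2.
rewrite -h1 /p; move: h2; set a := Rintegral _ _ _; set b := Rintegral _ _ _ => h2.
have -> : a = g * b / (alpha + 1) by rewrite -h2 mulrAC mulfV ?mul1r// gt_eqF.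
by field; rewrite !gt_eqF.
Qed.

(** The integral of [i] is also the height integral of the interval [(0, 1)] with slope 1, which
    brings in [disc_const]. *)
Lemma integral_arc_weight : W = disc_const alpha g / (alpha + 1) / (1 - p).
Proof.
have h1 := IJ; have h2 := IJ_FTC.
have h3 : \int[mu]_(t in `]0, 1[) i t = disc_const alpha g / (alpha + 1).
  have := @initial_interval_integral R alpha g alpha0 g0 1 1 ltr01 ltr01.
  rewrite powR1 mul1r => /(_ erefl).
  rewrite invr1 powR1 -[disc_integral _ _]fineK ?disc_integral_fin_num// -EFinM => h.
  have E : (\int[mu]_(t in `]0%R, 1%R[) (i t)%:E = (disc_const alpha g / (alpha + 1))%:E)%E; last by rewrite /Rintegral E.
  rewrite /disc_const mulrC -[X in (X * _)%:E]mul1r -h; apply: eq_integral => t; rewrite inE/= in_itv/= => /andP[t0 t1].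
  have -> : t `^ (alpha + g) = t `^ alpha * t `^ g by rewrite powRD//; apply/implyP => _; rewrite gt_eqF.
  have -> : (t `^ alpha) ^+ 2 - (1 * (t `^ alpha * t `^ g)) ^+ 2 = (t `^ alpha) ^+ 2 * (1 - t `^ (2 * g)).
    have -> : t `^ (2 * g) = t `^ g * t `^ g by rewrite -powRD ?mulr_natl//; apply/implyP => _; rewrite gt_eqF.
    by ring.
  by rewrite sqrtrM ?sqr_ge0// sqrtr_sqr ger0_norm ?powR_ge0.
rewrite -h3 -h1 /p; move: h2; set a := Rintegral _ _ _; set b := Rintegral _ _ _ => h2.
have -> : b = (alpha + 1) * a / g by rewrite h2 mulrAC mulfV ?mul1r// gt_eqF.
have -> : 1 - (alpha + 1) / (alpha + g + 1) = g / (alpha + g + 1) by field; rewrite gt_eqF.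
by field; rewrite !gt_eqF.
Qed.

Lemma isop_constE : isop_const alpha g = ((alpha + g) / p) `^ p * (2 * W) `^ (1 - p).
Proof. by rewrite /isop_const integral_arc_weight !mulrA. Qed.

(** The Beta variable is replaced by [t^(2g)]. *)
Lemma Beta_arc_weight : Beta ((alpha + 1) / (2 * g)) (1 / 2) = 2 * g * W.
Proof.
rewrite -RintegralZl// /Beta /Rintegral; congr fine.
pose G (t : R) : R := t `^ ((alpha + 1) / (2 * g) - 1) * (1 - t) `^ (1 / 2 - 1).
transitivity (\int[mu]_(t in `]0%R, 1%R[) (G (t `^ (2 * g)) * (2 * g * t `^ (2 * g - 1)))%:E)%E.
  apply: (powR_substitution (G := G) g2) => x /andP[x0 x1]; last by rewrite mulr_ge0 ?powR_ge0.
  apply: continuousM; first exact: powR_continuous.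
  apply: (@continuous_comp _ _ _ (fun t : R => 1 - t) (fun u : R => u `^ (1 / 2 - 1))).
    by apply: cvgB; [exact: cvg_cst|exact: cvg_id].
  by apply: powR_continuous; rewrite subr_gt0.
apply: eq_integral => t; rewrite inE/= in_itv/= => /andP[t0 t1]; congr EFin.
have h (x y : R) : t `^ (x + y) = t `^ x * t `^ y by rewrite powRD//; apply/implyP => _; rewrite gt_eqF.
rewrite /G -powRrM /arc_weight.
have -> : 1 / 2 - 1 = - 2^-1 :> R by field.
rewrite powRN powR12_sqrt; last exact: ltW (pow_lt1 g2 t0 t1).
have -> : t `^ alpha = t `^ (2 * g * ((alpha + 1) / (2 * g) - 1)) * t `^ (2 * g - 1).
  by rewrite -h; congr (_ `^ _); field; rewrite !gt_eqF.
by ring.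
Qed.

End arc_integrals.

(** * The case gamma = alpha + 1 *)

Section arc_pi.
Context {R : realType}.
Notation mu := (@lebesgue_measure R).

(** [asin] is not differentiable at 1; its left limit is obtained from the monotonicity of [sin]. *)
Lemma asin_cvg1 : asin x @[x --> (1 : R)^'-] --> (pi / 2 : R).
Proof.
apply/cvgrPdist_le => e e0; have pi0 := pi_gt0 R.
pose th := Num.max 0 (pi / 2 - e).
have th0 : 0 <= th by rewrite le_max lexx.
have th1 : th < pi / 2 by rewrite gt_max; apply/andP; split; lra.
have the : pi / 2 - e <= th by rewrite le_max lexx orbT.
have thpi : th \in `[- (pi / 2), pi / 2] by rewrite in_itv/=; apply/andP; split; lra.
have hpi : pi / 2 \in `[- (pi / 2), pi / 2 : R] by rewrite in_itv/=; apply/andP; split; lra.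
have s1 : sin th < 1 by rewrite -sin_pihalf ltr_sin.
near=> x.
have x1 : x < 1 by near: x; exact: nbhs_left_lt.
have x0 : 0 < x by near: x; exact: nbhs_left_gt.
have xs : sin th < x by near: x; exact: nbhs_left_gt.
have xB : -1 <= x <= 1 by apply/andP; split; lra.
have [/andP[a1 a2] sa] := asin_def xB.
have ha : th < asin x by rewrite -ltr_sin ?sa// in_itv/= a1.
rewrite ger0_norm; lra.
Unshelve. all: by end_near. Qed.

(** For this value of [g] the weight is the derivative of [asin (t^(alpha + 1)) / (alpha + 1)]. *)
Lemma integral_arc_weight_pi (alpha : R) : 0 <= alpha ->
  \int[mu]_(t in `]0, 1[) arc_weight alpha (alpha + 1) t = pi / 2 / (alpha + 1).
Proof.
move=> alpha0; have a1 : 0 < alpha + 1 by rewrite ltr_wpDl.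
have g2 : 0 < 2 * (alpha + 1) by rewrite mulr_gt0.
have root_gt0 (t : R) : 0 < t -> t < 1 -> 0 < Num.sqrt (1 - t `^ (2 * (alpha + 1))).
  by move=> t0 t1; rewrite sqrtr_gt0 pow_lt1.
have E : (\int[mu]_(t in `]0%R, 1%R[) (arc_weight alpha (alpha + 1) t)%:E = (pi / 2 / (alpha + 1) - 0)%:E)%E.
  apply: (@ge0_FTC_open R 0 1 0 (pi / 2 / (alpha + 1)) (arc_weight alpha (alpha + 1))
    (fun t => asin (t `^ (alpha + 1)) / (alpha + 1)) ltr01).
  - move=> t /andP[t0 t1]; apply: cvgM; first exact: powR_continuous.
    apply: cvgV; first by rewrite gt_eqF// root_gt0.
    apply: (@continuous_comp _ _ _ (fun t => 1 - t `^ (2 * (alpha + 1))) Num.sqrt); last exact: sqrt_continuous.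
    by apply: cvgB; [exact: cvg_cst|exact: powR_continuous].
  - move=> t /andP[t0 t1]; have r0 := root_gt0 t t0 t1.
    have u0 : 0 < t `^ (alpha + 1) by rewrite powR_gt0.
    have u1 : t `^ (alpha + 1) < 1 by rewrite -subr_gt0 pow_lt1.
    have h : -1 < t `^ (alpha + 1) < 1 by rewrite u1 (lt_trans _ u0).
    have := @is_deriveZ _ _ _ _ (alpha + 1)^-1 _ _ _
      (@is_derive1_comp _ asin (fun t => t `^ (alpha + 1)) t _ _ (is_derive1_asin h) (is_derive1_powR (alpha + 1) t0)).
    congr is_derive; first by apply/funext => u; rewrite /GRing.scale/= mulrC.
    have -> : (t `^ (alpha + 1)) ^+ 2 = t `^ (2 * (alpha + 1)) 
      by rewrite expr2 -powRD ?mulr_natl//; apply/implyP => _; rewrite gt_eqF.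
    rewrite /GRing.scale/= addrK /arc_weight; move: r0; set q := Num.sqrt _ => r0.
    by field; rewrite !gt_eqF.
  - rewrite -[X in _ --> X](mul0r (alpha + 1)^-1); apply: cvgM; last exact: cvg_cst.
    have as0 : asin 0 = 0 :> R by rewrite -[in LHS]sin0 sinK// in_itv/= oppr_le0 andbb divr_ge0// pi_ge0.
    rewrite -[X in _ --> X]as0; apply: (@continuous_cvg _ _ _ _ _ (fun t => t `^ (alpha + 1)) asin).
      by apply: continuous_asin; rewrite ltr01 ltrN10.
    exact: powR_cvg0.
  - apply: cvgM; last exact: cvg_cst.
    have h1 : t `^ (alpha + 1) @[t --> (1 : R)^'-] --> (1 : R).
      have := cvg_at_left_filter (powR_continuous (p := alpha + 1) (ltr01 : 0 < 1 :> R)).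
      by rewrite powR1.
    have lt1 : \forall t \near (1 : R)^'-, t `^ (alpha + 1) < 1.
      near=> t; have t0 : 0 < t by near: t; exact: nbhs_left_gt.
      by rewrite -subr_gt0 pow_lt1//; near: t; exact: nbhs_left_lt.
    (* [asin_cvg1] is a left limit, so the inner power must be known to approach 1 from below. *)
    have c : t `^ (alpha + 1) @[t --> (1 : R)^'-] --> (1 : R)^'-.
      move=> A hA; have h2 : \forall t \near (1 : R)^'-, t `^ (alpha + 1) < 1 -> A (t `^ (alpha + 1)) := h1 _ hA.
      have h3 : \forall t \near (1 : R)^'-, A (t `^ (alpha + 1)) by apply: filterS2 h2 lt1 => t; apply.
      exact: h3.
    exact: cvg_comp c asin_cvg1.
  - by move=> t _; exact: arc_weight_ge0.
by rewrite /Rintegral E subr0.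
Unshelve. all: by end_near. Qed.

End arc_pi.

(** * Weighted area of the minimizer *)

Section profile_area.
Context {R : realType}.
Notation mu := (@lebesgue_measure R).
Notation T2 := (measurableTypeR R * measurableTypeR R)%type.
Variables (alpha g : R).
Hypothesis alpha0 : 0 <= alpha.
Hypothesis g0 : 0 < g.
Let s := alpha + g.
Let p := (alpha + 1) / (s + 1).
Notation psi := (profile_slope g).
Notation f := (profile_fun g).
Notation w := (arc_weight alpha g).
Notation W := (\int[mu]_(t in `]0, 1[) w t).

Let s0 : 0 < s. Proof. by rewrite /s ltr_wpDl. Qed.
Let mI : measurable (`]0, 1[%classic : set (measurableTypeR R)).
Proof. exact: measurable_itv. Qed.
Let Wg := \int[mu]_(t in `]0, 1[) arc_weight g g t.

Let profile_fun_le y : 0 < y -> f y <= Wg.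
Proof.
move=> y0; apply: fine_le.
- by apply: integrable_fin_num; [exact: measurable_itv|exact: integrable_profile_slope].
- by apply: integrable_fin_num => //; exact: (integrable_arc_weight (ltW g0) g0).
have mY : measurable (`]y, 1[%classic : set (measurableTypeR R)) by exact: measurable_itv.
apply: (@ge0_subset_integral _ _ _ mu _ _ mY mI (fun t => (arc_weight g g t)%:E)).
- by apply/measurable_EFinP; apply: measurable_funTS; exact: measurable_root_slope.
- by move=> t _; rewrite lee_fin arc_weight_ge0.
- by move=> t; rewrite /= !in_itv/= => /andP[yt ->]; rewrite (lt_trans y0 yt).
Qed.

(** The boundary term [(2 / s) * f(t) * t^s] vanishes at both ends, and [psi * t^s = t^(2g) * w] has
    the integral [p * W] by [integral_arc_pow]. *)
Let integral_profile :
  (\int[mu]_(t in `]0%R, 1%R[) (2 * f t * t `^ (s - 1))%:E = (2 * (p * W) / s)%:E)%E.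
Proof.
pose j t := t `^ (2 * g) * w t.
pose k t := 2 * f t * t `^ (s - 1).
have Wg0 : 0 <= Wg by exact: le_trans (profile_fun_ge0 _ _) (profile_fun_le ltr01).
have ck t : 0 < t -> t < 1 -> {for t, continuous k}.
  move=> t0 t1; apply: continuousM; last exact: powR_continuous.
  by apply: continuousM; [exact: cst_continuous|exact: profile_fun_continuous].
have jE t : 0 < t -> j t = psi t * t `^ s.
  move=> t0; have h (x y : R) : t `^ (x + y) = t `^ x * t `^ y by rewrite powRD//; apply/implyP => _; rewrite gt_eqF.
  rewrite /j /arc_weight /profile_slope mulrA [RHS]mulrAC -!h.
  by congr (_ `^ _ / _); rewrite /s; ring.
have ij : mu.-integrable `]0, 1[ (EFin \o j) := integrable_arc_pow alpha0 g0.
have ip : mu.-integrable `]0, 1[ (EFin \o (fun t : R => t `^ (s - 1))).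
  apply/integrableP; split; first by apply/measurable_EFinP; apply: measurable_funTS; exact: measurable_powR.
  under eq_integral => t _ do rewrite /= ger0_norm ?powR_ge0//.
  by rewrite integral_powR ?subrK// ltry.
have ik : mu.-integrable `]0, 1[ (EFin \o k).
  have := integrableZl mI (2 * Wg) ip; apply: le_integrable => //.
    apply/measurable_EFinP; apply: open_continuous_measurable_fun; first exact: interval_open.
    by move=> x; rewrite inE/= in_itv/= => /andP[x0 x1]; exact: ck.
  move=> t; rewrite /= in_itv/= => /andP[t0 t1]; rewrite lee_fin /k.
  rewrite !ger0_norm ?mulr_ge0 ?powR_ge0 ?profile_fun_ge0//.
  by rewrite ler_wpM2r ?powR_ge0// ler_wpM2l// profile_fun_le.
pose F t := 2 / s * (f t * t `^ s).
pose h t := k t - 2 / s * j t.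
have ij2 : mu.-integrable `]0, 1[ (EFin \o (fun t => 2 / s * j t)).
  by have := integrableZl mI (2 / s) ij; apply: eq_integrable.
have E : (\int[mu]_(t in `]0%R, 1%R[) (h t)%:E = (0 - 0)%:E)%E.
  apply: (@integrable_FTC_open R 0 1 0 0 h F ltr01).
  - move=> t /andP[t0 t1]; apply: continuousB; first exact: ck.
    apply: continuousM; first exact: cst_continuous.
    apply: continuousM; first exact: powR_continuous.
    apply: cvgM; first exact: powR_continuous.
    apply: cvgV; first by rewrite gt_eqF// sqrtr_gt0 pow_lt1// mulr_gt0.
    apply: (@continuous_comp _ _ _ (fun t => 1 - t `^ (2 * g)) Num.sqrt); last exact: sqrt_continuous.
    by apply: cvgB; [exact: cvg_cst|exact: powR_continuous].
  - move=> t /andP[t0 t1].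
    have := @is_deriveZ _ _ _ _ (2 / s) _ _ _ (is_deriveM (is_derive_profile_fun g0 t0 t1) (is_derive1_powR s t0)).
    congr is_derive; rewrite /GRing.scale/= /h /k jE//.
    by field; rewrite gt_eqF.
  - apply: (@squeeze_cvgr _ _ _ _ (fun=> 0) (fun t => 2 / s * (Wg * t `^ s))).
    + near=> t; have t0 : 0 < t by near: t; exact: nbhs_right_gt.
      rewrite !mulr_ge0 ?invr_ge0 ?(ltW s0) ?profile_fun_ge0 ?powR_ge0//=.
      rewrite ler_wpM2l// ?divr_ge0 ?(ltW s0)//.
      by rewrite ler_wpM2r ?powR_ge0// profile_fun_le.
    + exact: cvg_cst.
    + have Z : 2 / s * (Wg * 0) = 0 by rewrite !mulr0.
      rewrite -[X in _ --> X]Z.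
      apply: cvgM; first exact: cvg_cst.
      by apply: cvgM; [exact: cvg_cst|exact: powR_cvg0].
  - have Z : 2 / s * (0 * 1 `^ s) = 0 by rewrite mul0r mulr0.
    rewrite -[X in _ --> X]Z.
    apply: cvgM; first exact: cvg_cst.
    apply: cvgM; first exact: profile_fun_cvg1.
    by apply: cvg_at_left_filter; exact: powR_continuous.
  - by have := integrableB mI ik ij2; apply: eq_integrable.
rewrite -[LHS]fineK; last exact: integrable_fin_num ik.
congr EFin; rewrite -[LHS]/(Rintegral mu `]0, 1[ k).
have : \int[mu]_(t in `]0, 1[) h t = 0 by rewrite /Rintegral E subr0.
rewrite RintegralB// RintegralZl// => /eqP; rewrite subr_eq0 => /eqP ->.
by rewrite (integral_arc_pow alpha0 g0) mulrAC.
Unshelve. all: by end_near. Qed.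

Lemma area_profile_region :
  (\int[@leb2_borel R]_(z in profile_region g) (z.2 `^ (s - 1))%:E = (2 * (p * W) / s)%:E)%E.
Proof.
have mO := measurable_profile_region g0.
rewrite (@area_functional_ge0 _ _ mO (fun t => t `^ (s - 1))); [|exact: measurable_powR|by move=> t; exact: powR_ge0].
rewrite -integral_profile [RHS]integral_mkcond; apply: eq_integral => t _; rewrite patchE mem_setE in_itv/=.
have [/andP[t0 t1]|t01] := boolP (0 < t < 1).
  have -> : slice (profile_region g) t = (2 * f t)%:E.
    rewrite /slice (_ : ysection _ t = `](- f t), (f t)[%classic).
      transitivity (mu `](- f t), (f t)[%classic) => //.
      have ft := profile_fun_gt0 g0 t0 t1.
      by rewrite lebesgue_measure_itv/= lte_fin (lt_trans _ ft) ?oppr_lt0// -EFinB opprK -mulr2n mulr_natl.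
    apply/seteqP; split => x; rewrite /ysection/= inE /profile_region/= in_itv/= ltr_norml.
      by move=> [].
    by rewrite t0 t1.
  by rewrite -EFinM mulrC.
rewrite (_ : slice _ t = 0%E) ?mule0// /slice (_ : ysection _ t = set0) ?measure0//.
by rewrite -subset0 => x; rewrite /ysection/= inE => -[_ /=]; rewrite (negbTE t01).
Qed.

End profile_area.

(** * The infimum, its minimizer and the closed forms *)

Section isoperimetric_constant.
Context {R : realType}.
Notation mu := (@lebesgue_measure R).
Notation T2 := (measurableTypeR R * measurableTypeR R)%type.
Variables (alpha beta : R).
Hypothesis alpha0 : 0 <= alpha.
Hypothesis alpha_lt : alpha < beta + 1.
Hypothesis beta_le : beta <= 2 * alpha.
Let g := beta - alpha + 1.
Let p := (alpha + 1) / (beta + 2).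
Notation W := (\int[mu]_(t in `]0, 1[) arc_weight alpha g t).

Let g0 : 0 < g. Proof. by rewrite /g addrAC subr_gt0. Qed.
Let g_le : g <= alpha + 1.
Proof. by rewrite /g lerD2r lerBlDr -mulr2n -mulr_natl. Qed.
Let a1 : 0 < alpha + 1. Proof. by rewrite ltr_wpDl. Qed.
Let b1 : 0 < beta + 1. Proof. exact: le_lt_trans alpha_lt. Qed.
Let b2 : 0 < beta + 2. Proof. by rewrite (lt_trans b1)// ltrD2l ltr1n. Qed.
Let sE : alpha + g = beta + 1. Proof. by rewrite /g; ring. Qed.
Let pE : p = (alpha + 1) / (alpha + g + 1). Proof. by rewrite sE -addrA. Qed.
Let p0 : 0 < p. Proof. by rewrite divr_gt0. Qed.

Lemma isop_quotient_ge (Omega : set (R * R)) : admissible beta Omega ->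
  ((isop_const alpha g)%:E <= isop_quotient alpha beta Omega)%E.
Proof.
move=> [OH mO /andP[A0 Afin]].
have [S [Z [mS mZ Z0 ZS]]] := leb2_borel_version mO.
(* A Borel version of [Omega] may contain points outside the half-plane; intersecting restores the
   inclusion without enlarging the exceptional set. *)
pose Omega' : set T2 := S `&` (setT `*` `]0, +oo[%classic).
have mO' : measurable Omega' by apply: measurableI => //; apply: measurableX => //; exact: measurable_itv.
have O'H (z : R * R) : Omega' z -> 0 < z.2 by move=> [_ [_]]; rewrite /= in_itv/= andbT.
have ZO z : ~ Z z -> (Omega z <-> Omega' z).
  move=> Nz; split=> [Oz|[Oz _]]; last by apply/(ZS z Nz).
  split; first by apply/(ZS z Nz).
  by split => //=; rewrite in_itv/= andbT; exact: OH.
have mp : measurable_fun setT (fun z : T2 => (z.2 `^ beta)%:E).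
  by apply/measurable_EFinP; exact: (measurableT_comp (measurable_powR beta) measurable_snd).
have AE : warea beta Omega = (\int[@leb2_borel R]_(z in Omega') (z.2 `^ beta)%:E)%E.
  by apply: (ge0_leb2_integral mO mO' mZ Z0 ZO mp) => z; rewrite lee_fin powR_ge0.
have bE : beta = alpha + g - 1 by rewrite sE addrK.
have A0' := A0; have Afin' := Afin; rewrite AE bE in A0' Afin'.
have cal := calibration_bound alpha0 mO mO' mZ Z0 ZO (finite_strip mO' Afin').
have afin : warea beta Omega \is a fin_num by rewrite ge0_fin_numE// ltW.
have x0 : 0 < fine (warea beta Omega) `^ p by rewrite powR_gt0// fine_gt0// A0.
rewrite /isop_quotient -/p -[warea beta Omega]fineK// poweR_EFin inver gt_eqF//.
have [Pfin|] := ltP (wperimeter alpha Omega) +oo%E; last first.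
  by rewrite leye_eq => /eqP ->; rewrite gt0_mulye ?lte_fin ?invr_gt0// leey.
have := perimeter_ge alpha0 g0 g_le mO' O'H A0' Afin' cal Pfin.
rewrite -bE -AE -pE; set c := fine _ `^ _ in x0 * => h.
have := lee_wpmul2r _ h => /(_ c^-1%:E); rewrite lee_fin invr_ge0 (ltW x0) => /(_ isT).
by rewrite -EFinM mulfK// gt_eqF.
Qed.

Lemma arc_integral_gt0 : 0 < W.
Proof.
have mI : measurable (`]0, 1[%classic : set (measurableTypeR R)) by exact: measurable_itv.
have E := @integral_powR R alpha 0 1 a1 (lexx 0) ler01.
have ip : mu.-integrable `]0, 1[ (EFin \o (fun t : R => t `^ alpha)).
  apply/integrableP; split; first by apply/measurable_EFinP; apply: measurable_funTS; exact: measurable_powR.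
  under eq_integral => t _ do rewrite /= ger0_norm ?powR_ge0//.
  by rewrite E ltry.
apply: (@lt_le_trans _ _ (\int[mu]_(t in `]0, 1[) (t `^ alpha))).
  by rewrite /Rintegral E/= powR1 powR0 ?gt_eqF// subr0 divr_gt0.
apply: (le_Rintegral mI ip (integrable_arc_weight alpha0 g0)) => t; rewrite /= in_itv/= => /andP[t0 t1].
have q0 : 0 < Num.sqrt (1 - t `^ (2 * g)) by rewrite sqrtr_gt0; apply: pow_lt1 => //; rewrite mulr_gt0.
rewrite ler_pdivlMr// ler_piMr ?powR_ge0//.
by rewrite -[leRHS]sqrtr1 ler_wsqrtr// gerBl powR_ge0.
Qed.

Lemma warea_Omega_star : warea beta (Omega_star alpha beta) = (2 * W * p / (beta + 1))%:E.
Proof.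
have mO := measurable_profile_region g0.
(* [Omega_star alpha beta] and [profile_region g] are convertible; the set is its own measurable
   version, with empty exceptional set. *)
transitivity (\int[@leb2_borel R]_(z in profile_region g) (z.2 `^ beta)%:E)%E.
- apply: (ge0_leb2_integral (lebesgue_measurable_profile_region g0) mO measurable0 (measure0 _)) => //.
  + by apply/measurable_EFinP; exact: (measurableT_comp (measurable_powR beta) measurable_snd).
  + by move=> z; rewrite lee_fin powR_ge0.
have bE : beta = alpha + g - 1 by rewrite sE addrK.
have := area_profile_region alpha0 g0; rewrite -bE -pE sE => ->; congr EFin; ring.
Qed.

Lemma Omega_star_admissible : admissible beta (Omega_star alpha beta).
Proof.
split.
- by move=> z [_ /andP[]].
- exact: (lebesgue_measurable_profile_region g0).
- rewrite warea_Omega_star ltry lte_fin andbT; apply: divr_gt0 => //; apply: mulr_gt0 => //.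
  by apply: mulr_gt0 => //; exact: arc_integral_gt0.
Qed.

Let oneBp : 1 - p = g / (beta + 2).
Proof. by rewrite /p /g; field; rewrite gt_eqF. Qed.

(** An upper bound for the perimeter is enough, since the general lower bound applies to this set
    too. Both constants equal [(2W)^(1 - p) * ((beta + 1) / p)^p]. *)
Lemma isop_quotient_Omega_star :
  isop_quotient alpha beta (Omega_star alpha beta) = (isop_const alpha g)%:E.
Proof.
apply/le_anti/andP; split; last exact: isop_quotient_ge Omega_star_admissible.
have W0 := arc_integral_gt0.
have A0 : 0 < 2 * W * p / (beta + 1) by apply: divr_gt0 => //; apply: mulr_gt0 => //; apply: mulr_gt0.
have x0 : 0 < (2 * W * p / (beta + 1)) `^ p by rewrite powR_gt0.
rewrite /isop_quotient -/p warea_Omega_star poweR_EFin inver gt_eqF//.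
apply: (le_trans (lee_wpmul2r _ (wperimeter_profile_le alpha0 g0))).
  by rewrite lee_fin invr_ge0 ltW.
rewrite -EFinM lee_fin isop_constE// -pE sE.
have q0 : 0 < (beta + 1) / p by exact: divr_gt0.
have w0 : 0 < 2 * W by exact: mulr_gt0.
have -> : (2 * W * p / (beta + 1)) `^ p = (2 * W) `^ p / ((beta + 1) / p) `^ p.
  have -> : 2 * W * p / (beta + 1) = 2 * W * ((beta + 1) / p)^-1 by field; rewrite !gt_eqF.
  have qV0 : 0 <= ((beta + 1) / p)^-1 by rewrite invr_ge0 ltW.
  rewrite (powRM _ (ltW w0) qV0); congr (_ * _).
  by rewrite -[_^-1](powR_inv1 (ltW q0)) powRAC powR_inv1 ?powR_ge0.
have -> : (2 * W) `^ (1 - p) = 2 * W / (2 * W) `^ p.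
  by rewrite powRB ?powRr1 ?(ltW w0)//; apply/implyP => _; rewrite gt_eqF.
by rewrite invf_div mulrCA.
Qed.

Lemma isop_mu_const : isop_mu alpha beta = (isop_const alpha g)%:E.
Proof.
apply/le_anti/andP; split.
  apply: ereal_inf_lbound; exists (Omega_star alpha beta); first exact: Omega_star_admissible.
  exact: isop_quotient_Omega_star.
by apply: le_ereal_inf_tmp => _ [S adm <-]; exact: isop_quotient_ge.
Qed.

(** [2 W] is the Beta value divided by [g]; taking [g^(1 - p)] out gives the factor [g^(p - 1)]. *)
Lemma isop_const_Beta : isop_const alpha g =
  g `^ (p - 1) * ((beta + 1) * (beta + 2) / (alpha + 1)) `^ p *
  (Beta ((alpha + 1) / (2 * g)) (1 / 2)) `^ (g / (beta + 2)).
Proof.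
have W0 := arc_integral_gt0.
rewrite isop_constE// -pE sE Beta_arc_weight// -oneBp.
have -> : (beta + 1) / p = (beta + 1) * (beta + 2) / (alpha + 1).
  by rewrite /p; field; rewrite !gt_eqF.
have -> : 2 * g * W = g * (2 * W) by ring.
rewrite (powRM _ (ltW g0)) ?mulr_ge0 ?(ltW W0)//.
have -> : g `^ (p - 1) = (g `^ (1 - p))^-1 by rewrite -powRN opprB.
by field; rewrite gt_eqF// powR_gt0.
Qed.

End isoperimetric_constant.

(** Here [p = 1 / 2], so both powers are square roots, and the arc integral is
    [pi / 2 / (alpha + 1)]. *)
Lemma isop_const_pi {R : realType} (alpha : R) : 0 <= alpha ->
  isop_const alpha (alpha + 1) = Num.sqrt (2 * pi * (2 * alpha + 1) / (alpha + 1)).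
Proof.
move=> alpha0; have a1 : 0 < alpha + 1 by rewrite ltr_wpDl.
have g0 : 0 < alpha + 1 by [].
rewrite isop_constE// integral_arc_weight_pi//.
have -> : (alpha + 1) / (alpha + (alpha + 1) + 1) = 2^-1.
  have -> : alpha + (alpha + 1) + 1 = 2 * (alpha + 1) by ring.
  by field; rewrite gt_eqF.
have -> : 1 - 2^-1 = 2^-1 :> R by field.
have ge1 : 0 <= (alpha + (alpha + 1)) / 2^-1 by rewrite divr_ge0// ?invr_ge0// !addr_ge0// ltW.
have ge2 : 0 <= 2 * (pi / 2 / (alpha + 1)) by rewrite mulr_ge0// !divr_ge0 ?pi_ge0// ltW.
rewrite -(powRM _ ge1 ge2) powR12_sqrt; last exact: mulr_ge0.
have -> : (alpha + (alpha + 1)) / 2^-1 * (2 * (pi / 2 / (alpha + 1))) = 2 * pi * (2 * alpha + 1) / (alpha + 1); last by [].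
by field; rewrite gt_eqF.
Qed.

Theorem theorem1p1 (R : realType) (alpha beta : R)
    (halpha0 : 0 <= alpha) (halphabeta : alpha < beta + 1)
    (hbeta : beta <= 2 * alpha) :
  let gamma := beta + 1 - alpha in
  let p := (alpha + 1) / (beta + 2) in
  [/\ is_minimizer alpha beta (Omega_star alpha beta),
      isop_mu alpha beta =
        (gamma `^ (p - 1)
         * ((beta + 1) * (beta + 2) / (alpha + 1)) `^ p
         * (Beta ((alpha + 1) / (2 * gamma)) (1 / 2)) `^ (gamma / (beta + 2)))%:E
    & isop_mu alpha (2 * alpha) =
        (Num.sqrt (2 * pi * (2 * alpha + 1) / (alpha + 1)))%:E].
Proof.
move=> gamma p; have gE : gamma = beta - alpha + 1 by rewrite /gamma addrAC.
split.
- split; first exact: Omega_star_admissible.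
  by rewrite isop_quotient_Omega_star// isop_mu_const.
- by rewrite gE isop_mu_const// isop_const_Beta.
- rewrite isop_mu_const ?lexx//; last by lra.
  by rewrite -isop_const_pi//; congr (isop_const _ _)%:E; ring.
Qed.
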